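(* (Relative energy estimate.) Let assumptions (A0)–(A7) (listed in the context) hold, let $(\phi_{h,\tau},\bar\mu_{h,\tau},\mathbf u_{h,\tau},\bar p_{h,\tau})$ be a solution of the fully discrete problem (P), let $\hat\phi_{h,\tau},\hat{\bar\mu}_{h,\tau},\hat{\mathbf u}_{h,\tau},\hat{\bar p}_{h,\tau}$ be the projections of the exact solution and $\bar r_{1,h,\tau},\bar r_{2,h,\tau},\bar{\mathbf r}_{3,h,\tau}$ the associated discrete residuals (all defined in the context). Then for every $1\le n\le N$ $$\mathcal E_\alpha(\phi_{h,\tau},\mathbf u_{h,\tau}|\hat\phi_{h,\tau},\hat{\mathbf u}_{h,\tau})\Big|_{t^{n-1}}^{t^n}+\frac34\int_{t^{n-1}}^{t^n}\mathcal D_{\bar\phi_{h,\tau}}(\bar\mu_{h,\tau}-\hat{\bar\mu}_{h,\tau},\bar{\mathbf u}_{h,\tau}-\hat{\bar{\mathbf u}}_{h,\tau})\,ds$$ $$\le \bar c\int_{t^{n-1}}^{t^n}\mathcal E_\alpha(\phi_{h,\tau},\mathbf u_{h,\tau}|\hat\phi_{h,\tau},\hat{\mathbf u}_{h,\tau})\,ds+\bar C\int_{t^{n-1}}^{t^n}\|\bar r_{1,h,\tau}\|_{H^{-1}}^2+\|\bar r_{2,h,\tau}\|_{H^1}^2+\|\bar{\mathbf r}_{3,h,\tau}\|_{\mathcal Z_h^*}^2\,ds,$$ with constants $\bar c,\bar C$ independent of $h$ and $\tau$.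
   Context: System (CHNS) on $\Omega\times(0,T)$: $$\partial_t\phi+\mathbf u\cdot\nabla\phi=\operatorname{div}(b(\phi)\nabla\mu),\quad \mu=-\gamma\Delta\phi+f'(\phi),$$ $$\partial_t\mathbf u+(\mathbf u\cdot\nabla)\mathbf u=\operatorname{div}(\eta(\phi)\nabla\mathbf u)-\nabla p-\phi\nabla\mu,\quad \operatorname{div}\mathbf u=0.$$ Assumptions. $T>0$ is a fixed final time. (A0) $\Omega\subset\mathbb R^d$, $d\in\{2,3\}$, is a cube identified with the $d$-dimensional torus; all functions on $\Omega$ are periodic. (A1) $\gamma>0$ is constant. (A2) $b\in C^2(\mathbb R)$, $0<b_1\le b(s)\le b_2$, $\|b'\|_{L^\infty(\mathbb R)}\le b_3$, $\|b''\|_{L^\infty(\mathbb R)}\le b_4$. (A3) $f\in C^4(\mathbb R)$, $f(s)\ge 0$, $f''(s)\ge -f_1$ for some $f_1\ge0$, and $|f^{(k)}(s)|\le f_2^{(k)}+f_3^{(k)}|s|^{4-k}$ for $0\le k\le4$ with constants $f_2^{(k)},f_3^{(k)}$. (A4) $\eta\in C^2(\mathbb R)$, $0<\eta_1\le\eta(s)\le\eta_2$, $\|\eta'\|_{L^\infty(\mathbb R)}\le\eta_3$, $\|\eta''\|_{L^\infty(\mathbb R)}\le\eta_4$. (A5) $\mathcal T_h$ is a geometrically conforming, quasi-uniform partition of $\Omega$ into simplices that extends periodically: there is $\sigma>0$ (independent of $h$) with $\sigma h\le\rho_K\le h_K\le h$ for all $K\in\mathcal T_h$ ($\rho_K$ inner-circle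 radius, $h_K$ diameter of $K$, $h=\max_K h_K$). (A6) The time grid is $\mathcal I_\tau=\{0=t^0,t^1,\dots,t^N=T\}$ with $t^n=n\tau$, $\tau=T/N$. (A7) $(\phi,\mu,\mathbf u,p)$ is a periodic solution of (CHNS), with pressure of zero spatial average, satisfying $\phi\in H^2(0,T;H^1(\Omega))\cap H^1(0,T;H^3(\Omega))$, $\mu\in H^2(0,T;H^1(\Omega))\cap L^2(0,T;H^3(\Omega))$, $\mathbf u\in H^2(0,T;H^1(\Omega))\cap H^1(0,T;H^3(\Omega))$ (vector-valued), $p\in L^2(0,T;H^2(\Omega))\cap H^2(0,T;L^2(\Omega))$. Spaces. $L^2_0(\Omega)$ is the space of $L^2$ functions with zero average; $\mathcal V_h=\{v\in H^1(\Omega): v|_K\in P_2(K)\ \forall K\in\mathcal T_h\}$; $\mathcal Q_h=\{v\in L^2_0(\Omega)\cap H^1(\Omega): v|_K\in P_1(K)\ \forall K\in\mathcal T_h\}$; $\mathcal Z_h=\{\mathbf v_h\in\mathcal V_h^d:\langle\operatorname{div}\mathbf v_h,q_h\rangle=0\ \forall q_h\in\mathcal Q_h\}$. $P_k(\mathcal I_\tau;X)$ denotes (possibly discontinuous) piecewise polynomials in time of degree $\le k$ over the grid with values in $X$, and $P_k^c(\mathcal I_\tau;X)=P_k(\mathcal I_\tau;X)\cap C(0,T;X)$. Notation. $\langle a,b\rangle=\int_\Omega a\cdot b\,dx$; $\langle a\cdot\nabla b,c\rangle_{\rm skw}=\frac12(\langle a\cdot\nabla b,c\rangle-\langle b,a\cdot\nabla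 c\rangle)$; $\langle a,b\rangle^n=\int_{t^{n-1}}^{t^n}\langle a(s),b(s)\rangle\,ds$ and likewise for $\langle\cdot\rangle_{\rm skw}^n$; $g|_{t^{n-1}}^{t^n}=g(t^n)-g(t^{n-1})$. A bar denotes functions piecewise constant in time; $\bar u=\bar\pi_\tau^0u$ is also the $L^2$-orthogonal projection of $u$ onto piecewise constants in time. $I_\tau^1$ is the piecewise linear interpolation in time on $\mathcal I_\tau$. $\pi_h^0:L^2(\Omega)\to\mathcal V_h$ and $\pi_h^1:H^1(\Omega)\to\mathcal V_h$ are the $L^2$- and $H^1$-orthogonal projections, $\tilde\pi_h^0:L^2_0(\Omega)\to\mathcal Q_h$ the $L^2$-orthogonal projection, and $\mathbf P_h^1:H^1(\Omega)^d\to\mathcal Z_h$ is defined by $\langle\mathbf u-\mathbf P_h^1\mathbf u,\mathbf v_h\rangle+\langle\nabla(\mathbf u-\mathbf P_h^1\mathbf u),\nabla\mathbf v_h\rangle=0$ for all $\mathbf v_h\in\mathcal Z_h$. Norms: $\|r\|_{H^{-1}}=\sup_{v\in H^1(\Omega)}\langle r,v\rangle/\|v\|_{H^1}$ and $\|\mathbf r\|_{\mathcal Z_h^*}=\sup_{\mathbf v_h\in\mathcal Z_h}\langle\mathbf r,\mathbf v_h\rangle/\|\mathbf v_h\|_{H^1}$. Problem (P). Find $\phi_{h,\tau}\in P_1^c(\mathcal I_\tau;\mathcal V_h)$, $\bar\mu_{h,\tau}\in P_0(\mathcal I_\tau;\mathcal V_h)$, $\mathbf u_{h,\tau}\in P_1^c(\mathcal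 I_\tau;\mathcal V_h^d)$, $\bar p_{h,\tau}\in P_0(\mathcal I_\tau;\mathcal Q_h)$ with $\phi_{h,\tau}(0)=\pi_h^1\phi(0)$, $\mathbf u_{h,\tau}(0)=\mathbf P_h^1\mathbf u(0)$, and $$\langle\partial_t\phi_{h,\tau},\bar\psi\rangle^n=\langle\phi_{h,\tau}\bar{\mathbf u}_{h,\tau},\nabla\bar\psi\rangle^n-\langle b(\bar\phi_{h,\tau})\nabla\bar\mu_{h,\tau},\nabla\bar\psi\rangle^n,$$ $$\langle\bar\mu_{h,\tau},\bar\xi\rangle^n=\gamma\langle\nabla\phi_{h,\tau},\nabla\bar\xi\rangle^n+\langle f'(\phi_{h,\tau}),\bar\xi\rangle^n,$$ $$\langle\partial_t\mathbf u_{h,\tau},\bar{\mathbf v}\rangle^n=-\langle\mathbf u_{h,\tau}\cdot\nabla\bar{\mathbf u}_{h,\tau},\bar{\mathbf v}\rangle^n_{\rm skw}-\langle\eta(\bar\phi_{h,\tau})\nabla\bar{\mathbf u}_{h,\tau},\nabla\bar{\mathbf v}\rangle^n+\langle\bar p_{h,\tau},\operatorname{div}\bar{\mathbf v}\rangle^n-\langle\phi_{h,\tau}\bar{\mathbf v},\nabla\bar\mu_{h,\tau}\rangle^n,$$ $$\langle\operatorname{div}\mathbf u_{h,\tau},\bar q\rangle^n=0$$ for all $\bar\psi,\bar\xi\in P_0(\mathcal I_\tau;\mathcal V_h)$, $\bar{\mathbf v}\in P_0(\mathcal I_\tau;\mathcal V_h^d)$, $\bar q\in P_0(\mathcal I_\tau;\mathcal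 Q_h)$ and all $1\le n\le N$. Projections of the exact solution: $\hat\phi_{h,\tau}=I_\tau^1\pi_h^1\phi$, $\hat{\bar\mu}_{h,\tau}=\bar\pi_\tau^0\pi_h^0\mu$, $\hat{\mathbf u}_{h,\tau}=I_\tau^1\mathbf P_h^1\mathbf u$, $\hat{\bar p}_{h,\tau}=\bar\pi_\tau^0\tilde\pi_h^0p$, and $\hat{\bar{\mathbf u}}_{h,\tau}=\bar\pi_\tau^0\hat{\mathbf u}_{h,\tau}$. Discrete residuals: $\bar r_{1,h,\tau},\bar r_{2,h,\tau}\in P_0(\mathcal I_\tau;\mathcal V_h)$ and $\bar{\mathbf r}_{3,h,\tau}\in P_0(\mathcal I_\tau;\mathcal V_h^d)$ are the functions determined by $$\langle\partial_t\hat\phi_{h,\tau},\bar\psi\rangle^n=\langle\phi_{h,\tau}\hat{\bar{\mathbf u}}_{h,\tau},\nabla\bar\psi\rangle^n-\langle b(\bar\phi_{h,\tau})\nabla\hat{\bar\mu}_{h,\tau},\nabla\bar\psi\rangle^n+\langle\bar r_{1,h,\tau},\bar\psi\rangle^n,$$ $$\langle\hat{\bar\mu}_{h,\tau},\bar\xi\rangle^n=\gamma\langle\nabla\hat\phi_{h,\tau},\nabla\bar\xi\rangle^n+\langle f'(\hat\phi_{h,\tau}),\bar\xi\rangle^n+\langle\bar r_{2,h,\tau},\bar\xi\rangle^n,$$ $$\langle\partial_t\hat{\mathbf u}_{h,\tau},\bar{\mathbf v}\rangle^n=-\langle\mathbf u_{h,\tau}\cdot\nabla\hat{\bar{\mathbf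 u}}_{h,\tau},\bar{\mathbf v}\rangle^n_{\rm skw}-\langle\eta(\bar\phi_{h,\tau})\nabla\hat{\bar{\mathbf u}}_{h,\tau},\nabla\bar{\mathbf v}\rangle^n+\langle\hat{\bar p}_{h,\tau},\operatorname{div}\bar{\mathbf v}\rangle^n-\langle\phi_{h,\tau}\nabla\hat{\bar\mu}_{h,\tau},\bar{\mathbf v}\rangle^n+\langle\bar{\mathbf r}_{3,h,\tau},\bar{\mathbf v}\rangle^n$$ for all $\bar\psi,\bar\xi\in P_0(\mathcal I_\tau;\mathcal V_h)$, $\bar{\mathbf v}\in P_0(\mathcal I_\tau;\mathcal V_h^d)$, $1\le n\le N$. Functionals: with $\alpha=\max\{\gamma,\gamma+f_1\}$ and $f(\phi|\hat\phi)=f(\phi)-f(\hat\phi)-f'(\hat\phi)(\phi-\hat\phi)$, $$\mathcal E_\alpha(\phi,\mathbf u|\hat\phi,\hat{\mathbf u})=\int_\Omega\frac\gamma2|\nabla\phi-\nabla\hat\phi|^2+f(\phi|\hat\phi)+\frac\alpha2|\phi-\hat\phi|^2+\frac12|\mathbf u-\hat{\mathbf u}|^2\,dx,\qquad \mathcal D_\phi(\mu,\mathbf u)=\int_\Omega b(\phi)|\nabla\mu|^2+\eta(\phi)|\nabla\mathbf u|^2\,dx.$$ *)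

(* Defs.v *)
From HB Require Import structures.
From mathcomp Require Import all_boot all_order all_algebra.
From mathcomp Require Import all_classical all_reals all_analysis.
Set Implicit Arguments. Unset Strict Implicit. Unset Printing Implicit Defensive.
Import Order.TTheory GRing.Theory Num.Theory numFieldNormedType.Exports.
Local Open Scope classical_set_scope.
Local Open Scope ring_scope.

(* R^n is 'rV[R]_n, with the Borel (= product) sigma-algebra generated by the
   coordinates and the Lebesgue measure obtained by iterating the product of
   one-dimensional Lebesgue measures. *)
Section measurable_rV.
Context {R : realType} (n : nat).

Let coor (i : 'I_n) (x : 'rV[R]_n) : R := x ord0 i.

Let rV_set0 : g_sigma_preimage coor set0.
Proof. exact: sigma_algebra0. Qed.

Let rV_setC A : g_sigma_preimage coor A -> g_sigma_preimage coor (~` A).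
Proof. exact: sigma_algebraC. Qed.

Let rV_bigcup (F : (set 'rV[R]_n)^nat) :
  (forall i, g_sigma_preimage coor (F i)) ->
  g_sigma_preimage coor (\bigcup_i F i).
Proof. exact: sigma_algebra_bigcup. Qed.

HB.instance Definition _ := @isMeasurable.Build default_measure_display
  'rV[R]_n (g_sigma_preimage coor) rV_set0 rV_setC rV_bigcup.

Lemma measurable_coor (i : 'I_n) :
  measurable_fun [set: 'rV[R]_n] (fun x : 'rV[R]_n => x ord0 i).
Proof.
move=> _ Y mY; rewrite setTI; apply: sub_sigma_algebra => /=.
rewrite -bigcup_seq/=; exists i => /=; first by rewrite mem_index_enum.
by exists Y => //; rewrite setTI.
Qed.

End measurable_rV.

Lemma measurable_fun_rV (R : realType) n d (T : measurableType d)
    (f : T -> 'rV[R]_n) :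
  (forall i, measurable_fun [set: T] (fun t => f t ord0 i)) ->
  measurable_fun [set: T] f.
Proof.
move=> mf.
have prefS : g_sigma_preimage (fun i => (fun x : 'rV[R]_n => x ord0 i) \o f)
    `<=` measurable.
  apply: smallest_sub; first exact: sigma_algebra_measurable.
  case: n => [|m] in f mf *; first by rewrite big_ord0.
  rewrite -bigcup_mkord_ord; apply: bigcup_sub => i Ii.
  by move=> A [B mB <-]; exact: mf.
move: prefS; rewrite g_sigma_preimage_comp => prefS _ A mA.
by apply: prefS; exists A.
Qed.


Definition rVcons (R : realType) n (p : measurableTypeR R * 'rV[R]_n) :
    'rV[R]_n.+1 :=
  \row_i oapp (fun j => p.2 ord0 j) p.1 (unlift ord0 i).

Definition rVuncons (R : realType) n (x : 'rV[R]_n.+1) :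
    measurableTypeR R * 'rV[R]_n :=
  (x ord0 ord0, \row_j x ord0 (lift ord0 j)).

Lemma rVconsK R n : cancel (@rVcons R n) (@rVuncons R n).
Proof.
case=> a x; rewrite /rVuncons mxE unlift_none /=; congr pair.
by apply/rowP => j; rewrite !mxE liftK.
Qed.

Lemma measurable_rVcons R n : measurable_fun setT (@rVcons R n).
Proof.
apply: measurable_fun_rV => i.
case: (unliftP ord0 i) => [j ->|->].
- rewrite (_ : (fun _ => _) = (fun x : 'rV[R]_n => x ord0 j) \o snd); last first.
    by apply/funext => p; rewrite /= mxE liftK.
  by apply: measurableT_comp => //; exact: measurable_coor.
- rewrite (_ : (fun _ => _) = fst) //.
  by apply/funext => p; rewrite /= mxE unlift_none.
Qed.

Lemma measurable_rVuncons R n : measurable_fun setT (@rVuncons R n).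
Proof.
apply: measurable_fun_pair; first exact: measurable_coor.
apply: measurable_fun_rV => i.
under eq_fun do rewrite mxE.
exact: measurable_coor.
Qed.

Section lebesgue_step.
Context {R : realType} (n : nat).
Variable m : {sigma_finite_measure set 'rV[R]_n -> \bar R}.

Definition lebesgue_rVS : set 'rV[R]_n.+1 -> \bar R :=
  pushforward (@lebesgue_measure R \x m)%E (@rVcons R n).

Let pm : {measure set 'rV[R]_n.+1 -> \bar R} :=
  measure_function_pushforward__canonical__measure_function_Measure
    (@lebesgue_measure R \x m)%E (@measurable_rVcons R n).

Let lebesgue_rVS0 : lebesgue_rVS set0 = 0%E. Proof. exact: (measure0 pm). Qed.

Let lebesgue_rVS_ge0 A : (0 <= lebesgue_rVS A)%E.
Proof. exact: (measure_ge0 pm). Qed.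

Let lebesgue_rVS_sigma_additive : semi_sigma_additive lebesgue_rVS.
Proof. exact: (@measure_semi_sigma_additive _ _ _ pm). Qed.

HB.instance Definition _ := isMeasure.Build _ _ _ lebesgue_rVS
  lebesgue_rVS0 lebesgue_rVS_ge0 lebesgue_rVS_sigma_additive.

Let sigma_finite_rVS : sigma_finite setT lebesgue_rVS.
Proof.
have /sigma_finiteP[F [TF ndF Foo]] := sigma_finiteT (@lebesgue_measure R).
have /sigma_finiteP[G [TG ndG Goo]] := sigma_finiteT m.
exists (fun k => @rVuncons R n @^-1` (F k `*` G k)).
  apply/esym; rewrite -subTset => x _.
  have [i _ Fi] : (\bigcup_k F k) (rVuncons x).1 by rewrite -TF.
  have [j _ Gj] : (\bigcup_k G k) (rVuncons x).2 by rewrite -TG.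
  exists (maxn i j) => //; split.
  - by move: Fi; exact/subsetPset/ndF/leq_maxl.
  - by move: Gj; exact/subsetPset/ndG/leq_maxr.
move=> k; have [mF Fk] := Foo k; have [mG Gk] := Goo k; split.
  rewrite -[X in measurable X]setTI; apply: measurable_rVuncons => //.
  exact: measurableX.
rewrite /lebesgue_rVS /pushforward -comp_preimage (_ : _ \o _ = id); last first.
  by apply/funext => p /=; rewrite rVconsK.
by rewrite preimage_id product_measure1E// lte_mul_pinfty// ge0_fin_numE.
Qed.

HB.instance Definition _ :=
  Measure_isSigmaFinite.Build _ _ _ lebesgue_rVS sigma_finite_rVS.

End lebesgue_step.

Fixpoint lebesgue_rV {R : realType} n :
    {sigma_finite_measure set 'rV[R]_n -> \bar R} :=
  match n with
  | 0 => \d_ (0 : 'rV[R]_0)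
  | n'.+1 => lebesgue_rVS (lebesgue_rV n')
  end.

Definition box (R : realType) n (a b : 'rV[R]_n) : set 'rV[R]_n :=
  [set x | forall i, a ord0 i <= x ord0 i <= b ord0 i].

Lemma measurable_box (R : realType) n (a b : 'rV[R]_n) : measurable (box a b).
Proof.
rewrite (_ : box a b = \big[setI/setT]_(i < n)
    ((fun x : 'rV[R]_n => x ord0 i) @^-1` `[a ord0 i, b ord0 i])).
  apply: bigsetI_measurable => i _; rewrite -[X in measurable X]setTI.
  by apply: measurable_coor.
rewrite -bigcap_seq; apply/seteqP; split => x /=.
  by move=> h i _ /=; rewrite in_itv; exact: h.
by move=> h i; have := h i; rewrite /= mem_index_enum in_itv; exact.
Qed.

Lemma lebesgue_rV_box (R : realType) n (a b : 'rV[R]_n) :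
  (forall i, a ord0 i <= b ord0 i) ->
  lebesgue_rV n (box a b) = (\prod_i (b ord0 i - a ord0 i))%:E.
Proof.
elim: n a b => [|n IH] a b ab.
  rewrite big_ord0 /= diracE mem_set //; by case.
rewrite big_ord_recl /= /lebesgue_rVS /pushforward.
set a' : 'rV_n := \row_i a ord0 (lift ord0 i).
set b' : 'rV_n := \row_i b ord0 (lift ord0 i).
rewrite (_ : _ @^-1` _ =
    `[a ord0 ord0, b ord0 ord0]%classic `*` box a' b'); last first.
  apply/seteqP; split => -[x y] /=.
    move=> h; split; first by have := h ord0; rewrite /= mxE unlift_none /= in_itv.
    by move=> i /=; have := h (lift ord0 i); rewrite !mxE liftK.
  move=> [h1 h2] i; rewrite mxE; case: (unliftP ord0 i) => [j ->|->] /=.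
    by have := h2 j; rewrite !mxE.
  by move: h1; rewrite in_itv.
rewrite product_measure1E//=; last exact: measurable_box.
rewrite lebesgue_measure_itv/= IH; last by move=> i; rewrite !mxE.
rewrite lte_fin; under eq_bigr do rewrite !mxE.
case: ltP => [//|h]; rewrite (@le_anti _ _ (b ord0 ord0) (a ord0 ord0)) ?ab ?h//.
by rewrite subrr mul0r mul0e.
Qed.

(* A carrier set together with an inner product. The elements are honest
   functions: spaces of classes modulo a.e. equality are replaced by the sets
   of all representatives. *)
Record ipspace (R : realType) (V : lmodType R) := IPSpace {
  ipset : set V;
  ip : V -> V -> R }.

Definition ipnorm (R : realType) (V : lmodType R) (X : ipspace V) (u : V) : R :=
  Num.sqrt (ip X u u).

(* ip-orthogonal projection of u onto S; 0 if there is none. *)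
Definition oproj (R : realType) (V : lmodType R) (ip : V -> V -> R)
    (S : set V) (u : V) : V :=
  xget 0 [set w | S w /\ forall z, S z -> ip (u - w) z = 0].

(* sup over v in S of <r, v> / |v|_X; a v of norm 0 contributes r / 0 = 0,
   which does not change the supremum. *)
Definition dual_norm (R : realType) (V : lmodType R) (pairing : V -> V -> R)
    (X : ipspace V) (S : set V) (r : V) : R :=
  sup [set pairing r v / ipnorm X v | v in S].

(* Vector fields are indexed families of components. *)
Definition ipvec (R : realType) (I : finType) (W : lmodType R)
    (X : ipspace W) : ipspace (I -> W) :=
  IPSpace [set u : I -> W | forall i, ipset X (u i)]
          (fun u v => \sum_(i : I) ip X (u i) (v i)).

Definition Ck (R : realType) (k : nat) (g : R -> R) :=
  (forall j, (j < k)%N -> forall t, derivable (derive1n j g) t 1) /\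
  continuous (derive1n k g).

Section bochner.
Context {R : realType} {V : lmodType R}.
Variables (T : R) (X : ipspace V).
Implicit Types u v : R -> V.
Local Notation mu := (@lebesgue_measure R).

Definition simple_fun (s : R -> V) :=
  exists m (A : 'I_m -> set R) (w : 'I_m -> V),
    [/\ forall j, measurable (A j), forall j, ipset X (w j) &
        forall t, s t = \sum_j \1_(A j) t *: w j].

Definition strongly_measurable u := exists s : nat -> R -> V,
  (forall k, simple_fun (s k)) /\
  {ae mu, forall t, 0 < t < T ->
    (fun k => ipnorm X (s k t - u t)) @ \oo --> (0 : R)}.

Definition bochner_L2 : set (R -> V) := [set u |
  [/\ {ae mu, forall t, 0 < t < T -> ipset X (u t)},
      strongly_measurable u &
      mu.-integrable `]0, T[ (fun t => (ipnorm X (u t) ^+ 2)%:E)]].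

Definition time_test (chi : R -> R) :=
  (forall k t, derivable (derive1n k chi) t 1) /\
  exists a b, [/\ 0 < a, b < T & forall t, ~~ (a <= t <= b) -> chi t = 0].

(* int_0^T chi' u = - int_0^T chi v in X. *)
Definition is_weak_dt u v := bochner_L2 v /\
  forall chi w, time_test chi -> ipset X w ->
    \int[mu]_(t in `]0, T[) (derive1 chi t * ip X (u t) w) =
    - \int[mu]_(t in `]0, T[) (chi t * ip X (v t) w).

Definition weak_dt u : R -> V := xget 0 (is_weak_dt u).

Fixpoint bochner_H (k : nat) : set (R -> V) :=
  if k is k'.+1 then
    [set u | bochner_L2 u /\ exists2 v, is_weak_dt u v & bochner_H k' v]
  else bochner_L2.

Definition bochner_C : set (R -> V) := [set u |
  (forall t, 0 <= t <= T -> ipset X (u t)) /\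
  forall t, 0 <= t <= T ->
    (fun s => ipnorm X (u s - u t)) @ within `[0, T] (nbhs t) --> (0 : R)].

End bochner.

Section time_grid.
Context {R : realType}.
Variables (T : R) (N : nat).

Definition tau : R := T / N%:R.
Definition tgrid (n : nat) : R := n%:R * tau.

Definition tint (n : nat) (g : R -> R) : R :=
  \int[@lebesgue_measure R]_(s in `[tgrid n.-1, tgrid n]) g s.

(* Piecewise polynomials are attached to the half-open intervals
   ]t^{n-1}, t^n]; their value at 0 is irrelevant without continuity. *)
Definition Ppw {V : lmodType R} (k : nat) (S : set V) : set (R -> V) :=
  [set u | forall n, (1 <= n <= N)%N ->
     exists a : 'I_k.+1 -> V, (forall j, S (a j)) /\
       forall t, tgrid n.-1 < t <= tgrid n ->
         u t = \sum_(j < k.+1) t ^+ j *: a j].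

Definition Ppwc {V : lmodType R} (k : nat) (X : ipspace V) : set (R -> V) :=
  Ppw k (ipset X) `&` bochner_C T X.

Definition pi0bar {V : lmodType R} (X : ipspace V) (u : R -> V) : R -> V :=
  oproj (fun v w => \int[@lebesgue_measure R]_(t in `[0, T]) ip X (v t) (w t))
        (Ppw 0 (ipset X)) u.

(* At t = T one has k = N and the (meaningless) value at t^{N+1} is
   multiplied by 0. *)
Definition I1 {V : lmodType R} (u : R -> V) (t : R) : V :=
  let k := Num.truncn (t / tau) in
  u (tgrid k) + (t / tau - k%:R) *: (u (tgrid k.+1) - u (tgrid k)).

End time_grid.

Record cube (R : realType) (d : nat) := Cube {
  corner : 'rV[R]_d;
  side : R;
  side_gt0 : 0 < side }.

Section torus.
Context {R : realType} {d : nat}.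
Variable Om : cube R d.
Local Notation point := 'rV[R]_d.
Local Notation scal := ('rV[R]_d -> R).
Local Notation vect := ('I_d -> 'rV[R]_d -> R).
Local Notation leb := (lebesgue_rV d).
Implicit Types (u v : 'rV[R]_d -> R) (i j : 'I_d).

Definition cube_set : set point :=
  box (corner Om) (corner Om + const_mx (side Om)).

(* Functions on the torus are periodic functions on R^d. *)
Definition periodic v :=
  forall x i, v (x + side Om *: delta_mx ord0 i) = v x.

Definition spint v : R := \int[leb]_(x in cube_set) v x.

Definition L2 : ipspace scal := IPSpace
  [set v | [/\ periodic v, measurable_fun setT v &
     leb.-integrable cube_set (fun x => (v x ^+ 2)%:E)]]
  (fun u v => spint (fun x => u x * v x)).

Definition partial i v : scal := fun x => 'D_(delta_mx ord0 i) v x.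

Definition smooth v := forall s : seq 'I_d,
  let g := foldr partial v s in
  continuous g /\ forall i x, derivable g x (delta_mx ord0 i).

(* No boundary terms: the test functions are periodic. *)
Definition is_wpartial i v (g : scal) := ipset L2 g /\
  forall psi, periodic psi -> smooth psi ->
    ip L2 v (partial i psi) = - ip L2 g psi.

Definition wpartial i v : scal := xget 0 (is_wpartial i v).

Definition grad v : vect := fun i => wpartial i v.
Definition div (F : vect) : scal := \sum_i wpartial i (F i).
Definition laplace v : scal := div (grad v).

Fixpoint sobolev (m : nat) : ipspace scal :=
  if m is m'.+1 then IPSpace
    [set v | ipset L2 v /\
       forall i, exists2 g, is_wpartial i v g & ipset (sobolev m') g]
    (fun u v => ip L2 u v +
       \sum_i ip (sobolev m') (wpartial i u) (wpartial i v))
  else L2.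

Definition L20 : set scal := ipset L2 `&` [set v | spint v = 0].

Definition L2v : ipspace vect := ipvec 'I_d L2.
Definition sobolevv (m : nat) : ipspace vect := ipvec 'I_d (sobolev m).

Definition scalev (a : scal) (F : vect) : vect := fun i x => a x * F i x.

(* (a . grad) v *)
Definition advect (a : vect) v : scal :=
  fun x => \sum_j a j x * wpartial j v x.
Definition advectv (a c : vect) : vect := fun i => advect a (c i).

Definition skw (a b c : vect) : R :=
  2^-1 * (ip L2v (advectv a b) c - ip L2v b (advectv a c)).

(* < a grad u, grad w > for vector fields u and w *)
Definition visc (a : scal) (u w : vect) : R :=
  \sum_i ip L2v (scalev a (grad (u i))) (grad (w i)).

Definition enorm (x : point) : R := Num.sqrt (\sum_i x ord0 i ^+ 2).

Definition conv_hull (S : set point) : set point :=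
  [set x | exists m (w : 'I_m -> R) (y : 'I_m -> point),
     [/\ forall k, 0 <= w k /\ S (y k), \sum_k w k = 1 &
         x = \sum_k w k *: y k]].

(* The rows of a matrix are the d+1 vertices of a simplex. *)
Local Notation simplex := 'M[R]_(d.+1, d).

Definition vertices (K : simplex) : set point := [set row k K | k in setT].

Definition cell (K : simplex) : set point := conv_hull (vertices K).

Definition affine_free (K : simplex) :=
  forall w : 'rV[R]_d.+1, w *m K = 0 -> \sum_k w ord0 k = 0 -> w = 0.

Definition translate (z : 'I_d -> int) (S : set point) : set point :=
  [set x + side Om *: \row_i (z i)%:~R | x in S].

Definition diam (K : simplex) : R :=
  sup [set r | exists x y, [/\ cell K x, cell K y & r = enorm (x - y)]].

Definition inradius (K : simplex) : R :=
  sup [set r | 0 <= r /\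
    exists c, forall y, enorm (y - c) <= r -> cell K y].

Definition meshsize (Th : seq simplex) : R :=
  \big[Num.max/0]_(K <- Th) diam K.

(* The periodic extension of the partition is geometrically conforming: two
   cells, one of them translated by a period, meet exactly in the convex hull
   of their common vertices (z = 0 is conformity inside the cube). *)
Definition admissible_mesh (sigma : R) (Th : seq simplex) :=
  [/\ forall K, K \in Th -> affine_free K,
      \bigcup_(K in [set` Th]) cell K = cube_set,
      forall K K' z, K \in Th -> K' \in Th ->
        cell K `&` translate z (cell K') =
        conv_hull (vertices K `&` translate z (vertices K')) &
      forall K, K \in Th ->
        [/\ sigma * meshsize Th <= inradius K, inradius K <= diam K &
            diam K <= meshsize Th]].

Definition poly_on (k : nat) (A : set point) v :=
  exists c : {ffun 'I_d -> 'I_k.+1} -> R, forall x, A x ->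
    v x = \sum_(a : {ffun 'I_d -> 'I_k.+1} | (\sum_i a i <= k)%N)
            c a * \prod_i x ord0 i ^+ a i.

Variable Th : seq simplex.

Definition Vh : set scal := [set v | ipset (sobolev 1) v /\
  forall K, K \in Th -> poly_on 2 (cell K) v].

Definition Qh : set scal := [set v | [/\ L20 v, ipset (sobolev 1) v &
  forall K, K \in Th -> poly_on 1 (cell K) v]].

Definition Vhv : set vect := [set v | forall i, Vh (v i)].

Definition Zh : set vect := [set v | Vhv v /\
  forall q, Qh q -> ip L2 (div v) q = 0].

Definition pih0 : scal -> scal := oproj (ip L2) Vh.
Definition pih1 : scal -> scal := oproj (ip (sobolev 1)) Vh.
Definition pih0t : scal -> scal := oproj (ip L2) Qh.
Definition Ph1 : vect -> vect := oproj (ip (sobolevv 1)) Zh.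

Definition VhX : ipspace scal := IPSpace Vh (ip (sobolev 1)).
Definition VhvX : ipspace vect := IPSpace Vhv (ip (sobolevv 1)).

Definition norm_Hm1 : scal -> R :=
  dual_norm (ip L2) (sobolev 1) (ipset (sobolev 1)).
Definition norm_Zhd : vect -> R :=
  dual_norm (ip L2v) (sobolevv 1) Zh.

End torus.

(* Classical time derivative; used for piecewise linear functions, for which
   it exists off the grid points. *)
Definition dt {R : realType} {S : Type} (u : R -> S -> R) (t : R) : S -> R :=
  fun x => derive1 (u ^~ x) t.
Definition dtv {R : realType} {I S : Type} (u : R -> I -> S -> R) (t : R) :
    I -> S -> R :=
  fun i => dt (fun s => u s i) t.

Definition coefficient_ok {R : realType} (b : R -> R) (b1 b2 b3 b4 : R) :=
  [/\ Ck 2 b, 0 < b1, forall s, b1 <= b s <= b2,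
      forall s, `|derive1 b s| <= b3 & forall s, `|derive1n 2 b s| <= b4].

Definition potential_ok {R : realType} (f : R -> R) (f1 : R)
    (f2 f3 : nat -> R) :=
  [/\ Ck 4 f, forall s, 0 <= f s, 0 <= f1, forall s, - f1 <= derive1n 2 f s &
      forall k s, (k <= 4)%N ->
        `|derive1n k f s| <= f2 k + f3 k * `|s| ^+ (4 - k)].

Section chns.
Context {R : realType} {d : nat}.
Variables (Om : cube R d) (T gamma : R) (b eta f : R -> R).
Local Notation scal := ('rV[R]_d -> R).
Local Notation vect := ('I_d -> 'rV[R]_d -> R).
Local Notation leb1 := (@lebesgue_measure R).
Local Notation L2 := (L2 Om).
Local Notation L2v := (L2v Om).
Local Notation H := (sobolev Om).
Local Notation Hv := (sobolevv Om).
Local Notation "<< u , v >>" := (ip L2 u v).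
Local Notation "<< u ; v >>" := (ip L2v u v).
Local Notation grad := (grad Om).
Local Notation div := (div Om).

(* All derivatives are weak ones, which exist as L2 functions under the
   regularity required below. *)
Definition CHNS (phi mu : R -> scal) (u : R -> vect) (p : R -> scal) :=
  {ae leb1, forall t, 0 < t < T ->
    {ae lebesgue_rV d, forall x, cube_set Om x ->
      [/\ weak_dt T L2 phi t x + advect Om (u t) (phi t) x =
            div (scalev (b \o phi t) (grad (mu t))) x,
          mu t x = - gamma * laplace Om (phi t) x + derive1 f (phi t x),
          forall i, weak_dt T L2v u t i x + advect Om (u t) (u t i) x =
            div (scalev (eta \o phi t) (grad (u t i))) x
            - grad (p t) i x - phi t x * grad (mu t) i x &
          div (u t) x = 0]}}.

(* The last two conditions select the time-continuous representatives of phi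
   and u, whose point values in time are used below. *)
Definition regular (phi mu : R -> scal) (u : R -> vect) (p : R -> scal) :=
  [/\ bochner_H T (H 1) 2 phi /\ bochner_H T (H 3) 1 phi,
      bochner_H T (H 1) 2 mu /\ bochner_L2 T (H 3) mu,
      bochner_H T (Hv 1) 2 u /\ bochner_H T (Hv 3) 1 u,
      bochner_L2 T (H 2) p /\ bochner_H T L2 2 p &
      bochner_C T (H 1) phi /\ bochner_C T (Hv 1) u].

Definition exact_solution (phi mu : R -> scal) (u : R -> vect)
    (p : R -> scal) :=
  [/\ CHNS phi mu u p, regular phi mu u p &
      {ae leb1, forall t, 0 < t < T -> spint Om (p t) = 0}].

Definition frel (x y : R) : R := f x - f y - derive1 f y * (x - y).

Definition rel_energy (alpha : R) (phi : scal) (u : vect)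
    (phih : scal) (uh : vect) : R :=
  spint Om (fun x =>
    gamma / 2 * \sum_i (grad phi i x - grad phih i x) ^+ 2
    + frel (phi x) (phih x) + alpha / 2 * (phi x - phih x) ^+ 2
    + 2^-1 * \sum_i (u i x - uh i x) ^+ 2).

Definition dissipation (phi mu : scal) (u : vect) : R :=
  spint Om (fun x =>
    b (phi x) * \sum_i grad mu i x ^+ 2
    + eta (phi x) * \sum_i \sum_j grad (u i) j x ^+ 2).

Variables (N : nat) (Th : seq 'M[R]_(d.+1, d)).
Local Notation Vh := (Vh Om Th).
Local Notation Vhv := (Vhv Om Th).
Local Notation Qh := (Qh Om Th).
Local Notation VhX := (VhX Om Th).
Local Notation VhvX := (VhvX Om Th).
Local Notation P0 := (Ppw T N 0).
Local Notation P1c := (Ppwc T N 1).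
Local Notation tint := (tint T N).
Local Notation bar := (pi0bar T N L2).
Local Notation barv := (pi0bar T N L2v).

Definition discrete_solution (phi0 : scal) (u0 : vect)
    (phi mub : R -> scal) (u : R -> vect) (pb : R -> scal) :=
  let phib := bar phi in
  let ub := barv u in
  [/\ [/\ P1c VhX phi, P0 Vh mub, P1c VhvX u & P0 Qh pb],
      phi 0 = pih1 Om Th phi0 /\ u 0 = Ph1 Om Th u0 &
      forall n, (1 <= n <= N)%N ->
      [/\ forall psi, P0 Vh psi ->
            tint n (fun s => << dt phi s, psi s >>) =
            tint n (fun s => << scalev (phi s) (ub s); grad (psi s) >>)
            - tint n (fun s =>
                << scalev (b \o phib s) (grad (mub s)); grad (psi s) >>),
          forall xi, P0 Vh xi ->
            tint n (fun s => << mub s, xi s >>) =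
            gamma * tint n (fun s => << grad (phi s); grad (xi s) >>)
            + tint n (fun s => << derive1 f \o phi s, xi s >>),
          forall v, P0 Vhv v ->
            tint n (fun s => << dtv u s; v s >>) =
            - tint n (fun s => skw Om (u s) (ub s) (v s))
            - tint n (fun s => visc Om (eta \o phib s) (ub s) (v s))
            + tint n (fun s => << pb s, div (v s) >>)
            - tint n (fun s => << scalev (phi s) (v s); grad (mub s) >>) &
          forall q, P0 Qh q -> tint n (fun s => << div (u s), q s >>) = 0]].

Definition hat_phi (phi : R -> scal) : R -> scal :=
  I1 T N (fun t => pih1 Om Th (phi t)).
Definition hat_mu (mu : R -> scal) : R -> scal :=
  bar (fun t => pih0 Om Th (mu t)).
Definition hat_u (u : R -> vect) : R -> vect :=
  I1 T N (fun t => Ph1 Om Th (u t)).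
Definition hat_p (p : R -> scal) : R -> scal :=
  bar (fun t => pih0t Om Th (p t)).

(* phi and u are the discrete solutions; the arguments with suffix h are the
   projections of the exact solution. *)
Definition discrete_residuals (phi : R -> scal) (u : R -> vect)
    (phih muh : R -> scal) (uh : R -> vect) (ph : R -> scal)
    (r1 r2 : R -> scal) (r3 : R -> vect) :=
  let phib := bar phi in
  let uhb := barv uh in
  [/\ P0 Vh r1, P0 Vh r2, P0 Vhv r3 &
      forall n, (1 <= n <= N)%N ->
      [/\ forall psi, P0 Vh psi ->
            tint n (fun s => << dt phih s, psi s >>) =
            tint n (fun s => << scalev (phi s) (uhb s); grad (psi s) >>)
            - tint n (fun s =>
                << scalev (b \o phib s) (grad (muh s)); grad (psi s) >>)
            + tint n (fun s => << r1 s, psi s >>),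
          forall xi, P0 Vh xi ->
            tint n (fun s => << muh s, xi s >>) =
            gamma * tint n (fun s => << grad (phih s); grad (xi s) >>)
            + tint n (fun s => << derive1 f \o phih s, xi s >>)
            + tint n (fun s => << r2 s, xi s >>) &
          forall v, P0 Vhv v ->
            tint n (fun s => << dtv uh s; v s >>) =
            - tint n (fun s => skw Om (u s) (uhb s) (v s))
            - tint n (fun s => visc Om (eta \o phib s) (uhb s) (v s))
            + tint n (fun s => << ph s, div (v s) >>)
            - tint n (fun s => << scalev (phi s) (grad (muh s)); v s >>)
            + tint n (fun s => << r3 s; v s >>)]].

End chns.

(* Main.v *)
Require Import Defs.
From mathcomp Require Import all_boot all_order all_algebra.
From mathcomp Require Import all_classical all_reals all_analysis.
From mathcomp Require Import measurable_realfun.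
From mathcomp Require Import ring lra.
Set Implicit Arguments.
Unset Strict Implicit.
Unset Printing Implicit Defensive.
Import Order.TTheory GRing.Theory Num.Theory numFieldNormedType.Exports.
Local Open Scope classical_set_scope.
Local Open Scope ring_scope.

(** The proof is a discrete relative energy argument on a single time interval. There
    the phase field and the velocity are affine in time and the chemical potential
    is constant, and the test functions that are constant in time turn the equations
    into finitely many identities between functions of space: the increments over
    the interval against the midpoint values. Let e, w and m be the errors of phase
    field, velocity and chemical potential, ebar and wbar the midpoint values.

    The residual equations are subtracted from the discrete ones; the first is tested
    with m + r2 + alpha ebar, the second with the increment of e, the third with
    wbar. Along affine paths the quadratic parts of the energy change by midpoint
    times increment, and the potential part by the chain rule, whose main term is the
    one tested in the second equation. The convection of wbar vanishes by skew
    symmetry, and the coupling < phi wbar, grad m > occurs twice with opposite signs.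
    What remains on the right is linear in the residuals, or contains m and wbar at
    most once together with e, or is the Taylor remainder of f' tested with the
    increment of the projected phase field (energy_identity). Young's inequality
    absorbs a quarter of the dissipation (absorb, relative_energy_step).

    The constants are independent of mesh and time step because of four facts.
    Products of H1 functions are estimated in L4 (ladyzhenskaya). The discrete phase
    field is bounded in H1 by the initial data, as mass is conserved and the energy
    decreases (discrete_bound). The increment of the projected phase field is bounded
    by the length of the interval, as functions of class H2 in time are Lipschitz
    (time_lipschitz). The H1 norm of m is controlled by its gradient and its mean
    (poincare), and the mean by the second equation tested with 1 (mean_m). Finally
    the choice of alpha makes the energy coercive, and on affine paths its integral
    in time dominates the errors at both ends of the interval
    (energy_integral_lower).

    The tools on the torus come from one identity: a weakly differentiable v
    satisfies v (x + h e_i) - v x = int_0^h g_i (x + s e_i) ds for almost all x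
    (translation_ae). Averaged over all translations it gives the Poincare
    inequality; applied to v^2 it bounds v^2 by averages over lines, from which the
    L4 estimate follows.

    Elements of the spaces are functions, not classes. Projections, time averages and
    left limits are thus determined only up to functions of norm zero, and a good part
    of the text replaces such values by convenient representatives. *)

(** * Smooth functions of one real variable *)

Section smooth_line.
Context {R : realType}.
Implicit Types f g : R -> R.

(** Differentiability is required with an explicit derivative at each order, so
    that closure under the operations is an induction on the order. *)
Fixpoint Cn (n : nat) f : Prop :=
  if n is n'.+1 then
    exists2 g, (forall t, is_derive t (1 : R) f (g t)) & Cn n' g
  else True.

Definition Cinf f := forall n, Cn n f.

Lemma CnW n f : Cn n.+1 f -> Cn n f.
Proof.
elim: n f => [//|n IH] f [g fg Cg]; exists g => //; exact: IH.
Qed.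

Lemma Cn_cst n (c : R) : Cn n (fun=> c).
Proof.
elim: n c => [//|n IH] c; exists (fun=> 0) => // t; exact: is_derive_cst.
Qed.

Lemma CnD n f g : Cn n f -> Cn n g -> Cn n (fun t => f t + g t).
Proof.
elim: n f g => [//|n IH] f g [f' ff' Cf] [g' gg' Cg].
exists (fun t => f' t + g' t); last exact: IH.
by move=> t; exact: is_deriveD.
Qed.

Lemma CnM n f g : Cn n f -> Cn n g -> Cn n (fun t => f t * g t).
Proof.
elim: n f g => [//|n IH] f g Cf Cg.
have [f' ff' Cf'] := Cf; have [g' gg' Cg'] := Cg.
exists (fun t => f t * g' t + g t * f' t).
  by move=> t; apply: is_derive_eq.
by apply: CnD; apply: IH => //; exact: CnW.
Qed.

Lemma Cn_comp n f g : Cn n f -> Cn n g -> Cn n (fun t => f (g t)).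
Proof.
elim: n f g => [//|n IH] f g [f' ff' Cf'] Cg; have [g' gg' Cg'] := Cg.
exists (fun t => f' (g t) * g' t).
  by move=> t; apply: (@is_derive1_comp _ f g).
by apply: CnM => //; apply: IH => //; exact: CnW.
Qed.

Lemma CnV n f : (forall t, f t != 0) -> Cn n f -> Cn n (fun t => (f t)^-1).
Proof.
elim: n f => [//|n IH] f f0 Cf; have [f' ff' Cf'] := Cf.
exists (fun t => - ((f t)^-1 * (f t)^-1) * f' t).
  move=> t; have h := is_deriveV (f0 t) (ff' t).
  by apply: is_derive_eq; rewrite -exprVn expr2.
apply: CnM => //; rewrite (_ : (fun t => _) = fun t => -1 * ((f t)^-1 * (f t)^-1)).
  by do 2 (apply: CnM; try exact: Cn_cst); apply: IH => //; exact: CnW.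
by apply/funext => t; rewrite mulN1r.
Qed.

Lemma Cn_id n : Cn n (@id R).
Proof.
case: n => [//|n]; exists (fun=> 1); last exact: Cn_cst.
by move=> t; exact: is_derive_id.
Qed.

Lemma Cinf_ex f : Cinf f ->
  exists2 g, (forall t, is_derive t (1 : R) f (g t)) & Cinf g.
Proof.
move=> Cf; exists (derive1 f).
  by move=> t; have [g fg _] := Cf 1%N; have [h _] := fg t; split=> //; rewrite derive1E.
move=> n; have [g fg Cg] := Cf n.+1.
suff -> : derive1 f = g by [].
by apply/funext => t; rewrite derive1E; have [_ ->] := fg t.
Qed.

Lemma Cinf_derive f : Cinf f -> Cinf (derive1 f).
Proof.
move=> /Cinf_ex[g fg Cg]; suff -> : derive1 f = g by [].
by apply/funext => t; rewrite derive1E; have [_ ->] := fg t.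
Qed.

Lemma Cinf_is_derive f t : Cinf f -> is_derive t (1 : R) f (derive1 f t).
Proof.
by move=> /Cinf_ex[g fg _]; have [h _] := fg t; split => //; rewrite derive1E.
Qed.

Lemma Cinf_derivable f t : Cinf f -> derivable f t 1.
Proof. by move=> /(@Cinf_is_derive _ t) []. Qed.

Lemma Cinf_continuous f : Cinf f -> continuous f.
Proof.
by move=> Cf t; apply/differentiable_continuous/derivable1_diffP/Cinf_derivable.
Qed.

Lemma Cinf_derive1n f k t : Cinf f -> derivable (derive1n k f) t 1.
Proof.
move=> Cf; suff : Cinf (derive1n k f) by exact: Cinf_derivable.
by elim: k => [//|k IH]; rewrite derive1nS; exact: Cinf_derive.
Qed.

Lemma Cinf_cst (c : R) : Cinf (fun=> c).
Proof. by move=> n; exact: Cn_cst. Qed.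
Lemma CinfD f g : Cinf f -> Cinf g -> Cinf (fun t => f t + g t).
Proof. by move=> Cf Cg n; exact: CnD. Qed.
Lemma CinfM f g : Cinf f -> Cinf g -> Cinf (fun t => f t * g t).
Proof. by move=> Cf Cg n; exact: CnM. Qed.
Lemma Cinf_comp f g : Cinf f -> Cinf g -> Cinf (fun t => f (g t)).
Proof. by move=> Cf Cg n; exact: Cn_comp. Qed.
Lemma CinfV f : (forall t, f t != 0) -> Cinf f -> Cinf (fun t => (f t)^-1).
Proof. by move=> f0 Cf n; exact: CnV. Qed.
Lemma Cinf_id : Cinf (@id R).
Proof. by move=> n; exact: Cn_id. Qed.
Lemma CinfZ (c : R) f : Cinf f -> Cinf (fun t => c * f t).
Proof. by move=> Cf; apply: CinfM => //; exact: Cinf_cst. Qed.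
Lemma CinfN f : Cinf f -> Cinf (fun t => - f t).
Proof.
move=> Cf; rewrite (_ : (fun _ => _) = fun t => -1 * f t); first exact: CinfZ.
by apply/funext => t; rewrite mulN1r.
Qed.
Lemma CinfB f g : Cinf f -> Cinf g -> Cinf (fun t => f t - g t).
Proof. by move=> Cf Cg; apply: CinfD => //; exact: CinfN. Qed.

Lemma Cn_sin_cos n : Cn n (@sin R) /\ Cn n (@cos R).
Proof.
elim: n => [//|n [IHs IHc]]; split.
  by exists (@cos R) => // t; exact: is_derive_sin.
exists (fun t => -1 * sin t); last by apply: CnM => //; exact: Cn_cst.
by move=> t; rewrite mulN1r; exact: is_derive_cos.
Qed.

Lemma Cinf_cos : Cinf (@cos R).
Proof. by move=> n; have [] := Cn_sin_cos n. Qed.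

Lemma Cinf_primitive f F : Cinf f ->
  (forall t, is_derive t (1 : R) F (f t)) -> Cinf F.
Proof. by move=> Cf FF [|n] //; exists f. Qed.

(** The whole family t^-k exp(-1/t) is introduced at once because it is stable
    under differentiation up to linear combinations, which makes the smoothness
    of its members a single induction. *)
Definition flat (k : nat) (t : R) : R :=
  if 0 < t then t ^- k * expR (- t^-1) else 0.

(** The exponential series dominates its term of order k+2, which leaves a factor
    t^2: the quadratic contact gives the derivative at 0. *)
Lemma flat_le k (t : R) : `|flat k t| <= (k.+2)`!%:R * t ^+ 2.
Proof.
rewrite /flat; case: ifPn => t0; last first.
  by rewrite normr0 mulr_ge0 ?sqr_ge0.
have iv0 : 0 < t^-1 by rewrite invr_gt0.
rewrite ger0_norm ?mulr_ge0 ?expR_ge0 ?invr_ge0 ?exprn_ge0 ?(ltW t0)//.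
rewrite expRN ler_pdivrMr ?expR_gt0//.
have h : t^-1 ^+ k.+2 / (k.+2)`!%:R <= expR t^-1.
  by apply: le_trans (expR_ge1Dxn k.+1 (ltW iv0)); rewrite lerDr.
have f0 : (0 : R) < (k.+2)`!%:R by rewrite ltr0n fact_gt0.
apply: le_trans (_ : (k.+2)`!%:R * t ^+ 2 * (t^-1 ^+ k.+2 / (k.+2)`!%:R) <= _).
  rewrite -exprVn !exprS.
  rewrite le_eqVlt; apply/orP; left; apply/eqP; field.
  by rewrite (gt_eqF f0) (gt_eqF t0).
by rewrite ler_wpM2l// mulr_ge0 ?sqr_ge0 ?ltW.
Qed.

Lemma is_derive_sqr0 f (C : R) : (forall t, `|f t| <= C * t ^+ 2) ->
  is_derive (0 : R) (1 : R) f 0.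
Proof.
move=> fC; have f0 : f 0 = 0.
  by apply/eqP; rewrite -normr_le0 (le_trans (fC 0))// expr0n mulr0.
have h : h^-1 *: (f (h *: (1:R) + 0) - f 0) @[h --> (0 : R)^'] --> (0 : R).
  have cC : (C * `|h|) @[h --> (0 : R)^'] --> (0 : R).
    have cn : `|h| @[h --> (0 : R)^'] --> (0 : R).
      rewrite -[X in _ --> X](@normr0 _ R); apply: cvg_norm.
      exact: nbhs_dnbhs.
    by rewrite -[X in _ --> X](mulr0 C); exact: (cvgM (cvg_cst _) cn).
  apply: (@squeeze_cvgr _ _ _ _ (fun h : R => - (C * `|h|)) (fun h => C * `|h|)) => //.
  - near=> h; have h0 : h != 0 by near: h; exact: nbhs_dnbhs_neq.
    rewrite f0 subr0 addr0 [h *: _]mulr1 -ler_norml normrM normfV.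
    rewrite mulrC ler_pdivrMr ?normr_gt0// -mulrA -expr2 real_normK ?num_real//.
  - by rewrite -[X in _ --> X]oppr0; exact: cvgN.
split; last exact/cvg_lim.
by apply/cvg_ex; exists 0.
Unshelve. all: by end_near. Qed.

Lemma is_derive_flat k (t : R) :
  is_derive t (1 : R) (flat k) (- k%:R * flat k.+1 t + flat k.+2 t).
Proof.
have [t0|t0|->] := ltgtP t 0.
- rewrite [flat k.+1 t]/flat [flat k.+2 t]/flat ltNge (ltW t0)/= mulr0 addr0.
  have dz : is_derive t (1 : R) (fun=> (0 : R)) (0 : R) by exact: is_derive_cst.
  apply: near_eq_is_derive dz; near=> s; rewrite /flat ltNge (_ : s <= 0)//= ltW//.
  by near: s; exact: lt_nbhsl.
- have tn0 : t != 0 by rewrite gt_eqF.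
  have d1 : is_derive t (1:R) (fun s : R => s^-1) (- t ^- 2 *: 1).
    exact: (@is_deriveV _ id t 1 1 tn0 (is_derive_id _ _)).
  have d2 : is_derive t (1:R) (fun s : R => - s^-1) (t ^- 2).
    rewrite [X in is_derive _ _ _ X](_ : _ = - (- t ^- 2 *: 1)).
      exact: is_deriveN.
    by rewrite scaleNr opprK [_ *: _]mulr1.
  have d3 : is_derive t (1:R) (fun s : R => expR (- s^-1)) (expR (- t^-1) * t ^- 2).
    exact: (@is_derive1_comp _ expR (fun s => - s^-1)).
  have d4 : is_derive t (1:R) (fun s : R => s ^- k) (- k%:R * t ^- k.+1).
    rewrite (_ : (fun _ => _) = (fun s : R => s^-1 ^+ k)); last first.
      by apply/funext => s; rewrite exprVn.
    have := @is_deriveX _ _ (fun s : R => s^-1) k t 1 (- t ^- 2 *: 1) d1.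
    case: k => [|k] h.
      by apply: is_derive_eq; rewrite /= !mul0r scale0r oppr0 mul0r.
    move: h; rewrite /= [_%:A]mulr1 [_ *: _]mulrN -mulrA mulNr -!exprVn.
    by rewrite -exprD addn2 exprfctE.
  have d5 : is_derive t (1:R) (fun s : R => s ^- k * expR (- s^-1))
      (- k%:R * flat k.+1 t + flat k.+2 t).
    apply: is_derive_eq; rewrite /flat t0 /GRing.scale /=.
    by rewrite -!exprVn !exprS; ring.
  apply: near_eq_is_derive d5; near=> s; rewrite /flat (_ : 0 < s)//.
  by near: s; exact: lt_nbhsr.
- rewrite (_ : _ + _ = 0); first exact: is_derive_sqr0 (flat_le k).
  by rewrite /flat ltxx mulr0 addr0.
Unshelve. all: by end_near. Qed.

Lemma Cinf_flat k : Cinf (flat k).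
Proof.
move=> n; elim: n k => [//|n IH] k.
exists (fun t => - k%:R * flat k.+1 t + flat k.+2 t).
  by move=> t; exact: is_derive_flat.
by apply: CnD => //; apply: CnM => //; exact: Cn_cst.
Qed.

Lemma flat_ge0 k (t : R) : 0 <= flat k t.
Proof.
rewrite /flat; case: ifPn => // t0.
by rewrite mulr_ge0 ?expR_ge0// invr_ge0 exprn_ge0 ?ltW.
Qed.

Lemma flat_gt0 k (t : R) : 0 < t -> 0 < flat k t.
Proof. by move=> t0; rewrite /flat t0 mulr_gt0 ?expR_gt0// invr_gt0 exprn_gt0. Qed.

Lemma flat_le0 k (t : R) : t <= 0 -> flat k t = 0.
Proof. by move=> t0; rewrite /flat ltNge t0. Qed.

Definition sstep (t : R) : R := flat 0 t / (flat 0 t + flat 0 (1 - t)).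

Lemma sstep_den (t : R) : 0 < flat 0 t + flat 0 (1 - t).
Proof.
have [t0|t0] := ltP 0 t; first by rewrite ltr_pwDl ?flat_gt0 ?flat_ge0.
by rewrite ltr_pwDr ?flat_gt0 ?flat_ge0// subr_gt0 (le_lt_trans t0).
Qed.

Lemma Cinf_sstep : Cinf sstep.
Proof.
apply: CinfM; first exact: Cinf_flat.
apply: CinfV; first by move=> t; rewrite gt_eqF// sstep_den.
apply: CinfD; first exact: Cinf_flat.
apply: Cinf_comp; first exact: Cinf_flat.
by apply: CinfB; [exact: Cinf_cst|exact: Cinf_id].
Qed.

Lemma sstep_le0 (t : R) : t <= 0 -> sstep t = 0.
Proof. by move=> t0; rewrite /sstep flat_le0// mul0r. Qed.

Lemma sstep_ge1 (t : R) : 1 <= t -> sstep t = 1.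
Proof.
move=> t1; rewrite /sstep (@flat_le0 _ (1 - t)) ?subr_le0// addr0 divff//.
by rewrite gt_eqF// flat_gt0// (lt_le_trans ltr01).
Qed.

Lemma sstep_ge0 (t : R) : 0 <= sstep t.
Proof. by rewrite divr_ge0 ?flat_ge0// ltW// sstep_den. Qed.

Lemma sstep_le1 (t : R) : sstep t <= 1.
Proof. by rewrite ler_pdivrMr ?sstep_den// mul1r lerDl flat_ge0. Qed.

End smooth_line.

(** * Lebesgue measure on boxes, translations and periodicity *)

Section boxes.
Context {R : realType}.

Lemma lebesgue_shift (h : R) (A : set (measurableTypeR R)) : measurable A ->
  @lebesgue_measure R ((fun t : R => t + h) @^-1` A) = lebesgue_measure A.
Proof.
move=> mA.
have mh : measurable_fun setT (fun t : measurableTypeR R => (t + h : measurableTypeR R)).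
  exact: measurable_funD.
pose m := measure_function_pushforward__canonical__measure_function_Measure
  (@lebesgue_measure R) mh.
rewrite [RHS](@lebesgue_measure_unique R m) // => X [[a b] _ <-] /=.
rewrite /pushforward lebesgue_measure_itv/= (_ : _ @^-1` _ = `]a - h, b - h]%classic).
  rewrite lebesgue_measure_itv/= !lte_fin ltrD2r; case: ifP => // _.
  by rewrite -!EFinD; congr EFin; ring.
by apply/seteqP; split => x /=; rewrite !in_itv/= ltrBlDr lerBrDr.
Qed.

Lemma ge0_integral_shift1 (h : R) (D : set (measurableTypeR R)) (w : R -> \bar R) :
  measurable D -> measurable_fun setT w -> (forall t, (0 <= w t)%E) ->
  (\int[@lebesgue_measure R]_(t in D) w t =
   \int[@lebesgue_measure R]_(t in (fun t => t + h)%R @^-1` D) w (t + h)%R)%E.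
Proof.
move=> mD mw w0.
have mh : measurable_fun setT (fun t : measurableTypeR R => (t + h : measurableTypeR R)).
  exact: measurable_funD.
rewrite -[RHS](@ge0_integral_pushforward _ _ _ _ R _ mh)//.
  by apply: eq_measure_integral => /= A mA _; rewrite -[LHS](lebesgue_shift h).
exact: measurable_funTS.
Qed.

Let I (w : R -> \bar R) (a b : R) := (\int[@lebesgue_measure R]_(t in `[a, b[) w t)%E.

Let I_cat w (a b c : R) : measurable_fun setT w -> (forall t, (0 <= w t)%E) ->
  a <= b -> b <= c -> (I w a c = I w a b + I w b c)%E.
Proof.
move=> mw w0 ab bc; rewrite /I -ge0_integral_setU//=.
- congr (integral _ _ _); apply/seteqP; split => x /=; rewrite !in_itv/=.
    by case: (ltP x b) => xb /andP[-> ->]; [left|right].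
  case=> /andP[ax xb]; rewrite ?ax ?xb ?andbT//=.
    exact: lt_le_trans bc.
  exact: le_trans ax.
- exact: measurable_funTS.
- apply/disj_setPS => x []; rewrite /= !in_itv/= => /andP[_ xb] /andP[bx _].
  by move: xb; rewrite ltNge bx.
Qed.

Let I_shift w (a b h : R) : measurable_fun setT w -> (forall t, (0 <= w t)%E) ->
  I w (a + h) (b + h) = I (fun t => w (t + h)) a b.
Proof.
move=> mw w0; rewrite /I (ge0_integral_shift1 h)//; congr (integral _ _ _).
by apply/seteqP; split => x /=; rewrite !in_itv/= lerD2r ltrD2r.
Qed.

Lemma periodicN_int (T : Type) (L : R) (w : R -> T) :
  (forall t, w (t + L) = w t) -> forall (k : int) t, w (t + k%:~R * L) = w t.
Proof.
move=> wL k; have wn n t : w (t + n%:R * L) = w t.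
  by elim: n t => [|n IH] t; rewrite ?mul0r ?addr0// -natr1 mulrDl mul1r addrA wL.
case: k => n t; first exact: wn.
by rewrite NegzE mulrNz mulNr -[LHS](wn n.+1) subrK.
Qed.

(** The part of the shifted period that leaves the interval comes back at the
    other end. *)
Lemma ge0_integral_shift_periodic (c L h : R) (w : R -> \bar R) : 0 < L ->
  measurable_fun setT w -> (forall t, (0 <= w t)%E) ->
  (forall t, w (t + L) = w t) ->
  (\int[@lebesgue_measure R]_(t in `[c, (c + L)%R]) w (t + h)%R =
   \int[@lebesgue_measure R]_(t in `[c, (c + L)%R]) w t)%E.
Proof.
move=> L0 mw w0 wL.
have mwh (h' : R) : measurable_fun setT (fun t : R => w (t + h')).
  by apply: (measurableT_comp mw); exact: measurable_funD.
suff H h' : 0 <= h' <= L -> I (fun t => w (t + h')) c (c + L) = I w c (c + L).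
  pose k := Num.floor (h / L).
  have := H (h - k%:~R * L); rewrite /I !integral_itv_bndo_bndc; last 2 first.
  - exact: measurable_funTS.
  - exact: measurable_funTS.
  move=> <-; last first.
    have /andP[] := floor_itv (h / L); rewrite -/k => k1 k2.
    rewrite subr_ge0 -ler_pdivlMr// k1 lerBlDr.
    by move: k2; rewrite ltr_pdivrMr// intrD mulrDl mul1r addrC => /ltW ->.
  by apply: eq_integral => t _; rewrite -[RHS](periodicN_int wL k) -addrA subrK.
move=> /andP[h0 hL]; rewrite -I_shift//.
have -> : c + L + h' = c + h' + L by rewrite addrAC.
rewrite (@I_cat w (c + h') (c + L)) //; [|by rewrite lerD2l|by rewrite lerD2r lerDl].
rewrite (@I_cat w c (c + h') (c + L))//; [|by rewrite lerDl|by rewrite lerD2l].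
by rewrite addeC I_shift//; congr (_ + _)%E; apply: eq_integral => t _; rewrite wL.
Qed.

End boxes.

Section boxes_rV.
Context {R : realType}.
Local Notation leb := (@lebesgue_rV R).

Definition boxes n : set (set 'rV[R]_n) := [set A | exists a b, A = box a b].

Lemma boxI n (a b a' b' : 'rV[R]_n) : box a b `&` box a' b' =
  box (\row_i Num.max (a ord0 i) (a' ord0 i)) (\row_i Num.min (b ord0 i) (b' ord0 i)).
Proof.
apply/seteqP; split => x /=.
  by move=> [h h'] i; rewrite !mxE ge_max le_min; case/andP: (h i) => -> ->;
    case/andP: (h' i) => -> ->.
move=> h; split => i; have := h i; rewrite !mxE ge_max le_min.
  by move=> /andP[/andP[-> _] /andP[-> _]].
by move=> /andP[/andP[_ ->] /andP[_ ->]].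
Qed.

Lemma boxes_setI n : setI_closed (@boxes n).
Proof. by move=> _ _ [a [b ->]] [a' [b' ->]]; rewrite boxI; do 2 eexists. Qed.

(** Half-spaces are countable unions of boxes, so that boxes form a generating
    pi-system. *)
Lemma measurable_boxes n : @measurable _ 'rV[R]_n = <<s @boxes n >>.
Proof.
apply/seteqP; split; last first.
  apply: smallest_sub; first exact: sigma_algebra_measurable.
  by move=> _ [a [b ->]]; exact: measurable_box.
have mid : measurable_fun [set: g_sigma_algebraType (@boxes n)]
    (fun x : g_sigma_algebraType (@boxes n) => (x : 'rV[R]_n)).
  apply: measurable_fun_rV => i.
  apply: (measurability _ (RGenCInfty.measurableE R)).
  move=> _ [_ [r ->] <-]; rewrite setTI.
  rewrite (_ : _ @^-1` _ = \bigcup_k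
    box (\row_j if j == i then r else - k%:R) (\row_j k%:R)); last first.
    apply/seteqP; split => x /=.
      rewrite in_itv/= andbT => rx.
      pose M := \sum_j `|x ord0 j|.
      have xM j : `|x ord0 j| <= M.
        by rewrite /M (bigD1 j)//= lerDl sumr_ge0.
      exists (Num.bound M) => // j; rewrite !mxE.
      have MB : M <= (Num.bound M)%:R.
        by rewrite ltW// archi_boundP// (le_trans _ (xM i)).
      have /andP[h1 h2] : - (Num.bound M)%:R <= x ord0 j <= (Num.bound M)%:R.
        by rewrite -ler_norml (le_trans (xM j)).
      by rewrite h2; case: eqP => [->|_]; rewrite ?rx ?h1.
    by move=> [k _ /(_ i)]; rewrite !mxE eqxx in_itv/= andbT => /andP[].
  apply: bigcupT_measurable => k; apply: sub_sigma_algebra.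
  by do 2 eexists.
move=> A mA; have := mid measurableT A mA.
by rewrite setTI preimage_id.
Qed.

(** The measurable sets on which the integral vanishes form a Dynkin class. *)
Lemma integral_boxes_ae0 n (F : 'rV[R]_n -> R) (a b : 'rV[R]_n) :
  (leb n).-integrable (box a b) (EFin \o F) ->
  (forall a' b', (\int[leb n]_(x in box a b `&` box a' b') (F x)%:E = 0)%E) ->
  {ae leb n, forall x, box a b x -> F x = 0}.
Proof.
move=> iF F0.
have mD : measurable (box a b) by exact: measurable_box.
have mF := measurable_int _ iF.
suff H A : measurable A -> (\int[leb n]_(x in box a b `&` A) (F x)%:E = 0)%E.
  have : ae_eq (leb n) (box a b) (EFin \o F) (cst 0%E).
    apply: integral_ae_eq => // E ED mE; rewrite integral0.
    by rewrite -(setIidr ED) H.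
  by apply: filterS => x /= h Dx; have [] := h Dx.
rewrite measurable_boxes.
apply: (@dynkin_induction _ 'rV[R]_n (@boxes n)
  (fun A => \int[leb n]_(x in box a b `&` A) (F x)%:E = 0)%E).
- exact: measurable_boxes.
- exact: boxes_setI.
- by rewrite setIT -[X in integral _ X](setIid (box a b)) F0.
- by move=> _ [a' [b' ->]]; exact: F0.
- move=> S mS S0.
  have : (\int[leb n]_(x in box a b `&` S `|` box a b `&` ~` S) (F x)%:E = 0)%E.
    by rewrite -setIUr setUCr setIT -[X in integral _ X](setIid (box a b)) F0.
  rewrite integral_setU//.
  + by rewrite S0 add0e.
  + exact: measurableI.
  + by apply: measurableI => //; exact: measurableC.
  + by rewrite -setIUr setUCr setIT.
  + by apply/disj_setPS => x [[_ Sx] [_]].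
- move=> F' mF' tF' F'0; rewrite setI_bigcupr integral_bigcup.
  + by apply: eseries0 => k _ _; exact: F'0.
  + by apply: trivIset_setIl.
  + by move=> k; exact: measurableI.
  + rewrite -setI_bigcupr; apply: integrableS iF => //.
    by apply: measurableI => //; exact: bigcupT_measurable.
Qed.

Lemma preimage_rVcons_box n (a b : 'rV[R]_n.+1) :
  @rVcons R n @^-1` box a b =
  `[(rVuncons a).1, (rVuncons b).1]%classic `*` box (rVuncons a).2 (rVuncons b).2.
Proof.
apply/seteqP; split => -[x y] /=.
  move=> h; split; first by have := h ord0; rewrite /= mxE unlift_none /= in_itv.
  by move=> i /=; have := h (lift ord0 i); rewrite !mxE liftK.
move=> [h1 h2] i; rewrite mxE; case: (unliftP ord0 i) => [j ->|->] /=.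
  by have := h2 j; rewrite !mxE.
by move: h1; rewrite in_itv.
Qed.

Lemma ge0_integral_rVS n (a b : 'rV[R]_n.+1) (f : 'rV[R]_n.+1 -> \bar R) :
  measurable_fun setT f -> (forall x, (0 <= f x)%E) ->
  (\int[leb n.+1]_(x in box a b) f x =
   \int[@lebesgue_measure R]_(t in `[(rVuncons a).1, (rVuncons b).1])
     \int[leb n]_(y in box (rVuncons a).2 (rVuncons b).2) f (rVcons (t, y)))%E.
Proof.
move=> mf f0.
rewrite [LHS](@ge0_integral_pushforward _ _ _ _ R _ (@measurable_rVcons R n)
  (@lebesgue_measure R \x leb n)%E)//; [|exact: measurable_box|exact: measurable_funTS].
rewrite preimage_rVcons_box.
have mfc : measurable_fun setT (f \o @rVcons R n).
  by apply: measurableT_comp => //; exact: measurable_rVcons.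
rewrite integral_mkcond fubini_tonelli1//=; last 2 first.
- apply/(measurable_restrictT _ _).1 => //.
    by apply: measurableX => //; exact: measurable_box.
  exact: measurable_funTS.
- by move=> x; rewrite patchE; case: ifP => // _; exact: f0.
rewrite [RHS]integral_mkcond; apply: eq_integral => t _.
rewrite /fubini_F patchE; case: ifPn => [|]; rewrite ?notin_setE ?in_setE => Dt.
  rewrite [RHS]integral_mkcond; apply: eq_integral => y _.
  rewrite !patchE; congr (if _ then _ else _).
  by apply/idP/idP => [/set_mem[_ h]|/set_mem h]; exact/mem_set.
rewrite integral0_eq// => y _; rewrite patchE ifF//.
by apply/negbTE; rewrite notin_setE => -[].
Qed.

End boxes_rV.

Section shift_rV.
Context {R : realType}.
Local Notation leb := (@lebesgue_rV R).

Definition Lperiodic n (T : Type) (L : R) (f : 'rV[R]_n -> T) :=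
  forall x i, f (x + L *: delta_mx ord0 i) = f x.

Lemma measurable_addrV n (z : 'rV[R]_n) : measurable_fun setT (fun x : 'rV[R]_n => x + z).
Proof.
apply: measurable_fun_rV => i; under eq_fun do rewrite mxE.
by apply: measurable_funD => //; exact: measurable_coor.
Qed.

Lemma rVconsD n t y t' (y' : 'rV[R]_n) :
  rVcons (t, y) + rVcons (t', y') = rVcons (t + t', y + y').
Proof.
by apply/rowP => i; rewrite !mxE; case: unliftP => [j _|_] //=; rewrite mxE.
Qed.

Lemma rVunconsK n : cancel (@rVuncons R n) (@rVcons R n).
Proof.
move=> x; apply/rowP => i; rewrite !mxE.
by case: unliftP => [j ->|->]//=; rewrite mxE.
Qed.

Lemma rVcons_delta0 n (L : R) :
  L *: delta_mx ord0 ord0 = rVcons (L, 0 : 'rV[R]_n).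
Proof.
apply/rowP => i; rewrite !mxE eqxx/=.
by case: unliftP => [j ->|->]/=; rewrite ?mulr0 ?mulr1 // mxE.
Qed.

Lemma rVcons_delta n (L : R) (j : 'I_n) :
  L *: delta_mx ord0 (lift ord0 j) = rVcons (0, L *: delta_mx ord0 j).
Proof.
apply/rowP => i; rewrite !mxE eqxx/=.
case: unliftP => [k ->|->]/=; rewrite ?mxE ?eqxx ?(inj_eq lift_inj)//.
by rewrite mulr0.
Qed.

(** Coordinates are shifted one after the other. Periodicity of the restriction
    to a slice is inherited, so that the induction on the dimension goes
    through. *)
Lemma ge0_integral_shift n (c z : 'rV[R]_n) (L : R) (f : 'rV[R]_n -> \bar R) :
  0 < L -> measurable_fun setT f -> (forall x, (0 <= f x)%E) -> Lperiodic L f ->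
  (\int[leb n]_(x in box c (c + const_mx L)) f (x + z)%R =
   \int[leb n]_(x in box c (c + const_mx L)) f x)%E.
Proof.
move=> L0; elim: n => [|n IH] in c z f *.
  by move=> _ _ _; apply: eq_integral => x _; congr f; apply/rowP; case.
move=> mf f0 fL.
rewrite !ge0_integral_rVS//; last first.
  by apply: (measurableT_comp mf); exact: measurable_addrV.
have -> : (rVuncons (c + const_mx L)).1 = (rVuncons c).1 + L by rewrite /= !mxE.
have -> : (rVuncons (c + const_mx L)).2 = (rVuncons c).2 + const_mx L.
  by apply/rowP => j; rewrite !mxE.
set c1 := (rVuncons c).1; set c2 := (rVuncons c).2.
pose z1 := (rVuncons z).1; pose z2 := (rVuncons z).2.
pose w (t : R) := (\int[leb n]_(y in box c2 (c2 + const_mx L)) f (rVcons (t, y)))%E.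
have mc t : measurable_fun setT (fun y => f (rVcons (t, y))).
  apply: (measurableT_comp mf); apply: (measurableT_comp (@measurable_rVcons R n)).
  exact: measurable_pair1.
have -> : (\int[lebesgue_measure]_(t in `[c1, (c1 + L)%R])
      \int[leb n]_(y in box c2 (c2 + const_mx L)) f (rVcons (t, y) + z)%R =
    \int[lebesgue_measure]_(t in `[c1, (c1 + L)%R]) w (t + z1)%R)%E.
  apply: eq_integral => t _; rewrite /w -(IH c2 z2 (fun y => f (rVcons (t + z1, y))))//.
    apply: eq_integral => y _; congr f.
    by rewrite -rVconsD -[z in LHS]rVunconsK.
  by move=> x i; rewrite -[in RHS](fL _ (lift ord0 i)) rVcons_delta rVconsD addr0.
rewrite ge0_integral_shift_periodic//.
- rewrite /w; under eq_fun do rewrite integral_mkcond.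
  apply: (@measurable_fun_fubini_tonelli_F _ _ _ _ _ (leb n) (fun p : measurableTypeR R * 'rV[R]_n =>
    ((fun y => f (rVcons (p.1, y))) \_ (box c2 (c2 + const_mx L))) p.2)); last first.
    by move=> x; rewrite patchE; case: ifP.
  rewrite (_ : (fun _ => _) =
     ((f \o @rVcons R n) \_ (setT `*` box c2 (c2 + const_mx L)))).
    apply/(measurable_restrictT _ _).1 => //.
      by apply: measurableX => //; exact: measurable_box.
    apply: measurable_funTS; apply: measurableT_comp => //; exact: measurable_rVcons.
  apply/funext => -[t y]; rewrite !patchE/=; congr (if _ then _ else _).
  by apply/idP/idP => [/set_mem h|/set_mem[_ h]]; exact/mem_set.
- by move=> t; apply: integral_ge0.
- move=> t; apply: eq_integral => y _.
  by rewrite -[in RHS](fL _ ord0) rVcons_delta0 rVconsD addr0.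
Qed.

Lemma integral_shift n (c z : 'rV[R]_n) (L : R) (f : 'rV[R]_n -> \bar R) :
  0 < L -> measurable_fun setT f -> Lperiodic L f ->
  (\int[leb n]_(x in box c (c + const_mx L)) f (x + z)%R =
   \int[leb n]_(x in box c (c + const_mx L)) f x)%E.
Proof.
move=> L0 mf fL; rewrite integralE [RHS]integralE; congr (_ - _)%E.
- rewrite -(@ge0_integral_shift _ c z L (f^\+)%E)//.
  + by apply: eq_integral => x _; rewrite !(funepos.unlock, funeneg.unlock).
  + exact: measurable_funepos.
  + by move=> x i; rewrite !funepos.unlock fL.
- rewrite -(@ge0_integral_shift _ c z L (f^\-)%E)//.
  + by apply: eq_integral => x _; rewrite !(funepos.unlock, funeneg.unlock).
  + exact: measurable_funeneg.
  + by move=> x i; rewrite !funeneg.unlock fL.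
Qed.

End shift_rV.

(** * Products of periodic smooth functions are dense *)

Section cutoff.
Context {R : realType}.
Implicit Types (L c lo hi t : R).

(** Comparing cosines tests whether t is closer to the midpoint of [lo, hi] modulo
    L than the end points are: a smooth periodic test, which a growing factor k
    inside the step sharpens to the indicator function. *)
Definition cut L lo hi (k : nat) t : R :=
  sstep (1 + k%:R * (cos (2 * pi * ((t - (lo + hi) / 2) / L))
                     - cos (2 * pi * ((hi - lo) / 2 / L)))).

Lemma Cinf_cut L lo hi k : Cinf (cut L lo hi k).
Proof.
apply: Cinf_comp; first exact: Cinf_sstep.
apply: CinfD; first exact: Cinf_cst.
apply: CinfZ; apply: CinfB; last exact: Cinf_cst.
apply: Cinf_comp; first exact: Cinf_cos.
apply: CinfZ; apply: CinfM; last exact: Cinf_cst.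
by apply: CinfB; [exact: Cinf_id|exact: Cinf_cst].
Qed.

Lemma cut_periodic L lo hi k t : L != 0 -> cut L lo hi k (t + L) = cut L lo hi k t.
Proof.
move=> L0; rewrite /cut; congr (sstep (1 + _ * (_ - _))).
have -> : 2 * pi * ((t + L - (lo + hi) / 2) / L) =
    2 * pi * ((t - (lo + hi) / 2) / L) + pi *+ 2 by rewrite -mulr_natl; field.
exact: cosD2pi.
Qed.

Lemma cut_ge0 L lo hi k t : 0 <= cut L lo hi k t.
Proof. exact: sstep_ge0. Qed.

Lemma cut_le1 L lo hi k t : cut L lo hi k t <= 1.
Proof. exact: sstep_le1. Qed.

(** The sequence is eventually constant at each point, because the argument of the
    step is at least 1 inside the interval and tends to minus infinity outside. *)
Lemma cut_cvg L c lo hi t : 0 < L -> c <= lo -> lo <= hi -> hi <= c + L ->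
  c < t < c + L ->
  \forall k \near \oo, cut L lo hi k t = ((lo <= t <= hi)%R)%:R.
Proof.
move=> L0 clo lohi hiL /andP[ct tL].
have Ln0 : L != 0 by rewrite gt_eqF.
pose m := (lo + hi) / 2; pose r := (hi - lo) / 2.
have pi0 := @pi_gt0 R.
pose sc x : R := 2 * pi * (x / L).
have scM x y : (sc x <= sc y) = (x <= y).
  by rewrite /sc ler_pM2l ?ler_pM2r ?invr_gt0// mulr_gt0.
have scMlt x y : (sc x < sc y) = (x < y).
  by rewrite /sc ltr_pM2l ?ltr_pM2r ?invr_gt0// mulr_gt0.
have sc0 : sc 0 = 0 by rewrite /sc mul0r mulr0.
have scL : sc (L / 2) = pi by rewrite /sc; field.
have rL : 0 <= r <= L / 2.
  rewrite /r ler_pM2r// divr_ge0 ?subr_ge0//=.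
  by rewrite lerBlDr (le_trans hiL)// addrC lerD2l.
have rI : sc r \in `[0, pi].
  by rewrite in_itv/= -{1}sc0 -scL !scM.
have cosabs : cos (sc (t - m)) = cos (sc `|t - m|).
  have [_|_] := ger0P (t - m) => //.
  by rewrite -[RHS]cosN; congr cos; rewrite /sc mulNr mulrN opprK.
rewrite /cut -/m -/r -/(sc r) -/(sc (t - m)) cosabs.
have [tin|tout] := boolP (lo <= t <= hi).
  apply: nearW => k; rewrite sstep_ge1// lerDl mulr_ge0// subr_ge0.
  have tm : `|t - m| <= r.
    by move/andP: tin => [lot thi]; rewrite ler_norml /m /r; apply/andP; split; lra.
  have yI : sc `|t - m| \in `[0, pi].
    rewrite in_itv/= -{1}sc0 -scL !scM normr_ge0/=.
    by apply: le_trans tm _; case/andP: rL.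
  by rewrite leNgt ltr_cos// scMlt -leNgt.
have [tm1 tm2] : r < `|t - m| /\ `|t - m| < L - r.
  move: tout; rewrite negb_and -!ltNge => /orP[h|h].
    by rewrite ler0_norm /m /r; [split; lra|lra].
  by rewrite ger0_norm /m /r; [split; lra|lra].
have d0 : cos (sc `|t - m|) < cos (sc r).
  have [yL|yL] := leP `|t - m| (L / 2).
    by rewrite ltr_cos// ?scMlt// in_itv/= -{1}sc0 -scL !scM normr_ge0.
  have -> : cos (sc `|t - m|) = cos (sc (L - `|t - m|)).
    rewrite -[RHS]cosN -[RHS](@cosD2pi R); congr cos.
    by rewrite /sc -mulr_natl; field.
  rewrite ltr_cos//; first by rewrite scMlt; lra.
  by rewrite in_itv/= -{1}sc0 -scL !scM; apply/andP; split; lra.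
near=> k; rewrite sstep_le0//.
have kK : (cos (sc r) - cos (sc `|t - m|))^-1 <= k%:R.
  apply: le_trans (ltW (archi_boundP _)) _.
    by rewrite invr_ge0 subr_ge0 ltW.
  by rewrite ler_nat; near: k; exact: nbhs_infty_ge.
rewrite -(opprB (cos (sc r))) mulrN subr_le0 -ler_pdivrMr ?subr_gt0//.
by rewrite mul1r.
Unshelve. all: by end_near. Qed.

End cutoff.

Section product_tests.
Context {R : realType} (n : nat).
Implicit Types (ps : 'I_n -> R -> R) (x : 'rV[R]_n).
Local Notation leb := (lebesgue_rV n).

(** These products are smooth, their partial derivatives are again of this form, and
    they suffice as test functions in space (density_prodf). *)
Definition prodf ps x : R := \prod_i ps i (x ord0 i).

Definition per1 (L : R) (p : R -> R) := Cinf p /\ forall t, p (t + L) = p t.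

Lemma prodf_continuous ps : (forall i, Cinf (ps i)) -> continuous (prodf ps).
Proof.
move=> Cps; rewrite /prodf.
suff H s : continuous (fun x : 'rV[R]_n => \prod_(i <- s) ps i (x ord0 i)) by exact: H.
elim: s => [|i s IH] x.
  rewrite (_ : (fun _ => _) = cst 1); first exact: cst_continuous.
  by apply/funext => y; rewrite big_nil.
rewrite (_ : (fun x0 => _) = (fun x0 : 'rV[R]_n =>
    ps i (x0 ord0 i) * \prod_(j <- s) ps j (x0 ord0 j))); last first.
  by apply/funext => y; rewrite big_cons.
apply: continuousM => //; last exact: IH.
apply: continuous_comp; first exact: coord_continuous.
exact: Cinf_continuous.
Qed.

Lemma is_derive_prodf ps x (i : 'I_n) : (forall i, Cinf (ps i)) ->
  is_derive x (delta_mx ord0 i) (prodf ps)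
    (prodf (fun j => if j == i then derive1 (ps j) else ps j) x).
Proof.
move=> Cps; set C := \prod_(j | j != i) ps j (x ord0 j).
have dE : (fun h : R => h^-1 *: (prodf ps (h *: delta_mx ord0 i + x) - prodf ps x)) =
    (fun h : R => h^-1 *: ((C * ps i (h *: 1 + x ord0 i)) - (C * ps i (x ord0 i)))).
  apply/funext => h; congr (_ *: (_ - _)).
    rewrite /prodf (bigD1 i)//= mulrC !mxE !eqxx; congr (_ * _).
    by apply: eq_bigr => j ji; rewrite !mxE eqxx (negbTE ji) mulr0 add0r.
  by rewrite /prodf (bigD1 i)//= mulrC.
have dC : is_derive (x ord0 i) (1 : R) (fun t => C * ps i t)
    (C * derive1 (ps i) (x ord0 i)).
  have := Cinf_is_derive (x ord0 i) (Cps i) => h.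
  exact: (@is_deriveZ _ _ _ (ps i) C).
have -> : prodf (fun j => if j == i then derive1 (ps j) else ps j) x =
    C * derive1 (ps i) (x ord0 i).
  rewrite /prodf (bigD1 i)//= eqxx mulrC; congr (_ * _).
  by apply: eq_bigr => j /negbTE ->.
have [h1 h2] := dC.
split; first by rewrite /derivable dE.
by rewrite /derive dE.
Qed.

Lemma partial_prodf ps (i : 'I_n) : (forall i, Cinf (ps i)) ->
  partial i (prodf ps) = prodf (fun j => if j == i then derive1 (ps j) else ps j).
Proof.
by move=> Cps; apply/funext => x; have [_] := is_derive_prodf x i Cps.
Qed.

Lemma foldr_partial_prodf ps (s : seq 'I_n) : (forall i, Cinf (ps i)) ->
  exists2 qs, (forall i, Cinf (qs i)) & foldr (@partial R n) (prodf ps) s = prodf qs.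
Proof.
move=> Cps; elim: s => [|i s [qs Cqs IH]] /=; first by exists ps.
exists (fun j => if j == i then derive1 (qs j) else qs j).
  by move=> j; case: ifP => _ //; exact: Cinf_derive.
by rewrite IH partial_prodf.
Qed.

Lemma prodf_smooth ps : (forall i, Cinf (ps i)) -> smooth (prodf ps).
Proof.
move=> Cps s; have [qs Cqs ->] := foldr_partial_prodf s Cps; split.
  exact: prodf_continuous.
by move=> i x; have [] := is_derive_prodf x i Cqs.
Qed.

Lemma prodf_periodic (L : R) ps : (forall i t, ps i (t + L) = ps i t) ->
  Lperiodic L (prodf ps).
Proof.
move=> pL x i; apply: eq_bigr => j _; rewrite !mxE eqxx/=.
by case: eqP => _; rewrite ?mulr1 ?mulr0 ?addr0// pL.
Qed.

Lemma measurable_prodf ps : (forall i, Cinf (ps i)) ->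
  measurable_fun setT (prodf ps).
Proof.
move=> Cps; apply: measurable_prod => i _.
apply: (measurableT_comp (f := ps i)); last exact: measurable_coor.
by apply: continuous_measurable_fun; exact: Cinf_continuous.
Qed.

Lemma negligible_face (c : 'rV[R]_n) (L : R) (i : 'I_n) (a : R) : 0 <= L ->
  leb.-negligible (box c (c + const_mx L) `&` [set x | x ord0 i = a]).
Proof.
move=> L0; pose lo := \row_j if j == i then a else c ord0 j.
pose hi := \row_j if j == i then a else c ord0 j + L.
exists (box lo hi); split.
- exact: measurable_box.
- rewrite [LHS]lebesgue_rV_box; last first.
    by move=> j; rewrite !mxE; case: eqP => // _; rewrite lerDl.
  by rewrite (bigD1 i)//= !mxE eqxx subrr mul0r.
- move=> x [h xa] j; rewrite !mxE; case: eqP => [->|_]; first by rewrite xa lexx.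
  by have := h j; rewrite !mxE.
Qed.

Lemma ae_interior (c : 'rV[R]_n) (L : R) : 0 <= L ->
  {ae leb, forall x, box c (c + const_mx L) x ->
     forall i, c ord0 i < x ord0 i < c ord0 i + L}.
Proof.
move=> L0.
have h (i : 'I_n) : {ae leb, forall x, box c (c + const_mx L) x ->
    c ord0 i < x ord0 i < c ord0 i + L}.
  have := negligibleU (negligible_face c i (c ord0 i) L0)
    (negligible_face c i (c ord0 i + L) L0).
  apply: negligibleS => x /= /not_implyP[Dx nh].
  have /andP[h1 h2] := Dx i; move: h2; rewrite !mxE => h2.
  have [h3|h3] := eqVneq (x ord0 i) (c ord0 i); first by left.
  have [h4|h4] := eqVneq (x ord0 i) (c ord0 i + L); first by right.
  by case: nh; rewrite !lt_neqAle h1 h2 h4 eq_sym h3.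
have := filter_forall (F := almost_everywhere leb) _ h => /(_ _).
by apply: filterS => x hx Dx i; exact: hx.
Qed.

(** Products of cutoffs converge boundedly to indicator functions of boxes, and an
    integrable function is determined almost everywhere by its integrals over
    boxes. *)
Lemma density_prodf (c : 'rV[R]_n) (L : R) (F : 'rV[R]_n -> R) : 0 < L ->
  leb.-integrable (box c (c + const_mx L)) (EFin \o F) ->
  (forall ps, (forall i, per1 L (ps i)) ->
    (\int[leb]_(x in box c (c + const_mx L)) (F x * prodf ps x)%:E = 0)%E) ->
  {ae leb, forall x, box c (c + const_mx L) x -> F x = 0}.
Proof.
move=> L0 iF F0; apply: integral_boxes_ae0 => // a' b'.
set D := box c (c + const_mx L).
have mD : measurable D by exact: measurable_box.
have mF : measurable_fun D F by apply/measurable_EFinP; exact: measurable_int iF.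
rewrite boxI; set lo := \row_i _; set hi := \row_i _.
have [lohi|] := pselect (forall i, lo ord0 i <= hi ord0 i); last first.
  move=> /existsNP[i ilohi]; rewrite (_ : box lo hi = set0) ?integral_set0//.
  apply/seteqP; split => // x /(_ i) /andP[h1 h2]; apply: ilohi.
  exact: le_trans h2.
have subD : box lo hi `<=` D.
  move=> x h i; have := h i; rewrite !mxE ge_max le_min.
  by move=> /andP[/andP[-> _] /andP[-> _]].
pose f_ (k : nat) x := (F x * prodf (fun i => cut L (lo ord0 i) (hi ord0 i) k) x)%:E.
pose f x := (F x * \1_(box lo hi) x)%:E.
(* The cutoffs converge on the open cube only; its boundary is a null set. *)
have [_ _] : [/\ leb.-integrable D f,
    [sequence \int[leb]_(x in D) (`|f_ n0 x - f x|)]_n0 @ \oo --> 0 &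
    [sequence \int[leb]_(x in D) (f_ n0 x)]_n0 @ \oo --> \int[leb]_(x in D) (f x)]%E.
  apply: (@dominated_convergence _ _ _ leb D mD f_ f (abse \o (EFin \o F))).
  - move=> k; apply/measurable_EFinP; apply: measurable_funM => //.
    apply: measurable_funTS; apply: measurable_prodf => i; exact: Cinf_cut.
  - apply/measurable_EFinP; apply: measurable_funM => //.
    by apply: measurable_indic; exact: measurable_box.
  - have := ae_interior c (ltW L0); apply: filterS => x int_x Dx.
    apply: cvg_near_cst; rewrite /f_ /f.
    have : \forall k \near \oo, forall i, cut L (lo ord0 i) (hi ord0 i) k (x ord0 i) =
        ((lo ord0 i <= x ord0 i <= hi ord0 i)%R)%:R.
      apply: filter_forall => i; apply: (@cut_cvg _ L (c ord0 i)) => //.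
      + by rewrite !mxE le_max lexx.
      + by rewrite !mxE ge_min lexx.
      + exact: int_x.
    apply: filterS => k hk; congr (_ * _)%:E.
    rewrite /prodf; under eq_bigr do rewrite hk.
    rewrite indicE; have [xin|xout] := pselect (box lo hi x).
      by rewrite mem_set// big1// => i _; rewrite xin.
    rewrite memNset//; have /existsNP[i /negP ni] := xout.
    by rewrite (bigD1 i)//= (negbTE ni) mul0r.
  - exact: integrable_abse.
  - apply: aeW => x k Dx; rewrite /f_ /= lee_fin normrM ler_piMr//.
    rewrite /prodf normr_prod; apply: prodr_ile1 => i _; rewrite normr_ge0/=.
    by rewrite ger0_norm ?cut_ge0// cut_le1.
rewrite [X in X @ _ --> _](_ : _ = cst 0%E); last first.
  apply/funext => k; apply: F0 => i; split; first exact: Cinf_cut.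
  by move=> t; rewrite cut_periodic// gt_eqF.
move=> /cvg_lim f0.
transitivity (\int[leb]_(x in D) f x)%E; last first.
  by rewrite -f0// lim_cst.
rewrite [RHS](eq_integral (fun x => ((EFin \o F) \_ (box lo hi)) x)); last first.
  move=> x _; rewrite /f patchE indicE; case: ifP => _; first by rewrite mulr1.
  by rewrite mulr0.
by rewrite -integral_mkcondr setIidr.
Qed.

End product_tests.

(** * Semi-definite inner products and square integrable functions on the torus *)

Section semi_inner_product.
Context {R : realType} {V : lmodType R}.
Implicit Types (S : set V) (b : V -> V -> R).

(** Function spaces consist of honest functions, on which the integral forms are
    only semi-definite and are only bilinear where the integrals exist; hence the
    explicit domain S. *)
Record semi_ip S b : Prop := SemiIp {
  sip0 : S 0;
  sipD : forall u v, S u -> S v -> S (u + v);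
  sipZ : forall (a : R) u, S u -> S (a *: u);
  sipC : forall u v, S u -> S v -> b u v = b v u;
  sipDl : forall u v w, S u -> S v -> S w -> b (u + v) w = b u w + b v w;
  sipZl : forall a u w, S u -> S w -> b (a *: u) w = a * b u w;
  sip_ge0 : forall u, S u -> 0 <= b u u }.

Variables (S : set V) (b : V -> V -> R) (hb : semi_ip S b).

Let nm u := Num.sqrt (b u u).

Lemma sipN u : S u -> S (- u).
Proof. by move=> Su; rewrite -scaleN1r; exact: (sipZ hb). Qed.
Lemma sipB u v : S u -> S v -> S (u - v).
Proof. by move=> Su Sv; apply: (sipD hb) => //; exact: sipN. Qed.
Lemma sipDr u v w : S u -> S v -> S w -> b w (u + v) = b w u + b w v.
Proof.
move=> Su Sv Sw; rewrite (sipC hb)// ?(sipDl hb)//; last exact: (sipD hb).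
by rewrite (sipC hb Su)// (sipC hb Sv).
Qed.
Lemma sipZr a u w : S u -> S w -> b w (a *: u) = a * b w u.
Proof.
move=> Su Sw; rewrite (sipC hb)// ?(sipZl hb)//; last exact: (sipZ hb).
by rewrite (sipC hb Su).
Qed.
Lemma sipNl u w : S u -> S w -> b (- u) w = - b u w.
Proof. by move=> Su Sw; rewrite -scaleN1r (sipZl hb)// mulN1r. Qed.
Lemma sipNr u w : S u -> S w -> b w (- u) = - b w u.
Proof. by move=> Su Sw; rewrite -scaleN1r sipZr// mulN1r. Qed.
Lemma sipBl u v w : S u -> S v -> S w -> b (u - v) w = b u w - b v w.
Proof. by move=> Su Sv Sw; rewrite (sipDl hb)// ?sipNl//; exact: sipN. Qed.
Lemma sipBr u v w : S u -> S v -> S w -> b w (u - v) = b w u - b w v.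
Proof. by move=> Su Sv Sw; rewrite sipDr// ?sipNr//; exact: sipN. Qed.
Lemma sip0l u : S u -> b 0 u = 0.
Proof. by move=> Su; rewrite -(scale0r u) (sipZl hb)// mul0r. Qed.
Lemma sip0r u : S u -> b u 0 = 0.
Proof. by move=> Su; rewrite -(scale0r u) sipZr// mul0r. Qed.

Lemma sip_quad u v t : S u -> S v ->
  b (u + t *: v) (u + t *: v) = b u u + 2 * t * b u v + t ^+ 2 * b v v.
Proof.
move=> Su Sv; have Stv : S (t *: v) by exact: (sipZ hb).
have Suv : S (u + t *: v) by exact: (sipD hb).
rewrite (sipDl hb)// !sipDr// !(sipZl hb)// !sipZr// (sipC hb Sv Su); ring.
Qed.

(** The quadratic b (u + t v, u + t v) is nonnegative in t; when b v v = 0 it is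
    affine, and nonnegative only if b u v = 0. *)
Lemma sip_CS u v : S u -> S v -> b u v ^+ 2 <= b u u * b v v.
Proof.
move=> Su Sv; have bv := sip_ge0 hb Sv; have bu := sip_ge0 hb Su.
have q t : 0 <= b u u + 2 * t * b u v + t ^+ 2 * b v v.
  by rewrite -sip_quad// (sip_ge0 hb)//; apply: (sipD hb) => //; exact: (sipZ hb).
have [v0|v0] := eqVneq (b v v) 0.
  suff -> : b u v = 0 by rewrite v0 expr0n mulr0.
  apply/eqP; apply: contraT => uv0.
  have := q (- (b u u + 1) / (2 * b u v)); rewrite v0 mulr0 addr0.
  have -> : b u u + 2 * (- (b u u + 1) / (2 * b u v)) * b u v = -1 by field.
  by rewrite lerNr oppr0 ler10.
have vp : 0 < b v v by rewrite lt_neqAle eq_sym v0.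
have := q (- b u v / b v v).
have -> : b u u + 2 * (- b u v / b v v) * b u v + (- b u v / b v v) ^+ 2 * b v v =
  (b u u * b v v - b u v ^+ 2) / b v v by field.
by rewrite pmulr_lge0 ?invr_gt0// subr_ge0.
Qed.

Lemma sip_CSn u v : S u -> S v -> `|b u v| <= nm u * nm v.
Proof.
move=> Su Sv; rewrite -sqrtr_sqr /nm -sqrtrM ?(sip_ge0 hb)// ler_sqrt ?sip_CS//.
by rewrite mulr_ge0 ?(sip_ge0 hb).
Qed.

Lemma sip_sqrn u : S u -> nm u ^+ 2 = b u u.
Proof. by move=> Su; rewrite sqr_sqrtr// (sip_ge0 hb). Qed.

Lemma sip_tri u v : S u -> S v -> nm (u + v) <= nm u + nm v.
Proof.
move=> Su Sv; have Suv := sipD hb Su Sv.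
have n0 w : 0 <= nm w by exact: sqrtr_ge0.
rewrite -ler_sqr ?nnegrE ?addr_ge0// sip_sqrn//.
have := @sip_quad u v 1 Su Sv; rewrite scale1r => ->.
have h : b u v <= nm u * nm v by apply: le_trans (ler_norm _) (sip_CSn Su Sv).
rewrite sqrrD -!sip_sqrn//; move: h.
set x := nm u; set y := nm v; set z := b u v; nra.
Qed.

Lemma sip_nmZ a u : S u -> nm (a *: u) = `|a| * nm u.
Proof.
move=> Su; rewrite /nm (sipZl hb)//; last exact: (sipZ hb).
by rewrite sipZr// mulrA -expr2 sqrtrM ?sqr_ge0// sqrtr_sqr.
Qed.

Lemma sip_nmN u : S u -> nm (- u) = nm u.
Proof. by move=> Su; rewrite -scaleN1r sip_nmZ// normrN1 mul1r. Qed.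

Lemma semi_ipS (S' : set V) : S' `<=` S -> S' 0 ->
  (forall u v, S' u -> S' v -> S' (u + v)) ->
  (forall a u, S' u -> S' (a *: u)) -> semi_ip S' b.
Proof.
move=> SS h0 hD hZ; split=> //.
- by move=> u v Su Sv; apply: (sipC hb); exact: SS.
- by move=> u v w Su Sv Sw; apply: (sipDl hb); exact: SS.
- by move=> a u w Su Sw; apply: (sipZl hb); exact: SS.
- by move=> u Su; apply: (sip_ge0 hb); exact: SS.
Qed.

End semi_inner_product.

Section continuous_measurable.
Context {R : realType} (n : nat).

Lemma continuous_measurable_rV (f : 'rV[R]_n -> R) :
  continuous f -> measurable_fun setT f.
Proof.
move=> cf.
pose rd (k : nat) (x : 'rV[R]_n) : 'rV[R]_n :=
  \row_i ((Num.floor (x ord0 i * k.+1%:R))%:~R / k.+1%:R).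
have mrd k : measurable_fun setT (fun x => f (rd k x)).
  move=> _ Y mY; rewrite setTI.
  pose g (z : 'rV[int]_n) : 'rV[R]_n := \row_i ((z ord0 i)%:~R / k.+1%:R).
  rewrite (_ : _ @^-1` Y = \bigcup_(z : 'rV[int]_n)
     ([set x | Y (f (g z))] `&` [set x : 'rV[R]_n | forall i, Num.floor (x ord0 i * k.+1%:R) = z ord0 i])).
    apply: countable_bigcupT_measurable; first exact: countableP.
    move=> z; apply: measurableI.
      by have [h|h] := pselect (Y (f (g z)));
        [rewrite (_ : [set _ | _] = setT)//; apply/seteqP; split
        |rewrite (_ : [set _ | _] = set0)//; apply/seteqP; split].
    rewrite (_ : [set x : 'rV[R]_n | _] = \big[setI/setT]_(i < n)
      ((fun x : 'rV[R]_n => x ord0 i) @^-1`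
         `[(z ord0 i)%:~R / k.+1%:R, (z ord0 i + 1)%:~R / k.+1%:R[)).
      apply: bigsetI_measurable => i _; rewrite -[X in measurable X]setTI.
      by apply: measurable_coor.
    have k0 : (0 : R) < k.+1%:R by rewrite ltr0n.
    rewrite -bigcap_seq; apply/seteqP; split => x /=.
      move=> h i _ /=; rewrite in_itv/= ler_pdivrMr// ltr_pdivlMr// -h.
      exact: floor_itv.
    move=> h i; have := h i; rewrite /= mem_index_enum in_itv/=.
    move=> /(_ isT); rewrite ler_pdivrMr// ltr_pdivlMr// => zi.
    exact: floor_def.
  apply/seteqP; split => x /=.
    move=> Yx; exists (\row_i Num.floor (x ord0 i * k.+1%:R)) => //=; split.
      rewrite (_ : g _ = rd k x)//.
      by apply/rowP => i; rewrite !mxE.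
    by move=> i; rewrite mxE.
  move=> [z _ [Yz hz]]; rewrite (_ : rd k x = g z)//.
  by apply/rowP => i; rewrite !mxE hz.
apply: (@measurable_fun_cvg _ _ _ setT (fun k (x : 'rV[R]_n) => f (rd k x)) f mrd).
move=> x _.
suff rdx : rd k x @[k --> \oo] --> x by exact: (cvg_comp _ _ rdx (cf x)).
apply/cvg_ballP => e e0; near=> k.
have kp : (0 : R) < k.+1%:R by rewrite ltr0n.
have ke : k.+1%:R^-1 < e by near: k; exact: near_infty_natSinv_lt (PosNum e0).
split => // i j; rewrite !ord1 /= /ball/= mxE.
have /andP[h1 h2] := floor_itv (x ord0 j * k.+1%:R).
rewrite ltr_norml; apply/andP; split.
  rewrite ltrNl opprB (le_lt_trans _ e0)// subr_le0 ler_pdivrMr//.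
rewrite (le_lt_trans _ ke)// -[leRHS]mul1r ler_pdivlMr//.
by rewrite mulrBl divfK ?gt_eqF// lerBlDl; move: h2; rewrite intrD => /ltW.
Unshelve. all: by end_near. Qed.
End continuous_measurable.

Section torus_L2.
Context {R : realType} {d : nat} (Om : cube R d).
Local Notation scal := ('rV[R]_d -> R).
Local Notation leb := (lebesgue_rV d).
Local Notation D := (cube_set Om).
Local Notation L := (side Om).
Implicit Types (u v w a : scal).

Lemma measurable_cube : measurable D.
Proof. exact: measurable_box. Qed.

Lemma lebesgue_cube : leb D = (L ^+ d)%:E.
Proof.
rewrite [LHS]lebesgue_rV_box; last by move=> i; rewrite !mxE lerDl ltW// side_gt0.
under eq_bigr do rewrite !mxE addrAC subrr add0r.
by rewrite prodr_const card_ord.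
Qed.

Definition vol : R := L ^+ d.
Lemma vol_gt0 : 0 < vol. Proof. by rewrite exprn_gt0// side_gt0. Qed.

Definition Sint v := leb.-integrable D (EFin \o v).

Lemma SintD u v : Sint u -> Sint v -> Sint (fun x => u x + v x).
Proof.
by move=> iu iv; apply: (eq_integrable measurable_cube _ _ _ (integrableD measurable_cube iu iv)).
Qed.

Lemma SintZ (k : R) u : Sint u -> Sint (fun x => k * u x).
Proof.
by move=> iu; apply: (eq_integrable measurable_cube _ _ _ (integrableZl measurable_cube k iu)).
Qed.

Lemma SintN u : Sint u -> Sint (fun x => - u x).
Proof.
move=> iu; rewrite (_ : (fun _ => _) = fun x => -1 * u x); first exact: SintZ.
by apply/funext => x; rewrite mulN1r.
Qed.

Lemma SintB u v : Sint u -> Sint v -> Sint (fun x => u x - v x).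
Proof. by move=> iu iv; apply: SintD => //; exact: SintN. Qed.

Lemma Sint_sum (I : Type) (s : seq I) (h : I -> scal) : (forall i, Sint (h i)) ->
  Sint (fun x => \sum_(i <- s) h i x).
Proof.
move=> ih; elim: s => [|i s IH].
  rewrite (_ : (fun _ => _) = cst 0); first exact: integrable0.
  by apply/funext => x; rewrite big_nil.
rewrite (_ : (fun _ => _) = fun x => h i x + \sum_(j <- s) h j x); first exact: SintD.
by apply/funext => x; rewrite big_cons.
Qed.

Lemma spintD u v : Sint u -> Sint v ->
  spint Om (fun x => u x + v x) = spint Om u + spint Om v.
Proof. by move=> iu iv; rewrite /spint RintegralD//; exact: measurable_cube. Qed.

Lemma spintZ (k : R) u : Sint u -> spint Om (fun x => k * u x) = k * spint Om u.
Proof. by move=> iu; rewrite /spint RintegralZl//; exact: measurable_cube. Qed.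

Lemma spintN u : Sint u -> spint Om (fun x => - u x) = - spint Om u.
Proof.
move=> iu; rewrite -mulN1r -spintZ//.
by congr (spint Om _); apply/funext => x; rewrite mulN1r.
Qed.

Lemma spintB u v : Sint u -> Sint v ->
  spint Om (fun x => u x - v x) = spint Om u - spint Om v.
Proof. by move=> iu iv; rewrite spintD ?spintN//; exact: SintN. Qed.

Lemma spint_cst (k : R) : spint Om (fun=> k) = k * vol.
Proof.
rewrite /spint Rintegral_cst; last exact: measurable_cube.
by rewrite [X in fine X]lebesgue_cube.
Qed.

Lemma spint_sum (I : Type) (s : seq I) (h : I -> scal) : (forall i, Sint (h i)) ->
  spint Om (fun x => \sum_(i <- s) h i x) = \sum_(i <- s) spint Om (h i).
Proof.
move=> ih; elim: s => [|i s IH].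
  rewrite big_nil (_ : (fun _ => _) = fun=> 0) ?spint_cst ?mul0r//.
  by apply/funext => x; rewrite big_nil.
rewrite big_cons -IH -spintD//; last exact: Sint_sum.
by congr (spint Om _); apply/funext => x; rewrite big_cons.
Qed.

Lemma spint_ge0 u : (forall x, D x -> 0 <= u x) -> 0 <= spint Om u.
Proof. by move=> u0; exact: Rintegral_ge0. Qed.

Lemma le_spint u v : Sint u -> Sint v -> (forall x, D x -> u x <= v x) ->
  spint Om u <= spint Om v.
Proof. by move=> iu iv uv; apply: le_Rintegral => //; exact: measurable_cube. Qed.

Lemma Sint_cst (k : R) : Sint (fun=> k).
Proof.
apply/integrableP; split; first by apply/measurable_EFinP; exact: measurable_cst.
rewrite (eq_integral (cst `|k|%:E))//.
rewrite integral_cst; last exact: measurable_cube.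
by rewrite [X in (_ * X)%E]lebesgue_cube -EFinM ltry.
Qed.

Definition aeq u v := {ae leb, forall x, D x -> u x = v x}.

Lemma aeq_refl u : aeq u u. Proof. exact: aeW. Qed.
Lemma aeq_sym u v : aeq u v -> aeq v u.
Proof. by apply: filterS => x h Dx; rewrite h. Qed.
Lemma aeq_op2 (op : R -> R -> R) u u' v v' : aeq u u' -> aeq v v' ->
  aeq (fun x => op (u x) (v x)) (fun x => op (u' x) (v' x)).
Proof. by apply: filterS2 => x h1 h2 Dx; rewrite h1// h2. Qed.

Lemma spint_aeq u v : measurable_fun setT u -> measurable_fun setT v ->
  aeq u v -> spint Om u = spint Om v.
Proof.
move=> mu mv uv; rewrite /spint /Rintegral; congr fine.
apply: ae_eq_integral => //; first exact: measurable_cube.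
- by apply/measurable_EFinP; exact: measurable_funTS.
- by apply/measurable_EFinP; exact: measurable_funTS.
- by apply: filterS uv => x h Dx /=; rewrite h.
Qed.

Definition pm v := Defs.periodic Om v /\ measurable_fun setT v.
(** Finite element functions are bounded, being piecewise polynomial and periodic.
    Working with bounded functions spares integrability conditions on products. *)
Definition bnd v := pm v /\ exists M, forall x, `|v x| <= M.
Local Notation L2 := (L2 Om).

Lemma L2_pm v : ipset L2 v -> pm v. Proof. by case. Qed.

Lemma pmD u v : pm u -> pm v -> pm (fun x => u x + v x).
Proof.
move=> [pu mu] [pv mv]; split; first by move=> x i; rewrite pu pv.
exact: measurable_funD.
Qed.
Lemma pmM u v : pm u -> pm v -> pm (fun x => u x * v x).
Proof.
move=> [pu mu] [pv mv]; split; first by move=> x i; rewrite pu pv.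
exact: measurable_funM.
Qed.
Lemma pm_cst (k : R) : pm (fun=> k).
Proof. by split. Qed.
Lemma pm_comp (g : R -> R) u : continuous g -> pm u -> pm (fun x => g (u x)).
Proof.
move=> cg [pu mu]; split; first by move=> x i; rewrite pu.
apply: measurableT_comp => //; exact: continuous_measurable_fun.
Qed.

Lemma Sint_le u v : measurable_fun setT u -> Sint v ->
  (forall x, D x -> `|u x| <= v x) -> Sint u.
Proof.
move=> mu iv uv; apply: (le_integrable measurable_cube _ _ iv).
  by apply/measurable_EFinP; exact: measurable_funTS.
by move=> x Dx /=; rewrite lee_fin (le_trans (uv x Dx))// ler_norm.
Qed.

Lemma L2P v : ipset L2 v <-> pm v /\ Sint (fun x => v x ^+ 2).
Proof. by split => [[? ? ?]|[[? ?] ?]]; split. Qed.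

Lemma L2_mul u v : ipset L2 u -> ipset L2 v -> Sint (fun x => u x * v x).
Proof.
move=> /L2P[[_ mu] iu] /L2P[[_ mv] iv].
apply: (Sint_le _ (SintD iu iv)); first exact: measurable_funM.
move=> x _; rewrite ler_norml; apply/andP; split.
  by rewrite -subr_ge0; have := sqr_ge0 (u x + v x); have := sqr_ge0 (u x);
    have := sqr_ge0 (v x); rewrite sqrrD; nra.
by have := sqr_ge0 (u x - v x); have := sqr_ge0 (u x);
  have := sqr_ge0 (v x); rewrite sqrrB; nra.
Qed.

Lemma L2D u v : ipset L2 u -> ipset L2 v -> ipset L2 (u + v).
Proof.
move=> Hu Hv; have iuv := L2_mul Hu Hv.
move: Hu Hv => /L2P[pu iu] /L2P[pv iv]; apply/L2P; split; first exact: pmD.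
rewrite (_ : (fun _ => _) = fun x => u x ^+ 2 + (2 * (u x * v x) + v x ^+ 2)).
  by apply: SintD => //; apply: SintD => //; exact: SintZ.
by apply/funext => x; have -> : (u + v) x = u x + v x by []; ring.
Qed.

Lemma bnd_L2M a v : bnd a -> ipset L2 v -> ipset L2 (fun x => a x * v x).
Proof.
move=> [pa [M aM]] /L2P[pv iv]; apply/L2P; split; first exact: pmM.
apply: (Sint_le _ (SintZ (M ^+ 2) iv)).
  by apply: measurable_funX; case: (pmM pa pv).
move=> x _; rewrite ger0_norm ?sqr_ge0// exprMn ler_wpM2r ?sqr_ge0//.
by rewrite -(real_normK (num_real (a x))) ler_pXn2r// nnegrE// (le_trans _ (aM x)).
Qed.

Lemma L2Z (k : R) v : ipset L2 v -> ipset L2 (k *: v).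
Proof.
move=> Hv; apply: (@bnd_L2M (fun=> k)) => //; split; first exact: pm_cst.
by exists `|k|.
Qed.

Lemma bnd_L2 a : bnd a -> ipset L2 a.
Proof.
move=> ba; rewrite (_ : a = fun x => a x * 1); last first.
  by apply/funext => x; rewrite mulr1.
apply: bnd_L2M => //; apply/L2P; split; first exact: pm_cst.
exact: Sint_cst.
Qed.

Lemma L2_0 : ipset L2 0.
Proof.
apply: bnd_L2; split; first exact: pm_cst.
by exists 0 => x; rewrite normr0.
Qed.

Lemma bnd_cst (k : R) : bnd (fun=> k).
Proof. by split; [exact: pm_cst|exists `|k|]. Qed.
Lemma bndD u v : bnd u -> bnd v -> bnd (u + v).
Proof.
move=> [pu [M hM]] [pv [M' hM']]; split; first exact: pmD.
by exists (M + M') => x; rewrite (le_trans (ler_normD _ _))// lerD.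
Qed.
Lemma bndM u v : bnd u -> bnd v -> bnd (fun x => u x * v x).
Proof.
move=> [pu [M hM]] [pv [M' hM']]; split; first exact: pmM.
by exists (M * M') => x; rewrite normrM ler_pM.
Qed.
Lemma bndZ (k : R) v : bnd v -> bnd (k *: v).
Proof. by move=> bv; apply: (@bndM (fun=> k)) => //; exact: bnd_cst. Qed.

Lemma L2_int v : ipset L2 v -> Sint v.
Proof.
move=> Hv; have := L2_mul Hv (bnd_L2 (bnd_cst 1)).
by rewrite (_ : (fun _ => _) = v)//; apply/funext => x; rewrite mulr1.
Qed.

Lemma bnd_int v : bnd v -> Sint v.
Proof. by move=> /bnd_L2 /L2_int. Qed.

Lemma semi_ip_L2 : semi_ip (ipset L2) (ip L2).
Proof.
split.
- exact: L2_0.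
- exact: L2D.
- exact: L2Z.
- by move=> u v _ _; congr (spint Om _); apply/funext => x; rewrite mulrC.
- move=> u v w Hu Hv Hw; rewrite /= -spintD; [|exact: L2_mul..].
  by congr (spint Om _); apply/funext => x; rewrite mulrDl.
- move=> a u w Hu Hw; rewrite /= -spintZ; last exact: L2_mul.
  by congr (spint Om _); apply/funext => x; rewrite mulrA.
- by move=> u Hu; apply: spint_ge0 => x _; rewrite -expr2 sqr_ge0.
Qed.

Lemma ip_aeq u u' v : pm u -> pm u' -> pm v -> aeq u u' -> ip L2 u v = ip L2 u' v.
Proof.
move=> [_ mu] [_ mu'] [_ mv] uu'; apply: spint_aeq; try exact: measurable_funM.
by apply: aeq_op2 => //; exact: aeq_refl.
Qed.

Lemma aeq_ip0 u : ipset L2 u -> ip L2 u u = 0 -> aeq u (fun=> 0).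
Proof.
move=> Hu; have /L2P[[_ mu] iu] := Hu; rewrite /= /spint /Rintegral => h.
have : (\int[leb]_(x in D) `|(u x * u x)%:E| = 0)%E.
  rewrite (eq_integral (fun x => (u x * u x)%:E)); last first.
    by move=> x _; rewrite gee0_abs// lee_fin -expr2 sqr_ge0.
  have := L2_mul Hu Hu => /(integrable_fin_num measurable_cube) /fineK <-.
  by rewrite h.
move/(ae_eq_integral_abs leb measurable_cube) => /(_ _)/wrap[].
  by apply/measurable_EFinP; apply: measurable_funTS; exact: measurable_funM.
by apply: filterS => x /= h0 Dx; have [] := h0 Dx; move/eqP; rewrite mulf_eq0 orbb => /eqP.
Qed.

Lemma aeq_ip00 u : pm u -> aeq u (fun=> 0) -> ip L2 u u = 0.
Proof.
move=> pu u0; rewrite (ip_aeq pu (pm_cst 0) pu u0) /=.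
rewrite (_ : (fun _ => _) = fun=> 0) ?spint_cst ?mul0r//.
by apply/funext => x; rewrite mul0r.
Qed.

End torus_L2.

(** * Weak derivatives and the space H1 of the torus *)

Section torus_H1.
Context {R : realType} {d : nat} (Om : cube R d).
Local Notation scal := ('rV[R]_d -> R).
Local Notation vect := ('I_d -> 'rV[R]_d -> R).
Local Notation leb := (lebesgue_rV d).
Local Notation D := (cube_set Om).
Local Notation L := (side Om).
Local Notation L2 := (L2 Om).
Local Notation H1 := (sobolev Om 1).
Local Notation bnd := (bnd Om).
Local Notation pm := (pm Om).
Local Notation aeq := (aeq Om).
Implicit Types (u v w a g : scal) (i j : 'I_d).

Lemma compact_cube : compact D.
Proof.
rewrite (_ : D = [set v : 'rV[R]_d | forall i,
   `[corner Om ord0 i, corner Om ord0 i + L]%classic (v ord0 i)]).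
  apply: (@rV_compact R d
    (fun i => `[corner Om ord0 i, corner Om ord0 i + L]%classic)) => i.
  exact: segment_compact.
by apply/seteqP; split => x /= h i; have := h i; rewrite in_itv/= !mxE.
Qed.

Lemma periodic_int v (z : 'rV[int]_d) x : Defs.periodic Om v ->
  v (x + L *: map_mx intr z) = v x.
Proof.
move=> pv.
have -> : L *: map_mx intr z = \sum_i L *: ((z ord0 i)%:~R *: delta_mx ord0 i) :> 'rV[R]_d.
  apply/rowP => j; rewrite !mxE summxE (bigD1 j)//= big1 => [|i ij].
    by rewrite addr0 !mxE !eqxx mulr1.
  by rewrite !mxE eqxx eq_sym (negbTE ij) !mulr0.
elim: (index_enum _) x => [|i s IH] x; first by rewrite big_nil addr0.
rewrite big_cons addrA IH.
have /= := @periodicN_int R R L (fun t => v (x + t *: delta_mx ord0 i)) _ (z ord0 i) 0.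
rewrite scale0r addr0 add0r => <-.
  by rewrite scalerA mulrC.
by move=> t; rewrite scalerDl addrA pv.
Qed.

(** The representative in the cube of a point of the torus. *)
Definition red (x : 'rV[R]_d) : 'rV[R]_d :=
  x + L *: map_mx intr (\row_i - Num.floor ((x ord0 i - corner Om ord0 i) / L)).

Lemma red_cube x : D (red x).
Proof.
move=> i; rewrite /red !mxE.
have L0 := side_gt0 Om.
have /andP[h1 h2] := floor_itv ((x ord0 i - corner Om ord0 i) / L).
move: h1 h2; set k := Num.floor _; rewrite ler_pdivlMr// ltr_pdivrMr//.
rewrite mulrNz intrD mulrDl mul1r mulrN mulrC => h1 h2; apply/andP; split; lra.
Qed.

Lemma red_periodic v x : Defs.periodic Om v -> v (red x) = v x.
Proof. by move=> pv; exact: periodic_int. Qed.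

Lemma pm_bnd v M : pm v -> (forall x, D x -> `|v x| <= M) -> bnd v.
Proof.
move=> [pv mv] vM; split=> //; exists M => x.
by rewrite -(red_periodic _ pv); apply: vM; exact: red_cube.
Qed.

(** The torus is compact. *)
Lemma continuous_bnd v : Defs.periodic Om v -> continuous v -> bnd v.
Proof.
move=> pv cv.
have cD : {within D, continuous v} by exact: continuous_subspaceT.
have Dne : D !=set0 by exists (red 0); exact: red_cube.
have cmpt := continuous_compact cD compact_cube.
have [M [_ hM]] := compact_bounded cmpt.
apply: (@pm_bnd _ (M + 1)).
  by split=> //; exact: continuous_measurable_rV.
move=> x Dx; apply: (hM (M + 1)); first by rewrite ltrDl.
by exists x.
Qed.

Lemma is_derive_line (psi : scal) x i : smooth psi ->
  forall t, is_derive t (1 : R) (fun s => psi (x + s *: delta_mx ord0 i))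
    (partial i psi (x + t *: delta_mx ord0 i)).
Proof.
move=> spsi t; have [_ /(_ i (x + t *: delta_mx ord0 i)) dpsi] := spsi [::].
have dE : (fun h : R => h^-1 *: (psi (h *: delta_mx ord0 i + (x + t *: delta_mx ord0 i))
      - psi (x + t *: delta_mx ord0 i))) =
    (fun h : R => h^-1 *: ((fun s => psi (x + s *: delta_mx ord0 i)) (h *: 1 + t)
      - psi (x + t *: delta_mx ord0 i))).
  apply/funext => h; congr (_ *: (psi _ - _)).
  by rewrite [h *: 1]mulr1 scalerDl addrCA.
split; first by move: dpsi; rewrite /derivable dE.
by rewrite /partial /derive dE.
Qed.

Lemma partial_periodic (psi : scal) i : Defs.periodic Om psi ->
  Defs.periodic Om (partial i psi).
Proof.
move=> ppsi x j; rewrite /partial /derive.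
rewrite (_ : (fun h => _) = (fun h => h^-1 *: ((psi \o shift x) (h *: delta_mx ord0 i) - psi x)))//.
apply/funext => h; rewrite ppsi; congr (_ *: (_ - _)).
by rewrite /= addrA ppsi.
Qed.

Lemma smooth_partial (psi : scal) i : smooth psi -> smooth (partial i psi).
Proof. by move=> spsi s; have := spsi (rcons s i); rewrite foldr_rcons. Qed.

Lemma smooth_bnd (psi : scal) : Defs.periodic Om psi -> smooth psi -> bnd psi.
Proof. by move=> ppsi /(_ [::]) [cpsi _]; exact: continuous_bnd. Qed.

Lemma spint_shift v z : pm v -> spint Om (fun x => v (x + z)) = spint Om v.
Proof.
move=> [pv mv]; rewrite /spint /Rintegral; congr fine.
apply: (@integral_shift R d (corner Om) z L (fun x => (v x)%:E)).
- exact: side_gt0.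
- exact/measurable_EFinP.
- by move=> x i; rewrite pv.
Qed.

Lemma pm_shift v z : pm v -> pm (fun x => v (x + z)).
Proof.
move=> [pv mv]; split; first by move=> x i; rewrite addrAC pv.
by apply: (measurableT_comp mv); exact: measurable_addrV.
Qed.

(** Translation invariance makes the integral of every difference quotient vanish,
    and the quotients converge boundedly by the mean value theorem. *)
Lemma spint_partial0 (psi : scal) i : Defs.periodic Om psi -> smooth psi ->
  spint Om (partial i psi) = 0.
Proof.
move=> ppsi spsi; have bpsi := smooth_bnd ppsi spsi.
have bd : bnd (partial i psi).
  by apply: smooth_bnd; [exact: partial_periodic|exact: smooth_partial].
have [[pd md] [M hM]] := bd; have [[_ mpsi] _] := bpsi.
pose e : 'rV[R]_d := delta_mx ord0 i.
pose q (k : nat) x := (psi (x + k.+1%:R^-1 *: e) - psi x) * k.+1%:R.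
have q0 k : (\int[leb]_(x in D) (q k x)%:E = 0)%E.
  have -> : q k = fun x => k.+1%:R * (psi (x + k.+1%:R^-1 *: e) - psi x).
    by apply/funext => x; rewrite /q mulrC.
  have bs : bnd (fun x => psi (x + k.+1%:R^-1 *: e)).
    have [pmp [M' hM']] := bpsi.
    by split; [exact: pm_shift|exists M' => x; exact: hM'].
  have iq := SintB (bnd_int bs) (bnd_int bpsi).
  have := spintZ k.+1%:R iq; rewrite (spintB (bnd_int bs) (bnd_int bpsi)).
  rewrite spint_shift; last by case: bpsi.
  rewrite subrr mulr0 /spint /Rintegral => h.
  have := SintZ k.+1%:R iq => /(integrable_fin_num (measurable_cube Om)) /fineK <-.
  by rewrite h.
have [_ _] : [/\ leb.-integrable D (EFin \o partial i psi),
    [sequence \int[leb]_(x in D) (`|(q n x)%:E - (partial i psi x)%:E|)]_n @ \oo --> 0 &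
    [sequence \int[leb]_(x in D) ((q n x)%:E)]_n @ \oo -->
      \int[leb]_(x in D) ((partial i psi x)%:E)]%E.
  apply: (@dominated_convergence _ _ _ leb D (measurable_cube Om) (fun n x => (q n x)%:E)
    (fun x => (partial i psi x)%:E) (fun=> M%:E)).
  - move=> k; apply/measurable_EFinP; apply: measurable_funTS.
    apply: measurable_funM => //; apply: measurable_funB => //.
    by apply: (measurableT_comp mpsi); exact: measurable_addrV.
  - by apply/measurable_EFinP; exact: measurable_funTS.
  - apply: aeW => x _; apply: cvg_EFin; first exact: nearW.
    have [dl dE] := is_derive_line x i spsi 0.
    have : (fun h : R => h^-1 *: (psi (x + (h *: 1 + 0) *: e) - psi (x + 0 *: e))) @ 0^' -->
       partial i psi x.
      have hh := cvg_toP dl dE.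
      by move: hh; rewrite scale0r addr0.
    move=> /cvgr_dnbhsP /(_ (fun k => k.+1%:R^-1)) hc.
    rewrite (_ : fine \o _ = (fun k : nat => (k.+1%:R^-1 : R)^-1 *:
        (psi (x + (k.+1%:R^-1 *: (1 : R) + 0) *: e) - psi (x + 0 *: e)))).
      apply: hc; split => [k|]; first by rewrite invr_neq0.
      exact: cvg_harmonic.
    apply/funext => k; rewrite /q /= invrK [_ *: (psi _ - _)]mulrC.
    by rewrite [_ *: 1]mulr1 !addr0 scale0r addr0.
  - exact: Sint_cst.
  - apply: aeW => x k _; rewrite lee_fin /q normrM.
    have k0 : (0 : R) < k.+1%:R^-1 by rewrite invr_gt0 ltr0n.
    have [|c _] := MVT_segment (ltW k0) (fun t _ => is_derive_line x i spsi t).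
      apply: continuous_subspaceT => t.
      apply/differentiable_continuous/derivable1_diffP.
      by have [] := is_derive_line x i spsi t.
    rewrite subr0 scale0r addr0 => ->; rewrite !normrM -mulrA -normrM.
    by rewrite mulVf ?gt_eqF ?ltr0n// normr1 mulr1.
rewrite (_ : [sequence _]_n = cst 0%E); last by apply/funext => k; exact: q0.
by move=> /cvg_lim; rewrite lim_cst// /spint /Rintegral => <-.
Qed.

Lemma test_bnd (psi : scal) i : Defs.periodic Om psi -> smooth psi ->
  bnd psi /\ bnd (partial i psi).
Proof.
move=> pp sp; split; apply: smooth_bnd => //; first exact: partial_periodic.
exact: smooth_partial.
Qed.

Lemma is_wpartialD i u v g h : ipset L2 u -> ipset L2 v ->
  is_wpartial Om i u g -> is_wpartial Om i v h -> is_wpartial Om i (u + v) (g + h).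
Proof.
move=> Lu Lv [Lg gE] [Lh hE]; split; first exact: L2D.
move=> psi pp sp; have [bp bdp] := test_bnd i pp sp.
have hL := semi_ip_L2 Om; have [b1 b2] := (bnd_L2 bp, bnd_L2 bdp).
by rewrite (sipDl hL)// gE// hE// (sipDl hL)// opprD.
Qed.

Lemma is_wpartialZ i (k : R) u g : ipset L2 u ->
  is_wpartial Om i u g -> is_wpartial Om i (k *: u) (k *: g).
Proof.
move=> Lu [Lg gE]; split; first exact: L2Z.
move=> psi pp sp; have [bp bdp] := test_bnd i pp sp.
have hL := semi_ip_L2 Om; have [b1 b2] := (bnd_L2 bp, bnd_L2 bdp).
by rewrite (sipZl hL)// gE// (sipZl hL)// mulrN.
Qed.

Lemma is_wpartial_aeq i u v g : pm u -> pm v -> aeq u v ->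
  is_wpartial Om i u g -> is_wpartial Om i v g.
Proof.
move=> pu pv uv [Lg gE]; split=> // psi pp sp.
have [_ [pdp _]] := test_bnd i pp sp.
by rewrite -gE// (ip_aeq pu pv pdp uv).
Qed.

(** The weak derivative is chosen from a set of functions that depends on u only
    through integrals; the choice is therefore the same for equal sets, and the
    equality is literal. *)
Lemma wpartial_aeq i u v : pm u -> pm v -> aeq u v ->
  wpartial Om i u = wpartial Om i v.
Proof.
move=> pu pv uv; rewrite /wpartial; congr xget; apply/seteqP.
by split => g; apply: is_wpartial_aeq => //; exact: aeq_sym.
Qed.

(** Differences of weak derivatives are orthogonal to products of smooth periodic
    functions, which are dense. *)
Lemma is_wpartial_unique i u g h :
  is_wpartial Om i u g -> is_wpartial Om i u h -> aeq g h.
Proof.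
move=> [Lg gE] [Lh hE].
have Lgh : ipset L2 (g - h) by apply: (sipB (semi_ip_L2 Om)).
suff : aeq (g - h) (fun=> 0).
  by apply: filterS => x gh Dx; apply/eqP; rewrite -subr_eq0; apply/eqP; exact: gh.
apply: (@density_prodf R d (corner Om) L (g - h) (side_gt0 Om)).
  exact: L2_int.
move=> ps hps.
have Cps i' : Cinf (ps i') by case: (hps i').
have pp : Defs.periodic Om (prodf ps).
  by apply: prodf_periodic => j t; case: (hps j).
have sp := prodf_smooth Cps.
have [bp _] := test_bnd i pp sp; have Lp := bnd_L2 bp.
have := sipBl (semi_ip_L2 Om) Lg Lh Lp.
have -> : ip L2 g (prodf ps) = ip L2 h (prodf ps).
  by apply: oppr_inj; rewrite -gE// -hE.
rewrite subrr /= /spint /Rintegral => h0.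
have := L2_mul Lgh Lp => /(integrable_fin_num (measurable_cube Om)) /fineK <-.
by rewrite h0.
Qed.

Lemma H1P v : ipset H1 v <->
  ipset L2 v /\ forall i, is_wpartial Om i v (wpartial Om i v).
Proof.
split => [[Lv hv]|[Lv hv]]; split => // i.
  have [g gv _] := hv i; apply: (@xgetPex _ 0 [set g | is_wpartial Om i v g]).
  by exists g.
by exists (wpartial Om i v) => //; have [] := hv i.
Qed.

Lemma H1_L2 v : ipset H1 v -> ipset L2 v. Proof. by case. Qed.
Lemma H1_w v i : ipset H1 v -> is_wpartial Om i v (wpartial Om i v).
Proof. by move=> /H1P[]. Qed.
Lemma H1_wL2 v i : ipset H1 v -> ipset L2 (wpartial Om i v).
Proof. by move=> /(H1_w i)[]. Qed.

Lemma H1_intro v (g : vect) : ipset L2 v -> (forall i, is_wpartial Om i v (g i)) ->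
  ipset H1 v /\ forall i, aeq (wpartial Om i v) (g i).
Proof.
move=> Lv gv; have Hv : ipset H1 v.
  by split => // i; exists (g i) => //; have [] := gv i.
by split => // i; apply: is_wpartial_unique (H1_w i Hv) (gv i).
Qed.

Lemma H1D u v : ipset H1 u -> ipset H1 v -> ipset H1 (u + v) /\
  forall i, aeq (wpartial Om i (u + v)) (wpartial Om i u + wpartial Om i v).
Proof.
move=> Hu Hv; apply: (@H1_intro _ (fun i => wpartial Om i u + wpartial Om i v)).
  by apply: L2D; exact: H1_L2.
by move=> i; apply: is_wpartialD; (exact: H1_L2 || exact: H1_w).
Qed.

Lemma H1Z (k : R) u : ipset H1 u -> ipset H1 (k *: u) /\
  forall i, aeq (wpartial Om i (k *: u)) (k *: wpartial Om i u).
Proof.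
move=> Hu; apply: (@H1_intro _ (fun i => k *: wpartial Om i u)).
  by apply: L2Z; exact: H1_L2.
by move=> i; apply: is_wpartialZ; (exact: H1_L2 || exact: H1_w).
Qed.

Lemma H1_cst (k : R) : ipset H1 (fun=> k) /\
  forall i, aeq (wpartial Om i (fun=> k)) (fun=> 0).
Proof.
apply: (@H1_intro _ (fun i => fun=> 0)); first exact: bnd_L2 (bnd_cst Om k).
move=> i; split; first exact: L2_0.
move=> psi pp sp; have [bp bdp] := test_bnd i pp sp.
rewrite /= spintZ ?spint_partial0//; last exact: bnd_int.
rewrite mulr0 (_ : (fun _ => _) = fun=> 0) ?spint_cst ?mul0r ?oppr0//.
by apply/funext => x; rewrite mul0r.
Qed.

Definition wgip a u v := \sum_i ip L2 (fun x => a x * wpartial Om i u x) (wpartial Om i v).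
Definition gip u v := \sum_i ip L2 (wpartial Om i u) (wpartial Om i v).

Lemma semi_ip_wgip a : bnd a -> (forall x, 0 <= a x) ->
  semi_ip (ipset H1) (wgip a).
Proof.
move=> ba a0; have hL := semi_ip_L2 Om.
have La u i : ipset H1 u -> ipset L2 (fun x => a x * wpartial Om i u x).
  by move=> Hu; apply: bnd_L2M => //; exact: H1_wL2.
split.
- by have [] := H1_cst 0.
- by move=> u v Hu Hv; have [] := H1D Hu Hv.
- by move=> k u Hu; have [] := H1Z k Hu.
- move=> u v _ _; apply: eq_bigr => i _; congr (spint Om _); apply/funext => x; ring.
- move=> u v w Hu Hv Hw; rewrite -big_split; apply: eq_bigr => i _; rewrite [RHS]/=.
  have [Huv huv] := H1D Hu Hv.
  rewrite -(sipDl hL); [|exact: La|exact: La|exact: H1_wL2].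
  apply: ip_aeq.
  + by have /L2_pm := La _ i Huv.
  + by apply: L2_pm; apply: L2D; exact: La.
  + by apply: L2_pm; exact: H1_wL2.
  + by apply: filterS (huv i) => x h Dx; rewrite h// mulrDr.
- move=> k u w Hu Hw; rewrite mulr_sumr; apply: eq_bigr => i _.
  have [Hku hku] := H1Z k Hu.
  rewrite -(sipZl hL); [|exact: La|exact: H1_wL2].
  apply: ip_aeq.
  + by have /L2_pm := La _ i Hku.
  + by apply: L2_pm; apply: L2Z; exact: La.
  + by apply: L2_pm; exact: H1_wL2.
  + apply: filterS (hku i) => x h Dx; rewrite h//.
    by rewrite [LHS]mulrCA.
- move=> u Hu; apply: sumr_ge0 => i _; apply: spint_ge0 => x _.
  by rewrite -mulrA -expr2 mulr_ge0// sqr_ge0.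
Qed.

Lemma wgip1 : wgip (fun=> 1) = gip.
Proof.
apply/funext => u; apply/funext => v; apply: eq_bigr => i _.
by congr (spint Om _); apply/funext => x; rewrite mul1r.
Qed.

Lemma semi_ip_gip : semi_ip (ipset H1) gip.
Proof. by rewrite -wgip1; apply: semi_ip_wgip => //; exact: bnd_cst. Qed.

Lemma semi_ip_H1 : semi_ip (ipset H1) (ip H1).
Proof.
have hG := semi_ip_gip; have hL := semi_ip_L2 Om.
have E u v : ip H1 u v = ip L2 u v + gip u v by [].
split; [exact: sip0 hG|exact: sipD hG|exact: sipZ hG| | | |].
- by move=> u v Hu Hv; rewrite !E (sipC hG)// (sipC hL)//; exact: H1_L2.
- move=> u v w Hu Hv Hw; rewrite !E (sipDl hG)// (sipDl hL); try exact: H1_L2.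
  by rewrite addrACA.
- move=> k u w Hu Hw; rewrite !E (sipZl hG)// (sipZl hL); try exact: H1_L2.
  by rewrite mulrDr.
- by move=> u Hu; rewrite E addr_ge0 ?(sip_ge0 hG)// (sip_ge0 hL)//; exact: H1_L2.
Qed.

Lemma wgip_le a M u : bnd a -> (forall x, 0 <= a x <= M) -> ipset H1 u ->
  wgip a u u <= M * gip u u.
Proof.
move=> ba aM Hu; rewrite /wgip /gip mulr_sumr; apply: ler_sum => i _ /=.
have Lw := H1_wL2 i Hu.
rewrite -spintZ; last exact: L2_mul.
apply: le_spint.
- by apply: L2_mul => //; exact: bnd_L2M.
- by apply: SintZ; exact: L2_mul.
- move=> x _; rewrite -mulrA ler_wpM2r//; last by case/andP: (aM x).
  by rewrite -expr2 sqr_ge0.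
Qed.

Lemma wgip_ge a m u : bnd a -> (forall x, m <= a x) -> ipset H1 u ->
  m * gip u u <= wgip a u u.
Proof.
move=> ba am Hu; rewrite /wgip /gip mulr_sumr; apply: ler_sum => i _ /=.
have Lw := H1_wL2 i Hu.
rewrite -spintZ; last exact: L2_mul.
apply: le_spint.
- by apply: SintZ; exact: L2_mul.
- by apply: L2_mul => //; exact: bnd_L2M.
- by move=> x _; rewrite -mulrA ler_wpM2r// -expr2 sqr_ge0.
Qed.

End torus_H1.

Section ipvec.
Context {R : realType} {V : lmodType R} (I : finType).

Lemma semi_ip_vec (S : set V) b : semi_ip S b ->
  semi_ip [set u : I -> V | forall i, S (u i)]
    (fun u v => \sum_(i : I) b (u i) (v i)).
Proof.
move=> h; split => /=.
- by move=> i; exact: sip0 h.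
- by move=> u v Hu Hv i; apply: (sipD h).
- by move=> a u Hu i; apply: (sipZ h).
- by move=> u v Hu Hv; apply: eq_bigr => i _; rewrite (sipC h).
- by move=> u v w Hu Hv Hw; rewrite -big_split; apply: eq_bigr => i _; rewrite (sipDl h).
- by move=> a u w Hu Hw; rewrite mulr_sumr; apply: eq_bigr => i _; rewrite (sipZl h).
- by move=> u Hu; apply: sumr_ge0 => i _; rewrite (sip_ge0 h).
Qed.

End ipvec.

(** * Primitives on the line and iterated integrals on product sets *)

Section calculus.
Context {R : realType}.
Local Notation leb1 := (@lebesgue_measure R).
Implicit Types (f F : R -> R) (a b c t : R).

Lemma continuous_itv_integrable f a b : continuous f ->
  leb1.-integrable `[a, b] (EFin \o f).
Proof.
move=> cf; apply: (@continuous_compact_integrable R f `[a, b]%classic).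
  exact: segment_compact.
exact: continuous_subspaceT.
Qed.

Lemma is_derive_continuous f F : (forall t, is_derive t (1 : R) F (f t)) ->
  continuous F.
Proof.
move=> FF t; apply/differentiable_continuous/derivable1_diffP.
by have [] := FF t.
Qed.

Lemma Rintegral_cat f a b c : continuous f -> a <= b -> b <= c ->
  \int[leb1]_(t in `[a, c]) f t =
  \int[leb1]_(t in `[a, b]) f t + \int[leb1]_(t in `[b, c]) f t.
Proof.
move=> cf ab bc; rewrite -(@Rintegral_itv_obnd_cbnd _ b (BRight c)); last first.
  by apply: integrableS (continuous_itv_integrable b c cf) => //; exact: subset_itv_oc_cc.
rewrite -(@Rintegral_itvB _ f (BLeft a) (BRight c) b) ?bnd_simp//.
  by rewrite addrC subrK.
exact: continuous_itv_integrable.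
Qed.

Lemma FTC2 f F a b : a <= b -> continuous f ->
  (forall t, is_derive t (1 : R) F (f t)) ->
  \int[leb1]_(t in `[a, b]) f t = F b - F a.
Proof.
move=> ab cf FF; have cF := is_derive_continuous FF.
move: ab; rewrite le_eqVlt => /predU1P[<-|ab].
  by rewrite set_itv1 Rintegral_set1 subrr.
rewrite /Rintegral (@continuous_FTC2 _ f F)//=.
- exact: continuous_subspaceT.
- split; first by move=> x _; have [] := FF x.
    exact: cvg_at_right_filter (cF a).
  exact: cvg_at_left_filter (cF b).
- by move=> x _; rewrite derive1E; have [_ ->] := FF x.
Qed.

Lemma ex_primitive f : continuous f ->
  exists F, forall t, is_derive t (1 : R) F (f t).
Proof.
move=> cf.
pose F t := if 0 <= t then \int[leb1]_(s in `[0, t]) f s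
            else - \int[leb1]_(s in `[t, 0]) f s.
exists F => t; pose a := Num.min t 0 - 1.
have a0 : a < 0 by rewrite /a ltrBlDr add0r gt_min ltr01 orbT.
have at_ : a < t by rewrite /a ltrBlDr gt_min ltrDl ltr01.
pose G x := \int[leb1]_(s in `[a, x]) f s - \int[leb1]_(s in `[a, 0]) f s.
have FG x : a < x -> G x = F x.
  move=> ax; rewrite /G /F; case: ifPn => [x0|].
    by rewrite (@Rintegral_cat f a 0 x)// ?(ltW a0)// addrAC subrr add0r.
  rewrite -ltNge => x0.
  by rewrite (@Rintegral_cat f a x 0)// ?(ltW ax) ?(ltW x0)// opprD addrA subrr add0r.
have tt1 : t < t + 1 by rewrite ltrDl.
have [] := @continuous_FTC1 _ f (BLeft a) t (t + 1) tt1
  (continuous_itv_integrable a (t + 1) cf) _ (cf t).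
  by rewrite (@lte_fin R).
move=> d1 d2.
have dG : is_derive t (1 : R) G (f t).
  have dI : is_derive t (1 : R) (fun x => \int[leb1]_(s in `[a, x]) f s) (f t).
    by split => //; rewrite -derive1E.
  have dc : is_derive t (1 : R) (fun=> \int[leb1]_(s in `[a, 0]) f s) 0.
    exact: is_derive_cst.
  by rewrite -[X in is_derive _ _ _ X]subr0; exact: is_deriveB.
apply: near_eq_is_derive dG; near=> x; apply: FG.
by near: x; exact: lt_nbhsr.
Unshelve. all: by end_near. Qed.

End calculus.

Section fubini_on.
Context {R : realType} d1 d2 (S : measurableType d1) (T : measurableType d2).
Variables (m1 : {sigma_finite_measure set S -> \bar R})
  (m2 : {sigma_finite_measure set T -> \bar R}).
Variables (E : set S) (D : set T) (mE : measurable E) (mD : measurable D).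

Let pE (V : Type) (K : S -> T -> V) := fun p : S * T => K p.1 p.2.

Let mED : measurable (E `*` D). Proof. exact: measurableX. Qed.

Lemma patch_pairE (f : S * T -> \bar R) s x :
  (f \_ (E `*` D)) (s, x) =
  if s \in E then ((fun x => f (s, x)) \_ D) x else 0%E.
Proof.
rewrite !patchE; case: ifPn => [/set_mem[/= Es Dx]|].
  by rewrite !mem_set.
rewrite notin_setE => nEx; case: ifPn => // /set_mem Es.
rewrite ifF//; apply/negbTE; rewrite notin_setE => Dx; exact: nEx.
Qed.

Lemma patch_pairE2 (f : S * T -> \bar R) s x :
  (f \_ (E `*` D)) (s, x) =
  if x \in D then ((fun s => f (s, x)) \_ E) s else 0%E.
Proof.
by rewrite patch_pairE !patchE; case: ifP; case: ifP.
Qed.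

Let in1 (f : S * T -> \bar R) s :
  (\int[m2]_x (f \_ (E `*` D)) (s, x) =
   ((fun s => \int[m2]_(x in D) f (s, x)) \_ E) s)%E.
Proof.
under eq_integral do rewrite patch_pairE.
by rewrite patchE; case: ifPn => Es; [rewrite -integral_mkcond|rewrite integral0].
Qed.

Let in2 (f : S * T -> \bar R) x :
  (\int[m1]_s (f \_ (E `*` D)) (s, x) =
   ((fun x => \int[m1]_(s in E) f (s, x)) \_ D) x)%E.
Proof.
under eq_integral do rewrite patch_pairE2.
by rewrite patchE; case: ifPn => Es; [rewrite -integral_mkcond|rewrite integral0].
Qed.

Lemma tonelli_on (K : S -> T -> \bar R) : measurable_fun setT (pE K) ->
  (forall s x, (0 <= K s x)%E) ->
  (\int[m1]_(s in E) \int[m2]_(x in D) K s x =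
   \int[m2]_(x in D) \int[m1]_(s in E) K s x)%E.
Proof.
move=> mK K0; rewrite integral_mkcond [RHS]integral_mkcond.
have mf : measurable_fun setT (pE K \_ (E `*` D)).
  by apply/(measurable_restrictT _ _).1 => //; exact: measurable_funTS.
have f0 p : (0 <= (pE K \_ (E `*` D)) p)%E by rewrite patchE; case: ifP => // _; exact: K0.
have := @fubini_tonelli _ _ S T R m1 m2 _ mf f0.
have e1 : (fun s => \int[m2]_x (pE K \_ (E `*` D)) (s, x))%E =
  (fun s => \int[m2]_(x in D) K s x)%E \_ E by apply/funext => s; exact: in1.
have e2 : (fun x => \int[m1]_s (pE K \_ (E `*` D)) (s, x))%E =
  (fun x => \int[m1]_(s in E) K s x)%E \_ D by apply/funext => s; exact: in2.
by rewrite e1 e2.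
Qed.

Lemma measurable_tonelli_on (K : S -> T -> \bar R) : measurable_fun setT (pE K) ->
  (forall s x, (0 <= K s x)%E) ->
  measurable_fun setT (fun x => (\int[m1]_(s in E) K s x)%E).
Proof.
move=> mK K0.
rewrite (_ : (fun x => _) = fun x => (\int[m1]_s ((pE K) \_ (E `*` setT)) (s, x))%E).
  apply: (@measurable_fun_fubini_tonelli_G _ _ S T R m1 (pE K \_ (E `*` setT))).
    apply/(measurable_restrictT _ _).1 => //; first exact: measurableX.
    exact: measurable_funTS.
  by move=> p; rewrite patchE; case: ifP => // _; exact: K0.
apply/funext => x; rewrite integral_mkcond; apply: eq_integral => s _.
rewrite !patchE; case: ifPn => [Es|nEs].
  by rewrite mem_set//; split => //; exact/set_mem.
rewrite ifF//; apply/negbTE; rewrite notin_setE => -[/= Es _].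
by rewrite mem_set in nEs.
Qed.

Variable K : S -> T -> R.
Hypothesis mK : measurable_fun setT (pE K).
Hypothesis iK : (\int[m1]_(s in E) \int[m2]_(x in D) `|K s x|%:E < +oo)%E.

Let f : S * T -> \bar R := (EFin \o pE K) \_ (E `*` D).

Let if_ : (m1 \x m2)%E.-integrable setT f.
Proof.
have mf : measurable_fun setT f.
  apply/(measurable_restrictT _ _).1 => //; apply: measurable_funTS.
  exact/measurable_EFinP.
apply/integrable12ltyP => //.
have fE s x : (`|f (s, x)| = ((fun p => `|K p.1 p.2|%:E) \_ (E `*` D)) (s, x))%E.
  by rewrite /f !patchE; case: ifP => //; rewrite abse0.
rewrite (eq_integral (fun s => ((fun s => \int[m2]_(x in D) `|K s x|%:E) \_ E) s)%E).
  by rewrite -integral_mkcond.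
move=> s _; rewrite -[RHS](in1 (fun p => `|K p.1 p.2|%:E)).
by apply: eq_integral => x _; exact: fE.
Qed.

Lemma fubini_on_ae : {ae m2, forall x, D x -> m1.-integrable E (fun s => (K s x)%:E)}.
Proof.
have := ae_integrable2 if_; apply: filterS => x h Dx.
apply/(integrable_mkcond _ mE); apply: eq_integrable h => // s _.
by rewrite /f patch_pairE2 mem_set.
Qed.

Let RF s := \int[m2]_(x in D) K s x.
Let RG x := \int[m1]_(s in E) K s x.

Let FE : fubini_F m2 f = ((fun s => \int[m2]_(x in D) (K s x)%:E) \_ E)%E.
Proof. by apply/funext => s; rewrite /fubini_F in1. Qed.
Let GE : fubini_G m1 f = ((fun x => \int[m1]_(s in E) (K s x)%:E) \_ D)%E.
Proof. by apply/funext => x; rewrite /fubini_G in2. Qed.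

Let iF : m1.-integrable E (fun s => \int[m2]_(x in D) (K s x)%:E)%E.
Proof. by apply/(integrable_mkcond _ mE); rewrite -FE; exact: integrable_fubini_F if_. Qed.
Let iG : m2.-integrable D (fun x => \int[m1]_(s in E) (K s x)%:E)%E.
Proof.
apply/(integrable_mkcond _ mD); rewrite -GE.
have mf : measurable_fun setT f by exact: measurable_int if_.
have maf : measurable_fun setT (abse \o f) by exact: measurableT_comp.
have mGa : measurable_fun setT (fun x => \int[m1]_s `|f (s, x)|)%E.
  apply: (@measurable_fun_fubini_tonelli_G _ _ S T R m1 (abse \o f)) => // p.
  exact: abse_ge0.
apply/integrableP; split; first exact: measurable_fubini_G if_.
apply: le_lt_trans ((integrable21ltyP _ _ mf).1 if_).
apply: ge0_le_integral => //.
- by apply: measurableT_comp => //; exact: measurable_fubini_G if_.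
- move=> x _; apply: le_abse_integral => //.
  by apply: (measurableT_comp mf); exact: measurable_pair2.
Qed.

Let fine_int d (U : measurableType d) (m : {measure set U -> \bar R}) (A : set U)
    (g : U -> \bar R) : measurable A -> m.-integrable A g ->
  m.-integrable A (EFin \o (fine \o g)) /\
  (\int[m]_(x in A) (fine (g x))%:E = \int[m]_(x in A) g x)%E.
Proof.
move=> mA ig; have mg := measurable_int _ ig.
have mfg : measurable_fun A (EFin \o (fine \o g)).
  by apply/measurable_EFinP; apply: measurableT_comp.
split.
  apply: le_integrable ig => // x Ax /=.
  by case: (g x) => [r||]; rewrite /= ?normr0 ?leey.
apply: ae_eq_integral => //.
have := integrable_ae mA ig; apply: filterS => x h Ax; exact: fineK (h Ax).
Qed.

Lemma fubini_on_int1 : m1.-integrable E (EFin \o RF).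
Proof. by have [] := fine_int mE iF. Qed.
Lemma fubini_on_int2 : m2.-integrable D (EFin \o RG).
Proof. by have [] := fine_int mD iG. Qed.

(** Passing through functions restricted to the product of the two domains reduces
    the statement to the whole space. *)
Lemma fubini_on :
  \int[m1]_(s in E) \int[m2]_(x in D) K s x =
  \int[m2]_(x in D) \int[m1]_(s in E) K s x.
Proof.
rewrite /Rintegral; congr fine.
have [_ ->] := fine_int mE iF; have [_ ->] := fine_int mD iG.
rewrite integral_mkcond [RHS]integral_mkcond -FE -GE.
exact: (Fubini if_).
Qed.

End fubini_on.

(** * Translations of H1 functions and the Poincare inequality *)

Section translations.
Context {R : realType} {d : nat} (Om : cube R d).
Local Notation scal := ('rV[R]_d -> R).
Local Notation leb := (lebesgue_rV d).
Local Notation leb1 := (@lebesgue_measure R).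
Local Notation D := (cube_set Om).
Local Notation L := (side Om).
Local Notation L2 := (L2 Om).
Local Notation bnd := (bnd Om).
Local Notation aeq := (aeq Om).
Local Notation Sint := (Sint Om).
Local Notation e i := (delta_mx ord0 i : 'rV[R]_d).
Implicit Types (u v w g : scal) (i : 'I_d).

Let hL := semi_ip_L2 Om.
Let nm v := Num.sqrt (ip L2 v v).

Lemma SintE v : Sint v -> (\int[leb]_(x in D) (v x)%:E = (spint Om v)%:E)%E.
Proof.
by move=> /(integrable_fin_num (measurable_cube Om)) iv; rewrite /spint /Rintegral fineK.
Qed.

Lemma L2_shift v z : ipset L2 v -> ipset L2 (fun x => v (x + z)).
Proof.
move=> /L2P[pv iv]; apply/L2P; split; first exact: pm_shift.
apply/integrableP; split.
  apply/measurable_EFinP; apply: measurable_funTS; apply: measurable_funX.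
  by case: (pm_shift z pv).
have [pe mv] := pv.
rewrite (eq_integral (fun x : 'rV[R]_d => (v (x + z)%R ^+ 2)%:E)); last first.
  by move=> x _ /=; rewrite ger0_norm// sqr_ge0.
rewrite (@integral_shift R d (corner Om) z L (fun x => (v x ^+ 2)%:E)).
- by rewrite SintE// ltry.
- exact: side_gt0.
- by apply/measurable_EFinP; exact: measurable_funX.
- by move=> x i; rewrite pe.
Qed.

Lemma ip_shift u v z : ipset L2 u -> ipset L2 v ->
  ip L2 (fun x => u (x + z)) (fun x => v (x + z)) = ip L2 u v.
Proof.
move=> Hu Hv; apply: (@spint_shift R d Om (fun x => u x * v x)).
by apply: pmM; exact: L2_pm.
Qed.

Lemma nm_shift u z : ipset L2 u -> nm (fun x => u (x + z)) = nm u.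
Proof. by move=> Hu; rewrite /nm ip_shift. Qed.

Lemma ip_shiftC u v z : ipset L2 u -> ipset L2 v ->
  ip L2 (fun x => u (x + z)) v = ip L2 u (fun x => v (x - z)).
Proof.
move=> Hu Hv; rewrite -(@ip_shift u (fun x => v (x - z)) z)//; last exact: L2_shift.
by congr (spint Om _); apply/funext => x; rewrite addrK.
Qed.

(** Averages over s in E of the correlation of w with the translate of g by tau s:
    the common shape of the double integrals behind the translation identity and
    the Poincare inequality. *)
Section correlation.
Context dS (S : measurableType dS) (m : {sigma_finite_measure set S -> \bar R})
  (E : set S) (tau : S -> 'rV[R]_d).
Hypotheses (mE : measurable E) (mtau : measurable_fun setT tau) (Efin : (m E < +oo)%E).

Let mst : measurable_fun setT (fun p : S * 'rV[R]_d => p.2 + tau p.1).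
Proof.
apply: measurable_fun_rV => i; under eq_fun do rewrite mxE.
apply: measurable_funD.
  exact: (measurableT_comp (measurable_coor i) measurable_snd).
by apply: (measurableT_comp (measurable_coor i)); exact: (measurableT_comp mtau measurable_fst).
Qed.

Variables (g w : scal) (Hg : ipset L2 g) (Hw : ipset L2 w).

Let mK : measurable_fun setT (fun p : S * 'rV[R]_d => g (p.2 + tau p.1) * w p.2).
Proof.
have [[_ mg] [_ mw]] := (L2_pm Hg, L2_pm Hw).
apply: measurable_funM; first exact: (measurableT_comp mg).
exact: (measurableT_comp mw measurable_snd).
Qed.

Let iK : (\int[m]_(s in E) \int[leb]_(x in D) `|g (x + tau s)%R * w x|%:E < +oo)%E.
Proof.
have [[_ mg] [_ mw]] := (L2_pm Hg, L2_pm Hw).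
pose C := ip L2 g g + ip L2 w w.
apply: (@le_lt_trans _ _ (\int[m]_(s in E) (C%:E))%E); last first.
  rewrite integral_cst//.
  have mEf : m E = (fine (m E))%:E by rewrite fineK// ge0_fin_numE.
  by rewrite [X in (_ * X)%E]mEf -EFinM ltry.
apply: ge0_le_integral => //.
- by move=> s _; apply: integral_ge0 => x _; rewrite lee_fin.
- apply: measurable_funTS.
  apply: (@measurable_tonelli_on R _ _ 'rV[R]_d S leb D (measurable_cube Om)
    (fun x s => `|g (x + tau s) * w x|%:E)); last by move=> x s; rewrite lee_fin.
  apply/measurable_EFinP; apply: measurableT_comp => //; apply: measurable_funM.
    apply: (measurableT_comp mg); apply: measurable_fun_rV => i.
    under eq_fun do rewrite mxE; apply: measurable_funD.
      exact: (measurableT_comp (measurable_coor i) measurable_fst).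
    by apply: (measurableT_comp (measurable_coor i)); exact: (measurableT_comp mtau measurable_snd).
  exact: (measurableT_comp mw measurable_fst).
- move=> s _; have Hgs := L2_shift (tau s) Hg.
  have i1 := L2_mul Hgs Hw.
  have ia : Sint (fun x => `|g (x + tau s) * w x|).
    exact: (@integrable_norm _ _ _ leb D _ i1).
  rewrite SintE// lee_fin /C -(ip_shift (tau s) Hg Hg) -spintD; last 2 first.
    exact: L2_mul.
    exact: L2_mul.
  apply: le_spint => //; first by apply: SintD; exact: L2_mul.
  move=> x _; set a := g _; set b := w _.
  have := sqr_ge0 (a + b); have := sqr_ge0 (a - b).
  by rewrite ler_norml => q1 q2; apply/andP; split; nra.
Qed.

Lemma corr_integrable : m.-integrable E
  (fun s => (ip L2 (fun x => g (x + tau s)) w)%:E).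
Proof. exact: (fubini_on_int1 mE (measurable_cube Om) mK iK). Qed.

Lemma corr_fubini : \int[m]_(s in E) ip L2 (fun x => g (x + tau s)) w =
  spint Om (fun x => \int[m]_(s in E) (g (x + tau s) * w x)).
Proof. exact: (fubini_on mE (measurable_cube Om) mK iK). Qed.

Lemma corr_ae : {ae leb, forall x, D x ->
  m.-integrable E (fun s => (g (x + tau s) * w x)%:E)}.
Proof. exact: (fubini_on_ae mE (measurable_cube Om) mK iK). Qed.

Lemma corr_int2 : Sint (fun x => \int[m]_(s in E) (g (x + tau s) * w x)).
Proof. exact: (fubini_on_int2 mE (measurable_cube Om) mK iK). Qed.

End correlation.

Lemma measurable_scale_e i : measurable_fun setT (fun s : measurableTypeR R => s *: e i).
Proof.
apply: measurable_fun_rV => j; under eq_fun do rewrite !mxE.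
exact: measurable_funM.
Qed.

Lemma leb1_itv_fin (a b : R) : (leb1 `[a, b] < +oo)%E.
Proof. by rewrite lebesgue_measure_itv/=; case: ifP => _; rewrite -?EFinD ltry. Qed.

Let leb1_itv0 (h : R) : 0 <= h -> fine (leb1 `[0, h]) = h.
Proof.
move=> h0; rewrite [X in fine X]lebesgue_measure_itv/= lte_fin.
by move: h0; rewrite le_eqVlt => /predU1P[<-|h0]; rewrite ?ltxx// h0/= subr0.
Qed.

(** Testing with products only makes the product rules below a matter of
    one-dimensional calculus. *)
Definition wder i v g := forall ps, (forall j, per1 L (ps j)) ->
  ip L2 v (partial i (prodf ps)) = - ip L2 g (prodf ps).

Lemma is_wpartial_wder i v g : is_wpartial Om i v g -> wder i v g.
Proof.
move=> [_ gE] ps hps; apply: gE.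
  by apply: prodf_periodic => j t; case: (hps j).
by apply: prodf_smooth => j; case: (hps j).
Qed.

Lemma prodf_bnd ps : (forall j, per1 L (ps j)) -> bnd (prodf ps).
Proof.
move=> hps; apply: smooth_bnd.
  by apply: prodf_periodic => j t; case: (hps j).
by apply: prodf_smooth => j; case: (hps j).
Qed.

Lemma Cinf_derive_per1 p : per1 L p -> per1 L (derive1 p).
Proof.
move=> [Cp pL]; split; first exact: Cinf_derive.
move=> t; have [h1 h2] := Cinf_is_derive (t + L) Cp.
have d1 : is_derive t (1 : R) (fun s => p (s + L)) (derive1 p (t + L)).
  have dl : is_derive t (1 : R) (fun s => s + L) 1.
    rewrite -[X in is_derive _ _ _ X]addr0; apply: is_deriveD; exact: is_derive_id.
  have := @is_derive1_comp _ p (fun s => s + L) t _ _ (Cinf_is_derive (t + L) Cp) dl.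
  by rewrite mulr1.
have E2 : (fun s => p (s + L)) = p by apply/funext => s; rewrite pL.
by rewrite E2 in d1; rewrite [RHS]derive1E; have [_ ->] := d1.
Qed.

Lemma prodf_dbnd ps i : (forall j, per1 L (ps j)) ->
  bnd (prodf (fun j => if j == i then derive1 (ps j) else ps j)).
Proof.
move=> hps; apply: prodf_bnd => j; case: ifP => _ //.
exact: Cinf_derive_per1.
Qed.

Lemma prodf_at (ps qs : 'I_d -> R -> R) i x : (forall j, j != i -> ps j = qs j) ->
  prodf ps x = ps i (x ord0 i) * \prod_(j | j != i) qs j (x ord0 j).
Proof.
by move=> pq; rewrite /prodf (bigD1 i)//=; congr (_ * _); apply: eq_bigr => j /pq ->.
Qed.

Let coordD x (s : R) i j : (x + s *: e i) ord0 j = x ord0 j + s * (j == i)%:R.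
Proof. by rewrite !mxE eqxx. Qed.

(** A test function p of the i-th coordinate is moved onto the translate of v. The
    difference of p and its translate is the derivative of the window average of
    p over length h, which is again periodic and smooth, so that the definition of
    the weak derivative applies to it. *)
Lemma translation_test i v g h ps : ipset L2 v -> ipset L2 g -> wder i v g -> 0 <= h ->
  (forall j, per1 L (ps j)) ->
  ip L2 (fun x => v (x + h *: e i) - v x) (prodf ps) =
  \int[leb1]_(s in `[0, h]) ip L2 (fun x => g (x + s *: e i)) (prodf ps).
Proof.
move=> Hv Hg vg h0 hps; have Lp := bnd_L2 (prodf_bnd hps).
have [Cp pL] := hps i.
have [P dP] := ex_primitive (Cinf_continuous Cp).
have CP := Cinf_primitive Cp dP.
(* q is the integral of p over the window [t - h, t]; it is written with a
   primitive for smoothness, and as an integral for periodicity. *)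
pose q t := P t - P (t - h).
have dsh t : is_derive t (1 : R) (fun s => s - h) 1.
  rewrite -[X in is_derive _ _ _ X]subr0; apply: is_deriveB; exact: is_derive_id.
have dq t : is_derive t (1 : R) q (ps i t - ps i (t - h)).
  apply: is_deriveB => //.
  by rewrite -[X in is_derive _ _ _ X]mulr1; exact: (@is_derive1_comp _ P (fun s => s - h)).
have qE t : \int[leb1]_(s in `[0, h]) ps i (t - s) = q t.
  have c1 : continuous (fun s => ps i (t - s)).
    move=> s; apply: continuous_comp; last exact: Cinf_continuous.
    by apply: continuousB; [exact: cst_continuous|exact: cvg_id].
  have d1 s : is_derive s (1 : R) (fun s => - P (t - s)) (ps i (t - s)).
    have dm : is_derive s (1 : R) (fun s => t - s) (-1).
      rewrite -[X in is_derive _ _ _ X]add0r; apply: is_deriveB; exact: is_derive_id.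
    have := is_deriveN (@is_derive1_comp _ P (fun s => t - s) s _ _ (dP _) dm).
    by rewrite mulrN1 opprK.
  by rewrite (FTC2 h0 c1 d1) subr0 /q addrC opprK.
have Cq : Cinf q.
  apply: CinfB => //; apply: Cinf_comp => //.
  by apply: CinfB; [exact: Cinf_id|exact: Cinf_cst].
have perq : per1 L q.
  split=> // t; rewrite -!qE; apply: eq_Rintegral => s _.
  by rewrite addrAC pL.
have q'E : derive1 q = fun t => ps i t - ps i (t - h).
  by apply/funext => t; rewrite derive1E; have [_ ->] := dq t.
pose qs j := if j == i then q else ps j.
have hqs j : per1 L (qs j) by rewrite /qs; case: ifP.
pose C (x : 'rV[R]_d) := \prod_(j | j != i) ps j (x ord0 j).
have Cs x s : C (x + s *: e i) = C x.
  by apply: eq_bigr => j ji; rewrite coordD (negbTE ji) mulr0 addr0.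
have pE x : prodf ps x = ps i (x ord0 i) * C x by exact: prodf_at.
have QE x : prodf qs x = q (x ord0 i) * C x.
  by rewrite (@prodf_at _ ps i) /qs ?eqxx// => j /negbTE ->.
have dQE x : partial i (prodf qs) x = prodf ps x - prodf ps (x - h *: e i).
  rewrite partial_prodf; last by move=> j; case: (hqs j).
  rewrite (@prodf_at _ ps i) ?eqxx//; last by move=> j /negbTE ji; rewrite /qs !ji.
  rewrite /qs eqxx q'E !pE; have := Cs x (- h); have := coordD x (- h) i i.
  rewrite scaleNr => -> ->; rewrite eqxx mulr1 -mulrBl.
  by [].
have Lph := L2_shift (- (h *: e i)) Lp.
have Hvh := L2_shift (h *: e i) Hv.
rewrite (sipBl hL Hvh Hv Lp) ip_shiftC//.
have -> : ip L2 v (fun x => prodf ps (x - h *: e i)) - ip L2 v (prodf ps) =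
    - ip L2 v (partial i (prodf qs)).
  have -> : partial i (prodf qs) = prodf ps - (fun x => prodf ps (x - h *: e i)).
    by apply/funext => x; rewrite dQE.
  by rewrite (sipBr hL)// opprB.
rewrite (vg _ hqs) opprK.
transitivity (\int[leb1]_(s in `[0, h]) ip L2 (fun x => prodf ps (x + - s *: e i)) g).
  rewrite (@corr_fubini _ _ leb1 `[0, h]%classic (fun s => - s *: e i))//; last 2 first.
  - by apply: (measurableT_comp (measurable_scale_e i)); exact: oppr_measurable.
  - exact: leb1_itv_fin.
  rewrite (sipC hL)//; last exact: bnd_L2 (prodf_bnd hqs).
  apply: eq_Rintegral => x _; rewrite QE -qE.
  have Cpi : Cinf (fun s => ps i (x ord0 i - s)).
    by apply: Cinf_comp; [case: (hps i)|apply: CinfB; [exact: Cinf_cst|exact: Cinf_id]].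
  have cI (k : R) : leb1.-integrable `[0, h] (EFin \o (fun s => ps i (x ord0 i - s) * k)).
    apply: continuous_itv_integrable; apply: Cinf_continuous.
    by apply: CinfM => //; exact: Cinf_cst.
  have cI1 : leb1.-integrable `[0, h] (EFin \o (fun s => ps i (x ord0 i - s))).
    by apply: continuous_itv_integrable; exact: Cinf_continuous.
  rewrite -RintegralZr// -RintegralZr//.
  by apply: eq_Rintegral => s _; rewrite pE Cs coordD eqxx mulr1.
apply: eq_Rintegral => s _; rewrite ip_shiftC//.
rewrite (sipC hL)//; last exact: L2_shift.
by congr (ip L2 _ _); apply/funext => x; rewrite scaleNr opprK.
Qed.


Let corr_line h g w i : ipset L2 g -> ipset L2 w ->
  leb1.-integrable `[0, h] (fun s => (ip L2 (fun x => g (x + s *: e i)) w)%:E).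
Proof.
move=> Hg Hw; apply: (@corr_integrable _ _ leb1 `[0, h]%classic (fun s => s *: e i)) => //.
  exact: measurable_scale_e.
exact: leb1_itv_fin.
Qed.

(** The fundamental theorem of calculus along lines. Both sides have the same
    integrals against products of smooth functions. *)
Lemma translation_ae i v g h : ipset L2 v -> ipset L2 g -> wder i v g -> 0 <= h ->
  aeq (fun x => v (x + h *: e i) - v x)
      (fun x => \int[leb1]_(s in `[0, h]) g (x + s *: e i)) /\
  {ae leb, forall x, D x -> leb1.-integrable `[0, h] (fun s => (g (x + s *: e i))%:E)}.
Proof.
move=> Hv Hg vg h0; have mD := measurable_cube Om.
have L1 := bnd_L2 (bnd_cst Om 1).
have mse := @measurable_scale_e i.
have aeI : {ae leb, forall x, D x -> leb1.-integrable `[0, h] (fun s => (g (x + s *: e i))%:E)}.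
  have := @corr_ae _ _ leb1 `[0, h]%classic (fun s => s *: e i)
    (measurable_itv _) mse (leb1_itv_fin 0 h) g (fun=> 1) Hg L1.
  apply: filterS => x hx Dx; apply: eq_integrable (hx Dx) => // s _.
  by rewrite mulr1.
split => //.
pose G x := \int[leb1]_(s in `[0, h]) g (x + s *: e i).
have iG : Sint G.
  have := @corr_int2 _ _ leb1 `[0, h]%classic (fun s => s *: e i)
    (measurable_itv _) mse (leb1_itv_fin 0 h) g (fun=> 1) Hg L1.
  apply: eq_integrable => // x _ /=; congr EFin.
  by apply: eq_Rintegral => s _; rewrite mulr1.
have Hvh := L2_shift (h *: e i) Hv.
have HF := sipB hL Hvh Hv.
have iF := L2_int HF.
suff : aeq (fun x => (v (x + h *: e i) - v x) - G x) (fun=> 0).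
  by apply: filterS => x h1 Dx; apply/eqP; rewrite -subr_eq0; apply/eqP; exact: h1.
apply: (@density_prodf R d (corner Om) L _ (side_gt0 Om)).
  exact: SintB.
move=> ps hps; have bp := prodf_bnd hps; have Lp := bnd_L2 bp.
have iGp : Sint (fun x => G x * prodf ps x).
  have [M hM] := bp.2.
  apply: (le_integrable mD _ _ (SintZ M (@integrable_norm _ _ _ leb D _ iG))).
    apply/measurable_EFinP; apply: measurable_funM.
      by apply/measurable_EFinP; exact: measurable_int iG.
    by apply: measurable_funTS; case: bp.1.
  move=> x _ /=; rewrite lee_fin !normrM (ger0_norm (normr_ge0 (G x))) mulrC.
  by rewrite ler_wpM2r// (le_trans (hM x))// ler_norm.
have iFp := L2_mul HF Lp.
rewrite (eq_integral (fun x : 'rV[R]_d => ((v (x + h *: e i) - v x) * prodf ps x - G x * prodf ps x)%R%:E)); last first.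
  by move=> x _; rewrite mulrBl.
rewrite [LHS](SintE (SintB iFp iGp)) (spintB iFp iGp).
have -> : spint Om (fun x => (v (x + h *: e i) - v x) * prodf ps x) =
    \int[leb1]_(s in `[0, h]) ip L2 (fun x => g (x + s *: e i)) (prodf ps).
  exact: translation_test.
rewrite (@corr_fubini _ _ leb1 `[0, h]%classic (fun s => s *: e i))//; last exact: leb1_itv_fin.
apply/eqP; rewrite eqe subr_eq0; apply/eqP; rewrite /spint /Rintegral; congr fine.
apply: ae_eq_integral => //.
- have := @corr_int2 _ _ leb1 `[0, h]%classic (fun s => s *: e i)
    (measurable_itv _) mse (leb1_itv_fin 0 h) g (prodf ps) Hg Lp.
  exact: measurable_int.
- exact: measurable_int iGp.
- apply: filterS aeI => x hx Dx; congr EFin.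
  by rewrite /G -RintegralZr//; exact: hx.
Qed.

Lemma translation_L2 i v g w h : ipset L2 v -> ipset L2 g -> ipset L2 w ->
  wder i v g -> 0 <= h ->
  ip L2 (fun x => v (x + h *: e i) - v x) w =
  \int[leb1]_(s in `[0, h]) ip L2 (fun x => g (x + s *: e i)) w.
Proof.
move=> Hv Hg Hw vg h0; have mse := @measurable_scale_e i.
have [vG aeI] := translation_ae Hv Hg vg h0.
rewrite (@corr_fubini _ _ leb1 `[0, h]%classic (fun s => s *: e i))//; last exact: leb1_itv_fin.
have HF := sipB hL (L2_shift (h *: e i) Hv) Hv.
rewrite /= /spint /Rintegral; congr fine; apply: ae_eq_integral => //.
- exact: measurable_cube.
- by have := L2_mul HF Hw; exact: measurable_int.
- have := @corr_int2 _ _ leb1 `[0, h]%classic (fun s => s *: e i)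
    (measurable_itv _) mse (leb1_itv_fin 0 h) g w Hg Hw.
  exact: measurable_int.
- apply: filterS2 vG aeI => x h1 h2 Dx; rewrite h1//; congr EFin.
  by rewrite -RintegralZr//; exact: h2.
Qed.

Let Rint_bound (h C : R) (f : R -> R) : 0 <= h ->
  leb1.-integrable `[0, h] (EFin \o f) ->
  (forall s, 0 <= s <= h -> `|f s| <= C) -> `|\int[leb1]_(s in `[0, h]) f s| <= h * C.
Proof.
move=> h0 if_ fC; apply: le_trans (le_normr_Rintegral _ if_) _ => //.
have <- : \int[leb1]_(s in `[0, h]) (cst C) s = h * C.
  rewrite Rintegral_cst// mulrC; congr (_ * _).
  by rewrite leb1_itv0.
apply: le_Rintegral => //.
- exact: (@integrable_norm _ _ _ leb1 `[0, h]%classic _ if_).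
- by apply: continuous_itv_integrable; exact: cst_continuous.
Qed.

(** Minkowski's inequality, obtained by pairing the translation identity with the
    difference v (. + h e_i) - v itself. *)
Lemma translation_estimate i v g h : ipset L2 v -> ipset L2 g ->
  wder i v g -> 0 <= h ->
  nm (fun x => v (x + h *: e i) - v x) <= h * nm g.
Proof.
move=> Hv Hg vg h0; set F := fun x => _.
have HF : ipset L2 F := sipB hL (L2_shift (h *: e i) Hv) Hv.
have nF := translation_L2 Hv Hg HF vg h0.
have [->|F0] := eqVneq (nm F) 0; first by rewrite mulr_ge0// sqrtr_ge0.
have Fp : 0 < nm F by rewrite lt_neqAle eq_sym F0 sqrtr_ge0.
rewrite -(ler_pM2r Fp) -mulrA.
rewrite -expr2 (sip_sqrn hL HF) [leLHS]nF.
apply: le_trans (ler_norm _) _; apply: Rint_bound => //; first exact: corr_line.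
move=> s _; rewrite -(nm_shift (s *: e i) Hg).
by apply: (sip_CSn hL) => //; exact: L2_shift.
Qed.

(** The test function is allowed to be weakly differentiable only. Translation
    invariance gives the discrete product rule in exact form; dividing by h, all
    error terms are bounded by h times a constant. *)
Lemma integration_by_parts_L2 i v w g k : ipset L2 v -> ipset L2 w ->
  ipset L2 g -> ipset L2 k -> wder i v g -> wder i w k ->
  ip L2 v k = - ip L2 g w.
Proof.
move=> Hv Hw Hg Hk vg wk.
set A := ip L2 g w + ip L2 k v.
pose C := nm g * nm k.
have AC h : 0 < h -> `|A| <= 2 * h * C.
  move=> hp; have h0 := ltW hp.
  have Hvh := L2_shift (h *: e i) Hv; have Hwh := L2_shift (h *: e i) Hw.
  have E1 := translation_L2 Hv Hg Hw vg h0.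
  have E2 := translation_L2 Hw Hk Hvh wk h0.
  (* The discrete product rule. *)
  have E3 : ip L2 (fun x => v (x + h *: e i) - v x) w +
            ip L2 (fun x => w (x + h *: e i) - w x) (fun x => v (x + h *: e i)) = 0.
    rewrite (sipBl hL Hvh Hv Hw) (sipBl hL Hwh Hw Hvh) (ip_shift _ Hw Hv).
    by rewrite (sipC hL Hw Hv) (sipC hL Hw Hvh); ring.
  pose f s := ip L2 (fun x => g (x + s *: e i)) w +
     ip L2 (fun x => k (x + s *: e i)) (fun x => v (x + h *: e i)).
  have i1 := corr_line h i Hg Hw; have i2 := corr_line h i Hk Hvh.
  have if0 : \int[leb1]_(s in `[0, h]) f s = 0 by rewrite RintegralD// -E1 -E2.
  have hA : \int[leb1]_(s in `[0, h]) (A - f s) = h * A.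
    rewrite RintegralB//; last 2 first.
    - by apply: (@continuous_itv_integrable R (cst A)); exact: cst_continuous.
    - by apply: eq_integrable (@integrableD _ _ _ leb1 `[0, h]%classic (measurable_itv _) _ _ i1 i2).
    rewrite if0 subr0.
    have -> : \int[leb1]_(s in `[0, h]) A = \int[leb1]_(s in `[0, h]) (cst A) s by [].
    by rewrite Rintegral_cst// mulrC leb1_itv0.
  have iAf : leb1.-integrable `[0, h] (EFin \o (fun s => A - f s)).
    have iA : leb1.-integrable `[0, h] (EFin \o cst A).
      by apply: continuous_itv_integrable; exact: cst_continuous.
    have iff := @integrableD _ _ _ leb1 `[0, h]%classic (measurable_itv _) _ _ i1 i2.
    by apply: eq_integrable (@integrableB _ _ _ leb1 `[0, h]%classic (measurable_itv _) _ _ iA iff).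
  have := Rint_bound h0 iAf (C := 2 * h * C).
  rewrite hA normrM (ger0_norm h0) ler_pM2l//; apply => s /andP[s0 sh].
  have Hgs := L2_shift (s *: e i) Hg; have Hws := L2_shift (- (s *: e i)) Hw.
  have Hks := L2_shift (s *: e i) Hk.
  have hs0 : 0 <= h - s by rewrite subr_ge0.
  have Hvs := L2_shift ((h - s) *: e i) Hv.
  have -> : A - f s = ip L2 g (fun x => w x - w (x - s *: e i)) -
      ip L2 k (fun x => v (x + (h - s) *: e i) - v x).
    rewrite (sipBr hL Hw Hws Hg) (sipBr hL Hvs Hv Hk) /A /f.
    rewrite (ip_shiftC _ Hg Hw) (ip_shiftC _ Hk Hvh).
    have -> : (fun x => v (x - s *: e i + h *: e i)) = (fun x => v (x + (h - s) *: e i)).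
      by apply/funext => x; rewrite scalerBl addrAC addrA.
    by ring.
  apply: le_trans (ler_normB _ _) _.
  have N1 : nm (fun x => w x - w (x - s *: e i)) <= s * nm k.
    rewrite -(nm_shift (s *: e i) (sipB hL Hw Hws)).
    have -> : (fun x => (w - (fun y => w (y - s *: e i))) (x + s *: e i)) =
       (fun x => w (x + s *: e i) - w x).
      apply/funext => x.
      have -> : (w - (fun y => w (y - s *: e i))) (x + s *: e i) =
        w (x + s *: e i) - w (x + s *: e i - s *: e i) by [].
      by rewrite addrK.
    exact: translation_estimate.
  have N2 : nm (fun x => v (x + (h - s) *: e i) - v x) <= (h - s) * nm g.
    exact: translation_estimate.
  have B1 := sip_CSn hL Hg (sipB hL Hw Hws).
  have B2 := sip_CSn hL Hk (sipB hL Hvs Hv).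
  have n0 u : 0 <= nm u by exact: sqrtr_ge0.
  apply: le_trans (lerD (le_trans B1 (ler_wpM2l (n0 g) N1))
    (le_trans B2 (ler_wpM2l (n0 k) N2))) _.
  have C0 : 0 <= C by exact: mulr_ge0.
  rewrite [leLHS](_ : _ = h * C); last by rewrite /C; ring.
  by rewrite ler_wpM2r// ler_peMl// ler1n.
have A0 : A = 0.
  apply/eqP; rewrite -normr_le0; apply/ler_addgt0Pl => eps eps0; rewrite addr0.
  have C0 : 0 <= C by apply: mulr_ge0; exact: sqrtr_ge0.
  have C1 : 0 < 2 * (C + 1) by rewrite mulr_gt0// ltr_wpDl.
  have := AC (eps / (2 * (C + 1))) (divr_gt0 eps0 C1).
  move=> /le_trans; apply.
  rewrite (_ : 2 * (eps / (2 * (C + 1))) * C = eps * (C / (C + 1))).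
    rewrite ger_pMr// ler_pdivrMr ?mul1r ?lerDl// ltr_wpDl//.
  by field; rewrite gt_eqF// ltr_wpDl.
by rewrite (sipC hL)//; apply/eqP; rewrite -addr_eq0 addrC; apply/eqP.
Qed.

Lemma prodfM (ps qs : 'I_d -> R -> R) x : prodf (fun j t => ps j t * qs j t) x = prodf ps x * prodf qs x :> R.
Proof. by rewrite /prodf big_split. Qed.

Lemma partial_prodfM i (ps qs : 'I_d -> R -> R) : (forall j, Cinf (ps j)) -> (forall j, Cinf (qs j)) ->
  partial i (prodf (fun j t => ps j t * qs j t)) =
  (fun x => prodf ps x * partial i (prodf qs) x + prodf qs x * partial i (prodf ps) x) :> scal.
Proof.
move=> Cp Cq; apply/funext => x.
have h1 := is_derive_prodf x i Cp; have h2 := is_derive_prodf x i Cq.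
rewrite /partial (_ : prodf _ = prodf ps * prodf qs); last first.
  by apply/funext => y; rewrite prodfM.
have [d1 _] := h1; have [d2 _] := h2.
by rewrite deriveM.
Qed.

Lemma wder_mul i v g (ps : 'I_d -> R -> R) : ipset L2 v -> ipset L2 g -> wder i v g ->
  (forall j, per1 L (ps j)) ->
  wder i (fun x => v x * prodf ps x)
    (fun x => g x * prodf ps x + v x * partial i (prodf ps) x).
Proof.
move=> Hv Hg vg hps qs hqs.
have Cp j : Cinf (ps j) by case: (hps j).
have Cq j : Cinf (qs j) by case: (hqs j).
have hpq j : per1 L (fun t => ps j t * qs j t).
  split; first exact: CinfM.
  by move=> t; rewrite (hps j).2 (hqs j).2.
have bdp : bnd (partial i (prodf ps)) by rewrite partial_prodf//; exact: prodf_dbnd.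
have bdq : bnd (partial i (prodf qs)) by rewrite partial_prodf//; exact: prodf_dbnd.
have bp := prodf_bnd hps; have bq := prodf_bnd hqs.
have := vg _ hpq; rewrite partial_prodfM//.
have -> : (fun x => prodf ps x * partial i (prodf qs) x + prodf qs x * partial i (prodf ps) x) =
  (fun x => prodf ps x * partial i (prodf qs) x) + (fun x => prodf qs x * partial i (prodf ps) x) by [].
rewrite (sipDr hL); [|exact: bnd_L2 (bndM _ _)..|by []].
rewrite (sipDl hL (u := fun x => g x * prodf ps x)); last 3 first.
- by rewrite (_ : (fun _ => _) = fun x => prodf ps x * g x);
    [exact: bnd_L2M|apply/funext => x; rewrite mulrC].
- by rewrite (_ : (fun _ => _) = fun x => partial i (prodf ps) x * v x);
    [exact: bnd_L2M|apply/funext => x; rewrite mulrC].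
- exact: bnd_L2.
have E1 : ip L2 v (fun x => prodf ps x * partial i (prodf qs) x) =
   ip L2 (fun x => v x * prodf ps x) (partial i (prodf qs)).
  by congr (spint Om _); apply/funext => x; rewrite mulrA.
have E2 : ip L2 g (prodf (fun j t => ps j t * qs j t)) =
   ip L2 (fun x => g x * prodf ps x) (prodf qs).
  by congr (spint Om _); apply/funext => x; rewrite prodfM mulrA.
have E3 : ip L2 v (fun x => prodf qs x * partial i (prodf ps) x) =
   ip L2 (fun x => v x * partial i (prodf ps) x) (prodf qs).
  by congr (spint Om _); apply/funext => x; rewrite mulrA mulrAC.
by rewrite E1 E2 E3 opprD => /eqP; rewrite eq_sym -subr_eq => /eqP <-.
Qed.

(** Integration by parts with the test function v psi, whose weak derivative the
    product rule provides. *)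
Lemma wder_sqr i v g : bnd v -> ipset L2 g -> wder i v g ->
  wder i (fun x => v x * v x) (fun x => 2 * (v x * g x)).
Proof.
move=> bv Hg vg ps hps; have Hv := bnd_L2 bv.
have bp := prodf_bnd hps.
have Cp j : Cinf (ps j) by case: (hps j).
have bdp : bnd (partial i (prodf ps)) by rewrite partial_prodf//; exact: prodf_dbnd.
have Hgp : ipset L2 (fun x => g x * prodf ps x).
  by rewrite (_ : (fun _ => _) = fun x => prodf ps x * g x);
    [exact: bnd_L2M|apply/funext => x; rewrite mulrC].
have Hvdp : ipset L2 (fun x => v x * partial i (prodf ps) x) by exact: bnd_L2 (bndM _ _).
have Hvp : ipset L2 (fun x => v x * prodf ps x) by exact: bnd_L2 (bndM _ _).
have := integration_by_parts_L2 Hv Hvp Hg (sipD hL Hgp Hvdp) vg (wder_mul Hv Hg vg hps).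
rewrite (sipDr hL Hgp Hvdp Hv).
have E1 : ip L2 v (fun x => g x * prodf ps x) = ip L2 g (fun x => v x * prodf ps x).
  by congr (spint Om _); apply/funext => x; rewrite mulrCA.
have E2 : ip L2 v (fun x => v x * partial i (prodf ps) x) =
   ip L2 (fun x => v x * v x) (partial i (prodf ps)).
  by congr (spint Om _); apply/funext => x; rewrite mulrA.
have E3 : ip L2 (fun x => 2 * (v x * g x)) (prodf ps) = 2 * ip L2 g (fun x => v x * prodf ps x).
  rewrite /= -spintZ; last exact: L2_mul.
  by congr (spint Om _); apply/funext => x; ring.
by rewrite E1 E2 E3; set a := ip L2 g _; set b := ip L2 _ _; lra.
Qed.

Lemma translation_estimate_vec v (g : 'I_d -> scal) (z : 'rV[R]_d) :
  ipset L2 v -> (forall i, ipset L2 (g i)) -> (forall i, wder i v (g i)) ->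
  (forall i, 0 <= z ord0 i) ->
  nm (fun x => v (x + z) - v x) <= \sum_i z ord0 i * nm (g i).
Proof.
move=> Hv Hg vg z0; rewrite {1}(row_sum_delta z).
elim: (index_enum _) => [|i s IH].
  rewrite !big_nil (_ : (fun _ => _) = 0) /nm ?(sip0l hL (sip0 hL)) ?sqrtr0//.
  by apply/funext => x; rewrite addr0 subrr.
rewrite !big_cons; set y := \sum_(j <- s) _ in IH *.
have Hvi := L2_shift (z ord0 i *: e i) Hv.
have Hd : ipset L2 (fun x => v (x + z ord0 i *: e i) - v x) := sipB hL Hvi Hv.
have Hdy := L2_shift y Hd.
have Hy : ipset L2 (fun x => v (x + y) - v x) := sipB hL (L2_shift y Hv) Hv.
rewrite (_ : (fun _ => _) = (fun x => v (x + y + z ord0 i *: e i) - v (x + y)) +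
   (fun x => v (x + y) - v x)); last first.
  apply/funext => x.
  transitivity ((v (x + y + z ord0 i *: e i) - v (x + y)) + (v (x + y) - v x)); last by [].
  by rewrite subrKA [_ *: _ + y]addrC addrA.
apply: le_trans (sip_tri hL Hdy Hy) _; apply: lerD => //.
by rewrite [leLHS](nm_shift y Hd); exact: translation_estimate.
Qed.

(** The integral over all shifts z of the correlation of v with its translate by z is
    the square of the integral of v, while each correlation differs from the square
    norm of v by half of |v (. + z) - v|^2, which the gradient controls. *)
Lemma poincare_aux v (g : 'I_d -> scal) :
  ipset L2 v -> (forall i, ipset L2 (g i)) -> (forall i, wder i v (g i)) ->
  vol Om * ip L2 v v <= spint Om v ^+ 2 + vol Om * (2^-1 * (L * \sum_i nm (g i)) ^+ 2).
Proof.
move=> Hv Hg vg; set K := L * _.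
have mD := measurable_cube Om; have pv := L2_pm Hv.
have mtau : measurable_fun setT (fun y : 'rV[R]_d => y - corner Om).
  exact: measurable_addrV.
have Dfin : (leb D < +oo)%E by rewrite [X in (X < _)%E]lebesgue_cube ltry.
have ci := @corr_integrable _ 'rV[R]_d leb D (fun y => y - corner Om) mD mtau Dfin v v Hv Hv.
have cf := @corr_fubini _ 'rV[R]_d leb D (fun y => y - corner Om) mD mtau Dfin v v Hv Hv.
have E1 : spint Om (fun y => ip L2 (fun x => v (x + (y - corner Om))) v) = spint Om v ^+ 2.
  rewrite [LHS]cf expr2 -(spintZ (spint Om v) (L2_int Hv)); apply: eq_Rintegral => x _.
  have Hvx := L2_shift (x - corner Om) Hv.
  rewrite -(spint_shift (x - corner Om) pv) mulrC -spintZ; last exact: L2_int.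
  apply: eq_Rintegral => y _; rewrite mulrC; congr (_ * v _).
  by rewrite addrCA.
rewrite -lerBlDr -mulrBr -E1 mulrC -spint_cst.
apply: le_spint => //; first exact: Sint_cst.
move=> y Dy; set z := y - corner Om.
have z0 i : 0 <= z ord0 i <= L.
  by have /andP[] := Dy i; rewrite !mxE subr_ge0 lerBlDl => -> ->.
have Hz := L2_shift z Hv.
have nzK : nm (fun x => v (x + z) - v x) <= K.
  apply: le_trans (translation_estimate_vec Hv Hg vg _) _.
    by move=> i; case/andP: (z0 i).
  rewrite /K mulr_sumr; apply: ler_sum => i _; apply: ler_wpM2r; first exact: sqrtr_ge0.
  by case/andP: (z0 i).
have nzK2 : ip L2 (fun x => v (x + z) - v x) (fun x => v (x + z) - v x) <= K ^+ 2.
  rewrite -(sip_sqrn hL (sipB hL Hz Hv)) ler_pXn2r// nnegrE ?sqrtr_ge0//.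
  by apply: le_trans nzK; exact: sqrtr_ge0.
(* |v (. + z) - v|^2 = 2 (|v|^2 - <v (. + z), v>). *)
have := ip_shift z Hv Hv.
have := sip_quad hL (-1) Hz Hv; rewrite scaleN1r => h1 h2.
move: nzK2; rewrite [leLHS]h1 h2 sqrrN expr1n.
by set a := ip L2 v v; set c := ip L2 _ _; lra.
Qed.

Lemma H1_wder i v : ipset (sobolev Om 1) v -> wder i v (wpartial Om i v).
Proof. by move=> Hv; apply: is_wpartial_wder; exact: H1_w. Qed.

Definition Cpoinc : R := 2^-1 * (L * d%:R) ^+ 2.

Lemma poincare v : ipset (sobolev Om 1) v ->
  ip L2 v v <= spint Om v ^+ 2 / vol Om + Cpoinc * gip Om v v.
Proof.
move=> Hv; have v0 := vol_gt0 Om; have G0 := sip_ge0 (semi_ip_gip Om) Hv.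
rewrite -(ler_pM2l v0) mulrDr mulrCA mulfV ?gt_eqF// mulr1.
apply: le_trans (poincare_aux (H1_L2 Hv) (fun i => H1_wL2 i Hv) (fun i => H1_wder i Hv)) _.
rewrite lerD2l ler_pM2l// /Cpoinc -mulrA ler_pM2l// -[gip _ _ _]sqr_sqrtr// -exprMn.
have n0 : 0 <= \sum_i nm (wpartial Om i v) by apply: sumr_ge0 => i _; exact: sqrtr_ge0.
have L0 := ltW (side_gt0 Om).
rewrite ler_pXn2r ?nnegrE ?mulr_ge0 ?sqrtr_ge0// -mulrA ler_wpM2l//.
have -> : d%:R * Num.sqrt (gip Om v v) = \sum_(i < d) Num.sqrt (gip Om v v).
  by rewrite sumr_const card_ord mulr_natl.
apply: ler_sum => i _; rewrite ler_sqrt// /gip (bigD1 i)//= lerDl.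
by apply: sumr_ge0 => j _; apply: (sip_ge0 hL); exact: H1_wL2.
Qed.

End translations.

(** * Line averages and the embedding of H1 into L4 *)

Section line_averages.
Context {R : realType} {d : nat} (Om : cube R d).
Local Notation leb := (lebesgue_rV d).
Local Notation leb1 := (@lebesgue_measure R).
Local Notation D := (cube_set Om).
Local Notation L := (side Om).
Local Notation e i := (delta_mx ord0 i : 'rV[R]_d).
Implicit Types (f g W : 'rV[R]_d -> \bar R) (i j : 'I_d).

(** Averages are taken of nonnegative functions with values in the extended reals,
    so that integrals may be exchanged without integrability conditions. *)
Record nnp f : Prop := Nnp {
  nnp_per : forall x i, f (x + L *: e i) = f x;
  nnp_mea : measurable_fun setT f;
  nnp_ge0 : forall x, (0 <= f x)%E }.

Definition Jint f : \bar R := (\int[leb]_(x in D) f x)%E.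
Definition line_int i f x : \bar R := (\int[leb1]_(s in `[0%R, L]) f (x + s *: e i)%R)%E.
Definition inv i W := forall x (s : R), W (x + s *: e i) = W x.

Arguments line_int : simpl never.
Arguments Jint : simpl never.

Let mD := measurable_cube Om.
Let L0 : 0 < L := side_gt0 Om.

Lemma nnpD f g : nnp f -> nnp g -> nnp (f \+ g)%E.
Proof.
move=> [pf mf f0] [pg mg g0]; split.
- by move=> x i /=; rewrite pf pg.
- exact: emeasurable_funD.
- by move=> x; rewrite adde_ge0.
Qed.

Lemma nnpM f g : nnp f -> nnp g -> nnp (f \* g)%E.
Proof.
move=> [pf mf f0] [pg mg g0]; split.
- by move=> x i /=; rewrite pf pg.
- exact: emeasurable_funM.
- by move=> x; rewrite mule_ge0.
Qed.

Lemma nnp_cst (k : \bar R) : (0 <= k)%E -> nnp (cst k).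
Proof. by move=> k0; split => //; exact: measurable_cst. Qed.

Lemma nnp_EFin (v : 'rV[R]_d -> R) : pm Om v -> (forall x, 0 <= v x) -> nnp (EFin \o v).
Proof.
move=> [pv mv] v0; split.
- by move=> x i /=; rewrite pv.
- exact/measurable_EFinP.
- by move=> x; rewrite lee_fin.
Qed.

Lemma nnp_shift f z : nnp f -> nnp (fun x => f (x + z)).
Proof.
move=> [pf mf f0]; split => //; first by move=> x i; rewrite addrAC pf.
by apply: (measurableT_comp mf); exact: measurable_addrV.
Qed.

Let mline i : measurable_fun setT
  (fun p : measurableTypeR R * 'rV[R]_d => p.2 + p.1 *: e i).
Proof.
apply: measurable_fun_rV => j; under eq_fun do rewrite !mxE.
apply: measurable_funD.
  exact: (measurableT_comp (measurable_coor j) measurable_snd).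
by apply: measurable_funM => //; exact: measurable_fst.
Qed.

Let mline1 i x : measurable_fun setT (fun s : measurableTypeR R => x + s *: e i).
Proof.
apply: measurable_fun_rV => j; under eq_fun do rewrite !mxE.
by apply: measurable_funD => //; apply: measurable_funM.
Qed.

Let mfl f i x (A : set (measurableTypeR R)) : nnp f -> measurable_fun A (fun s : measurableTypeR R => f (x + s *: e i)).
Proof. by move=> hf; apply: measurable_funTS; apply: (measurableT_comp (nnp_mea hf)); exact: mline1. Qed.

Let mT f (A : set 'rV[R]_d) : nnp f -> measurable_fun A f.
Proof. by move=> hf; apply: measurable_funTS; exact: nnp_mea hf. Qed.

Lemma nnp_line f i : nnp f -> nnp (line_int i f).
Proof.
move=> hf; split.
- by move=> x j; apply: eq_integral => s _; rewrite addrAC (nnp_per hf).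
- apply: (@measurable_tonelli_on R _ _ _ 'rV[R]_d leb1 `[0, L]%classic (measurable_itv _)
    (fun s x => f (x + s *: e i))) => [|s x]; last exact: (nnp_ge0 hf).
  by apply: (measurableT_comp (nnp_mea hf)); exact: mline.
- by move=> x; apply: integral_ge0 => s _; exact: (nnp_ge0 hf).
Qed.

Lemma JintD f g : nnp f -> nnp g -> Jint (f \+ g)%E = (Jint f + Jint g)%E.
Proof.
move=> hf hg; rewrite /Jint ge0_integralD//; by [move=> x _; exact: nnp_ge0|exact: mT].
Qed.

Lemma JintZ (k : \bar R) f : (0 <= k)%E -> nnp f -> Jint (fun x => k * f x)%E = (k * Jint f)%E.
Proof.
move=> k0 hf; rewrite /Jint ge0_integralZl//; first exact: mT.
by move=> x _; exact: nnp_ge0.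
Qed.

Lemma Jint_ge0 f : nnp f -> (0 <= Jint f)%E.
Proof. by move=> hf; apply: integral_ge0 => x _; exact: nnp_ge0. Qed.

Lemma le_Jint f g : nnp f -> nnp g -> (forall x, (f x <= g x)%E) -> (Jint f <= Jint g)%E.
Proof.
move=> hf hg fg; apply: ge0_le_integral => //.
- by move=> x _; exact: nnp_ge0.
- exact: mT.
- exact: mT.
Qed.

Lemma ae_le_Jint f g : nnp f -> nnp g -> {ae leb, forall x, D x -> (f x <= g x)%E} ->
  (Jint f <= Jint g)%E.
Proof.
move=> hf hg fg; apply: ae_ge0_le_integral => //.
- by move=> x _; exact: nnp_ge0.
- exact: mT.
- by move=> x _; exact: nnp_ge0.
- exact: mT.
Qed.

Lemma Jint_shift f z : nnp f -> Jint (fun x => f (x + z)) = Jint f.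
Proof.
move=> hf; apply: (@ge0_integral_shift R d (corner Om) z L f) => //.
- exact: nnp_mea hf.
- exact: (nnp_ge0 hf).
- exact: nnp_per hf.
Qed.

Lemma Jint_cst (k : \bar R) : Jint (cst k) = (k * (vol Om)%:E)%E.
Proof. by rewrite /Jint integral_cst// [X in (_ * X)%E]lebesgue_cube. Qed.

Let leb1L : (leb1 `[0%R, L] = L%:E)%E.
Proof. by rewrite lebesgue_measure_itv/= lte_fin L0/= oppr0 adde0. Qed.

Lemma Jint_avg f W i : nnp f -> nnp W ->
  (\int[leb1]_(s in `[0%R, L]) Jint (fun x => f (x + s *: e i)%R * W x) =
   Jint (line_int i f \* W))%E.
Proof.
move=> hf hW; rewrite /Jint /=.
rewrite (@tonelli_on R _ _ _ 'rV[R]_d leb1 leb `[0, L]%classic D (measurable_itv _) mD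
  (fun s x => f (x + s *: e i)%R * W x)%E); last 2 first.
- apply: emeasurable_funM.
    by apply: (measurableT_comp (nnp_mea hf)); exact: mline.
  exact: (measurableT_comp (nnp_mea hW) measurable_snd).
- by move=> s x; rewrite mule_ge0//; [exact: (nnp_ge0 hf)|exact: (nnp_ge0 hW)].
apply: eq_integral => x _; rewrite ge0_integralZr//.
- exact: mfl.
- by move=> s _; exact: (nnp_ge0 hf).
- exact: (nnp_ge0 hW).
Qed.

(** The integral of a product does not change when both factors are shifted, and W
    is not affected by shifts in direction i: f may be replaced by its average. *)
Lemma Jint_line f W i : nnp f -> nnp W -> inv i W ->
  Jint (line_int i f \* W)%E = (L%:E * Jint (f \* W))%E.
Proof.
move=> hf hW iW; rewrite -Jint_avg//.
rewrite (eq_integral (cst (Jint (f \* W)%E))); last first.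
  move=> s _; rewrite /= -(Jint_shift (s *: e i) (nnpM hf hW)); apply: eq_integral => x _ /=.
  by rewrite iW.
by rewrite integral_cst//= [X in (_ * X)%E]leb1L muleC.
Qed.

Lemma inv_line f i : nnp f -> inv i (line_int i f).
Proof.
move=> hf x h; rewrite /line_int.
have := @ge0_integral_shift_periodic R 0 L h (fun s => f (x + s *: e i)) L0.
rewrite add0r => <- //.
- by apply: eq_integral => s _; rewrite scalerDl addrA addrAC.
- exact: mfl.
- by move=> t; exact: (nnp_ge0 hf).
- by move=> t; rewrite scalerDl addrA (nnp_per hf).
Qed.

Lemma inv_line_pres f i j : inv j f -> inv j (line_int i f).
Proof. by move=> jf x h; apply: eq_integral => s _; rewrite addrAC jf. Qed.

Lemma line_intC f i j : nnp f -> line_int i (line_int j f) = line_int j (line_int i f).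
Proof.
move=> hf; apply/funext => x; rewrite /line_int.
rewrite (@tonelli_on R _ _ _ _ leb1 leb1 `[0, L]%classic `[0, L]%classic
  (measurable_itv _) (measurable_itv _) (fun s t => f (x + s *: e i + t *: e j))); last 2 first.
- apply: (measurableT_comp (nnp_mea hf)).
  apply: measurable_fun_rV => k; under eq_fun do rewrite !mxE.
  apply: measurable_funD; first by apply: measurable_funD => //; apply: measurable_funM => //; exact: measurable_fst.
  by apply: measurable_funM => //; exact: measurable_snd.
- by move=> s t; exact: (nnp_ge0 hf).
by apply: eq_integral => t _; apply: eq_integral => s _; rewrite addrAC.
Qed.

Lemma line_intD f g i : nnp f -> nnp g ->
  line_int i (f \+ g)%E = (line_int i f \+ line_int i g)%E.
Proof.
move=> hf hg; apply/funext => x; rewrite /line_int /= ge0_integralD//.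
- by move=> s _; exact: (nnp_ge0 hf).
- exact: mfl.
- by move=> s _; exact: (nnp_ge0 hg).
- exact: mfl.
Qed.

Lemma line_intZ (k : R) f i : 0 <= k -> nnp f ->
  line_int i (fun x => k%:E * f x)%E = (fun x => k%:E * line_int i f x)%E.
Proof.
move=> k0 hf; apply/funext => x; rewrite /line_int ge0_integralZl_EFin//.
- by move=> s _; exact: (nnp_ge0 hf).
- exact: mfl.
Qed.

Lemma le_line_int f g i : nnp f -> nnp g -> (forall x, (f x <= g x)%E) ->
  forall x, (line_int i f x <= line_int i g x)%E.
Proof.
move=> hf hg fg x; apply: ge0_le_integral => //.
- by move=> s _; exact: (nnp_ge0 hf).
- exact: mfl.
- exact: mfl.
Qed.

Lemma nnpZ (k : R) f : 0 <= k -> nnp f -> nnp (fun x => k%:E * f x)%E.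
Proof. by move=> k0 hf; apply: (nnpM _ hf); apply: nnp_cst; rewrite lee_fin. Qed.

(** A function that depends on no coordinate is constant; full averages are thus
    computed from integrals over the torus. *)
Lemma inv_const f x : (forall i, inv i f) -> f x = f 0.
Proof.
move=> hf; rewrite [x]row_sum_delta; elim: (index_enum _) => [|i s IH].
  by rewrite big_nil.
by rewrite big_cons addrC hf.
Qed.

Lemma line_int2_comb (a b : R) f g i j : 0 <= a -> 0 <= b -> nnp f -> nnp g ->
  line_int i (line_int j (fun x => a%:E * f x + b%:E * g x))%E =
  (fun x => a%:E * line_int i (line_int j f) x + b%:E * line_int i (line_int j g) x)%E.
Proof.
move=> a0 b0 hf hg; have := nnpZ a0 hf; have := nnpZ b0 hg => hbg haf.
rewrite (line_intD j haf hbg) line_intZ// line_intZ//.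
rewrite (line_intD i (nnpZ a0 (nnp_line j hf)) (nnpZ b0 (nnp_line j hg))).
by rewrite line_intZ ?line_intZ//; exact: nnp_line.
Qed.

Lemma JintC f g : Jint (f \* g)%E = Jint (g \* f)%E.
Proof. by apply: eq_integral => x _; rewrite /= muleC. Qed.

Lemma Jint_line1 f i : nnp f -> Jint (line_int i f) = (L%:E * Jint f)%E.
Proof.
move=> hf; have := @Jint_line f (cst 1%E) i hf (nnp_cst lee01) (fun _ _ => erefl).
have E (h : 'rV[R]_d -> \bar R) : (h \* cst 1)%E = h by apply/funext => x; rewrite /= mule1.
by rewrite !E.
Qed.

Lemma line_int2_fin f i j : nnp f -> (Jint f < +oo)%E ->
  {ae leb, forall x, D x -> line_int i (line_int j f) x \is a fin_num}.
Proof.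
move=> hf Jf; have hN := nnp_line i (nnp_line j hf).
apply: integrable_ae => //; apply/integrableP; split; first exact: mT.
rewrite (eq_integral (line_int i (line_int j f))); last first.
  by move=> x _; rewrite gee0_abs//; exact: (nnp_ge0 hN).
rewrite [X in (X < _)%E](Jint_line1 i (nnp_line j hf)) Jint_line1//.
by rewrite lte_mul_pinfty ?lee_fin ?(ltW L0)// lte_mul_pinfty ?lee_fin ?(ltW L0).
Qed.

(** Each factor is independent of one of the two coordinates, so that averaging it in
    the other one only multiplies the integral by L. In two
    dimensions both averages are constants. *)
Lemma Jint_line2 P Q i j : nnp P -> nnp Q -> inv i P -> inv j Q ->
  ((L * L)%:E * Jint (P \* Q) = Jint (line_int j P \* line_int i Q))%E.
Proof.
move=> hP hQ iP jQ; rewrite (@Jint_line P); [|by []|exact: nnp_line|exact: inv_line_pres].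
by rewrite (JintC P (line_int i Q)) (Jint_line hQ hP iP) (JintC Q P) muleA -EFinM.
Qed.

Let cube3 (l : R) : l * (l * l) = l ^+ 3. Proof. by ring. Qed.

Lemma Jint_line3 P Z i j k : nnp P -> nnp Z -> inv k P -> inv i Z -> inv j Z ->
  Jint (line_int i (line_int j P) \* line_int k Z)%E = ((L ^+ 3)%:E * Jint (P \* Z))%E.
Proof.
move=> nP nZ kP iZ jZ; have nkZ := nnp_line k nZ.
transitivity (L%:E * (L%:E * (L%:E * Jint (Z \* P))))%E; last first.
  by rewrite !muleA -!EFinM -mulrA cube3 (JintC Z P).
rewrite -(Jint_line nZ nP kP) (JintC (line_int k Z) P).
rewrite -(Jint_line nP nkZ (inv_line_pres k jZ)).
by rewrite -(Jint_line (nnp_line j nP) nkZ (inv_line_pres k iZ)).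
Qed.

Lemma Jint_line_line f Z i j : nnp f -> nnp Z -> inv i Z -> inv j Z ->
  Jint (line_int i (line_int j f) \* Z)%E = (L%:E * (L%:E * Jint (f \* Z)))%E.
Proof.
move=> nf nZ iZ jZ; rewrite -(Jint_line nf nZ jZ).
by rewrite -(Jint_line (nnp_line j nf) nZ iZ).
Qed.

Section ladyzhenskaya.
Variables (v : 'rV[R]_d -> R) (g : 'I_d -> 'rV[R]_d -> R).
Hypotheses (bv : bnd Om v) (Hg : forall i, ipset (L2 Om) (g i))
  (vg : forall i, wder Om i v (g i)).

Let Hv := bnd_L2 bv.
Let pv : pm Om v := bv.1.
Let pg i : pm Om (g i) := L2_pm (Hg i).

Definition sq (u : 'rV[R]_d -> R) x : \bar R := (u x * u x)%:E.
Definition absvg i x : \bar R := `|v x * g i x|%:E.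

Let nsq u : pm Om u -> nnp (sq u).
Proof. by move=> pu; apply: nnp_EFin; [exact: pmM|move=> x; rewrite -expr2 sqr_ge0]. Qed.
Let nvg i : nnp (absvg i).
Proof.
apply: nnp_EFin => //; apply: (pm_comp (g := fun t => `|t|)); last exact: pmM.
exact: norm_continuous.
Qed.

(** The average of ladyA i over a line in direction i dominates L v^2 on that line,
    since v^2 differs from its average by at most the integral of its derivative
    2 v g_i. *)
Definition ladyA i x : \bar R := (sq v x + (2 * L)%:E * absvg i x)%E.

Let l2 : 0 <= 2 * L. Proof. by rewrite mulr_ge0// ltW. Qed.

Let nA i : nnp (ladyA i).
Proof. by apply: nnpD; [exact: nsq|exact: nnpZ]. Qed.

(** The pointwise bound of v^2 by a line average, in the weak form that survives
    almost everywhere statements: tested with nonnegative weights and averaged over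
    the shift h. *)
Lemma lady_line i W : nnp W ->
  (L%:E * Jint (sq v \* W) <= Jint (line_int i (ladyA i) \* W))%E.
Proof.
move=> hW.
have bvv : bnd Om (fun x => v x * v x) by exact: bndM.
have Hvv := bnd_L2 bvv.
have Hg2 : ipset (L2 Om) (fun x => 2 * (v x * g i x)).
  by apply: (L2Z 2); apply: bnd_L2M.
have wvv := wder_sqr bv (Hg i) (vg i).
pose q x : \bar R := (2%:E * absvg i x)%E.
have nq : nnp q by exact: nnpZ.
have nqi := nnp_line i nq.
have step h : 0 <= h <= L ->
  (Jint (sq v \* W) <= Jint (fun x => sq v (x + h *: e i)%R * W x) + Jint (line_int i q \* W))%E.
  move=> /andP[h0 hL].
  have n1 := nnp_shift (h *: e i) (nsq pv).
  rewrite -(@JintD ((fun x => sq v (x + h *: e i)%R) \* W)%E); [|exact: nnpM|exact: nnpM].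
  apply: ae_le_Jint; [exact: nnpM (nsq pv) hW|by apply: nnpD; exact: nnpM|].
  have [E1 E2] := translation_ae Hvv Hg2 wvv h0.
  apply: filterS2 E1 E2 => x e1 e2 Dx /=.
  rewrite -ge0_muleDl; [|exact: (nnp_ge0 n1)|exact: (nnp_ge0 nqi)].
  apply: lee_wpmul2r; first exact: (nnp_ge0 hW).
  have {e1} := e1 Dx; have {e2} i2 := e2 Dx.
  set I := \int[_]_(_ in _) _ => e1.
  have IE : (`|I|%:E <= line_int i q x)%E.
    have -> : `|I|%:E = `|(\int[leb1]_(s in `[0%R, h]) (2 * (v (x + s *: e i) * g i (x + s *: e i)))%R%:E)%E|%E.
      by rewrite /I /Rintegral -abse_EFin fineK//; exact: integrable_fin_num i2.
    apply: le_trans (le_abse_integral _ _ _) _ => //; first exact: measurable_int i2.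
    apply: (@le_trans _ _ (\int[leb1]_(s in `[0%R, h]) q (x + s *: e i)%R)%E).
      rewrite le_eqVlt; apply/orP; left; apply/eqP; apply: eq_integral => s _.
      by rewrite /q /absvg /= normrM ger0_norm.
    apply: ge0_subset_integral => //; first exact: mfl.
      by move=> s _; exact: (nnp_ge0 nq).
    by apply: subset_itvl; rewrite bnd_simp.
  apply: (@le_trans _ _ (sq v (x + h *: e i)%R + `|I|%:E)%E); last by rewrite leeD2l.
  rewrite /sq -EFinD lee_fin -e1.
  have := ler_norm (- (v (x + h *: e i) * v (x + h *: e i) - v x * v x)).
  by rewrite normrN; lra.
have mJ : measurable_fun `[0%R, L] (fun s : measurableTypeR R => Jint (fun x => sq v (x + s *: e i)%R * W x)%E).
  apply: measurable_funTS.
  apply: (@measurable_tonelli_on R _ _ 'rV[R]_d (measurableTypeR R) leb D mD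
    (fun x s => sq v (x + s *: e i)%R * W x)%E).
    apply: emeasurable_funM; last exact: (measurableT_comp (nnp_mea hW) measurable_fst).
    apply: (measurableT_comp (nnp_mea (nsq pv))).
    apply: measurable_fun_rV => j; under eq_fun do rewrite !mxE.
    apply: measurable_funD.
      exact: (measurableT_comp (measurable_coor j) measurable_fst).
    by apply: measurable_funM => //; exact: measurable_snd.
  by move=> x s; rewrite mule_ge0//; [exact: (nnp_ge0 (nsq pv))|exact: (nnp_ge0 hW)].
have J0 s : (0 <= Jint (fun x => sq v (x + s *: e i)%R * W x)%E)%E.
  by apply: (@Jint_ge0 ((fun x => sq v (x + s *: e i)%R) \* W)%E); apply: nnpM => //; apply: nnp_shift; exact: nsq.
have JA : (L%:E * Jint (sq v \* W) <= Jint (line_int i (sq v) \* W) + L%:E * Jint (line_int i q \* W))%E.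
  rewrite -Jint_avg//; last exact: nsq.
  have c1 (k : \bar R) : (L%:E * k = \int[leb1]_(s in `[0%R, L]) (cst k s))%E.
    rewrite integral_cst//= muleC; congr (_ * _)%E; exact/esym.
  rewrite c1 [(L%:E * Jint (line_int i q \* W))%E]c1 -ge0_integralD//; last first.
    by move=> s _; apply: Jint_ge0; exact: nnpM.
  apply: ge0_le_integral => //.
  - by move=> s _; apply: Jint_ge0; apply: nnpM => //; exact: nsq.
  - by apply: emeasurable_funD.
apply: le_trans JA _.
have -> : ladyA i = (sq v \+ (fun x => L%:E * q x))%E.
  apply/funext => x; rewrite /ladyA /q /=; congr (_ + _)%E.
  rewrite [RHS]muleA; have -> : (L%:E * 2 = (2 * L)%:E :> \bar R)%E by rewrite muleC.
  by [].
rewrite line_intD//; [|exact: nsq|exact: nnpZ (ltW L0) nq].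
rewrite line_intZ//; last exact: ltW.
rewrite -JintZ//; [|by rewrite lee_fin ltW|exact: nnpM].
rewrite -(@JintD (line_int i (sq v) \* W)%E); last 2 first.
- by apply: nnpM => //; apply: nnp_line; exact: nsq.
- by apply: nnpZ; [exact: ltW|exact: nnpM].
rewrite le_eqVlt; apply/orP; left; apply/eqP; apply: eq_integral => x _.
rewrite -[LHS]/((line_int i (sq v) x * W x + L%:E * (line_int i q x * W x))%E).
rewrite -[RHS]/(((line_int i (sq v) x + L%:E * line_int i q x) * W x)%E).
have h1 := nnp_ge0 (nnp_line i (nsq pv)) x.
have h2 := nnp_ge0 (nnpZ (ltW L0) nqi) x.
by rewrite (ge0_muleDl _ h1 h2) muleA.
Qed.

(** The square integral of v g_i along planes is split by Cauchy and Schwarz; the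
    second factor of the product of two averages is collected here. *)
Definition ladyw i j x : \bar R :=
  (2%:E * sq v x + (4 * L ^+ 2)%:E * (sq (g i) x + sq (g j) x))%E.

Let L4_0 : 0 <= 4 * L ^+ 2. Proof. by rewrite mulr_ge0// sqr_ge0. Qed.

Let nw i j : nnp (ladyw i j).
Proof.
apply: (@nnpD (fun x => 2%:E * sq v x)%E (fun x => (4 * L ^+ 2)%:E * (sq (g i) x + sq (g j) x))%E).
  by apply: nnpZ => //; exact: nsq.
by apply: nnpZ => //; apply: (nnpD (nsq (pg i)) (nsq (pg j))).
Qed.

Let Jsq u : ipset (L2 Om) u -> Jint (sq u) = (ip (L2 Om) u u)%:E.
Proof. by move=> Hu; apply: SintE; exact: L2_mul. Qed.

Let young_sq (m V G : R) : 0 <= m -> 0 <= V -> 0 <= G ->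
  (forall l, 0 < l -> 2 * m <= l * V + l^-1 * G) -> m * m <= V * G.
Proof.
move=> m0 V0 G0 h; move: m0; rewrite le_eqVlt => /predU1P[<-|mp].
  by rewrite mul0r mulr_ge0.
move: V0; rewrite le_eqVlt => /predU1P[V0|Vp].
  have lp : 0 < (G + 1) / m by rewrite divr_gt0// ltr_wpDl.
  have := h _ lp; rewrite -V0 mulr0 add0r invf_div mulrAC ler_pdivlMr ?ltr_wpDl// => k.
  by exfalso; nra.
have := h _ (divr_gt0 mp Vp); rewrite divfK ?gt_eqF// invf_div mulrAC => k.
have : m <= V * G / m by lra.
by rewrite ler_pdivlMr.
Qed.

Let scal_sq (l m V G : R) : m * m <= V * G ->
  (2 * l * m) * (2 * l * m) <= V * (4 * l ^+ 2 * G).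
Proof.
move=> h; have l4 : 0 <= 4 * l ^+ 2 by rewrite mulr_ge0// sqr_ge0.
have := ler_wpM2l l4 h.
have -> : 4 * l ^+ 2 * (m * m) = 2 * l * m * (2 * l * m) by ring.
by rewrite [V * (_ * _)]mulrCA.
Qed.

Let prod_sq_le (V p q P Q S : R) : p * p <= P -> q * q <= Q -> S = P + Q ->
  (V + p) * (V + q) <= V * (2 * V) + S.
Proof.
move=> hp hq ->.
have sqB (x y : R) : 0 <= x * x - 2 * (x * y) + y * y.
  by rewrite (_ : _ + _ = (x - y) ^+ 2) ?sqr_ge0//; ring.
have h1 := sqB p q; have h2 := sqB V p; have h3 := sqB V q.
rewrite [leLHS](_ : _ = V * V + V * p + V * q + p * q); last by ring.
by rewrite (_ : V * (2 * V) = 2 * (V * V)); [lra|ring].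
Qed.

(** Ladyzhenskaya's argument. One factor v^2 is bounded by its average in direction
    i and the other one in direction j. The product of these averages integrates
    over the planes spanned by i and j like the product of the plane integrals,
    which contain v^2 and |v g|; the latter is split by Cauchy and Schwarz, with
    the optimal weight l found pointwise. *)
Lemma lady_core i j :
  ((L ^+ 4)%:E * Jint (sq v \* sq v) <=
   Jint (line_int i (line_int j (sq v)) \* line_int i (line_int j (ladyw i j))))%E.
Proof.
have hv := nsq pv.
have nPi := nnp_line i (nA i); have nPj := nnp_line j (nA j).
have h1 : ((L * L)%:E * Jint (sq v \* sq v) <= Jint (line_int i (ladyA i) \* line_int j (ladyA j)))%E.
  rewrite EFinM -muleA; apply: le_trans (lee_wpmul2l _ (lady_line i hv)) _.
    by rewrite lee_fin ltW.
  by rewrite JintC [leRHS]JintC; exact: lady_line.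
have -> : L ^+ 4 = (L * L) * (L * L) by ring.
rewrite EFinM -muleA.
apply: le_trans (lee_wpmul2l _ h1) _; first by rewrite lee_fin mulr_ge0// ltW.
(* Averaging each factor in the direction of the other makes both of them the
   same plane average. *)
rewrite (Jint_line2 nPi nPj (inv_line i (nA i)) (inv_line j (nA j))).
rewrite (line_intC j i (nA i)).
have nN f : nnp f -> nnp (line_int i (line_int j f)) by move=> hf; do 2!apply: nnp_line.
have finv : (Jint (sq v) < +oo)%E by rewrite Jsq// ltry.
have fing k : (Jint (sq (g k)) < +oo)%E by rewrite Jsq// ltry.
apply: ae_le_Jint; [by apply: nnpM; exact: nN|by apply: nnpM; exact: nN|].
have F0 := line_int2_fin i j hv finv.
have F1 := line_int2_fin i j (nsq (pg i)) (fing i).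
have F2 := line_int2_fin i j (nsq (pg j)) (fing j).
(* Young's inequality for all weights l at once, which avoids dividing by an
   average that may vanish. *)
have Mest k (l : R) x : 0 < l -> (2%:E * line_int i (line_int j (absvg k)) x <=
   l%:E * line_int i (line_int j (sq v)) x + l^-1%:E * line_int i (line_int j (sq (g k))) x)%E.
  move=> l0; have li : 0 <= l^-1 by rewrite invr_ge0 ltW.
  have E1 := line_int2_comb i j (ltW l0) li hv (nsq (pg k)).
  rewrite -[leRHS](congr1 (fun h => h x) E1).
  have E2 := line_intZ j (ler0n R 2) (nvg k).
  have E3 := line_intZ i (ler0n R 2) (nnp_line j (nvg k)).
  rewrite -[leLHS](congr1 (fun h => h x) E3) -E2.
  have nl : nnp (fun x => l%:E * sq v x + l^-1%:E * sq (g k) x)%E.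
    by apply: nnpD; [exact: nnpZ (ltW l0) hv|exact: nnpZ li (nsq (pg k))].
  have nl2 : nnp (fun x => 2%:E * absvg k x)%E by exact: nnpZ.
  apply: le_line_int; [exact: nnp_line|exact: nnp_line|].
  apply: le_line_int => // y.
  rewrite /absvg /sq -!EFinM -EFinD lee_fin.
  have h : forall t : R, 2 * t <= l * (v y * v y) + l^-1 * (g k y * g k y) ->
     2 * - t <= l * (v y * v y) + l^-1 * (g k y * g k y) ->
     2 * `|t| <= l * (v y * v y) + l^-1 * (g k y * g k y).
    by move=> t q1 q2; case: (lerP 0 t) => t0; [rewrite ger0_norm|rewrite ltr0_norm].
  have ll : l * l^-1 = 1 by rewrite mulfV// gt_eqF.
  set a := v y; set b := g k y.
  have s1 : 0 <= l * (a - l^-1 * b) ^+ 2 by rewrite mulr_ge0 ?sqr_ge0// ltW.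
  have s2 : 0 <= l * (a + l^-1 * b) ^+ 2 by rewrite mulr_ge0 ?sqr_ge0// ltW.
  have e1 : l * (a - l^-1 * b) ^+ 2 = l * (a * a) + l^-1 * (b * b) - 2 * (a * b).
    by field; rewrite gt_eqF.
  have e2 : l * (a + l^-1 * b) ^+ 2 = l * (a * a) + l^-1 * (b * b) + 2 * (a * b).
    by field; rewrite gt_eqF.
  move: s1 s2; rewrite e1 e2 => s1 s2; apply: (h (a * b)); rewrite -/a -/b.
    by rewrite -subr_ge0.
  by rewrite -subr_ge0 mulrN opprK.
have NA k x : (line_int i (line_int j (ladyA k)) x = line_int i (line_int j (sq v)) x +
    (2 * L)%:E * line_int i (line_int j (absvg k)) x)%E.
  have := line_int2_comb i j (ler01 : (0 : R) <= 1) l2 hv (nvg k) => /(congr1 (fun h => h x)) /=.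
  rewrite mul1e => <-; congr (line_int i (line_int j _) x); apply/funext => y.
  by rewrite /ladyA mul1e.
have Nw x : (line_int i (line_int j (ladyw i j)) x = 2%:E * line_int i (line_int j (sq v)) x +
    (4 * L ^+ 2)%:E * (line_int i (line_int j (sq (g i))) x + line_int i (line_int j (sq (g j))) x))%E.
  have hg2 := nnpD (nsq (pg i)) (nsq (pg j)).
  have := line_int2_comb i j (ler0n R 2) L4_0 hv hg2 => /(congr1 (fun h => h x)) /=.
  rewrite (line_intD j (nsq (pg i)) (nsq (pg j))).
  by rewrite (line_intD i (nnp_line j (nsq (pg i))) (nnp_line j (nsq (pg j)))).
apply: filterS3 F0 F1 F2 => x f0 f1 f2 Dx; move: (f0 Dx) (f1 Dx) (f2 Dx) => {f0 f1 f2}.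
rewrite /= !NA Nw.
have Mi l := @Mest i l x; have Mj l := @Mest j l x.
have V0 := nnp_ge0 (nN _ hv) x.
have Gi0 := nnp_ge0 (nN _ (nsq (pg i))) x.
have Gj0 := nnp_ge0 (nN _ (nsq (pg j))) x.
have Mi0 := nnp_ge0 (nN _ (nvg i)) x.
have Mj0 := nnp_ge0 (nN _ (nvg j)) x.
move: V0 Gi0 Gj0 Mi0 Mj0 Mi Mj.
case: (line_int i (line_int j (sq v)) x) => [V||]// V0.
case: (line_int i (line_int j (sq (g i))) x) => [Gi||]// Gi0.
case: (line_int i (line_int j (sq (g j))) x) => [Gj||]// Gj0.
case: (line_int i (line_int j (absvg i)) x) => [mi||]// mi0; last first.
  by move=> _ /(_ 1 ltr01); rewrite -!EFinM -EFinD mulry gtr0_sg// mul1e leye_eq.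
case: (line_int i (line_int j (absvg j)) x) => [mj||]// mj0; last first.
  by move=> _ /(_ 1 ltr01); rewrite -!EFinM -EFinD mulry gtr0_sg// mul1e leye_eq.
move=> Mi Mj _ _ _; move: V0 Gi0 Gj0 mi0 mj0; rewrite !lee_fin => V0 Gi0 Gj0 mi0 mj0.
have qi : mi * mi <= V * Gi.
  by apply: young_sq => // l l0; have := Mi l l0; rewrite -!EFinM -EFinD lee_fin.
have qj : mj * mj <= V * Gj.
  by apply: young_sq => // l l0; have := Mj l l0; rewrite -!EFinM -EFinD lee_fin.
have pi := scal_sq L qi; have pj := scal_sq L qj.
rewrite [leRHS]mulrDr; apply: prod_sq_le pi pj _.
by rewrite !mulrDr.
Qed.

Lemma const_line2 f i j : nnp f -> (forall k, k = i \/ k = j) ->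
  forall x, ((vol Om)%:E * line_int i (line_int j f) x = (L * L)%:E * Jint f)%E.
Proof.
move=> hf hij x.
have -> : ((L * L)%:E * Jint f = Jint (line_int i (line_int j f)))%E.
  by rewrite (Jint_line1 i (nnp_line j hf)) Jint_line1// muleA -EFinM.
have c y : line_int i (line_int j f) y = line_int i (line_int j f) 0.
  apply: inv_const => k; case: (hij k) => ->; first exact/inv_line/nnp_line.
  by apply: inv_line_pres; exact: inv_line.
have -> : line_int i (line_int j f) = cst (line_int i (line_int j f) 0).
  by apply/funext => y; exact: c.
by rewrite Jint_cst muleC.
Qed.

Lemma const_line3 f i j k : nnp f -> (forall l, [\/ l = i, l = j | l = k]) ->
  forall x, ((vol Om)%:E * line_int i (line_int j (line_int k f)) x =
  (L * L * L)%:E * Jint f)%E.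
Proof.
move=> hf hij x; set F := line_int i _.
have -> : ((L * L * L)%:E * Jint f = Jint F)%E.
  rewrite /F (Jint_line1 i (nnp_line j (nnp_line k hf))) (Jint_line1 j (nnp_line k hf)).
  by rewrite Jint_line1// !muleA -!EFinM.
have c y : F y = F 0.
  apply: inv_const => l; case: (hij l) => ->.
  - by apply: inv_line; do 2!apply: nnp_line.
  - by apply: inv_line_pres; apply: inv_line; exact: nnp_line.
  - by do 2!apply: inv_line_pres; exact: inv_line.
have -> : F = cst (F 0) by apply/funext => y; exact: c.
by rewrite Jint_cst muleC.
Qed.

Let solve_vol (y : \bar R) (r : R) : ((vol Om)%:E * y = r%:E)%E -> y = ((vol Om)^-1 * r)%:E.
Proof.
move=> h; rewrite EFinM -h muleA -EFinM mulVf ?mul1e//.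
by rewrite gt_eqF// vol_gt0.
Qed.

Let Jw i j : Jint (ladyw i j) = (2 * ip (L2 Om) v v +
  4 * L ^+ 2 * (ip (L2 Om) (g i) (g i) + ip (L2 Om) (g j) (g j)))%:E.
Proof.
have h2 := nnpD (nsq (pg i)) (nsq (pg j)).
have -> : ladyw i j = ((fun x => 2%:E * sq v x) \+
   (fun x => (4 * L ^+ 2)%:E * (sq (g i) \+ sq (g j)) x))%E by [].
rewrite JintD; [|exact: nnpZ (nsq pv)|exact: nnpZ].
rewrite (JintZ _ (nsq pv)) ?lee_fin// (JintZ _ h2) ?lee_fin//.
by rewrite (JintD (nsq (pg i)) (nsq (pg j))) !Jsq.
Qed.

Definition ladyA' k x : \bar R := ((1 + L)%:E * sq v x + L%:E * sq (g k) x)%E.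

Let L1_0 : 0 <= 1 + L. Proof. by rewrite addr_ge0// ltW. Qed.

Let nA' k : nnp (ladyA' k).
Proof. by apply: nnpD; apply: nnpZ => //; [exact: nsq|exact: ltW|exact: nsq]. Qed.

Let JA' k : Jint (ladyA' k) = ((1 + L) * ip (L2 Om) v v + L * ip (L2 Om) (g k) (g k))%:E.
Proof.
have -> : ladyA' k = ((fun x => (1 + L)%:E * sq v x) \+ (fun x => L%:E * sq (g k) x))%E by [].
have n1 := nnpZ L1_0 (nsq pv); have n2 := nnpZ (ltW L0) (nsq (pg k)).
rewrite (JintD n1 n2) (JintZ _ (nsq pv)) ?(JintZ _ (nsq (pg k))) ?lee_fin ?(ltW L0)//.
by rewrite !Jsq.
Qed.

Let leA' k x : (ladyA k x <= ladyA' k x)%E.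
Proof.
rewrite /ladyA /ladyA' /absvg /sq -!EFinM -!EFinD lee_fin normrM.
have LL := ltW L0; set a := v x; set b := g k x.
have h : 0 <= (`|a| - `|b|) ^+ 2 by exact: sqr_ge0.
rewrite -[a * a]expr2 -[b * b]expr2 -(real_normK (num_real a)) -(real_normK (num_real b)).
have -> : (1 + L) * `|a| ^+ 2 + L * `|b| ^+ 2 =
  `|a| ^+ 2 + 2 * L * (`|a| * `|b|) + L * (`|a| - `|b|) ^+ 2.
    by move: `|a| `|b| L => p q l; ring.
by rewrite lerDl mulr_ge0.
Qed.

Let ar1 (l v1 a b n : R) : 0 <= l -> 0 <= v1 <= n -> 0 <= a <= n -> 0 <= b <= n ->
  0 <= 2 * v1 + 4 * l ^+ 2 * (a + b) <= (2 + 8 * l ^+ 2) * n.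
Proof.
move=> l0 /andP[v0 v1n] /andP[a0 an] /andP[b0 bn]; have q : 0 <= 4 * l ^+ 2 by rewrite mulr_ge0// sqr_ge0.
rewrite addr_ge0 ?mulr_ge0 ?addr_ge0//= (_ : _ * n = 2 * n + 4 * l ^+ 2 * (n + n)); last by ring.
by apply: lerD; [rewrite ler_wpM2l|rewrite ler_wpM2l// lerD].
Qed.

Let ar2 (l v1 a n : R) : 0 <= l -> 0 <= v1 <= n -> 0 <= a <= n ->
  0 <= (1 + l) * v1 + l * a <= (1 + 2 * l) * n /\ v1 <= (1 + l) * v1 + l * a.
Proof.
move=> l0 /andP[v0 v1n] /andP[a0 an].
have h1 : 0 <= l * v1 by exact: mulr_ge0. have h2 : 0 <= l * a by exact: mulr_ge0.
have h3 : l * v1 <= l * n by exact: ler_wpM2l. have h4 : l * a <= l * n by exact: ler_wpM2l.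
by split; [apply/andP; split|]; lra.
Qed.

Let ar3 (V l a w : R) : V != 0 ->
  V^-1 * (l * l * a) * (V^-1 * (l * l * w)) * V = l ^+ 4 * (V^-1 * (a * w)).
Proof. by move=> V0; field. Qed.

Let ar4 (V l a w : R) : V != 0 ->
  V^-1 * (l * l * l * a) * (V^-1 * (l * l * l * w)) * V = l ^+ 2 * (l ^+ 4 * (V^-1 * (a * w))).
Proof. by move=> V0; field. Qed.

(** In two dimensions the averages over planes are constants. In three dimensions
    they still depend on the third coordinate k: the first factor is bounded once
    more by an average in direction k, after which both factors are constants. The
    powers of n2 are the same in both cases because only quadratic quantities of v
    and of its gradient occur. *)
Lemma lady_bound i j k n2 : ip (L2 Om) v v <= n2 -> (forall l, ip (L2 Om) (g l) (g l) <= n2) ->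
  (forall l, l = i \/ l = j) \/ (forall l, [\/ l = i, l = j | l = k]) ->
  vol Om * spint Om (fun x => v x ^+ 4) <= (1 + 2 * L) * (2 + 8 * L ^+ 2) * n2 ^+ 2.
Proof.
move=> hv hg hij.
have v0 := vol_gt0 Om; have LL := ltW L0; have L2_0 : 0 <= L ^+ 2 by exact: sqr_ge0.
set jv := ip _ v v in hv; pose jw := 2 * jv + 4 * L ^+ 2 * (ip (L2 Om) (g i) (g i) + ip (L2 Om) (g j) (g j)).
pose jA := (1 + L) * jv + L * ip (L2 Om) (g k) (g k).
have ip0 u : ipset (L2 Om) u -> 0 <= ip (L2 Om) u u by move=> Hu; exact: (sip_ge0 (semi_ip_L2 Om)).
have jv0 : 0 <= jv := ip0 _ Hv.
have n0 : 0 <= n2 by exact: le_trans hv.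
have jvn : 0 <= jv <= n2 by rewrite jv0.
have gn l : 0 <= ip (L2 Om) (g l) (g l) <= n2 by rewrite ip0// hg.
have jwn : 0 <= jw <= (2 + 8 * L ^+ 2) * n2 by exact: ar1.
have [jAn jvA] := ar2 LL jvn (gn k); rewrite -/jA in jAn jvA.
set K := spint Om _.
have JK : Jint (sq v \* sq v)%E = K%:E.
  have b4 : bnd Om (fun x => v x * v x * (v x * v x)) by do 2!apply: bndM.
  rewrite [LHS](SintE (bnd_int b4)); congr (spint Om _)%:E.
  by apply/funext => x; ring.
suff : vol Om * K <= jA * jw.
  move=> /le_trans; apply; case/andP: jwn => a1 a2; case/andP: jAn => b1 b2.
  apply: le_trans (ler_pM b1 a1 b2 a2) _.
  by rewrite mulrACA.
have core := lady_core i j; rewrite JK in core.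
have cc (a w : R) (F G : 'rV[R]_d -> \bar R) : (forall x, F x = a%:E) -> (forall x, G x = w%:E) ->
    Jint (F \* G)%E = (a * w * vol Om)%:E.
  move=> Fa Gw; have -> : (F \* G)%E = cst (a * w)%:E by apply/funext => x; rewrite /= Fa Gw.
  by rewrite Jint_cst -EFinM.
case: hij => [h2|h3].
  have c1 x := solve_vol (etrans (const_line2 (nsq pv) h2 x) (congr1 _ (Jsq Hv))).
  have c2 x := solve_vol (etrans (const_line2 (nw i j) h2 x) (congr1 _ (Jw i j))).
  move: core; rewrite (cc _ _ _ _ c1 c2) -EFinM lee_fin -/jv -/jw.
  rewrite ar3 ?gt_eqF//.
  rewrite ler_pM2l ?exprn_gt0// ler_pdivlMl// => /le_trans; apply.
  by apply: ler_wpM2r => //; case/andP: jwn.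
set Z := line_int i (line_int j (ladyw i j)) in core.
have nZ : nnp Z by do 2!apply: nnp_line.
have iZ : inv i Z by apply: inv_line; exact: nnp_line.
have jZ : inv j Z by apply: inv_line_pres; exact: inv_line.
(* ladyA' k dominates ladyA k by Young's inequality. *)
pose P := line_int k (ladyA' k); have nP : nnp P by exact: nnp_line.
have nkZ := nnp_line k nZ.
have e1 := Jint_line3 nP nZ (inv_line k (nA' k)) iZ jZ.
have c1 x := solve_vol (etrans (const_line3 (nA' k) h3 x) (congr1 _ (JA' k))).
have h3' l : [\/ l = k, l = i | l = j] by case: (h3 l) => ->; [apply: Or32|apply: Or33|apply: Or31].
have c2 x := solve_vol (etrans (const_line3 (nw i j) h3' x) (congr1 _ (Jw i j))).
have e2 := cc _ _ _ _ c1 c2; rewrite -/P -/Z e1 -/jA -/jw in e2.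
have e3 : ((L ^+ 4)%:E * K%:E <= L%:E * Jint (P \* Z))%E.
  apply: le_trans core _.
  rewrite (Jint_line_line (nsq pv) nZ iZ jZ).
  apply: lee_wpmul2l; first by rewrite lee_fin.
  apply: le_trans (lady_line k nZ) _.
  apply: le_Jint; [exact: nnpM (nnp_line k (nA k)) nZ|exact: nnpM|].
  move=> x; apply: lee_wpmul2r; first exact: (nnp_ge0 nZ).
  by apply: le_line_int => //; exact: nA'.
have : ((L ^+ 2)%:E * ((L ^+ 4)%:E * K%:E) <= (L ^+ 2)%:E * (L%:E * Jint (P \* Z)))%E.
  by apply: lee_wpmul2l => //; rewrite lee_fin.
rewrite [leRHS]muleA -!EFinM -exprSr e2 lee_fin.
rewrite ar4 ?gt_eqF//.
by rewrite !ler_pM2l ?exprn_gt0// ler_pdivlMl.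
Qed.

End ladyzhenskaya.
Definition C4 : R := (vol Om)^-1 * ((1 + 2 * L) * (2 + 8 * L ^+ 2)).

Lemma ladyzhenskaya (hd : d = 2%N \/ d = 3%N) v : bnd Om v -> ipset (sobolev Om 1) v ->
  spint Om (fun x => v x ^+ 4) <= C4 * ip (sobolev Om 1) v v ^+ 2.
Proof.
move=> bv Hv; rewrite /C4 -[leRHS]mulrA ler_pdivlMl ?vol_gt0//.
have hg i := H1_wL2 i Hv.
have G0 := sip_ge0 (semi_ip_gip Om) Hv.
have V0 := sip_ge0 (semi_ip_L2 Om) (H1_L2 Hv).
have hv : ip (L2 Om) v v <= ip (sobolev Om 1) v v by rewrite lerDl.
have hg1 l : ip (L2 Om) (wpartial Om l v) (wpartial Om l v) <= ip (sobolev Om 1) v v.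
  apply: (@le_trans _ _ (gip Om v v)); last by rewrite lerDr.
  rewrite /gip (bigD1 l)//= lerDl; apply: sumr_ge0 => m _.
  exact: (sip_ge0 (semi_ip_L2 Om)).
suff [i [j [k hijk]]] : exists i j k : 'I_d,
  (forall l : 'I_d, l = i \/ l = j) \/ (forall l, [\/ l = i, l = j | l = k]).
  exact: (lady_bound bv hg (fun i => H1_wder i Hv) hv hg1 hijk).
case: hd => e.
  have h0 : (0 < d)%N by rewrite e. have h1 : (1 < d)%N by rewrite e.
  exists (Ordinal h0), (Ordinal h1), (Ordinal h0); left => -[[|[|m]] hm].
  - by left; apply: val_inj.
  - by right; apply: val_inj.
  - by exfalso; rewrite e in hm.
have h0 : (0 < d)%N by rewrite e. have h1 : (1 < d)%N by rewrite e.
have h2 : (2 < d)%N by rewrite e.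
exists (Ordinal h0), (Ordinal h1), (Ordinal h2); right => -[[|[|[|m]]] hm].
- by apply: Or31; apply: val_inj.
- by apply: Or32; apply: val_inj.
- by apply: Or33; apply: val_inj.
- by exfalso; rewrite e in hm.
Qed.

End line_averages.

(** * Scalar pairings of Bochner square integrable functions *)

Import HBNNSimple.

Section integral_ae.
Context d (T : measurableType d) {R : realType} (m : {measure set T -> \bar R}).
Variables (D : set T) (mD : measurable D).

(** The pairing t |-> <u t, w> of a strongly measurable function is measurable only
    up to a null set, hence the integral of functions that are not known to be
    measurable. A null set does not matter even then: a simple function below f is,
    off the null set, below g. *)
Lemma ge0_integral_ae (f g : T -> \bar R) : measurable_fun D g ->
  (forall x, D x -> (0 <= f x)%E) -> (forall x, D x -> (0 <= g x)%E) ->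
  {ae m, forall x, D x -> f x = g x} ->
  (\int[m]_(x in D) f x = \int[m]_(x in D) g x)%E.
Proof.
move=> mg f0 g0 [N [mN N0 sN]].
have gD0 x : (0 <= (g \_ D) x)%E by rewrite patchE; case: ifPn => // /set_mem; exact: g0.
have fD0 x : (0 <= (f \_ D) x)%E by rewrite patchE; case: ifPn => // /set_mem; exact: f0.
have mgD : measurable_fun setT (g \_ D) by apply/(measurable_restrictT _ _).1.
have fgN x : ~ N x -> (f \_ D) x = (g \_ D) x.
  move=> Nx; rewrite !patchE; case: ifPn => // /set_mem Dx.
  by apply: contrapT => h; apply: Nx; apply: sN => /(_ Dx).
apply/eqP; rewrite eq_le; apply/andP; split.
  rewrite ge0_integralE//; apply: ge_ereal_sup => _ [h hf <-].
  rewrite -[leLHS](_ : \int[m]_x (h x)%:E = _)%E; last first.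
    by rewrite integral_nnsfun// patch_setT.
  rewrite [leRHS]integral_mkcond; apply: ae_ge0_le_integral => //.
  - by move=> x _; rewrite lee_fin; exact: fun_ge0.
  - exact/measurable_EFinP.
  - exists N; split => // x; apply: contra_notP => Nx _.
    by rewrite -fgN//; exact: hf.
rewrite [leRHS]ge0_integralE// integral_mkcond.
pose g' := ((g \_ D) \_ (~` N))%E.
have g'0 x : (0 <= g' x)%E by rewrite /g' patchE; case: ifPn.
have mg' : measurable_fun setT g'.
  by apply/(measurable_restrictT _ _).1; [exact: measurableC|exact: measurable_funTS].
rewrite (_ : \int[m]_x (g \_ D) x = \int[m]_x g' x)%E; last first.
  apply: ae_eq_integral => //; exists N; split => // x.
  apply: contra_notP => Nx _; rewrite /g' [RHS]patchE mem_set//.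
rewrite ge0_integralTE//; apply: ereal_sup_le => _ [h hg <-].
exists h => //= x.
apply: le_trans (hg x) _; rewrite /g' patchE; case: ifPn => [/set_mem Nx|_//].
by rewrite -fgN.
Qed.

Lemma integral_ae (f g : T -> \bar R) : measurable_fun D g ->
  {ae m, forall x, D x -> f x = g x} ->
  (\int[m]_(x in D) f x = \int[m]_(x in D) g x)%E.
Proof.
move=> mg fg; rewrite integralE [RHS]integralE; congr (_ - _)%E.
- apply: ge0_integral_ae => //; first exact: measurable_funepos.
  by apply: filterS fg => x h Dx; rewrite !funepos.unlock h.
- apply: ge0_integral_ae => //; first exact: measurable_funeneg.
  by apply: filterS fg => x h Dx; rewrite !funeneg.unlock h.
Qed.

Lemma Rintegral_ae (f g : T -> R) : measurable_fun D g ->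
  {ae m, forall x, D x -> f x = g x} ->
  \int[m]_(x in D) f x = \int[m]_(x in D) g x.
Proof.
move=> mg fg; rewrite /Rintegral; congr fine; apply: integral_ae.
  exact/measurable_EFinP.
by apply: filterS fg => x h Dx; rewrite h.
Qed.

End integral_ae.

Section ae_line.
Context {R : realType}.
Local Notation leb1 := (@lebesgue_measure R).

Lemma ae1_1 (P Q : R -> Prop) : (forall t, P t -> Q t) ->
  {ae leb1, forall t, P t} -> {ae leb1, forall t, Q t}.
Proof. by move=> h; apply: negligibleS => t; apply: contra_not; exact: h. Qed.

Lemma ae1_2 (P Q S : R -> Prop) : (forall t, P t -> Q t -> S t) ->
  {ae leb1, forall t, P t} -> {ae leb1, forall t, Q t} -> {ae leb1, forall t, S t}.
Proof.
move=> h hP hQ; apply: negligibleS (negligibleU hP hQ) => t.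
by rewrite -setCI; apply: contra_not => -[]; exact: h.
Qed.

End ae_line.

Section bochner_scalar.
Context {R : realType} {V : lmodType R} (X : ipspace V) (T : R).
Hypothesis hX : semi_ip (ipset X) (ip X).
Local Notation leb1 := (@lebesgue_measure R).
Local Notation I := (`]0, T[%classic : set (measurableTypeR R)).
Local Notation nm := (ipnorm X).

Lemma sip_sum m (c : 'I_m -> R) (w : 'I_m -> V) z : (forall j, ipset X (w j)) -> ipset X z ->
  ipset X (\sum_j c j *: w j) /\ ip X (\sum_j c j *: w j) z = \sum_j c j * ip X (w j) z.
Proof.
move=> Hw Hz; elim: (index_enum _) => [|j s [IH1 IH2]].
  by rewrite !big_nil; split; [exact: sip0 hX|exact: (sip0l hX)].
rewrite !big_cons; have Hj := sipZ hX (c j) (Hw j); split; first exact: (sipD hX).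
by rewrite (sipDl hX)// IH2 (sipZl hX).
Qed.

(** Simple functions give the measurability in the limit. The square integrable
    bound replaces nm by 1 + nm^2, which avoids the integrability of nm itself. *)
Lemma bochner_scalar v w : bochner_L2 T X v -> ipset X w ->
  exists f : R -> R, [/\ measurable_fun setT f,
    {ae leb1, forall t, I t -> ip X (v t) w = f t} &
    {ae leb1, forall t, I t -> `|f t| <= nm w * (1 + nm (v t) ^+ 2)}].
Proof.
move=> [HvX [s [simp cvs]] _] Hw.
have [N [mN N0 sN]] : {ae leb1, forall t, I t -> ipset X (v t) /\
    (fun k => ipnorm X (s k t - v t)) @ \oo --> (0 : R)}.
  apply: (ae1_2 _ HvX cvs) => t h1 h2; rewrite /= in_itv/= => It.
  by split; [exact: h1|exact: h2].
pose A := I `&` ~` N.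
have mA : measurable A by apply: measurableI => //; exact: measurableC.
have At t : A t -> ipset X (v t) /\ (fun k => ipnorm X (s k t - v t)) @ \oo --> (0 : R).
  by move=> [It Nt]; apply: contrapT => h; apply: Nt; apply: sN => /(_ It).
pose f t := \1_A t * ip X (v t) w.
pose F (k : nat) t := \1_A t * ip X (s k t) w.
have ms k t : ipset X (s k t).
  by have [m [B [z [_ hz ->]]]] := simp k; have [] := sip_sum (fun j => \1_(B j) t) hz Hw.
have mF k : measurable_fun setT (F k).
  have [m [B [z [mB hz sE]]]] := simp k.
  apply: measurable_funM; first exact: measurable_indic.
  rewrite (_ : (fun _ => _) = fun t => \sum_(j < m) \1_(B j) t * ip X (z j) w).
    apply: measurable_sum => j; apply: measurable_funM => //.
    by apply: measurable_indic; exact: mB.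
  by apply/funext => t; rewrite sE; have [_ ->] := sip_sum (fun j => \1_(B j) t) hz Hw.
exists f; split.
- apply: (measurable_fun_cvg mF) => t _; rewrite /F /f indicE.
  have [At'|nAt] := boolP (t \in A); last first.
    by rewrite mul0r; under eq_fun do rewrite mul0r; exact: cvg_cst.
  rewrite mul1r; under eq_fun do rewrite mul1r.
  have [Hv cv] := At t (set_mem At').
  suff : (fun k => ip X (s k t) w) @ \oo --> ip X (v t) w by [].
  apply/cvgrPdist_le => e e0.
  have w0 : 0 < nm w + 1 by rewrite ltr_wpDl// sqrtr_ge0.
  have /cvgrPdist_le/(_ (e / (nm w + 1)) (divr_gt0 e0 w0)) := cv.
  apply: filterS => k; rewrite sub0r normrN ger0_norm ?sqrtr_ge0// => hk.
  rewrite distrC -(sipBl hX (ms k t) Hv Hw).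
  apply: le_trans (sip_CSn hX (sipB hX (ms k t) Hv) Hw) _.
  apply: le_trans (ler_pM _ _ hk (_ : _ <= nm w + 1)) _; rewrite ?sqrtr_ge0 ?lerDl//.
  by rewrite divfK// gt_eqF.
- exists N; split => // t; apply: contra_notP => Nt It.
  by rewrite /f indicE mem_set ?mul1r.
- exists N; split => // t; apply: contra_notP => Nt It.
  have At' : A t by [].
  have [Hv _] := At t At'.
  rewrite /f indicE mem_set ?mul1r//.
  apply: le_trans (sip_CSn hX Hv Hw) _; rewrite mulrC ler_wpM2l ?sqrtr_ge0//.
  rewrite -/(nm (v t)); have : 0 <= (nm (v t) - 1) ^+ 2 by exact: sqr_ge0.
  have : 0 <= nm (v t) by exact: sqrtr_ge0.
  by rewrite sqrrB1 -mulr_natl; set y := nm (v t); nra.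
Qed.

Definition B2 v : R := T + \int[leb1]_(t in I) (nm (v t) ^+ 2).

Hypothesis hT : 0 < T.

Lemma leb1_I : leb1 I = T%:E.
Proof. by rewrite lebesgue_measure_itv/= lte_fin hT/= oppr0 adde0. Qed.

Lemma cst_integrable (c : R) : leb1.-integrable I (fun=> c%:E).
Proof.
have cI := @continuous_itv_integrable R (cst c) 0 T (@cst_continuous _ _ c).
by apply: integrableS cI => //; exact: subset_itv_oo_cc.
Qed.

Let iB v : bochner_L2 T X v -> leb1.-integrable I (EFin \o (fun t => 1 + nm (v t) ^+ 2)).
Proof.
move=> [_ _ iv]; have mI : measurable I by [].
by apply: eq_integrable (integrableD mI (cst_integrable 1) iv).
Qed.

Lemma B2E v : bochner_L2 T X v -> \int[leb1]_(t in I) (1 + nm (v t) ^+ 2) = B2 v.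
Proof.
move=> Hv; have [_ _ iv] := Hv; have mI : measurable I by [].
rewrite RintegralD//; last exact: (cst_integrable 1).
have -> : \int[leb1]_(t in I) 1 = \int[leb1]_(t in I) (cst (1 : R)) t by [].
by rewrite Rintegral_cst// [X in fine X]leb1_I mul1r.
Qed.

Lemma B2_ge0 v : 0 <= B2 v.
Proof.
rewrite addr_ge0 ?(ltW hT)//; apply: Rintegral_ge0 => t _; exact: sqr_ge0.
Qed.

Lemma bochner_pair v w : bochner_L2 T X v -> ipset X w ->
  exists f : R -> R, [/\ leb1.-integrable I (EFin \o f),
   (forall chi : R -> R, measurable_fun setT chi ->
     \int[leb1]_(t in I) (chi t * ip X (v t) w) = \int[leb1]_(t in I) (chi t * f t)),
   (forall (chi : R -> R) M, measurable_fun setT chi -> (forall t, `|chi t| <= M) ->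
     leb1.-integrable I (EFin \o (fun t => chi t * f t))) &
   (forall (chi : R -> R) M, measurable_fun setT chi -> (forall t, `|chi t| <= M) ->
     `|\int[leb1]_(t in I) (chi t * f t)| <= M * (nm w * B2 v))].
Proof.
move=> Hv Hw; have [f [mf vf fB]] := bochner_scalar Hv Hw.
have mI : measurable I by [].
have iBv := iB Hv.
have bchi (chi : R -> R) M : (forall t, `|chi t| <= M) ->
   {ae leb1, forall t, I t -> `|chi t * f t| <= M * nm w * (1 + nm (v t) ^+ 2)}.
  move=> hM; apply: (ae1_1 _ fB) => t h It; rewrite normrM -mulrA.
  by apply: ler_pM => //; exact: h.
have iBM M : leb1.-integrable I (EFin \o (fun t => M * nm w * (1 + nm (v t) ^+ 2))).
  by apply: eq_integrable (integrableZl mI (M * nm w) iBv).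
have ichi (chi : R -> R) M : measurable_fun setT chi -> (forall t, `|chi t| <= M) ->
     leb1.-integrable I (EFin \o (fun t => chi t * f t)).
  move=> mchi hM; apply/integrableP; split.
    by apply/measurable_EFinP; apply: measurable_funTS; exact: measurable_funM.
  have /integrableP[mB +] := iBM M; apply: le_lt_trans.
  apply: ae_ge0_le_integral => //.
  - apply: measurableT_comp => //; apply/measurable_EFinP; apply: measurable_funTS.
    exact: measurable_funM.
  - exact: measurableT_comp.
  - apply: (ae1_1 _ (bchi _ _ hM)) => t h It /=; rewrite lee_fin.
    by apply: le_trans (h It) _; exact: ler_norm.
exists f; split => //.
- have := ichi (cst 1) 1 (measurable_cst _) _ => /(_ _)/wrap[].
    by move=> t; rewrite normr1.
  by apply: eq_integrable => // t _; rewrite /= mul1r.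
- move=> chi mchi; apply: Rintegral_ae => //.
    by apply: measurable_funTS; exact: measurable_funM.
  by apply: (ae1_1 _ vf) => t h It; rewrite h.
- move=> chi M mchi hM; apply: le_trans (le_normr_Rintegral mI (ichi _ _ mchi hM)) _.
  rewrite mulrA -(B2E Hv) -RintegralZl//.
  rewrite /Rintegral fine_le//.
  + by apply: integrable_fin_num => //; exact: (@integrable_norm _ _ _ leb1 I _ (ichi _ _ mchi hM)).
  + by apply: integrable_fin_num => //; exact: iBM.
  + apply: ae_ge0_le_integral => //.
    * apply/measurable_EFinP; apply: measurableT_comp => //; apply: measurable_funTS.
      exact: measurable_funM.
    * move=> t It; rewrite lee_fin; apply: mulr_ge0; last by rewrite addr_ge0// sqr_ge0.
      by rewrite mulr_ge0 ?sqrtr_ge0//; exact: le_trans (hM 0).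
    * exact: measurable_int (iBM M).
    * by apply: (ae1_1 _ (bchi _ _ hM)) => t h It; rewrite lee_fin h.
Qed.

End bochner_scalar.

(** * Functions of class H2 in time are Lipschitz *)

Section smooth_steps.
Context {R : realType}.
Implicit Types (F : R -> R) (a k t : R).
Local Notation S := (@sstep R).
Local Notation S' := (derive1 (@sstep R)).

Lemma is_derive_aff F F' a k t : (forall s, is_derive s (1 : R) F (F' s)) ->
  is_derive t (1 : R) (fun t => F ((t - a) * k)) (F' ((t - a) * k) * k).
Proof.
move=> FF; have dl : is_derive t (1 : R) (fun t => (t - a) * k) k.
  have d0 : is_derive t (1 : R) (fun t : R => t) 1 by exact: is_derive_id.
  have dc : is_derive t (1 : R) (fun=> a) 0 by exact: is_derive_cst.
  have dk : is_derive t (1 : R) (fun=> k) 0 by exact: is_derive_cst.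
  have := is_deriveM (is_deriveB d0 dc) dk.
  by rewrite scaler0 add0r subr0 => h; apply: is_derive_eq h _; rewrite /GRing.scale /= mulr1.
exact: (is_derive1_comp (FF _) dl).
Qed.

Lemma Cinf_aff F a k : Cinf F -> Cinf (fun t => F ((t - a) * k)).
Proof.
move=> CF; apply: Cinf_comp => //; apply: CinfM; last exact: Cinf_cst.
by apply: CinfB; [exact: Cinf_id|exact: Cinf_cst].
Qed.

Lemma is_derive_sstep t : is_derive t (1 : R) S (S' t).
Proof. by apply: Cinf_is_derive; exact: Cinf_sstep. Qed.

Lemma Cinf_dsstep : Cinf S'. Proof. by apply: Cinf_derive; exact: Cinf_sstep. Qed.

Lemma dsstep_out t : ~~ (0 <= t <= 1) -> S' t = 0.
Proof.
rewrite negb_and -!ltNge derive1E => h.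
have [c cE] : exists c : R, \forall s \near t, (cst c : R -> R) s = S s.
  case/orP: h => h.
    exists 0; near=> s; rewrite sstep_le0//; apply: ltW.
    by near: s; exact: lt_nbhsl.
  exists 1; near=> s; rewrite sstep_ge1//; apply: ltW.
  by near: s; exact: lt_nbhsr.
have dc : is_derive t (1 : R) (cst c : R -> R) 0 by exact: is_derive_cst.
by have [_ ->] := near_eq_is_derive cE dc.
Unshelve. all: by end_near. Qed.

Lemma dsstep_bnd : exists2 M, 0 <= M & forall t, `|S' t| <= M.
Proof.
have cS := Cinf_continuous Cinf_dsstep.
have cn : {within `[(0 : R), 1], continuous (fun t => `|S' t|)}.
  apply: continuous_subspaceT => t; apply: continuous_comp; first exact: cS.
  exact: norm_continuous.
have [c _ hc] := EVT_max (ler01 : (0 : R) <= 1) cn.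
exists `|S' c|; first exact: normr_ge0.
move=> t; have [t01|/dsstep_out ->] := boolP (0 <= t <= 1).
  by apply: hc; rewrite in_itv.
by rewrite normr0.
Qed.

(** A primitive of the smooth step is a smooth version of the positive part; its
    differences are bounded ramps. *)
Lemma ex_sstep_primitive : exists P : R -> R, [/\ Cinf P,
  forall t, is_derive t (1 : R) P (S t),
  forall s t, `|P t - P s| <= `|t - s|,
  forall t, t <= 0 -> P t = P 0 &
  forall t, 1 <= t -> P t = P 1 + (t - 1)].
Proof.
have cS := Cinf_continuous (@Cinf_sstep R).
have [P hP] := ex_primitive cS.
have mvt s t : s <= t -> exists2 c, s <= c <= t & P t - P s = S c * (t - s).
  move=> st; have cP := is_derive_continuous hP.
  have [|c] := MVT_segment st (fun x _ => hP x); first exact: continuous_subspaceT.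
  by rewrite in_itv => ? ?; exists c.
exists P; split => //.
- exact: Cinf_primitive (@Cinf_sstep R) hP.
- move=> s t; wlog st : s t / s <= t.
    move=> h; case: (leP s t) => [/h//|/ltW/h]; by rewrite distrC [`|s - t|]distrC.
  have [c _ ->] := mvt _ _ st.
  rewrite normrM (ger0_norm (sstep_ge0 c)) ler_piMl//.
  exact: sstep_le1.
- move=> t t0; have [c /andP[_ c0]] := mvt _ _ t0.
  by rewrite sstep_le0// mul0r => /eqP; rewrite subr_eq0 => /eqP.
- move=> t t1; have [c /andP[c1 _]] := mvt _ _ t1.
  by rewrite sstep_ge1// mul1r => <-; rewrite addrC subrK.
Qed.

Lemma Cinf_measurable F : Cinf F -> measurable_fun setT F.
Proof. by move=> CF; apply: continuous_measurable_fun; exact: Cinf_continuous. Qed.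

End smooth_steps.

Section time_lipschitz.
Context {R : realType} {V : lmodType R} (X : ipspace V) (T : R).
Hypothesis hX : semi_ip (ipset X) (ip X).
Hypothesis hT : 0 < T.
Local Notation leb1 := (@lebesgue_measure R).
Local Notation I := (`]0, T[%classic : set (measurableTypeR R)).
Local Notation nm := (ipnorm X).
Local Notation S := (@sstep R).
Local Notation S' := (derive1 (@sstep R)).

Lemma derive1n_derivable (F : R -> R) : Cinf F -> forall k t, derivable (derive1n k F) t 1.
Proof. by move=> CF k t; exact: Cinf_derive1n. Qed.

Section pairing.
Variables (u v1 v2 : R -> V) (hv1 : is_weak_dt T X u v1) (hv2 : is_weak_dt T X v1 v2).
Variables (M : R) (M0 : 0 <= M) (hM : forall t, `|S' t| <= M).

(** The Lipschitz constant comes from the two terms of the test functions below: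
    the second derivative is paired with a weight bounded by 2 (b - a), the first
    derivative with one bounded by a multiple of b - a. *)
Definition rateK : R := 2 * B2 X T v2 + M * (T / 3)^-1 * B2 X T v1.

Let mI : measurable I. Proof. by []. Qed.
Let T3 : 0 < T / 3. Proof. by rewrite divr_gt0. Qed.

(** The left side is the smoothed difference u b - u a. The trapezoid Et with Et' as
    weight turns it into a pairing with the first derivative, but Et is not the
    derivative of a compactly supported function. Subtracting b - a times a fixed
    bump th of integral 1 repairs this, and the primitive chi, of size b - a, moves
    one more derivative onto u. *)
Lemma weak_dt_window w a b e : ipset X w -> 0 < a -> a < b -> 0 < e -> b + e < T ->
  `| \int[leb1]_(t in I) ((S' ((t - a) * e^-1) * e^-1 - S' ((t - b) * e^-1) * e^-1) * ip X (u t) w) |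
  <= (b - a) * (nm w * rateK).
Proof.
move=> Hw a0 ab e0 beT.
have [P [CP dP lipP P0 P1]] := @ex_sstep_primitive R.
have ei : 0 < e^-1 by rewrite invr_gt0.
have T3i : 0 < (T / 3)^-1 by rewrite invr_gt0.
have ba : 0 <= b - a by rewrite subr_ge0 ltW.
pose Et t := S ((t - a) * e^-1) - S ((t - b) * e^-1).
pose Et' t := S' ((t - a) * e^-1) * e^-1 - S' ((t - b) * e^-1) * e^-1.
pose Q t := e * (P ((t - a) * e^-1) - P ((t - b) * e^-1)).
(* sg steps from 0 to 1 in the middle third of the time interval. *)
pose sg t := S ((t - T / 3) * (T / 3)^-1).
pose th t := S' ((t - T / 3) * (T / 3)^-1) * (T / 3)^-1.
pose chi t := Q t - (b - a) * sg t.
have dEt t : is_derive t (1 : R) Et (Et' t).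
  by apply: is_deriveB; apply: is_derive_aff => s; exact: is_derive_sstep.
have dQ t : is_derive t (1 : R) Q (Et t).
  have d1 : is_derive t (1 : R) (fun t => P ((t - a) * e^-1) - P ((t - b) * e^-1))
      (S ((t - a) * e^-1) * e^-1 - S ((t - b) * e^-1) * e^-1).
    by apply: is_deriveB; apply: is_derive_aff => s; exact: dP.
  have -> : Et t = e *: (S ((t - a) * e^-1) * e^-1 - S ((t - b) * e^-1) * e^-1).
    by rewrite -mulrBl [RHS]mulrC mulfVK// gt_eqF.
  exact: is_deriveZ.
have dsg t : is_derive t (1 : R) sg (th t).
  by apply: is_derive_aff => s; exact: is_derive_sstep.
have dchi t : is_derive t (1 : R) chi (Et t - (b - a) * th t).
  by apply: is_deriveB; exact: is_deriveZ.
have CS := @Cinf_sstep R; have CS' := @Cinf_dsstep R.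
have CEt : Cinf Et by apply: CinfB; exact: Cinf_aff.
have Cth : Cinf th by apply: CinfM; [exact: Cinf_aff|exact: Cinf_cst].
have Cchi : Cinf chi.
  apply: CinfB; first by apply: CinfZ; apply: CinfB; exact: Cinf_aff.
  by apply: CinfZ; exact: Cinf_aff.
have tEt : time_test T Et.
  split; first exact: derive1n_derivable.
  exists a, (b + e); split => // t; rewrite negb_and -!ltNge => /orP[ta|bt].
    rewrite /Et !sstep_le0 ?subrr// pmulr_lle0// subr_le0 ltW//.
    exact: lt_trans ab.
  rewrite /Et !sstep_ge1 ?subrr// ler_pdivlMr// mul1r; lra.
have tchi : time_test T chi.
  split; first exact: derive1n_derivable.
  exists (Num.min a (T / 3)), (Num.max (b + e) (T - T / 3)); split.
  - by rewrite lt_min a0.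
  - by rewrite gt_max beT ltrBlDr ltrDl.
  move=> t; rewrite negb_and -!ltNge lt_min gt_max => /orP[/andP[ta t3]|/andP[bt t3]].
    rewrite /chi /Q /sg P0 ?P0 ?sstep_le0 ?subrr ?mulr0 ?subrr//;
    by rewrite pmulr_lle0// subr_le0 ltW//; exact: lt_trans ab.
  have h1 : 1 <= (t - a) * e^-1 by rewrite ler_pdivlMr// mul1r; lra.
  have h2 : 1 <= (t - b) * e^-1 by rewrite ler_pdivlMr// mul1r; lra.
  have h3 : 1 <= (t - T / 3) * (T / 3)^-1 by rewrite ler_pdivlMr// mul1r; lra.
  rewrite /chi /Q /sg (P1 _ h1) (P1 _ h2) sstep_ge1//.
  by field; rewrite gt_eqF.
have hchi t : `|chi t| <= 2 * (b - a).
  have q1 : `|Q t| <= b - a.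
    rewrite /Q normrM (gtr0_norm e0); apply: le_trans (ler_wpM2l (ltW e0) (lipP _ _)) _.
    rewrite -mulrBl normrM (gtr0_norm ei) mulrCA mulfV ?gt_eqF// mulr1.
    by rewrite (_ : t - a - (t - b) = b - a) ?ger0_norm//; ring.
  have q2 : `|(b - a) * sg t| <= b - a.
    by rewrite normrM !ger0_norm ?sstep_ge0// ler_piMr// sstep_le1.
  apply: le_trans (ler_normB _ _) _; rewrite (_ : 2 * (b - a) = (b - a) + (b - a)).
    exact: lerD.
  by rewrite mulr_natl.
have hth t : `|th t| <= M * (T / 3)^-1.
  by rewrite normrM (gtr0_norm T3i); apply: ler_wpM2r; [exact: ltW|exact: hM].
have hEt t : `|Et t| <= 1.
  rewrite /Et ler_norml; have := sstep_ge0 ((t - a) * e^-1); have := sstep_le1 ((t - a) * e^-1).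
  have := sstep_ge0 ((t - b) * e^-1); have := sstep_le1 ((t - b) * e^-1); lra.
have [Lv1 wu] := hv1; have [Lv2 wv] := hv2.
have [f1 [if1 f1E f1I f1B]] := bochner_pair hX hT Lv1 Hw.
have [f2 [if2 f2E f2I f2B]] := bochner_pair hX hT Lv2 Hw.
have mC (F : R -> R) : Cinf F -> measurable_fun setT F by exact: Cinf_measurable.
have E1 := wu _ _ tEt Hw; have E2 := wv _ _ tchi Hw.
have dEtE : derive1 Et = Et' by apply/funext => t; rewrite derive1E; have [_ ->] := dEt t.
have dchiE : derive1 chi = fun t => Et t - (b - a) * th t.
  by apply/funext => t; rewrite derive1E; have [_ ->] := dchi t.
rewrite dEtE f1E in E1; last exact: mC.
have mdchi : measurable_fun setT (fun t => Et t - (b - a) * th t).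
  by apply: mC; apply: CinfB => //; exact: CinfZ.
rewrite dchiE f1E// f2E in E2; last exact: mC.
have i1 := f1I _ _ (mC _ CEt) hEt; have i2 := f1I _ _ (mC _ Cth) hth.
have E3 : \int[leb1]_(t in I) ((Et t - (b - a) * th t) * f1 t) =
   (\int[leb1]_(t in I) (Et t * f1 t)) - (b - a) * (\int[leb1]_(t in I) (th t * f1 t)).
  rewrite -RintegralZl// -RintegralB//; last first.
    by apply: eq_integrable (integrableZl mI (b - a) i2).
  by apply: eq_Rintegral => t _; ring.
have b1 := f1B _ _ (mC _ Cth) hth; have b2 := f2B _ _ (mC _ Cchi) hchi.
rewrite [X in `|X|]E1 normrN.
have -> : \int[leb1]_(t in I) (Et t * f1 t) =
  - (\int[leb1]_(t in I) (chi t * f2 t)) + (b - a) * (\int[leb1]_(t in I) (th t * f1 t)).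
  by rewrite -E2 E3 subrK.
apply: le_trans (ler_normD _ _) _; rewrite normrN normrM (ger0_norm ba).
apply: le_trans (lerD b2 (ler_wpM2l ba b1)) _.
by rewrite le_eqVlt; apply/orP; left; apply/eqP; rewrite /rateK; ring.
Qed.

(** The window has integral 1, length e and height at most M / e; M enters because
    the derivative of the step is not known to be nonnegative. *)
Lemma window_value (g : R -> R) a e del : 0 < a -> 0 < e -> a + e < T ->
  leb1.-integrable I (EFin \o g) -> (forall t, a <= t <= a + e -> `|g t - g a| <= del) ->
  leb1.-integrable I (EFin \o (fun t => S' ((t - a) * e^-1) * e^-1 * g t)) /\
  exists2 A, \int[leb1]_(t in I) (S' ((t - a) * e^-1) * e^-1 * g t) = A & `|A - g a| <= M * del.
Proof.
move=> a0 e0 aeT ig gd; pose be t := S' ((t - a) * e^-1) * e^-1.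
have ei : 0 < e^-1 by rewrite invr_gt0.
have CS' := @Cinf_dsstep R.
have Cbe : Cinf be by apply: CinfM; [exact: Cinf_aff|exact: Cinf_cst].
have cbe := Cinf_continuous Cbe.
have hbe t : `|be t| <= M * e^-1.
  by rewrite normrM (gtr0_norm ei); apply: ler_wpM2r; [exact: ltW|exact: hM].
have ibg : leb1.-integrable I (EFin \o (fun t => be t * g t)).
  have im : leb1.-integrable I (EFin \o (fun t => M * e^-1 * `|g t|)).
    by apply: eq_integrable (integrableZl mI (M * e^-1) (@integrable_norm _ _ _ leb1 I _ ig)).
  apply: (le_integrable mI _ _ im).
    apply/measurable_EFinP; apply: measurable_funM.
      by apply: measurable_funTS; exact: Cinf_measurable.
    by apply/measurable_EFinP; exact: measurable_int ig.
  move=> t _ /=; rewrite lee_fin normrM [leRHS]normrM normr_id.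
  by apply: ler_wpM2r => //; apply: le_trans (hbe t) (ler_norm _).
have ibe : leb1.-integrable I (EFin \o be).
  by apply: integrableS (continuous_itv_integrable 0 T cbe) => //; exact: subset_itv_oo_cc.
split => //; eexists; first reflexivity.
have one : \int[leb1]_(t in I) be t = 1.
  have -> : \int[leb1]_(t in I) be t = \int[leb1]_(t in `[0, T]) be t.
    rewrite /Rintegral; congr fine; rewrite [RHS]integral_itv_bndoo//.
    exact: measurable_int ibe.
  have dS t : is_derive t (1 : R) (fun t => S ((t - a) * e^-1)) (be t).
    by apply: is_derive_aff => s; exact: is_derive_sstep.
  rewrite (FTC2 (ltW hT) cbe dS) sstep_ge1 ?sstep_le0 ?subr0//.
    by rewrite pmulr_lle0// sub0r oppr_le0 ltW.
  by rewrite ler_pdivlMr// mul1r; lra.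
have iga : leb1.-integrable I (EFin \o (fun t => g a * be t)).
  by apply: eq_integrable (integrableZl mI (g a) ibe).
have -> : \int[leb1]_(t in I) (be t * g t) - g a = \int[leb1]_(t in I) (be t * (g t - g a)).
  rewrite -[g a in LHS]mulr1 -one -RintegralZl// -RintegralB//.
  by apply: eq_Rintegral => t _; ring.
have id : leb1.-integrable I (EFin \o (fun t => be t * (g t - g a))).
  apply: eq_integrable (integrableB mI ibg iga) => // t _ /=.
  by rewrite -EFinB; congr EFin; ring.
apply: le_trans (le_normr_Rintegral mI id) _.
pose J := `[a, a + e]%classic : set (measurableTypeR R).
have mJ : measurable J by exact: measurable_itv.
have del0 : 0 <= del.
  apply: le_trans (normr_ge0 _) (gd a _) => //.
  by rewrite lexx/= lerDl ltW.
have i0 : leb1.-integrable I (EFin \o (fun t => \1_J t)).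
  apply: (@le_integrable _ _ _ leb1 I mI (EFin \o (fun t => \1_J t)) (fun=> 1%:E)) => //.
  - by apply/measurable_EFinP; apply: measurable_funTS; exact: measurable_indic mJ.
  - move=> t _ /=; rewrite indicE; case: (_ \in _) => /=; by rewrite ?normr1 ?normr0 lee_fin ?ler01.
  - exact: cst_integrable.
have iJ : leb1.-integrable I (EFin \o (fun t => M * e^-1 * del * \1_J t)).
  by apply: eq_integrable (integrableZl mI (M * e^-1 * del) i0).
have -> : M * del = M * e^-1 * del * e by rewrite -[RHS]mulrA [del * e]mulrC mulrA divfK ?gt_eqF.
apply: (@le_trans _ _ (\int[leb1]_(t in I) (M * e^-1 * del * \1_J t))).
  apply: le_Rintegral => //; first exact: (@integrable_norm _ _ _ leb1 I _ id).
  move=> t _; rewrite normrM indicE; have [tJ|tJ] := boolP (t \in J).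
    rewrite mulr1; apply: ler_pM => //; apply: gd.
    by move/set_mem : tJ; rewrite /J/= in_itv.
  rewrite /be dsstep_out ?mul0r ?normr0 ?mul0r ?mulr0//.
  apply: contra tJ => /andP[h1 h2]; rewrite inE /J/= in_itv/=.
  move: h1 h2; rewrite pmulr_lge0// ler_pdivrMr// mul1r; lra.
rewrite RintegralZl//; apply: ler_wpM2l; first by rewrite !mulr_ge0// ltW.
rewrite /Rintegral integral_indic//.
have eE : leb1 J = e%:E.
  by rewrite lebesgue_measure_itv/= lte_fin ltrDl e0/= -EFinB addrC addKr.
rewrite -[leRHS]/(fine e%:E) -eE fine_le//.
- rewrite ge0_fin_numE//; apply: (@le_lt_trans _ _ (leb1 J)); last by rewrite eE ltry.
  by apply: le_measure; rewrite ?inE//; exact: measurableI.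
- by rewrite eE.
- by apply: le_measure; rewrite ?inE//; exact: measurableI.
Qed.

Let ar_win (x y z t : R) : y - x = z - x - (t - y) - (z - t). Proof. by ring. Qed.

Hypothesis uC : bochner_C T X u.

Let Hu t : 0 <= t <= T -> ipset X (u t). Proof. by case: uC => h _; exact: h. Qed.

Lemma bochner_C_near t e : 0 <= t <= T -> 0 < e ->
  exists2 r, 0 < r & forall s, 0 <= s <= T -> `|s - t| < r -> nm (u s - u t) <= e.
Proof.
move=> tT e0; have [_ /(_ t tT)] := uC.
move/cvgrPdist_le => /(_ e e0); rewrite near_withinE => /nbhs_ballP[r r0 hr].
exists r => // s sT st; have := hr s; rewrite /= /ball/= in_itv/= distrC => /(_ st sT).
by rewrite sub0r normrN ger0_norm// sqrtr_ge0.
Qed.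

Lemma ip_u_integrable w : ipset X w -> leb1.-integrable I (EFin \o (fun t => ip X (u t) w)).
Proof.
move=> Hw; apply: (@integrableS _ _ _ leb1 `[0, T]%classic) => //; first exact: subset_itv_oo_cc.
apply: continuous_compact_integrable; first exact: segment_compact.
apply/subspace_continuousP => t; rewrite /= in_itv/= => tT.
apply/cvgrPdist_le => e e0; rewrite near_withinE.
have w0 : 0 < nm w + 1 by rewrite ltr_wpDl// sqrtr_ge0.
have [r r0 hr] := bochner_C_near tT (divr_gt0 e0 w0).
apply/nbhs_ballP; exists r => // s; rewrite /= /ball/= distrC => st; rewrite in_itv/= => sT.
rewrite distrC -(sipBl hX (Hu sT) (Hu tT) Hw).
apply: le_trans (sip_CSn hX (sipB hX (Hu sT) (Hu tT)) Hw) _.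
apply: le_trans (ler_pM _ _ (hr s sT st) (_ : _ <= nm w + 1)) _; rewrite ?sqrtr_ge0 ?lerDl//.
by rewrite divfK// gt_eqF.
Qed.

Lemma lipschitz_scalar w a b : ipset X w -> 0 < a -> a < b -> b < T ->
  `|ip X (u b) w - ip X (u a) w| <= (b - a) * (nm w * rateK).
Proof.
move=> Hw a0 ab bT; apply/ler_addgt0Pl => eps eps0.
pose g t := ip X (u t) w.
have ig : leb1.-integrable I (EFin \o g) by exact: ip_u_integrable.
pose del := eps / (2 * (M + 1)).
have M1 : 0 < 2 * (M + 1) by rewrite mulr_gt0// ltr_wpDl.
have del0 : 0 < del by exact: divr_gt0.
have w0 : 0 < nm w + 1 by rewrite ltr_wpDl// sqrtr_ge0.
have bet a' : 0 < a' < T -> exists2 r, 0 < r & forall t, 0 <= t <= T -> `|t - a'| < r -> `|g t - g a'| <= del.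
  move=> /andP[h1 h2]; have aT : 0 <= a' <= T by rewrite !ltW.
  have [r r0 hr] := bochner_C_near aT (divr_gt0 del0 w0).
  exists r => // s sT st; rewrite /g -(sipBl hX (Hu sT) (Hu aT) Hw).
  apply: le_trans (sip_CSn hX (sipB hX (Hu sT) (Hu aT)) Hw) _.
  apply: le_trans (ler_pM _ _ (hr s sT st) (_ : _ <= nm w + 1)) _; rewrite ?sqrtr_ge0 ?lerDl//.
  by rewrite divfK// gt_eqF.
have aT : 0 < a < T by rewrite a0 (lt_trans ab).
have b0T : 0 < b < T by rewrite bT (lt_trans a0).
have [r1 r10 h1] := bet _ aT; have [r2 r20 h2] := bet _ b0T.
pose e := Num.min (Num.min r1 r2) (T - b) / 2.
have m0 : 0 < Num.min (Num.min r1 r2) (T - b) by rewrite !lt_min r10 r20 subr_gt0.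
have e0 : 0 < e by exact: divr_gt0.
have em : e < Num.min (Num.min r1 r2) (T - b) by rewrite ltr_pdivrMr// ltr_pMr// ltr1n.
move: em; rewrite !lt_min => /andP[/andP[er1 er2] eT].
have beT : b + e < T by rewrite addrC -ltrBrDr.
have aeT : a + e < T by apply: lt_trans beT; rewrite ltrD2r.
have n1 t : a <= t <= a + e -> `|g t - g a| <= del.
  move=> /andP[q1 q2]; apply: h1.
    by rewrite (le_trans _ q1) ?(le_trans q2)// ltW// (lt_trans a0).
  rewrite ger0_norm ?subr_ge0// ltrBlDl; apply: le_lt_trans q2 _.
  by rewrite ltrD2l.
have n2 t : b <= t <= b + e -> `|g t - g b| <= del.
  move=> /andP[q1 q2]; apply: h2.
    by rewrite (le_trans _ q1) ?(le_trans q2)// ltW// (lt_trans a0).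
  rewrite ger0_norm ?subr_ge0// ltrBlDl; apply: le_lt_trans q2 _.
  by rewrite ltrD2l.
have [i1 [A1 E1 W1]] := window_value a0 e0 aeT ig n1.
have [i2 [A2 E2 W2]] := window_value (lt_trans a0 ab) e0 beT ig n2.
have E3 := etrans (RintegralB mI i1 i2) (f_equal2 (fun x y => x - y) E1 E2).
have W3 : `|A1 - A2| <= (b - a) * (nm w * rateK).
  rewrite -E3; apply: le_trans (weak_dt_window Hw a0 ab e0 beT).
  rewrite le_eqVlt; apply/orP; left; apply/eqP; congr (`| _ |).
  apply: eq_Rintegral => t _.
  by rewrite [RHS]mulrBl.
rewrite -/(g a) -/(g b) in W1 W2 *.
have Md : 2 * (M * del) <= eps.
  rewrite /del (_ : 2 * (M * (eps / (2 * (M + 1)))) = eps * (M / (M + 1))); last first.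
    by field; rewrite gt_eqF// ltr_wpDl.
  by rewrite ger_pMr// ler_pdivrMr ?mul1r ?lerDl// ltr_wpDl.
have -> : g b - g a = (A1 - g a) - (A2 - g b) - (A1 - A2).
  exact: ar_win.
apply: le_trans (ler_normB _ _) _; apply: lerD => //.
apply: le_trans (ler_normB _ _) _; apply: le_trans (lerD W1 W2) _.
by rewrite -mulr2n -mulr_natl.
Qed.

Lemma rateK_ge0 : 0 <= rateK.
Proof.
rewrite /rateK; apply: addr_ge0; apply: mulr_ge0 => //; try exact: B2_ge0.
by apply: mulr_ge0 => //; rewrite invr_ge0 ltW.
Qed.

(** Pairing the increment with itself. *)
Lemma lipschitz_inner a b : 0 < a -> a < b -> b < T -> nm (u b - u a) <= rateK * (b - a).
Proof.
move=> a0 ab bT.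
have aT : 0 <= a <= T by rewrite !ltW ?(lt_trans ab).
have b0T : 0 <= b <= T by rewrite !ltW ?(lt_trans a0).
have Hd := sipB hX (Hu b0T) (Hu aT).
have := lipschitz_scalar Hd a0 ab bT.
rewrite -(sipBl hX (Hu b0T) (Hu aT) Hd) ger0_norm; last exact: (sip_ge0 hX).
rewrite -(sip_sqrn hX Hd) -/(nm _) expr2 mulrCA.
have : 0 <= nm (u b - u a) by exact: sqrtr_ge0.
rewrite le_eqVlt => /predU1P[<- _|n0]; first by rewrite mulr_ge0 ?rateK_ge0// subr_ge0 ltW.
by rewrite ler_pM2l// [_ * rateK]mulrC.
Qed.

(** Continuity extends the bound to the end points of the time interval. *)
Lemma lipschitz_le a b : 0 <= a -> a <= b -> b <= T -> nm (u b - u a) <= rateK * (b - a).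
Proof.
move=> a0; rewrite le_eqVlt => /predU1P[->|ab] bT.
  by rewrite !subrr mulr0 /ipnorm (sip0l hX (sip0 hX)) sqrtr0.
have K0 := rateK_ge0.
have aT : 0 <= a <= T by rewrite a0 ltW// (lt_le_trans ab).
have b0T : 0 <= b <= T by rewrite bT ltW// (le_lt_trans a0).
apply/ler_addgt0Pl => eps eps0.
have e2 : 0 < eps / 2 by exact: divr_gt0.
have [r1 r10 h1] := bochner_C_near aT e2; have [r2 r20 h2] := bochner_C_near b0T e2.
pose h := Num.min (Num.min r1 r2) (b - a) / 3.
have m0 : 0 < Num.min (Num.min r1 r2) (b - a) by rewrite !lt_min r10 r20 subr_gt0.
have h0 : 0 < h by exact: divr_gt0.
have : h * 3 <= Num.min (Num.min r1 r2) (b - a) by rewrite divfK.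
rewrite !le_min => /andP[/andP[hr1 hr2] hba].
pose a' := a + h; pose b' := b - h.
have a'T : 0 <= a' <= T by rewrite /a'; apply/andP; split; lra.
have b'T : 0 <= b' <= T by rewrite /b'; apply/andP; split; lra.
have n1 : nm (u a' - u a) <= eps / 2.
  by apply: h1 => //; rewrite /a' addrAC subrr add0r gtr0_norm//; lra.
have n2 : nm (u b' - u b) <= eps / 2.
  by apply: h2 => //; rewrite /b' addrAC subrr add0r normrN gtr0_norm//; lra.
have n3 : nm (u b' - u a') <= rateK * (b - a).
  apply: le_trans (lipschitz_inner _ _ _) _; rewrite /a' /b'; try lra.
  by apply: ler_wpM2l => //; lra.
have Hd1 := sipB hX (Hu a'T) (Hu aT); have Hd2 := sipB hX (Hu b'T) (Hu b0T).
have Hd3 := sipB hX (Hu b'T) (Hu a'T).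
have -> : u b - u a = (u b' - u a') + ((u a' - u a) - (u b' - u b)).
  by rewrite addrA subrKA opprB addrC subrKA.
apply: le_trans (sip_tri hX Hd3 (sipB hX Hd1 Hd2)) _; rewrite addrC; apply: lerD => //.
apply: le_trans (sip_tri hX Hd1 (sipN hX Hd2)) _; rewrite (sip_nmN hX Hd2).
by rewrite [leRHS]splitr lerD.
Qed.

End pairing.

Lemma time_lipschitz (u : R -> V) : bochner_H T X 2 u -> bochner_C T X u ->
  exists2 K, 0 <= K & forall s t, 0 <= s <= T -> 0 <= t <= T ->
    nm (u t - u s) <= K * `|t - s|.
Proof.
move=> [_ [v1 h1 [_ [v2 h2 _]]]] uC; have [M M0 hM] := @dsstep_bnd R.
exists (rateK v1 v2 M); first by apply: rateK_ge0.
move=> s t /andP[s0 sT] /andP[t0 tT].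
have Hu r : 0 <= r <= T -> ipset X (u r) by case: uC => h _; exact: h.
have [st|/ltW ts] := leP s t.
  by rewrite ger0_norm ?subr_ge0//; exact: (lipschitz_le h1 h2 M0 hM uC s0 st tT).
have -> : nm (u t - u s) = nm (u s - u t).
  rewrite -[u t - u s]opprB; apply: (sip_nmN hX).
  by apply: (sipB hX); apply: Hu; apply/andP.
rewrite distrC ger0_norm ?subr_ge0//.
exact: (lipschitz_le h1 h2 M0 hM uC t0 ts sT).
Qed.

End time_lipschitz.

(** * Orthogonal projections and finite element spaces *)

Section finite_span.
Context {R : realType} {V : lmodType R}.
Implicit Types (S : set V) (b : V -> V -> R).

(** Peeling off one vector at a time is the form in which projections are built by
    induction. *)
Fixpoint span (l : seq V) : set V :=
  if l is x :: l' then [set v | exists c : R, span l' (v - c *: x)] else [set 0].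

Lemma span_sum (I : Type) (s : seq I) (f : I -> V) (c : I -> R) :
  span [seq f i | i <- s] (\sum_(i <- s) c i *: f i).
Proof.
elim: s => [|i s IH] /=; first by rewrite big_nil.
exists (c i); rewrite big_cons addrAC subrr add0r; exact: IH.
Qed.

Lemma spanD l u v : span l u -> span l v -> span l (u + v).
Proof.
elim: l u v => [|x l IH] u v /=; first by move=> -> ->; rewrite addr0.
move=> [c hc] [c' hc']; exists (c + c'); rewrite scalerDl opprD addrACA; exact: IH.
Qed.

Lemma spanZ l (k : R) v : span l v -> span l (k *: v).
Proof.
elim: l v => [|x l IH] v /=; first by move=> ->; rewrite scaler0.
by move=> [c /IH h]; exists (k * c); rewrite -scalerA -scalerBr.
Qed.

Lemma span0 l : span l 0.
Proof. by elim: l => [|x l IH] //=; exists 0; rewrite scale0r subr0. Qed.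

Definition lin S := [/\ S 0, forall u v, S u -> S v -> S (u + v) &
  forall (a : R) u, S u -> S (a *: u)].

Definition has_proj (Dom : set V) b S := forall u, Dom u -> exists2 w, S w &
  forall z, S z -> b (u - w) z = 0.

(** Gram-Schmidt on the length of the list. If S is not contained in the shorter
    span, it is spanned by a hyperplane and one vector s0; the projection onto the
    hyperplane is corrected by a multiple of the component r of s0 orthogonal to
    it. When r has norm zero, the Cauchy-Schwarz inequality makes the correction
    superfluous. *)
Lemma fin_proj Dom b S l : semi_ip Dom b -> S `<=` Dom -> lin S -> S `<=` span l ->
  has_proj Dom b S.
Proof.
move=> hb; elim: l S => [|x l IH] S SD [S0 SA SZ] Sl u Du.
  by exists 0 => // z /Sl ->; rewrite subr0 (sip0r hb Du).
pose S' := S `&` span l.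
have linS' : lin S'.
  split; first by split => //; exact: span0.
  - by move=> v w [? ?] [? ?]; split; [exact: SA|exact: spanD].
  - by move=> a v [? ?]; split; [exact: SZ|exact: spanZ].
have S'D : S' `<=` Dom by move=> v [/SD].
have P' : has_proj Dom b S' by apply: IH => // v [].
have [hS|] := pselect (S `<=` span l).
  have [w [Sw _] hw] := P' u Du; exists w => // z Sz; apply: hw; split => //; exact: hS.
move=> /existsNP[s0 /not_implyP[Ss0 ns0]].
have [c0 hc0] := Sl _ Ss0.
have c00 : c0 != 0.
  by apply: contra_notN ns0 => /eqP c0E; move: hc0; rewrite c0E scale0r subr0.
have dec v : S v -> exists k : R, S' (v - k *: s0).
  move=> Sv; have [c hc] := Sl _ Sv; exists (c / c0); split.
    by apply: SA => //; rewrite -scaleNr; exact: SZ.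
  have := spanD hc (spanZ (- (c / c0)) hc0).
  rewrite scalerBr scalerA mulNr divfK// scaleNr scaleNr opprK addrACA.
  by rewrite addNr addr0.
have Ds0 := SD _ Ss0.
(* r is the component of s0 orthogonal to the hyperplane S'. *)
have [q S'q hq] := P' s0 Ds0.
have [w S'w hw] := P' u Du.
have Dq := S'D _ S'q; have Dw := S'D _ S'w.
pose r := s0 - q.
have Sr : S r by apply: SA => //; rewrite -scaleN1r; apply: SZ; case: S'q.
have Dr := SD _ Sr.
have Duw := sipB hb Du Dw.
pose t := b (u - w) r / b r r.
have key : b (u - w - t *: r) r = 0.
  rewrite (sipBl hb) ?(sipZl hb)//; last exact: (sipZ hb).
  rewrite /t; have [r0|r0] := eqVneq (b r r) 0; last by rewrite divfK// subrr.
  rewrite r0 mulr0 subr0; apply/eqP; rewrite -sqrf_eq0.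
  rewrite eq_le sqr_ge0 andbT; apply: le_trans (sip_CS hb Duw Dr) _.
  by rewrite r0 mulr0.
exists (w + t *: r); first by apply: SA; [case: S'w|exact: SZ].
move=> z Sz; have [k S'z'] := dec z Sz; set z' := z - k *: s0 in S'z'.
have Dz' := S'D _ S'z'.
have Dtr := sipZ hb t Dr.
have orth y : S' y -> b (u - w - t *: r) y = 0.
  move=> S'y; have Dy := S'D _ S'y.
  by rewrite (sipBl hb Duw Dtr Dy) hw// (sipZl hb)// hq// mulr0 subr0.
have -> : z = z' + k *: (r + q) by rewrite /r subrK /z' subrK.
have D3 : Dom (u - w - t *: r) := sipB hb Duw Dtr.
rewrite opprD addrA (sipDr hb Dz' (sipZ hb k (sipD hb Dr Dq)) D3) (sipZr hb _ (sipD hb Dr Dq) D3).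
by rewrite (sipDr hb Dr Dq D3) key (orth _ S'z') (orth _ S'q) addr0 mulr0 addr0.
Qed.

Lemma oprojP Dom b S u : has_proj Dom b S -> Dom u ->
  S (oproj b S u) /\ forall z, S z -> b (u - oproj b S u) z = 0.
Proof.
move=> hP Du; have [w Sw hw] := hP u Du.
by apply: (@xgetPex _ 0 [set w | S w /\ forall z, S z -> b (u - w) z = 0]); exists w.
Qed.

Lemma oproj_in b S u : S 0 -> S (oproj b S u).
Proof. by move=> S0; rewrite /oproj; case: xgetP => // w -> []. Qed.

(** The projection of a difference need not be the difference of the projections,
    which are unique only up to elements of norm zero; orthogonality suffices. *)
Lemma oproj_contract Dom b S u v : semi_ip Dom b -> S `<=` Dom -> lin S ->
  has_proj Dom b S -> Dom u -> Dom v ->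
  Num.sqrt (b (oproj b S u - oproj b S v) (oproj b S u - oproj b S v)) <=
  Num.sqrt (b (u - v) (u - v)).
Proof.
move=> hb SD [_ SA SZ] hP Du Dv.
have [Su hu] := oprojP hP Du; have [Sv hv] := oprojP hP Dv.
set pu := oproj b S u in Su hu *; set pv := oproj b S v in Sv hv *.
have Sw : S (pu - pv) by apply: SA => //; rewrite -scaleN1r; exact: SZ.
have [Dpu Dpv Dw] := And3 (SD _ Su) (SD _ Sv) (SD _ Sw).
have Duv := sipB hb Du Dv.
have E : b (u - v) (pu - pv) = b (pu - pv) (pu - pv).
  have := hu _ Sw; have := hv _ Sw.
  rewrite (sipBl hb Dv Dpv Dw) (sipBl hb Du Dpu Dw) => h1 h2.
  rewrite (sipBl hb Du Dv Dw) (sipBl hb Dpu Dpv Dw).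
  by lra.
have := sip_CSn hb Duv Dw; rewrite E ger0_norm ?(sip_ge0 hb)//.
rewrite -{1}(sip_sqrn hb Dw) expr2.
have := sqrtr_ge0 (b (pu - pv) (pu - pv)); rewrite le_eqVlt => /predU1P[<- _|p].
  exact: sqrtr_ge0.
by rewrite ler_pM2r.
Qed.

End finite_span.

Section vector_span.
Context {R : realType} {V : lmodType R} (I : finType).

Definition single (i : I) (v : V) : I -> V := fun j => if j == i then v else 0.

Lemma span_vec (J : finType) (f : J -> V) (u : I -> V) :
  (forall i, exists c : J -> R, u i = \sum_j c j *: f j) ->
  span [seq single p.1 (f p.2) | p <- enum {: I * J}] u.
Proof.
move=> /choice[c hc].
have -> : u = \sum_(p <- enum {: I * J}) c p.1 p.2 *: single p.1 (f p.2).
  rewrite big_enum/= -(pair_bigA _ (fun i j => c i j *: single i (f j)))/=.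
  apply/funext => i; rewrite hc fct_sumE (bigD1 i)//= [X in _ = _ + X]big1; last first.
    move=> k ki; rewrite fct_sumE big1// => j _.
    rewrite -[LHS]/(c k j *: (single k (f j) i)) /single eq_sym (negbTE ki).
    exact: scaler0.
  rewrite addr0 fct_sumE; apply: eq_bigr => j _.
  by rewrite -[RHS]/(c i j *: (single i (f j) i)) /single eqxx.
exact: span_sum.
Qed.

End vector_span.

Section fe_spaces.
Context {R : realType} {d : nat} (Om : cube R d) (Th : seq 'M[R]_(d.+1, d)).
Local Notation scal := ('rV[R]_d -> R).
Local Notation D := (cube_set Om).
Local Notation L := (side Om).
Local Notation H1 := (sobolev Om 1).
Hypothesis cover : \bigcup_(K in [set` Th]) cell K = D.

Definition mono (k : nat) := {ffun 'I_d -> 'I_k.+1}.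

(** Cells overlap along faces. Attaching a point to the first cell that contains it
    makes every piecewise polynomial an exact linear combination of these functions,
    with no exceptional set. *)
Definition pwmono k (p : 'I_(size Th) * mono k) : scal := fun x =>
  if `[< cell (nth 0 Th p.1) (red Om x) /\
         forall j : nat, (j < p.1)%N -> ~ cell (nth 0 Th j) (red Om x) >]
  then \prod_i red Om x ord0 i ^+ p.2 i else 0.

Lemma pwmono_span k v : Defs.periodic Om v ->
  (forall K, K \in Th -> poly_on k (cell K) v) ->
  exists c : 'I_(size Th) * mono k -> R, v = \sum_p c p *: pwmono p.
Proof.
move=> pv hv.
have hc (j : 'I_(size Th)) : exists c : mono k -> R, forall x, cell (nth 0 Th j) x ->
    v x = \sum_a c a * \prod_i x ord0 i ^+ a i.
  have [c hc] := hv _ (mem_nth 0 (ltn_ord j)).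
  exists (fun a : mono k => if (\sum_i a i <= k)%N then c a else 0) => x /hc ->.
  rewrite big_mkcond/=; apply: eq_bigr => a _.
  by case: ifP => // _; rewrite mul0r.
have [c {}hc] := choice hc.
exists (fun p => c p.1 p.2); apply/funext => x.
rewrite fct_sumE -(pair_bigA _ (fun j a => (c j a *: pwmono (j, a)) x))/=.
have [j [hj1 hj2]] : exists j : 'I_(size Th), cell (nth 0 Th j) (red Om x) /\
    forall j' : nat, (j' < j)%N -> ~ cell (nth 0 Th j') (red Om x).
  have : D (red Om x) by exact: red_cube.
  rewrite -cover => -[K /= KTh xK].
  have ex : exists n, (n < size Th)%N && `[< cell (nth 0 Th n) (red Om x) >].
    by exists (index K Th); rewrite index_mem KTh/= nth_index//; apply/asboolP.
  (* Only the first cell that contains the reduction of x contributes. *)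
  case: (ex_minnP ex) => n /andP[nT /asboolP hn] hmin.
  exists (Ordinal nT); split => // j' j'n hj'.
  have := hmin j'; rewrite (ltn_trans j'n nT)/= => /(_ (asboolT hj')).
  by rewrite leqNgt j'n.
rewrite (bigD1 j)//= [X in _ = _ + X]big1; last first.
  move=> j' jj'; rewrite big1// => a _.
  rewrite -[LHS]/(c j' a * pwmono (j', a) x) /pwmono/=.
  case: ifPn => [/asboolP[h1 h2]|_]; last by rewrite mulr0.
  exfalso; case: (ltngtP j j') => h.
  - exact: h2 h hj1.
  - exact: hj2 h h1.
  - by move: jj'; rewrite -val_eqE/= h eqxx.
rewrite addr0 -(red_periodic x pv) (hc j)//; apply: eq_bigr => a _.
rewrite -[RHS]/(c j a * pwmono (j, a) x) /pwmono/=.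
by case: ifPn => // /asboolP[].
Qed.

(** Finitely many polynomials on a bounded set. *)
Lemma pw_bnd k v : pm Om v -> (forall K, K \in Th -> poly_on k (cell K) v) -> bnd Om v.
Proof.
move=> pv hv.
pose B i : R := `|corner Om ord0 i| + L.
have hB x i : D x -> `|x ord0 i| <= B i.
  move=> /(_ i); rewrite !mxE => /andP[h1 h2].
  have L0 := side_gt0 Om.
  have n1 := ler_norm (corner Om ord0 i); have n2 := ler_norm (- corner Om ord0 i).
  by rewrite normrN in n2; rewrite /B ler_norml; apply/andP; split; lra.
have sub K x : K \in Th -> cell K x -> D x by move=> KT Kx; rewrite -cover; exists K.
have hK K : K \in Th -> exists M : R, forall x, cell K x -> `|v x| <= M.
  move=> KT; have [c hc] := hv K KT.
  exists (\sum_(a : mono k | (\sum_i a i <= k)%N) `|c a| * \prod_i B i ^+ a i) => x Kx.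
  rewrite (hc x Kx); apply: le_trans (ler_norm_sum _ _ _) _; apply: ler_sum => a _.
  rewrite normrM ler_wpM2l// normr_prod; apply: ler_prod => i _.
  rewrite normr_ge0/= normrX lerXn2r// ?nnegrE//; last exact: hB (sub _ _ KT Kx).
  by apply: addr_ge0 => //; exact: ltW (side_gt0 Om).
have [M hM] : exists M : R, forall K x, K \in Th -> cell K x -> `|v x| <= M.
  have gen (l : seq 'M[R]_(d.+1, d)) : (forall K, K \in l -> K \in Th) ->
      exists M : R, forall K x, K \in l -> cell K x -> `|v x| <= M; last by apply: (gen Th).
  elim: l => [|K l IH] sl; first by exists 0.
  have [M1 h1] := hK K (sl K (mem_head _ _)).
  have [|M2 h2] := IH; first by move=> K' h; apply: sl; rewrite inE h orbT.
  exists (Num.max M1 M2) => K' x; rewrite inE => /predU1P[->|K'l] K'x.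
    by rewrite le_max h1.
  by rewrite le_max (h2 K')// orbT.
apply: (pm_bnd (M := M) pv) => x; rewrite -cover => -[K /= KT Kx]; exact: hM Kx.
Qed.

Lemma poly_onD k (A : set 'rV[R]_d) u v : poly_on k A u -> poly_on k A v -> poly_on k A (u + v).
Proof.
move=> [c hc] [c' hc']; exists (fun a => c a + c' a) => x Ax.
rewrite -[LHS]/(u x + v x) hc// hc'// -big_split; apply: eq_bigr => a _.
by rewrite /= mulrDl.
Qed.

Lemma poly_onZ k (A : set 'rV[R]_d) (s : R) u : poly_on k A u -> poly_on k A (s *: u).
Proof.
move=> [c hc]; exists (fun a => s * c a) => x Ax.
rewrite -[LHS]/(s * u x) hc// mulr_sumr; apply: eq_bigr => a _.
by rewrite mulrA.
Qed.

Lemma poly_on_cst k (A : set 'rV[R]_d) (s : R) : poly_on k A (fun=> s).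
Proof.
exists (fun a => if a == [ffun=> ord0] then s else 0) => x _.
rewrite (bigD1 [ffun=> ord0])/=; last by rewrite big1// => i _; rewrite ffunE.
rewrite eqxx [X in _ = _ + X]big1 ?addr0; last by move=> a /andP[_ /negbTE ->]; rewrite mul0r.
by rewrite big1 ?mulr1// => i _; rewrite ffunE.
Qed.

Lemma Vh_H1 v : Vh Om Th v -> ipset H1 v. Proof. by case. Qed.

Lemma lin_Vh : lin (Vh Om Th).
Proof.
split.
- split; first by have [] := H1_cst Om 0.
  by move=> K _; exact: (poly_on_cst 2 (cell K) 0).
- move=> u v [Hu pu] [Hv pv]; split; first by have [] := H1D Hu Hv.
  by move=> K KT; apply: poly_onD; [exact: pu|exact: pv].
- move=> a u [Hu pu]; split; first by have [] := H1Z a Hu.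
  by move=> K KT; apply: poly_onZ; exact: pu.
Qed.

Lemma Vh_cst (s : R) : Vh Om Th (fun=> s).
Proof. by split; [have [] := H1_cst Om s|move=> K _; exact: poly_on_cst]. Qed.

Lemma lin_Qh : lin (Qh Om Th).
Proof.
split.
- split; last by move=> K _; exact: (poly_on_cst 1 (cell K) 0).
    split; first by exact: bnd_L2 (bnd_cst Om 0).
    by rewrite /= spint_cst mul0r.
  by have [] := H1_cst Om 0.
- move=> u v [[Lu iu] Hu pu] [[Lv iv] Hv pv]; split; last first.
  + by move=> K KT; apply: poly_onD; [exact: pu|exact: pv].
  + by have [] := H1D Hu Hv.
  split; first exact: L2D.
  by rewrite /= in iu iv *; rewrite (spintD (L2_int Lu) (L2_int Lv)) iu iv addr0.
- move=> a u [[Lu iu] Hu pu]; split; last first.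
  + by move=> K KT; apply: poly_onZ; exact: pu.
  + by have [] := H1Z a Hu.
  split; first exact: L2Z.
  by rewrite /= in iu *; rewrite (spintZ a (L2_int Lu)) iu mulr0.
Qed.

Lemma Vh_bnd v : Vh Om Th v -> bnd Om v.
Proof. by move=> [/H1_L2/L2_pm pv hv]; exact: pw_bnd pv hv. Qed.

Lemma Vh_span v : Vh Om Th v -> span [seq pwmono p | p <- enum {: 'I_(size Th) * mono 2}] v.
Proof.
move=> [/H1_L2/L2_pm[pv _] hv]; have [c ->] := pwmono_span pv hv.
by rewrite -big_enum; exact: span_sum.
Qed.

Lemma Qh_span v : Qh Om Th v -> span [seq pwmono p | p <- enum {: 'I_(size Th) * mono 1}] v.
Proof.
move=> [_ /H1_L2/L2_pm[pv _] hv]; have [c ->] := pwmono_span pv hv.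
by rewrite -big_enum; exact: span_sum.
Qed.

Lemma Vhv_span v : Vhv Om Th v -> span [seq single p.1 (pwmono p.2) |
  p <- enum {: 'I_d * ('I_(size Th) * mono 2)}] v.
Proof.
move=> hv; apply: span_vec => i; have [/H1_L2/L2_pm[pv _] hvi] := hv i.
exact: pwmono_span pv hvi.
Qed.

End fe_spaces.

(** * The time grid and averages over time intervals *)

Section grid.
Context {R : realType}.
Variables (T : R) (N : nat).
Hypotheses (hT : 0 < T) (hN : (0 < N)%N).
Local Notation leb1 := (@lebesgue_measure R).
Local Notation tg := (tgrid T N).
Local Notation tau := (tau T N).
Local Notation tint := (tint T N).

Lemma tau_gt0 : 0 < tau.
Proof. by rewrite divr_gt0// ltr0n. Qed.
Lemma tg0 : tg 0 = 0. Proof. by rewrite /tgrid mul0r. Qed.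
Lemma tgS n : tg n.+1 = tg n + tau.
Proof. by rewrite /tgrid -natr1 mulrDl mul1r. Qed.
Lemma tgN : tg N = T.
Proof. by rewrite /tgrid /Defs.tau mulrC divfK// pnatr_eq0 -lt0n. Qed.
Lemma tg_mono n m : (n <= m)%N -> tg n <= tg m.
Proof. by move=> nm; rewrite ler_wpM2r ?ler_nat// ltW// tau_gt0. Qed.
Lemma tg_ge0 n : 0 <= tg n.
Proof. by rewrite mulr_ge0// ltW// tau_gt0. Qed.
Lemma tgP n : (0 < n)%N -> tg n = tg n.-1 + tau.
Proof. by case: n => // n _; rewrite tgS. Qed.
Lemma tg_lt n : (0 < n)%N -> tg n.-1 < tg n.
Proof. by move=> n0; rewrite (tgP n0) ltrDl tau_gt0. Qed.
Lemma tg_le n : tg n.-1 <= tg n.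
Proof. by apply: tg_mono; exact: leq_pred. Qed.

Lemma grid_uniq n m t : (0 < n)%N -> (0 < m)%N ->
  tg n.-1 < t <= tg n -> tg m.-1 < t <= tg m -> n = m.
Proof.
wlog nm : n m / (n <= m)%N.
  move=> h n0 m0 h1 h2; case: (leqP n m) => [/h|/ltnW/h]; first exact.
  by move=> /(_ m0 n0 h2 h1) ->.
move=> n0 m0 /andP[h1 h2] /andP[h3 h4]; apply/eqP; rewrite eqn_leq nm/= leqNgt.
apply/negP => lt; have : tg n <= tg m.-1 by apply: tg_mono; rewrite -ltnS prednK.
by move=> /(le_trans h2) /(lt_le_trans h3); rewrite ltxx.
Qed.

Lemma grid_ex t : 0 < t <= T -> exists2 n, (1 <= n <= N)%N & tg n.-1 < t <= tg n.
Proof.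
move=> /andP[t0 tT].
have ex : exists n, t <= tg n by exists N; rewrite tgN.
case: (ex_minnP ex) => n tn hmin.
have n0 : (0 < n)%N.
  by case: n tn {hmin} => //; rewrite tg0 leNgt t0.
exists n; first by rewrite n0 hmin// tgN.
rewrite tn andbT ltNge; apply/negP => /hmin.
by rewrite leqNgt prednK ?leqnn.
Qed.

Lemma ends_null n : leb1.-negligible [set tg n.-1; tg n].
Proof.
have n1 (c : R) : leb1.-negligible [set c].
  by exists [set c]; split => //; exact: lebesgue_measure_set1.
exact: negligibleU (n1 _) (n1 _).
Qed.

(** Equality is required at interior points only, because the data of the discrete
    problem have derivatives there only. *)
Lemma tint_eq n g g' : continuous g' ->
  (forall t, tg n.-1 < t < tg n -> g t = g' t) -> tint n g = tint n g'.
Proof.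
move=> cg' gg'; apply: Rintegral_ae => //.
  by apply: measurable_funTS; exact: continuous_measurable_fun.
apply: negligibleS (ends_null n) => t /= h.
apply: contrapT => /not_orP[h1 h2]; apply: h; rewrite in_itv/= => /andP[t1 t2].
apply: gg'; rewrite lt_neqAle t1 andbT lt_neqAle t2 andbT.
by apply/andP; split; apply/eqP => // h; apply: h1.
Qed.

Definition cell_time n t : R := (t - tg n.-1) * tau^-1.
Local Notation th := cell_time.

Lemma Cinf_th n : Cinf (th n).
Proof. by apply: CinfM; [apply: CinfB; [exact: Cinf_id|]|]; exact: Cinf_cst. Qed.

Lemma continuous_th_affine n (a b : R) : continuous (fun t => a + th n t * b).
Proof.
apply: Cinf_continuous; apply: CinfD; first exact: Cinf_cst.
by apply: CinfM; [exact: Cinf_th|exact: Cinf_cst].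
Qed.

Lemma tint_cst n c : (0 < n)%N -> tint n (fun=> c) = tau * c.
Proof.
move=> n0; have cc : continuous (fun _ : R => c) by exact: Cinf_continuous (Cinf_cst c).
have dc t : is_derive t (1 : R) (fun t : R => t * c) c.
  have d1 : is_derive t (1 : R) (fun t : R => t) 1 by exact: is_derive_id.
  have d2 : is_derive t (1 : R) (fun=> c) 0 by exact: is_derive_cst.
  have := is_deriveM d1 d2; rewrite scaler0 add0r => h; apply: is_derive_eq h _.
  by rewrite [LHS]mulr1.
by rewrite [LHS](FTC2 (tg_le n) cc dc) -mulrBl (tgP n0) addrAC subrr add0r.
Qed.

Lemma tint_affine n a b : (0 < n)%N -> tint n (fun t => a + th n t * b) = tau * (a + 2^-1 * b).
Proof.
move=> n0; have t0 := tau_gt0.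
have cc := @continuous_th_affine n a b.
pose F t := t * a + (th n t * th n t) * (tau / 2 * b).
have dF t : is_derive t (1 : R) F (a + th n t * b).
  have dth : is_derive t (1 : R) (th n) tau^-1.
    have := @is_derive_aff R id (fun=> 1) (tg n.-1) tau^-1 t (fun s => is_derive_id _ _).
    by rewrite mul1r.
  have d1 : is_derive t (1 : R) (fun t : R => t) 1 by exact: is_derive_id.
  have d2 : is_derive t (1 : R) (fun=> a) 0 by exact: is_derive_cst.
  have d3 : is_derive t (1 : R) (fun=> tau / 2 * b) 0 by exact: is_derive_cst.
  have := is_deriveD (is_deriveM d1 d2) (is_deriveM (is_deriveM dth dth) d3).
  move=> h; apply: is_derive_eq h _; rewrite !scaler0 !add0r.
  rewrite -[LHS]/(a * 1 + (tau / 2 * b) * (th n t * tau^-1 + th n t * tau^-1)).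
  by field; rewrite gt_eqF.
have h1 : th n (tg n) = 1 by rewrite /cell_time (tgP n0) addrAC subrr add0r mulfV// gt_eqF.
have h0 : th n (tg n.-1) = 0 by rewrite /cell_time subrr mul0r.
rewrite [LHS](FTC2 (tg_le n) cc dF) /F h1 h0 (tgP n0).
by field.
Qed.

Lemma sum_Rintegral (D : set (measurableTypeR R)) (mD : measurable D) (s : seq nat) (h : nat -> R -> R) :
  (forall i, leb1.-integrable D (EFin \o h i)) ->
  leb1.-integrable D (EFin \o (fun t => \sum_(i <- s) h i t)) /\
  \int[leb1]_(t in D) (\sum_(i <- s) h i t) = \sum_(i <- s) \int[leb1]_(t in D) h i t.
Proof.
move=> ih; elim: s => [|i s [IH1 IH2]].
  have -> : (fun t : R => \sum_(i <- [::]) h i t) = cst 0.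
    by apply/funext => t; rewrite big_nil.
  split; first exact: integrable0.
  by rewrite big_nil /Rintegral integral0.
have -> : (fun t : R => \sum_(j <- i :: s) h j t) = (fun t => h i t + \sum_(j <- s) h j t).
  by apply/funext => t; rewrite big_cons.
rewrite big_cons -IH2 -RintegralD//; split => //.
by apply: eq_integrable (integrableD mD (ih i) IH1).
Qed.

Lemma Rint_cut n (G : R -> R) : (1 <= n <= N)%N -> continuous G ->
  leb1.-integrable `[0, T] (EFin \o (fun t => \1_(`]tg n.-1, tg n]%classic : set (measurableTypeR R)) t * G t)) /\
  \int[leb1]_(t in `[0, T]) (\1_(`]tg n.-1, tg n]%classic : set (measurableTypeR R)) t * G t) = tint n G.
Proof.
move=> /andP[n0 nN] cG; pose A := `]tg n.-1, tg n]%classic : set (measurableTypeR R).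
have mA : measurable A by exact: measurable_itv.
have iG := continuous_itv_integrable 0 T cG.
have E : (fun t : R => \1_A t * G t) = (G \_ A).
  apply/funext => t; rewrite indicE patchE; case: ifP => _; rewrite ?mul1r ?mul0r//.
have sub : A `<=` `[0, T]%classic.
  move=> t; rewrite /A/= !in_itv/= => /andP[h1 h2].
  by rewrite (le_trans (tg_ge0 n.-1) (ltW h1))/= -tgN (le_trans h2)// tg_mono.
have iA : leb1.-integrable `[0, T] (EFin \o (fun t => \1_A t * G t)).
  apply: (@le_integrable _ _ _ leb1 `[0, T]%classic (measurable_itv _) _ _ _ _ iG).
    apply/measurable_EFinP; apply: measurable_funTS; apply: measurable_funM.
      exact: measurable_indic mA.
    exact: continuous_measurable_fun.
  move=> t _ /=; rewrite lee_fin normrM indicE; case: (_ \in _) => /=.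
    by rewrite normr1 mul1r.
  by rewrite normr0 mul0r.
split => //; rewrite -/A E.
rewrite /Rintegral (_ : (fun x : R => ((G \_ A) x)%:E) = (EFin \o G) \_ A); last first.
  by apply/funext => t; rewrite !patchE; case: ifP.
rewrite -integral_mkcondr (_ : _ `&` A = A); last by apply: setIidr.
have := @Rintegral_itv_obnd_cbnd R (tg n.-1) (BRight (tg n)) G; rewrite /Rintegral => -> //.
by apply: integrableS (continuous_itv_integrable (tg n.-1) (tg n) cG) => //; exact: subset_itv_oc_cc.
Qed.

Lemma int0T_split (F : R -> R) (G : nat -> R -> R) : (forall n, continuous (G n)) ->
  (forall n t, (1 <= n <= N)%N -> tg n.-1 < t <= tg n -> F t = G n t) ->
  \int[leb1]_(t in `[0, T]) F t = \sum_(i < N) tint i.+1 (G i.+1).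
Proof.
move=> cG FG.
pose h i t := if (i < N)%N then \1_(`]tg i, tg i.+1]%classic : set (measurableTypeR R)) t * G i.+1 t else 0 : R.
have hi i : leb1.-integrable `[0, T] (EFin \o h i) /\
    ((i < N)%N -> \int[leb1]_(t in `[0, T]) h i t = tint i.+1 (G i.+1)).
  have [iN|iN] := boolP (i < N)%N; last first.
    by rewrite /h (negbTE iN); split => //; exact: integrable0.
  rewrite /h iN; by have [] := @Rint_cut i.+1 (G i.+1) _ (cG _).
have [iH EH] := sum_Rintegral (measurable_itv `[0, T]) (iota 0 N) (fun i => (hi i).1).
transitivity (\int[leb1]_(t in `[0, T]) (\sum_(i <- iota 0 N) h i t)).
  apply: Rintegral_ae => //.
    by apply/measurable_EFinP; exact: measurable_int iH.
  have n0 : leb1.-negligible [set (0 : R)] by exists [set 0]; split => //; exact: lebesgue_measure_set1.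
  apply: negligibleS n0 => t /= ht; apply: contrapT => t0; apply: ht.
  rewrite in_itv/= => /andP[t1 t2].
  have [|n nN tn] := @grid_ex t.
    by rewrite t2 andbT lt_neqAle t1 andbT; apply/eqP => /esym.
  rewrite (FG n t nN tn); have /andP[np nN'] := nN.
  have nr : n.-1 \in iota 0 N by rewrite mem_iota/= add0n prednK.
  rewrite (big_rem n.-1)//= big_seq [X in _ = _ + X]big1.
    rewrite addr0 /h prednK// nN' indicE mem_set ?mul1r//.
  move=> i; rewrite mem_rem_uniq ?iota_uniq// inE => /andP[ni iN].
  rewrite /h; case: ifP => // _; rewrite indicE memNset ?mul0r//=.
  rewrite in_itv/= => ti; move/eqP: ni; apply.
  by rewrite (@grid_uniq n i.+1 t np _ tn ti).
rewrite EH -(big_mkord xpredT (fun i => tint i.+1 (G i.+1))) /index_iota subn0.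
rewrite big_seq [RHS]big_seq; apply: eq_bigr => i; rewrite mem_iota/= add0n => iN.
by have [_ ->] := hi i.
Qed.

End grid.

Section pi0bar.
Context {R : realType} {V : lmodType R} (X : ipspace V).
Variables (T : R) (N : nat).
Hypotheses (hT : 0 < T) (hN : (0 < N)%N).
Hypotheses (hX : semi_ip (ipset X) (ip X)) (hX0 : forall v, ip X v 0 = 0).
Local Notation leb1 := (@lebesgue_measure R).
Local Notation tg := (tgrid T N).
Local Notation tint := (tint T N).
Local Notation P0 := (Ppw T N 0).
Local Notation bar := (pi0bar T N X).
Local Notation Inn n t := (tg n.-1 < t <= tg n).

Lemma P0_val (S : set V) z n : P0 S z -> (1 <= n <= N)%N ->
  exists2 a, S a & forall t, Inn n t -> z t = a.
Proof.
move=> /(_ n) h nN; have [a [Sa aE]] := h nN; exists (a ord0) => // t /aE ->.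
by rewrite big_ord1 expr0 scale1r.
Qed.

Lemma P0_cst (S : set V) a : S a -> P0 S (fun=> a).
Proof. by move=> Sa n _; exists (fun=> a); split => // t _; rewrite big_ord1 expr0 scale1r. Qed.

Lemma P0_vals (S : set V) (a : nat -> V) z : (forall n, (1 <= n <= N)%N -> S (a n)) ->
  (forall n t, (1 <= n <= N)%N -> Inn n t -> z t = a n) -> P0 S z.
Proof.
move=> Sa za n nN; exists (fun=> a n); split => [_|t tn]; first exact: Sa.
by rewrite big_ord1 expr0 scale1r; exact: za.
Qed.

(** Testing with functions that live on one interval localizes the orthogonality
    that defines averages in time. *)
Definition cutoff n (a : V) (t : R) : V := if Inn n t then a else 0.

Lemma P0_cutoff (S : set V) n a : S 0 -> S a -> P0 S (cutoff n a).
Proof.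
move=> S0 Sa; apply: (@P0_vals S (fun m => if m == n then a else 0)) => [m _|m t mN tm].
  by case: ifP.
rewrite /cutoff; case: eqP => [<-|mn]; first by rewrite tm.
case: ifP => // tn; exfalso; apply: mn.
have /andP[m0 _] := mN; have n0 : (0 < n)%N.
  case: n tn {Sa} => // /andP[h1 h2]; have /= := lt_le_trans h1 h2.
  by rewrite ltxx.
exact: (grid_uniq hT hN m0 n0 tm tn).
Qed.

Let X0 : ipset X 0 := sip0 hX.

Lemma bar_P0 u : P0 (ipset X) (bar u).
Proof.
have h0 : P0 (ipset X) (0 : R -> V) by exact: (@P0_vals _ (fun=> 0)).
exact: (oproj_in _ _ h0).
Qed.

Lemma bar_test u n a z (g : R -> R) : bar u != (0 : R -> V) -> (1 <= n <= N)%N -> ipset X z ->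
  (forall t, Inn n t -> bar u t = a) -> (forall t, Inn n t -> ip X (u t - a) z = g t) ->
  continuous g -> tint n g = 0.
Proof.
move=> nz nN Xz ua ug cg.
have : forall z, P0 (ipset X) z ->
    \int[leb1]_(t in `[0, T]) ip X ((u - bar u) t) (z t) = 0.
  by move: nz; rewrite /pi0bar /oproj; case: xgetP => [w _ [_ h] _|_]; [exact: h|rewrite eqxx].
move=> /(_ (cutoff n z) (P0_cutoff n X0 Xz)).
rewrite (@int0T_split R T N hT hN _ (fun m => if m == n then g else cst 0)).
- have /andP[n0 nN'] := nN; have nl : (n.-1 < N)%N by rewrite prednK.
  rewrite (bigD1 (Ordinal nl))//= prednK// eqxx big1 ?addr0// => i ij.
  rewrite ifF; last first.
    by apply: contra_neqF ij => /eqP iE; apply: val_inj; rewrite /= -iE.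
  by rewrite [LHS](tint_cst hT hN 0)// mulr0.
- by move=> m; case: eqP => // _; exact: cst_continuous.
- move=> m t mN tm; rewrite /cutoff; case: eqP => [mn|mn].
    rewrite mn in tm; rewrite tm -[LHS]/(ip X (u t - bar u t) z) (ua t tm).
    exact: ug.
  rewrite ifF//; apply/negP => tn; apply: mn.
  by have [/andP[m0 _] /andP[n0 _]] := (mN, nN); exact: (grid_uniq hT hN m0 n0 tm tn).
Qed.

(** However u depends on time, its average has values in the space of u up to elements of
    norm zero: the part of the average orthogonal to Y is orthogonal to u, hence to
    itself. If no projection exists, the average is 0 by convention and the claim
    is trivial. *)
Lemma bar_sub (Y : set V) u n : Y `<=` ipset X -> lin Y -> has_proj (ipset X) (ip X) Y ->
  (forall t, Y (u t)) -> (1 <= n <= N)%N ->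
  exists a y, [/\ ipset X a, Y y, forall t, Inn n t -> bar u t = a & ip X (a - y) (a - y) = 0].
Proof.
move=> YX [Y0 _ _] hY uY nN.
have [/eqP b0|nz] := boolP (bar u == 0).
  exists 0, 0; split => //; first by move=> t _; rewrite b0.
  by rewrite subrr hX0.
have [a Xa ua] := P0_val (bar_P0 u) nN.
have [y Yy hy] := hY a Xa.
have Xy := YX _ Yy; have Xd := sipB hX Xa Xy.
exists a, y; split => //.
have /andP[n0 _] := nN.
have gE t : Inn n t -> ip X (u t - a) (a - y) = - ip X a (a - y).
  move=> _; have Xu := YX _ (uY t).
  by rewrite (sipBl hX Xu Xa Xd) (sipC hX Xu Xd) hy// sub0r.
have := bar_test nz nN Xd ua gE (@Cinf_continuous R _ (@Cinf_cst R _)).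
rewrite [LHS](tint_cst hT hN _ n0) => /eqP; rewrite mulf_eq0 gt_eqF ?tau_gt0//= oppr_eq0 => /eqP a0.
by rewrite (sipBl hX Xa Xy Xd) a0 (sipC hX Xy Xd) hy// subrr.
Qed.

(** The average of an affine function is its value at the midpoint. Being affine is
    required on all intervals, since the projection is defined by conditions over
    the whole time interval and must be shown to exist. *)
Lemma bar_affine u n : (forall m, (1 <= m <= N)%N -> exists a0 a1, [/\ ipset X a0, ipset X a1 &
    forall t, Inn m t -> u t = a0 + cell_time T N m t *: a1]) ->
  forall a0 a1, (1 <= n <= N)%N -> ipset X a0 -> ipset X a1 ->
  (forall t, Inn n t -> u t = a0 + cell_time T N n t *: a1) ->
  exists a, [/\ ipset X a, forall t, Inn n t -> bar u t = a &
    ip X (a - (a0 + 2^-1 *: a1)) (a - (a0 + 2^-1 *: a1)) = 0].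
Proof.
move=> hu a0 a1 nN Xa0 Xa1 uE.
have [f hf] : exists f : nat -> V * V, forall m, (1 <= m <= N)%N ->
    [/\ ipset X (f m).1, ipset X (f m).2 & forall t, Inn m t -> u t = (f m).1 + cell_time T N m t *: (f m).2].
  have : forall m, exists p : V * V, (1 <= m <= N)%N ->
    [/\ ipset X p.1, ipset X p.2 & forall t, Inn m t -> u t = p.1 + cell_time T N m t *: p.2].
    move=> m; have [mN|mN] := boolP (1 <= m <= N)%N; last by exists (0, 0).
    by have [b0 [b1 [h1 h2 h3]]] := hu m mN; exists (b0, b1).
  by move=> /choice[f hf]; exists f.
pose mid m := (f m).1 + 2^-1 *: (f m).2.
have Xmid m : (1 <= m <= N)%N -> ipset X (mid m).
  by move=> mN; have [h1 h2 _] := hf m mN; apply: (sipD hX) => //; exact: (sipZ hX).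
pose idx (t : R) : nat := xget 0%N [set m | (1 <= m <= N)%N /\ Inn m t].
have idxE m t : (1 <= m <= N)%N -> Inn m t -> idx t = m.
  move=> mN tm; have : [set m | (1 <= m <= N)%N /\ Inn m t] (idx t).
    by apply: (@xgetPex _ 0%N [set m | (1 <= m <= N)%N /\ Inn m t]); exists m.
  move=> [/andP[i0 _] ti]; have /andP[m0 _] := mN.
  exact: (grid_uniq hT hN i0 m0 ti tm).
pose w (t : R) := mid (idx t).
have P0w : P0 (ipset X) w by apply: (@P0_vals _ mid) => // m t mN tm; rewrite /w (idxE m).
(* The candidate w: on each interval, an affine function minus its midpoint value
   has integral zero against constants. *)
have ow z : P0 (ipset X) z -> \int[leb1]_(t in `[0, T]) ip X ((u - w) t) (z t) = 0.
  move=> Pz; have [c hc] : exists c : nat -> V, forall m, (1 <= m <= N)%N ->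
      ipset X (c m) /\ forall t, Inn m t -> z t = c m.
    have : forall m, exists c, (1 <= m <= N)%N -> ipset X c /\ forall t, Inn m t -> z t = c.
      move=> m; have [mN|mN] := boolP (1 <= m <= N)%N; last by exists 0.
      by have [c Xc cE] := P0_val Pz mN; exists c.
    by move=> /choice[c hc]; exists c.
  rewrite (@int0T_split R T N hT hN _ (fun m t => - 2^-1 * ip X (f m).2 (c m) + cell_time T N m t * ip X (f m).2 (c m))).
  - rewrite big1// => i _; rewrite (tint_affine hT hN)//.
    by rewrite mulNr addNr mulr0.
  - by move=> m; exact: continuous_th_affine.
  - move=> m t mN tm; have [h1 h2 h3] := hf m mN; have [Xc cE] := hc m mN.
    rewrite -[LHS]/(ip X (u t - w t) (z t)) (cE t tm) (h3 t tm) /w (idxE m t mN tm) /mid.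
    rewrite opprD addrACA subrr add0r -scalerBl (sipZl hX)//.
    by rewrite mulrBl addrC mulNr.
have hw : P0 (ipset X) (bar u) /\ forall z, P0 (ipset X) z ->
    \int[leb1]_(t in `[0, T]) ip X ((u - bar u) t) (z t) = 0.
  apply: (@xgetPex _ 0 [set w | P0 (ipset X) w /\ forall z, P0 (ipset X) z ->
    \int[leb1]_(t in `[0, T]) ip X ((u - w) t) (z t) = 0]).
  by exists w.
have [_ ho] := hw; have [a Xa aE] := P0_val (bar_P0 u) nN.
have Xm : ipset X (a0 + 2^-1 *: a1) by apply: (sipD hX) => //; exact: (sipZ hX).
exists a; split => //; set m := a0 + _ in Xm *.
have Xd := sipB hX Xa Xm.
have /andP[n0 nN'] := nN.
have := ho _ (@P0_cutoff _ n _ X0 Xd).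
rewrite (@int0T_split R T N hT hN _ (fun k => if k == n then (fun t =>
   (ip X a0 (a - m) - ip X a (a - m)) + cell_time T N n t * ip X a1 (a - m)) else cst 0)).
- have nl : (n.-1 < N)%N by rewrite prednK.
  rewrite (bigD1 (Ordinal nl))//= prednK// eqxx big1 ?addr0; last first.
    move=> i ij; rewrite ifF; last first.
      by apply: contra_neqF ij => /eqP iE; apply: val_inj; rewrite /= -iE.
    by rewrite [LHS](tint_cst hT hN 0)// mulr0.
  rewrite (tint_affine hT hN)// => /eqP; rewrite mulf_eq0 gt_eqF ?tau_gt0//= => /eqP h.
  rewrite (sipBl hX Xa Xm Xd) {1 3}/m (sipDl hX Xa0 (sipZ hX _ Xa1) Xd) (sipZl hX _ Xa1 Xd).
  by move: h; rewrite -/m; set p := ip X a0 _; set q := ip X a1 _; set r := ip X a _; lra.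
- by move=> k; case: eqP => // _; [exact: continuous_th_affine|exact: cst_continuous].
- move=> k t kN tk; rewrite /cutoff; case: eqP => [kn|kn].
    rewrite kn in tk; rewrite tk -[LHS]/(ip X (u t - bar u t) (a - m)) (aE t tk) (uE t tk).
    have Xt := sipZ hX (cell_time T N n t) Xa1.
    by rewrite (sipBl hX (sipD hX Xa0 Xt) Xa Xd) (sipDl hX Xa0 Xt Xd) (sipZl hX _ Xa1 Xd) addrAC.
  rewrite ifF//; apply/negP => tn; apply: kn.
  by have /andP[k0 _] := kN; exact: (grid_uniq hT hN k0 n0 tk tn).
Qed.

End pi0bar.

(** * Nonlinear estimates in space *)

Section scalar_potential.
Context {R : realType} (f : R -> R) (f1 : R) (f2 f3 : nat -> R).
Hypothesis hf : potential_ok f f1 f2 f3.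
Local Notation f' := (derive1 f).
Local Notation f'' := (derive1n 2 f).

Lemma pot_is_derive j t : (j < 4)%N ->
  is_derive t (1 : R) (derive1n j f) (derive1n j.+1 f t).
Proof.
move=> j4; case: hf => -[df _] _ _ _ _; split; first exact: df.
by rewrite -derive1E.
Qed.

Lemma pot_continuous j : (j < 4)%N -> continuous (derive1n j f).
Proof. by move=> j4; apply: is_derive_continuous => t; exact: pot_is_derive. Qed.

Let ratio_l (x y c : R) : x < c -> c < y -> 0 <= (y - c) / (y - x) <= 1.
Proof.
move=> c1 c2; have xy : 0 < y - x by rewrite subr_gt0 (lt_trans c1).
apply/andP; split; first by apply: divr_ge0; rewrite ?subr_ge0 ltW// -subr_gt0.
by rewrite ler_pdivrMr// mul1r lerD2l lerN2 ltW.
Qed.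

Let ratio_r (x y c : R) : y < c -> c < x -> 0 <= (c - y) / (x - y) <= 1.
Proof.
move=> c1 c2; have xy : 0 < x - y by rewrite subr_gt0 (lt_trans c1).
apply/andP; split; first by apply: divr_ge0; rewrite ?subr_ge0 ltW// -subr_gt0.
by rewrite ler_pdivrMr// mul1r lerD2r ltW.
Qed.

Lemma pot_mvt j x y : (j < 4)%N -> exists2 c, 0 <= c <= 1 &
  derive1n j f x - derive1n j f y = derive1n j.+1 f (y + c * (x - y)) * (x - y).
Proof.
move=> j4.
have aux a b : a < b -> exists2 c, a < c < b & derive1n j f b - derive1n j f a = derive1n j.+1 f c * (b - a).
  move=> ab; have [|c] := MVT ab (fun t _ => @pot_is_derive j t j4).
    by apply: continuous_subspaceT; exact: pot_continuous.
  by rewrite in_itv/= => ? ?; exists c.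
have [xy|yx|->] := ltgtP x y.
- have [c /andP[c1 c2] E] := aux _ _ xy.
  have d0 : 0 < y - x by rewrite subr_gt0.
  exists ((y - c) / (y - x)).
    exact: ratio_l c1 c2.
  have -> : y + (y - c) / (y - x) * (x - y) = c by field; rewrite gt_eqF.
  by rewrite -[x - y]opprB mulrN -E opprB.
- have [c /andP[c1 c2] E] := aux _ _ yx.
  have d0 : 0 < x - y by rewrite subr_gt0.
  exists ((c - y) / (x - y)).
    exact: ratio_r c1 c2.
  by rewrite divfK ?gt_eqF// (addrC y) subrK.
- by exists 0; rewrite ?lexx ?ler01// !subrr mulr0.
Qed.

Lemma convex_norm (x y c : R) : 0 <= c <= 1 -> `|y + c * (x - y)| <= `|x| + `|y|.
Proof.
move=> /andP[c0 c1]; rewrite (_ : _ + _ = c * x + (1 - c) * y); last by ring.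
have c1' : 0 <= 1 - c by rewrite subr_ge0.
apply: le_trans (ler_normD _ _) _; rewrite !normrM (ger0_norm c0) (ger0_norm c1').
by apply: lerD; rewrite ler_piMl// lerBlDr lerDl.
Qed.

Lemma convex_sqr (x y c : R) : 0 <= c <= 1 -> (y + c * (x - y)) ^+ 2 <= x ^+ 2 + y ^+ 2.
Proof.
move=> /andP[c0 c1]; have h : 0 <= c * (1 - c) * (x - y) ^+ 2.
  by apply: mulr_ge0; [apply: mulr_ge0 => //; rewrite subr_ge0|exact: sqr_ge0].
have -> : (y + c * (x - y)) ^+ 2 = c * x ^+ 2 + (1 - c) * y ^+ 2 - c * (1 - c) * (x - y) ^+ 2 by ring.
apply: (@le_trans _ _ (c * x ^+ 2 + (1 - c) * y ^+ 2)); first by rewrite gerBl.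
by apply: lerD; rewrite ler_piMl ?sqr_ge0// lerBlDr lerDl.
Qed.

Lemma pot_norm k s : (k <= 4)%N -> `|derive1n k f s| <= `|f2 k| + `|f3 k| * `|s| ^+ (4 - k).
Proof.
move=> k4; case: hf => _ _ _ _ /(_ k s k4) /le_trans; apply.
apply: lerD; first exact: ler_norm.
by rewrite ler_wpM2r ?exprn_ge0// ler_norm.
Qed.

Lemma pot_lip x y : `|f' x - f' y| <= (`|f2 2| + `|f3 2| * (x ^+ 2 + y ^+ 2)) * `|x - y|.
Proof.
have [c c01 ->] := @pot_mvt 1 x y isT.
rewrite normrM ler_wpM2r//; apply: le_trans (pot_norm _ _) _ => //.
by rewrite lerD2l ler_wpM2l// real_normK ?num_real// convex_sqr.
Qed.

Lemma pot_taylor x y : `|f' x - f' y - f'' y * (x - y)| <=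
  (`|f2 3| + `|f3 3| * (`|x| + `|y|)) * (x - y) ^+ 2.
Proof.
have [c /andP[c0 c1] E1] := @pot_mvt 1 x y isT.
rewrite [f' x - f' y]E1 -mulrBl.
have [c' /andP[c0' c1'] E2] := @pot_mvt 2 (y + c * (x - y)) y isT.
rewrite [X in `|X * _|]E2 !normrM -mulrA.
have h : `|y + c * (x - y) - y| * `|x - y| <= (x - y) ^+ 2.
  rewrite addrAC subrr add0r normrM (ger0_norm c0) -mulrA -expr2 real_normK ?num_real//.
  by rewrite ler_piMl// sqr_ge0.
apply: ler_pM; [by []|exact: mulr_ge0| |exact: h].
apply: le_trans (pot_norm _ _) _ => //; rewrite lerD2l ler_wpM2l// expr1.
have -> : y + c' * (y + c * (x - y) - y) = y + (c' * c) * (x - y) by ring.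
by apply: convex_norm; rewrite mulr_ge0//= mulr_ile1.
Qed.

(** Two applications of the mean value theorem and the lower bound of the second
    derivative. *)
Lemma pot_frel x y : - (f1 / 2) * (x - y) ^+ 2 <= Defs.frel f x y.
Proof.
pose h t := Defs.frel f t y + f1 / 2 * (t - y) ^+ 2.
pose h' t := f' t - f' y + f1 * (t - y).
have dh t : is_derive t (1 : R) h (h' t).
  have d0 := @pot_is_derive 0 t isT.
  have di : is_derive t (1 : R) (fun t : R => t) 1 by exact: is_derive_id.
  have dc (c : R) : is_derive t (1 : R) (fun=> c) 0 by exact: is_derive_cst.
  have dy := is_deriveB di (dc y).
  have := is_deriveD (is_deriveB (is_deriveB d0 (dc (f y))) (is_deriveM (dc (f' y)) dy))
    (is_deriveM (dc (f1 / 2)) (is_deriveM dy dy)).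
  have -> : ((derive1n 0 f - (fun=> f y)) - ((fun=> f' y) * ((fun t => t) - (fun=> y))) +
     (fun=> f1 / 2) * (((fun t => t) - (fun=> y)) * ((fun t => t) - (fun=> y)))) = h :> (R -> R).
    apply/funext => s; rewrite /h /Defs.frel expr2.
    by rewrite -[LHS]/(f s - f y - f' y * (s - y) + f1 / 2 * ((s - y) * (s - y))).
  move=> hh; apply: is_derive_eq hh _; rewrite !subr0 !scaler0 !addr0.
  rewrite -[LHS]/(f' t - f' y * 1 + f1 / 2 * ((t - y) * 1 + (t - y) * 1)) /h'.
  by field.
have hx : 0 <= h x.
  have [c c01 E] : exists2 c, 0 <= c <= 1 & h x = h' (y + c * (x - y)) * (x - y).
    have hy : h y = 0 by rewrite /h /Defs.frel !subrr mulr0 expr0n mulr0 subrr addr0.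
    have ch := is_derive_continuous dh.
    have [xy|yx|->] := ltgtP x y.
    - have [|c] := MVT xy (fun t _ => dh t); first exact: continuous_subspaceT.
      rewrite in_itv/= hy sub0r => /andP[c1 c2] E.
      have d0 : 0 < y - x by rewrite subr_gt0.
      exists ((y - c) / (y - x)).
        exact: ratio_l c1 c2.
      have -> : y + (y - c) / (y - x) * (x - y) = c by field; rewrite gt_eqF.
      by rewrite -[x - y]opprB mulrN -E opprK.
    - have [|c] := MVT yx (fun t _ => dh t); first exact: continuous_subspaceT.
      rewrite in_itv/= hy subr0 => /andP[c1 c2] E.
      have d0 : 0 < x - y by rewrite subr_gt0.
      exists ((c - y) / (x - y)).
        exact: ratio_r c1 c2.
      by rewrite divfK ?gt_eqF// (addrC y) subrK.
    - by exists 0; rewrite ?lexx ?ler01// !subrr mulr0 hy.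
  have [c' _ E2] := @pot_mvt 1 (y + c * (x - y)) y isT.
  move: c01 => /andP[c0 c1].
  have ff : 0 <= f'' (y + c' * (y + c * (x - y) - y)) + f1.
    by case: hf => _ _ _ /(_ (y + c' * (y + c * (x - y) - y))) h2 _; rewrite -lerBlDr sub0r.
  rewrite E /h' [f' _ - f' y]E2 -mulrDl.
  move: ff; move: (f'' _ + f1) => K K0.
  have -> : K * (y + c * (x - y) - y) * (x - y) = K * (c * (x - y) ^+ 2) by ring.
  by apply: mulr_ge0 => //; apply: mulr_ge0 => //; exact: sqr_ge0.
by rewrite mulNr -subr_ge0 opprK addrC; move: hx; rewrite /h addrC.
Qed.

End scalar_potential.

Section space_estimates.
Context {R : realType} {d : nat} (Om : cube R d).
Hypothesis hd : d = 2%N \/ d = 3%N.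
Local Notation scal := ('rV[R]_d -> R).
Local Notation vect := ('I_d -> 'rV[R]_d -> R).
Local Notation L2 := (L2 Om).
Local Notation H1 := (sobolev Om 1).
Local Notation Hv := (sobolevv Om 1).
Local Notation bnd := (bnd Om).
Local Notation n1 := (ipnorm H1).
Local Notation nv := (ipnorm Hv).
Local Notation gr u := (Num.sqrt (gip Om u u)).
Implicit Types (a p q u v w e : scal) (i j : 'I_d).

Let hL := semi_ip_L2 Om.
Let hH := semi_ip_H1 Om.
Let hG := semi_ip_gip Om.

(** All functions of the discrete problem are bounded and in H1; boundedness
    gives a meaning to products, while the estimates are in terms of H1 norms. *)
Definition BH v := bnd v /\ ipset H1 v.

Lemma bnd_comp (h : R -> R) v : continuous h -> bnd v -> bnd (fun x => h (v x)).
Proof.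
move=> ch [pv [M' hM']]; split; first exact: pm_comp.
pose M : R := M'; have hM x : `|v x| <= M by exact: hM'.
have M0 : 0 <= M by exact: le_trans (hM 0).
have cn : {within `[- M, M], continuous (fun t => `|h t|)}.
  apply: continuous_subspaceT => t; apply: continuous_comp; first exact: ch.
  exact: norm_continuous.
have MM : - M <= M by rewrite (le_trans _ M0)// oppr_le0.
have [c _ hc] := EVT_max MM cn.
exists `|h c| => x; apply: hc; rewrite in_itv/= -ler_norml; exact: hM.
Qed.

Lemma bnd_norm v : bnd v -> bnd (fun x => `|v x|).
Proof. by move=> bv; apply: (bnd_comp (h := fun t => `|t|)) => //; exact: norm_continuous. Qed.

Lemma bndX v k : bnd v -> bnd (fun x => v x ^+ k).
Proof. by move=> bv; apply: (bnd_comp (h := fun t => t ^+ k)) => //; exact: exprn_continuous. Qed.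

Lemma H1_split v : ipset H1 v -> n1 v ^+ 2 = ip L2 v v + gip Om v v.
Proof. by move=> Hv; rewrite (sip_sqrn hH). Qed.

Lemma L2_le_n1 v : ipset H1 v -> Num.sqrt (ip L2 v v) <= n1 v.
Proof.
move=> Hv; rewrite ler_sqrt ?lerDl; first exact: (sip_ge0 hG).
exact: (sip_ge0 hH).
Qed.

Lemma gr_le_n1 v : ipset H1 v -> gr v <= n1 v.
Proof.
move=> Hv; rewrite ler_sqrt ?lerDr; first by apply: (sip_ge0 hL); exact: H1_L2.
exact: (sip_ge0 hH).
Qed.

Lemma wpartial_le v i : ipset H1 v -> Num.sqrt (ip L2 (wpartial Om i v) (wpartial Om i v)) <= gr v.
Proof.
move=> Hv; rewrite ler_sqrt ?(sip_ge0 hG)// /gip (bigD1 i)//= lerDl.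
by apply: sumr_ge0 => j _; apply: (sip_ge0 hL); exact: H1_wL2.
Qed.

Definition c4 : R := Num.sqrt (C4 Om).

Lemma c4_ge0 : 0 <= c4. Proof. exact: sqrtr_ge0. Qed.

Let prod_arith (X A B c a b' : R) : 0 <= A -> 0 <= B -> 0 <= c -> 0 <= a -> 0 <= b' ->
  A <= c * a ^+ 2 -> B <= c * b' ^+ 2 -> `|X| <= A * B -> Num.sqrt X <= c * a * b'.
Proof.
move=> A0 B0 c0 a0 b0 hA hB hX.
have h0 : 0 <= c * a * b' by rewrite !mulr_ge0.
rewrite -[leRHS](ger0_norm h0) -sqrtr_sqr ler_sqrt ?sqr_ge0//.
apply: le_trans (ler_norm _) _; apply: le_trans hX _.
apply: le_trans (ler_pM A0 B0 hA hB) _.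
by rewrite le_eqVlt; apply/orP; left; apply/eqP; ring.
Qed.

(** The Cauchy-Schwarz inequality leaves the L4 norms of both factors. *)
Lemma prod_L2 u v : BH u -> BH v ->
  Num.sqrt (ip L2 (fun x => u x * v x) (fun x => u x * v x)) <= c4 * n1 u * n1 v.
Proof.
move=> [bu Hu] [bv Hv].
have b2u : bnd (fun x => u x * u x) by exact: bndM.
have b2v : bnd (fun x => v x * v x) by exact: bndM.
have C0 : 0 <= C4 Om.
  rewrite /C4 mulr_ge0 ?invr_ge0 ?ltW ?vol_gt0//.
  have L0 := side_gt0 Om; rewrite mulr_gt0//; first by rewrite ltr_wpDr// mulr_ge0// ltW.
  by rewrite ltr_wpDr// mulr_ge0// sqr_ge0.
have q4 w : bnd w -> ipset H1 w ->
    Num.sqrt (ip L2 (fun x => w x * w x) (fun x => w x * w x)) <= c4 * n1 w ^+ 2.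
  move=> bw Hw; have n0 : 0 <= n1 w ^+ 2 by exact: sqr_ge0.
  rewrite /c4 -[n1 w ^+ 2]ger0_norm// -sqrtr_sqr -sqrtrM// ler_sqrt.
    rewrite (sip_sqrn hH Hw); apply: le_trans (ladyzhenskaya hd bw Hw).
    rewrite le_eqVlt; apply/orP; left; apply/eqP; congr (spint Om _).
    by apply/funext => x; ring.
  by rewrite mulr_ge0 ?sqr_ge0.
have E : ip L2 (fun x => u x * v x) (fun x => u x * v x) =
    ip L2 (fun x => u x * u x) (fun x => v x * v x).
  by congr (spint Om _); apply/funext => x; ring.
have CS := sip_CSn hL (bnd_L2 b2u) (bnd_L2 b2v).
rewrite E; apply: (prod_arith (sqrtr_ge0 _) (sqrtr_ge0 _) c4_ge0 _ _ (q4 u bu Hu) (q4 v bv Hv) CS); exact: sqrtr_ge0.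
Qed.

Definition conv p (U : vect) (psi : scal) : R :=
  \sum_i ip L2 (fun x => p x * U i x) (wpartial Om i psi).

Let sqrt_le_sum (F : 'I_d -> R) i : (forall j, 0 <= F j) ->
  Num.sqrt (F i) <= Num.sqrt (\sum_j F j).
Proof.
move=> F0; rewrite ler_sqrt; last by apply: sumr_ge0 => j _; exact: F0.
by rewrite (bigD1 i)//= lerDl; apply: sumr_ge0 => j _; exact: F0.
Qed.

Lemma comp_le_nv (U : vect) i : ipset Hv U -> n1 (U i) <= nv U.
Proof.
move=> HU; have h j : 0 <= ip H1 (U j) (U j) by exact: (sip_ge0 hH).
exact: sqrt_le_sum h.
Qed.

Lemma conv_le p (U : vect) psi : BH p -> (forall i, BH (U i)) -> ipset H1 psi ->
  `|conv p U psi| <= d%:R * c4 * n1 p * nv U * gr psi.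
Proof.
move=> bp bU Hpsi; have HU : ipset Hv U by move=> i; case: (bU i).
apply: le_trans (ler_norm_sum _ _ _) _.
have -> : d%:R * c4 * n1 p * nv U * gr psi = \sum_(i < d) (c4 * n1 p * nv U * gr psi).
  by rewrite sumr_const card_ord -!mulrA mulr_natl.
apply: ler_sum => i _.
have bpU : bnd (fun x => p x * U i x) by apply: bndM; [case: bp|case: (bU i)].
apply: le_trans (sip_CSn hL (bnd_L2 bpU) (H1_wL2 i Hpsi)) _.
apply: ler_pM; rewrite ?sqrtr_ge0//; last exact: wpartial_le.
apply: le_trans (prod_L2 bp (bU i)) _; apply: ler_wpM2l; last exact: comp_le_nv.
by rewrite mulr_ge0 ?c4_ge0 ?sqrtr_ge0.
Qed.

Lemma ip_abs u v : bnd u -> bnd v ->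
  spint Om (fun x => `|u x| * `|v x|) <= Num.sqrt (ip L2 u u) * Num.sqrt (ip L2 v v).
Proof.
move=> bu bv; have bu' := bnd_norm bu; have bv' := bnd_norm bv.
have E w : ip L2 (fun x => `|w x|) (fun x => `|w x|) = ip L2 w w.
  congr (spint Om _); apply/funext => x.
  by rewrite -expr2 real_normK ?num_real// expr2.
have := sip_CSn hL (bnd_L2 bu') (bnd_L2 bv'); rewrite !E; apply: le_trans.
exact: ler_norm.
Qed.

Lemma n1_cst (c : R) : n1 (fun=> c) = `|c| * Num.sqrt (vol Om).
Proof.
have [Hc hc] := H1_cst Om c; have v0 := ltW (vol_gt0 Om).
rewrite -(ger0_norm (sqrtr_ge0 (vol Om))) -normrM -sqrtr_sqr exprMn sqr_sqrtr//.
rewrite /ipnorm; congr Num.sqrt.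
rewrite -[LHS]/(ip L2 (fun=> c) (fun=> c) + gip Om (fun=> c) (fun=> c)).
have -> : gip Om (fun=> c) (fun=> c) = 0.
  apply: big1 => i _; apply: aeq_ip00 => //; exact: L2_pm (H1_wL2 i Hc).
by rewrite addr0 /= spint_cst expr2.
Qed.

Lemma BH_cst (c : R) : BH (fun=> c).
Proof. by split; [exact: bnd_cst|have [] := H1_cst Om c]. Qed.

Let four_arith (X A B c a e q : R) : 0 <= A -> 0 <= B ->
  A <= c * a * e -> B <= c * e * q -> X <= A * B -> X <= c ^+ 2 * a * q * e ^+ 2.
Proof.
move=> A0 B0 hA hB /le_trans; apply; apply: le_trans (ler_pM A0 B0 hA hB) _.
by rewrite le_eqVlt; apply/orP; left; apply/eqP; ring.
Qed.


(** The Cauchy-Schwarz inequality for p e and e q leaves four L4 norms. *)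
Lemma four_factors p e q : BH p -> BH e -> BH q ->
  spint Om (fun x => `|p x| * `|e x| * (`|e x| * `|q x|)) <=
  c4 ^+ 2 * n1 p * n1 q * n1 e ^+ 2.
Proof.
move=> bp be bq.
have b1 : bnd (fun x => p x * e x) by apply: bndM; [case: bp|case: be].
have b2 : bnd (fun x => e x * q x) by apply: bndM; [case: be|case: bq].
have := ip_abs b1 b2.
rewrite (_ : (fun x => `|p x * e x| * `|e x * q x|) = (fun x => `|p x| * `|e x| * (`|e x| * `|q x|))); last first.
  by apply/funext => x; rewrite !normrM.
exact: (four_arith (sqrtr_ge0 _) (sqrtr_ge0 _) (prod_L2 bp be) (prod_L2 be bq)).
Qed.

Lemma spint_abs v : bnd v -> `|spint Om v| <= spint Om (fun x => `|v x|).
Proof. by move=> bv; apply: le_normr_Rintegral; [exact: measurable_cube|exact: bnd_int]. Qed.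

Let Knl_arith (c a S b' M g e : R) :
  c ^+ 2 * (a * S) * g * e + (b' * (c ^+ 2 * M * g * e) + b' * (c ^+ 2 * M * g * e)) <=
  c ^+ 2 * (a * S + 2 * b' * M) * g * e.
Proof. by rewrite le_eqVlt; apply/orP; left; apply/eqP; ring. Qed.

Let Kml_arith (c a S b' M e : R) :
  a * S * e + (b' * (c * M ^+ 2 * e) + b' * (c * M ^+ 2 * e)) <=
  (a * S + 2 * b' * c * M ^+ 2) * e.
Proof. by rewrite le_eqVlt; apply/orP; left; apply/eqP; ring. Qed.

Section potential.
Variables (f : R -> R) (f1 : R) (f2 f3 : nat -> R).
Hypothesis hf : potential_ok f f1 f2 f3.
Local Notation f' := (derive1 f).
Local Notation f'' := (derive1n 2 f).

Let cf : continuous f := pot_continuous hf (j := 0) isT.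
Let cf' : continuous f' := pot_continuous hf (j := 1) isT.
Let cf'' : continuous f'' := pot_continuous hf (j := 2) isT.

Definition Knl (M : R) : R := c4 ^+ 2 * (`|f2 3| * Num.sqrt (vol Om) + 2 * `|f3 3| * M).

(** The third derivative of the potential grows linearly, so that the remainder
    times g is a product of at most four H1 functions. *)
Lemma nonlinear_remainder p q e g M : BH p -> BH q -> BH e -> BH g ->
  (forall x, e x = p x - q x) -> n1 p <= M -> n1 q <= M ->
  `|spint Om (fun x => (f' (p x) - f' (q x) - f'' (q x) * (p x - q x)) * g x)| <=
  Knl M * n1 g * n1 e ^+ 2.
Proof.
move=> bp bq be bg eE pM qM.
have [Bp Bq Be Bg] := And4 bp.1 bq.1 be.1 bg.1.
have b1 : bnd (fun x => (f' (p x) - f' (q x) - f'' (q x) * (p x - q x)) * g x).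
  apply: bndM => //.
  have h1 := bnd_comp cf' Bp; have h2 := bnd_comp cf' Bq; have h3 := bnd_comp cf'' Bq.
  rewrite (_ : (fun x => _) = ((fun x => f' (p x)) + (-1) *: (fun x => f' (q x))) +
     (-1) *: (fun x => f'' (q x) * e x)).
    by apply: bndD; [apply: bndD => //|]; apply: bndZ => //; exact: bndM.
  apply/funext => x; rewrite -eE.
  by rewrite -[RHS]/(f' (p x) + -1 * f' (q x) + -1 * (f'' (q x) * e x)) !mulN1r.
apply: le_trans (spint_abs b1) _.
have bn := bnd_norm.
pose G (a : scal) x := `|a x| * `|e x| * (`|e x| * `|g x|).
have bG a : bnd a -> bnd (G a).
  by move=> ba; apply: bndM; apply: bndM; apply: bn.
pose c1 : scal := fun=> `|f2 3|; pose one := c1.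
have bc : BH c1 by exact: BH_cst.
have iG a : bnd a -> Sint Om (G a) by move=> ba; apply: bnd_int; exact: bG.
apply: (@le_trans _ _ (spint Om (fun x => G c1 x + (`|f3 3| * G p x + `|f3 3| * G q x)))).
  apply: le_spint.
  - by apply: bnd_int; exact: bn.
  - apply: SintD; first exact: iG bc.1.
    by apply: SintD; apply: SintZ; exact: iG.
  - move=> x _; rewrite normrM.
    apply: le_trans (ler_wpM2r (normr_ge0 _) (pot_taylor hf _ _)) _.
    rewrite /G /c1 -eE -(real_normK (num_real (e x))) (ger0_norm (normr_ge0 (f2 3))).
    by rewrite le_eqVlt; apply/orP; left; apply/eqP; ring.
rewrite spintD; [|exact: iG bc.1|by apply: SintD; apply: SintZ; exact: iG].
rewrite spintD; [|by apply: SintZ; exact: iG|by apply: SintZ; exact: iG].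
rewrite !spintZ; [|exact: iG|exact: iG].
have F1 := four_factors bc be bg; have F2 := four_factors bp be bg; have F3 := four_factors bq be bg.
have g0 : 0 <= n1 g by exact: sqrtr_ge0.
have e0 : 0 <= n1 e ^+ 2 by exact: sqr_ge0.
have k0 : 0 <= c4 ^+ 2 by exact: sqr_ge0.
have up a : n1 a <= M -> c4 ^+ 2 * n1 a * n1 g * n1 e ^+ 2 <= c4 ^+ 2 * M * n1 g * n1 e ^+ 2.
  by move=> aM; rewrite !ler_wpM2r// ler_wpM2l.
have E : n1 c1 = `|f2 3| * Num.sqrt (vol Om) by rewrite n1_cst normr_id.
rewrite E in F1.
apply: le_trans (lerD F1 (lerD (ler_wpM2l (normr_ge0 _) (le_trans F2 (up _ pM)))
   (ler_wpM2l (normr_ge0 _) (le_trans F3 (up _ qM))))) _.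
exact: Knl_arith.
Qed.

Definition Kml (M : R) : R := `|f2 2| * Num.sqrt (vol Om) + 2 * `|f3 2| * c4 * M ^+ 2.

(** The second derivative of the potential grows quadratically: again at most four
    H1 factors, one of which is the constant 1. *)
Lemma lipschitz_mean p q e M : BH p -> BH q -> BH e ->
  (forall x, e x = p x - q x) -> n1 p <= M -> n1 q <= M ->
  `|spint Om (fun x => f' (p x) - f' (q x))| <= Kml M * n1 e.
Proof.
move=> bp bq be eE pM qM.
have [Bp Bq Be] := And3 bp.1 bq.1 be.1.
have b1 : bnd (fun x => f' (p x) - f' (q x)).
  have h1 := bnd_comp cf' Bp; have h2 := bnd_comp cf' Bq.
  rewrite (_ : (fun x => _) = (fun x => f' (p x)) + (-1) *: (fun x => f' (q x))).
    by apply: bndD => //; exact: bndZ.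
  by apply/funext => x; rewrite -[RHS]/(f' (p x) + -1 * f' (q x)) mulN1r.
apply: le_trans (spint_abs b1) _.
pose G (a : scal) x := `|a x * a x| * `|e x|.
have bG a : bnd a -> bnd (G a).
  by move=> ba; apply: bndM; apply: bnd_norm => //; exact: bndM.
have iG a : bnd a -> Sint Om (G a) by move=> ba; apply: bnd_int; exact: bG.
pose c1 : scal := fun=> `|f2 2|.
have bc : BH c1 by exact: BH_cst.
have i0 : Sint Om (fun x => `|c1 x| * `|e x|).
  by apply: bnd_int; apply: bndM; apply: bnd_norm => //; case: bc.
apply: (@le_trans _ _ (spint Om (fun x => `|c1 x| * `|e x| + (`|f3 2| * G p x + `|f3 2| * G q x)))).
  apply: le_spint.
  - by apply: bnd_int; exact: bnd_norm.
  - by apply: SintD => //; apply: SintD; apply: SintZ; exact: iG.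
  - move=> x _; apply: le_trans (pot_lip hf _ _) _.
    rewrite /G /c1 -eE !normrM -!expr2 !(real_normK (num_real _)) (ger0_norm (normr_ge0 (f2 2))).
    by rewrite le_eqVlt; apply/orP; left; apply/eqP; ring.
rewrite spintD; [|exact: i0|by apply: SintD; apply: SintZ; exact: iG].
rewrite spintD; [|by apply: SintZ; exact: iG|by apply: SintZ; exact: iG].
rewrite !spintZ; [|exact: iG|exact: iG].
have F0 := ip_abs bc.1 Be.
have Fa a : BH a -> n1 a <= M -> spint Om (G a) <= c4 * M ^+ 2 * n1 e.
  move=> ba aM; have [Ba Ha] := ba; have := ip_abs (bndM Ba Ba) Be; move/le_trans; apply.
  apply: ler_pM; rewrite ?sqrtr_ge0//; last by apply: L2_le_n1; case: be.
  apply: le_trans (prod_L2 ba ba) _; rewrite -mulrA -expr2 ler_wpM2l ?c4_ge0//.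
  by rewrite lerXn2r// nnegrE ?sqrtr_ge0// (le_trans _ aM)// sqrtr_ge0.
have E : Num.sqrt (ip L2 c1 c1) <= `|f2 2| * Num.sqrt (vol Om).
  by apply: le_trans (L2_le_n1 bc.2) _; rewrite n1_cst normr_id.
have F0' : spint Om (fun x => `|c1 x| * `|e x|) <= `|f2 2| * Num.sqrt (vol Om) * n1 e.
  apply: le_trans F0 _; apply: ler_pM; rewrite ?sqrtr_ge0//.
  by apply: L2_le_n1; case: be.
apply: le_trans (lerD F0' (lerD (ler_wpM2l (normr_ge0 _) (Fa p bp pM))
   (ler_wpM2l (normr_ge0 _) (Fa q bq qM)))) _.
exact: Kml_arith.
Qed.

(** The quartic growth of the potential is exactly what the L4 norm controls. *)
Lemma spint_potential p : BH p ->
  0 <= spint Om (fun x => f (p x)) <= `|f2 0| * vol Om + `|f3 0| * (c4 ^+ 2 * n1 p ^+ 4).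
Proof.
move=> [bp Hp]; have bf := bnd_comp cf bp.
apply/andP; split; first by apply: spint_ge0 => x _; case: hf.
have b4 := bndX 4 bp.
apply: (@le_trans _ _ (spint Om (fun x => `|f2 0| + `|f3 0| * p x ^+ 4))).
  apply: le_spint; [exact: bnd_int| |].
    by apply: SintD; [exact: Sint_cst|apply: SintZ; exact: bnd_int].
  move=> x _; apply: le_trans (ler_norm _) _; have := pot_norm hf (p x) (isT : (0 <= 4)%N).
  have E4 : `|p x| ^+ 4 = p x ^+ 4 by rewrite -normrX ger0_norm// (exprM _ 2 2) sqr_ge0.
  by rewrite subn0 E4.
rewrite spintD; [|exact: Sint_cst|by apply: SintZ; exact: bnd_int].
rewrite spint_cst spintZ; last exact: bnd_int.
rewrite lerD2l ler_wpM2l//.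
have := ladyzhenskaya hd bp Hp; rewrite -(sip_sqrn hH Hp) -exprM /c4 sqr_sqrtr//.
rewrite /C4 mulr_ge0 ?invr_ge0 ?ltW ?vol_gt0//.
have L0 := side_gt0 Om; rewrite mulr_gt0//; first by rewrite ltr_wpDr// mulr_ge0// ltW.
by rewrite ltr_wpDr// mulr_ge0// sqr_ge0.
Qed.

End potential.
End space_estimates.

(** * Chain rule along affine paths of functions *)

Section second_order.
Context {R : realType}.
Implicit Types g : R -> R.

(** A locally uniform Taylor bound of second order. It implies that g has the
    continuous derivative g' and passes through integrals in space without any
    exchange of limits. *)
Definition second_order g g' := forall r : R, 0 <= r -> exists2 C : R, 0 <= C &
  forall s t, `|s| <= r -> `|t| <= r -> `|g t - g s - (t - s) * g' s| <= C * (t - s) ^+ 2.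

(** The two expansions, at s and at t, add up to a bound of the variation of g'. *)
Lemma second_order_continuous g g' : second_order g g' -> continuous g'.
Proof.
move=> h t; have r0 : 0 <= `|t| + 1 by rewrite addr_ge0.
have [C C0 hC] := h _ r0.
have tr : `|t| <= `|t| + 1 by rewrite lerDl.
apply/cvgrPdist_le => e e0; have k0 : 0 < 2 * C + 1 by rewrite ltr_wpDl// mulr_ge0.
near=> s.
have sr : `|s| <= `|t| + 1.
  rewrite -[s](subrK t); apply: le_trans (ler_normD _ _) _; rewrite addrC lerD2l.
  by rewrite distrC; near: s; apply: (@cvgr_dist_le _ _ _ _ _ id t); [exact: cvg_id|].
have hs : `|t - s| <= e / (2 * C + 1).
  near: s; apply: (@cvgr_dist_le _ _ _ _ _ id t); [exact: cvg_id|by rewrite divr_gt0].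
have h1 := hC s t sr tr; have h2 := hC t s tr sr.
have [->|st] := eqVneq s t; first by rewrite subrr normr0 ltW.
have d0 : 0 < `|t - s| by rewrite normr_gt0 subr_eq0 eq_sym.
have : `|(t - s) * (g' t - g' s)| <= 2 * C * (t - s) ^+ 2.
  have -> : (t - s) * (g' t - g' s) =
     (g t - g s - (t - s) * g' s) + (g s - g t - (s - t) * g' t) by ring.
  apply: le_trans (ler_normD _ _) _; apply: le_trans (lerD h1 h2) _.
  by rewrite le_eqVlt; apply/orP; left; apply/eqP; ring.
rewrite normrM -(real_normK (num_real (t - s))) expr2 mulrCA ler_pM2l// => /le_trans; apply.
apply: (@le_trans _ _ ((2 * C + 1) * `|t - s|)); first by rewrite ler_wpM2r// lerDl.
by rewrite mulrC -ler_pdivlMr.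
Unshelve. all: by end_near. Qed.

Lemma second_order_is_derive g g' t : second_order g g' -> is_derive t (1 : R) g (g' t).
Proof.
move=> h; have r0 : 0 <= `|t| + 1 by rewrite addr_ge0.
have [C C0 hC] := h _ r0.
have tr : `|t| <= `|t| + 1 by rewrite lerDl.
have L : (fun k : R => k^-1 *: ((g \o shift t) (k *: (1 : R)) - g t)) @ 0^' --> g' t.
  apply/cvgrPdist_le => e e0; have k0 : 0 < C + 1 by rewrite ltr_wpDl.
  near=> k.
  have kn0 : k != 0 by near: k; exact: nbhs_dnbhs_neq.
  have k1 : `|k| <= 1.
    near: k; apply: dnbhs0_le; exact: ltr01.
  have ke : `|k| <= e / (C + 1).
    near: k; apply: dnbhs0_le; exact: divr_gt0.
  have sr : `|k + t| <= `|t| + 1.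
    by apply: le_trans (ler_normD _ _) _; rewrite addrC lerD2l.
  have := hC t (k + t) tr sr; rewrite addrK => hk.
  rewrite /= distrC -[_ *: _]/(k^-1 * (g (k * 1 + t) - g t)) mulr1.
  have -> : k^-1 * (g (k + t) - g t) - g' t = k^-1 * (g (k + t) - g t - k * g' t).
    by field.
  rewrite normrM normfV ler_pdivrMl ?normr_gt0//; apply: le_trans hk _.
  rewrite -(real_normK (num_real k)) expr2 mulrCA ler_wpM2l//.
  apply: (@le_trans _ _ ((C + 1) * `|k|)); first by rewrite ler_wpM2r// lerDl.
  by rewrite mulrC -ler_pdivlMr.
split; first exact: (cvgP _ L).
exact: (cvg_lim _ L).
Unshelve. all: by end_near. Qed.

End second_order.

Section tint_ftc.
Context {R : realType} (T : R) (N : nat).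
Hypotheses (hT : 0 < T) (hN : (0 < N)%N).
Local Notation tg := (tgrid T N).
Local Notation tau := (Defs.tau T N).
Local Notation tint := (tint T N).
Local Notation th := (cell_time T N).

Lemma th_start n : th n (tg n.-1) = 0.
Proof. by rewrite /cell_time subrr mul0r. Qed.

Lemma th_end n : (0 < n)%N -> th n (tg n) = 1.
Proof. by move=> n0; rewrite /cell_time (tgP T N n0) addrAC subrr add0r mulfV// gt_eqF// tau_gt0. Qed.

Lemma continuous_th (g : R -> R) n : continuous g -> continuous (fun t => g (th n t)).
Proof. by move=> cg t; apply: continuous_comp; [exact: Cinf_continuous (Cinf_th T N n) t|exact: cg]. Qed.

Lemma tint_ftc n (g g' : R -> R) : (0 < n)%N -> second_order g g' ->
  tint n (fun t => g' (th n t)) = tau * (g 1 - g 0).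
Proof.
move=> n0 hg; have t0 := tau_gt0 hT hN.
have cg' := second_order_continuous hg.
have cc := continuous_th (n := n) cg'.
pose F t := tau * g (th n t).
have dF t : is_derive t (1 : R) F (g' (th n t)).
  have dg := @is_derive_aff R g g' (tg n.-1) tau^-1 t (fun s => second_order_is_derive s hg).
  have d3 : is_derive t (1 : R) (fun=> tau) 0 by exact: is_derive_cst.
  have := is_deriveM d3 dg; rewrite scaler0 addr0 => h; apply: is_derive_eq h _.
  rewrite -[LHS]/(tau * (g' (th n t) * tau^-1)).
  by field; rewrite gt_eqF.
rewrite [LHS](FTC2 (tg_le hT hN n) cc dF) /F th_end// th_start.
by rewrite mulrBr.
Qed.

Lemma tint_int n g : continuous g ->
  (@lebesgue_measure R).-integrable `[tg n.-1, tg n]%classic (EFin \o g).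
Proof. by move=> cg; exact: continuous_itv_integrable. Qed.

Lemma tintD n (g1 g2 : R -> R) : continuous g1 -> continuous g2 ->
  tint n (fun t => g1 t + g2 t) = tint n g1 + tint n g2.
Proof. by move=> c1 c2; apply: RintegralD; [exact: measurable_itv|exact: tint_int|exact: tint_int]. Qed.

Lemma tintB n (g1 g2 : R -> R) : continuous g1 -> continuous g2 ->
  tint n (fun t => g1 t - g2 t) = tint n g1 - tint n g2.
Proof. by move=> c1 c2; apply: RintegralB; [exact: measurable_itv|exact: tint_int|exact: tint_int]. Qed.

Lemma tint_le n (g1 g2 : R -> R) : continuous g1 -> continuous g2 ->
  (forall t, tg n.-1 <= t <= tg n -> g1 t <= g2 t) -> tint n g1 <= tint n g2.
Proof.
move=> c1 c2 h; apply: le_Rintegral; [exact: measurable_itv|exact: tint_int|exact: tint_int|].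
by move=> t /=; rewrite in_itv/=; exact: h.
Qed.

Lemma th01 n t : (0 < n)%N -> tg n.-1 <= t <= tg n -> 0 <= th n t <= 1.
Proof.
move=> n0 /andP[h1 h2]; have t0 := tau_gt0 hT hN.
rewrite /cell_time; apply/andP; split; first by rewrite divr_ge0 ?subr_ge0// ltW.
by rewrite ler_pdivrMr// mul1r lerBlDl -(tgP T N n0).
Qed.

Lemma tint_abs n g B : (0 < n)%N -> continuous g ->
  (forall t, tg n.-1 <= t <= tg n -> `|g t| <= B) -> `|tint n g| <= tau * B.
Proof.
move=> n0 cg h; have cB (c : R) : continuous (fun _ : R => c) by move=> ?; exact: cvg_cst.
rewrite ler_norml; apply/andP; split.
  rewrite -mulrN -(tint_cst hT hN (- B) n0); apply: tint_le => // t /h.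
  by rewrite ler_norml => /andP[].
rewrite -(tint_cst hT hN B n0); apply: tint_le => // t /h.
by rewrite ler_norml => /andP[].
Qed.

Lemma tint_quad n a b c : (0 < n)%N ->
  tint n (fun t => a + th n t * b + th n t ^+ 2 * c) = tau * (a + b / 2 + c / 3).
Proof.
move=> n0; pose g (t : R) : R := t * a + t ^+ 2 * (b / 2) + t ^+ 3 * (c / 3).
have -> : a + b / 2 + c / 3 = g 1 - g 0 by rewrite /g; field.
rewrite -(@tint_ftc n g (fun t => a + t * b + t ^+ 2 * c) n0)// => r r0.
exists (`|b| / 2 + `|c| * r) => [|s t sr tr]; first by rewrite addr_ge0// mulr_ge0// invr_ge0.
have -> : g t - g s - (t - s) * (a + s * b + s ^+ 2 * c) =
   (b / 2 + c / 3 * (t + 2 * s)) * (t - s) ^+ 2 by rewrite /g; field.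
rewrite normrM (ger0_norm (sqr_ge0 _)) ler_wpM2r ?sqr_ge0//.
apply: le_trans (ler_normD _ _) _; rewrite normrM normfV (ger0_norm (ler0n _ 2)) lerD2l.
rewrite normrM normrM normfV (ger0_norm (ler0n _ 3)) -mulrA ler_wpM2l//.
rewrite ler_pdivrMl ?ltr0n//; apply: le_trans (ler_normD _ _) _.
rewrite normrM (ger0_norm (ler0n _ 2)).
have : `|t| + 2 * `|s| <= r + 2 * r by rewrite lerD// ler_wpM2l.
by move/le_trans; apply; rewrite le_eqVlt; apply/orP; left; apply/eqP; ring.
Qed.

End tint_ftc.

Section families.
Context {R : realType} {d : nat} (Om : cube R d).
Local Notation scal := ('rV[R]_d -> R).
Local Notation bnd := (bnd Om).
Implicit Types (K L : R -> scal) (a p q u v w e : scal).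

(** Paths of bounded functions that satisfy the Taylor bound uniformly in space. *)
Definition C2family K K' := (forall t, bnd (K t) /\ bnd (K' t)) /\
  forall r : R, 0 <= r -> exists2 C : R, 0 <= C & forall s t x, `|s| <= r -> `|t| <= r ->
    [/\ `|K t x| <= C, `|K' t x| <= C &
        `|K t x - K s x - (t - s) * K' s x| <= C * (t - s) ^+ 2].

Lemma C2family_second_order K K' : C2family K K' ->
  second_order (fun t => spint Om (K t)) (fun t => spint Om (K' t)).
Proof.
move=> [bK h] r r0; have [C C0 hC] := h r r0.
exists (C * vol Om) => [|s t sr tr]; first by rewrite mulr_ge0// ltW// vol_gt0.
have i1 (u : R) : Sint Om (K u) by apply: bnd_int; case: (bK u).
have i2 (u : R) : Sint Om (K' u) by apply: bnd_int; case: (bK u).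
rewrite -spintZ// -spintB// -spintB; [|exact: SintB|exact: SintZ].
have bb : bnd (fun x => K t x - K s x - (t - s) * K' s x).
  rewrite (_ : (fun x => _) = (K t + (-1) *: K s) + (- (t - s)) *: K' s).
    by apply: bndD; [apply: bndD; [case: (bK t)|apply: bndZ; case: (bK s)]|apply: bndZ; case: (bK s)].
  by apply/funext => x; rewrite -[RHS]/(K t x + -1 * K s x + - (t - s) * K' s x) mulN1r mulNr.
apply: le_trans (spint_abs bb) _.
rewrite mulrAC -spint_cst; apply: le_spint; [by apply: bnd_int; exact: bnd_norm|exact: Sint_cst|].
by move=> x _; have [] := hC s t x sr tr.
Qed.

Lemma C2family_affine a u : bnd a -> bnd u -> C2family (fun t x => a x + t * u x) (fun t => u).
Proof.
move=> ba bu; split => [t|r r0].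
  split => //; rewrite (_ : (fun x => _) = a + t *: u)//; apply: bndD => //; exact: bndZ.
have [_ [A' hA']] := ba; have [_ [B' hB']] := bu.
pose A : R := A'; pose B : R := B'.
have hA x : `|a x| <= A by exact: hA'.
have hB x : `|u x| <= B by exact: hB'.
have A0 : 0 <= A by exact: le_trans (hA 0).
have B0 : 0 <= B by exact: le_trans (hB 0).
exists (A + r * B + B) => [|s t x sr tr]; first by rewrite !addr_ge0// mulr_ge0.
split.
- apply: le_trans (ler_normD _ _) _; rewrite ler_wpDr// lerD// normrM.
  by apply: ler_pM.
- by apply: le_trans (hB x) _; rewrite lerDr addr_ge0// mulr_ge0.
- have -> : a x + t * u x - (a x + s * u x) - (t - s) * u x = 0 by ring.
  by rewrite normr0 mulr_ge0 ?sqr_ge0// !addr_ge0// mulr_ge0.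
Qed.

Lemma C2familyD K K' L L' : C2family K K' -> C2family L L' ->
  C2family (fun t x => K t x + L t x) (fun t x => K' t x + L' t x).
Proof.
move=> [bK hK] [bL hL]; split => [t|r r0].
  by have [? ?] := bK t; have [? ?] := bL t; split; exact: bndD.
have [C C0 hC] := hK r r0; have [E E0 hE] := hL r r0.
exists (C + E) => [|s t x sr tr]; first by rewrite addr_ge0.
have [c1 c2 c3] := hC s t x sr tr; have [e1 e2 e3] := hE s t x sr tr.
split; [by apply: le_trans (ler_normD _ _) _; exact: lerD|
        by apply: le_trans (ler_normD _ _) _; exact: lerD|].
rewrite [leRHS]mulrDl; apply: le_trans _ (lerD c3 e3); apply: le_trans _ (ler_normD _ _).
by rewrite le_eqVlt; apply/orP; left; apply/eqP; congr (`| _ |); ring.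
Qed.

Lemma C2familyZ k K K' : C2family K K' -> C2family (fun t x => k * K t x) (fun t x => k * K' t x).
Proof.
move=> [bK hK]; split => [t|r r0].
  by have [? ?] := bK t; split; exact: (bndZ k).
have [C C0 hC] := hK r r0.
exists (`|k| * C) => [|s t x sr tr]; first by rewrite mulr_ge0.
have [c1 c2 c3] := hC s t x sr tr.
split; [by rewrite normrM ler_wpM2l|by rewrite normrM ler_wpM2l|].
rewrite -mulrA; apply: le_trans _ (ler_wpM2l (normr_ge0 k) c3); rewrite -normrM.
by rewrite le_eqVlt; apply/orP; left; apply/eqP; congr (`| _ |); ring.
Qed.

Let lip_arith (k k' s t r C : R) : 0 <= C -> `|s| <= r -> `|t| <= r -> `|k'| <= C ->
  `|k - (t - s) * k'| <= C * (t - s) ^+ 2 -> `|k| <= C * (1 + 2 * r) * `|t - s|.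
Proof.
move=> C0 sr tr hk' h; rewrite -[k](subrK ((t - s) * k')).
apply: le_trans (ler_normD _ _) _; apply: le_trans (lerD h _) _.
  by rewrite normrM; apply: ler_wpM2l hk'.
have h2 : `|t - s| <= 2 * r.
  by apply: le_trans (ler_normB _ _) _; rewrite mulr2n mulrDl mul1r lerD.
rewrite -(real_normK (num_real (t - s))) expr2 mulrA [`|t - s| * C]mulrC -mulrDl ler_wpM2r//.
by rewrite mulrDr mulr1 addrC lerD2l ler_wpM2l.
Qed.

Lemma C2familyM K K' L L' : C2family K K' -> C2family L L' ->
  C2family (fun t x => K t x * L t x) (fun t x => K' t x * L t x + K t x * L' t x).
Proof.
move=> [bK hK] [bL hL]; split => [t|r r0].
  have [? ?] := bK t; have [? ?] := bL t; split; first exact: bndM.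
  by apply: (@bndD _ _ Om (fun x => K' t x * L t x) (fun x => K t x * L' t x)); exact: bndM.
have [C C0 hC] := hK r r0; have [E E0 hE] := hL r r0.
exists (4 * (C * E) + C * (E * (1 + 2 * r))) => [|s t x sr tr].
  by rewrite addr_ge0 ?mulr_ge0// ?addr_ge0 ?mulr_ge0.
have [c1 c2 c3] := hC s t x sr tr; have [e1 e2 e3] := hE s t x sr tr.
have [c1s c2s _] := hC s s x sr sr; have [e1s e2s _] := hE s s x sr sr.
have CE0 : 0 <= C * E by rewrite mulr_ge0.
have R0 : 0 <= C * (E * (1 + 2 * r)) by rewrite mulr_ge0// mulr_ge0// addr_ge0// mulr_ge0.
split.
- rewrite normrM; apply: le_trans (ler_pM _ _ c1 e1) _ => //; apply: ler_wpDr => //.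
  by rewrite ler_peMl// ler1n.
- apply: le_trans (ler_normD _ _) _; rewrite !normrM.
  apply: le_trans (lerD (ler_pM _ _ c2 e1) (ler_pM _ _ c1 e2)) _ => //; apply: ler_wpDr => //.
  by rewrite -[X in X + _]mul1r -[X in _ + X]mul1r -mulrDl ler_wpM2r//; lra.
- have -> : K t x * L t x - K s x * L s x - (t - s) * (K' s x * L s x + K s x * L' s x) =
    (K t x - K s x - (t - s) * K' s x) * L t x + K s x * (L t x - L s x - (t - s) * L' s x)
    + (t - s) * (K' s x * (L t x - L s x)) by ring.
  have l3 : `|L t x - L s x| <= E * (1 + 2 * r) * `|t - s| by exact: lip_arith e3.
  have t1 : `|(K t x - K s x - (t - s) * K' s x) * L t x| <= C * (t - s) ^+ 2 * E.
    by rewrite normrM; exact: ler_pM.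
  have t2 : `|K s x * (L t x - L s x - (t - s) * L' s x)| <= C * (E * (t - s) ^+ 2).
    by rewrite normrM; exact: ler_pM.
  have t3 : `|(t - s) * (K' s x * (L t x - L s x))| <= `|t - s| * (C * (E * (1 + 2 * r) * `|t - s|)).
    by rewrite normrM ler_wpM2l// normrM; exact: ler_pM.
  apply: le_trans (ler_normD _ _) _; apply: le_trans (lerD (le_trans (ler_normD _ _) (lerD t1 t2)) t3) _.
  rewrite (_ : `|t - s| * _ = C * (E * (1 + 2 * r)) * `|t - s| ^+ 2); last by ring.
  rewrite real_normK ?num_real// [in leRHS]mulrDl lerD2r.
  rewrite (_ : _ + _ = 2 * (C * E) * (t - s) ^+ 2); last by ring.
  by rewrite ler_wpM2r ?sqr_ge0// ler_wpM2r// ler_nat.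
Qed.

Lemma C2family_pot (f : R -> R) f1 f2 f3 j a u : potential_ok f f1 f2 f3 -> (j <= 2)%N ->
  bnd a -> bnd u ->
  C2family (fun t x => derive1n j f (a x + t * u x))
           (fun t x => derive1n j.+1 f (a x + t * u x) * u x).
Proof.
move=> hf j2 ba bu.
have j4 : (j < 4)%N by exact: leq_ltn_trans j2 _.
have j5 : (j.+1 < 4)%N by rewrite ltnS (leq_ltn_trans j2).
have [bP hP] := C2family_affine ba bu.
split => [t|r r0].
  have [b1 _] := bP t; split; first exact: bnd_comp (pot_continuous hf j4) b1.
  by apply: bndM => //; exact: bnd_comp (pot_continuous hf j5) b1.
have [C C0 hC] := hP r r0.
pose B k : R := `|f2 k| + `|f3 k| * (C + C) ^+ (4 - k).
have B0 k : 0 <= B k by rewrite addr_ge0// mulr_ge0// exprn_ge0// addr_ge0.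
have hB k y : (k <= 4)%N -> `|y| <= C + C -> `|derive1n k f y| <= B k.
  move=> k4 hy; apply: le_trans (pot_norm hf y k4) _; rewrite lerD2l ler_wpM2l//.
  by rewrite lerXn2r// nnegrE addr_ge0.
exists (B j + B j.+1 * C + B j.+2 * C ^+ 2) => [|s t x sr tr].
  by apply: addr_ge0; [apply: addr_ge0 => //; exact: mulr_ge0|apply: mulr_ge0 => //; exact: sqr_ge0].
have [c1 c2 _] := hC s t x sr tr; have [c1s _ _] := hC t s x tr sr.
have dC (y : R) : `|y| <= C -> `|y| <= C + C by move=> h; rewrite (le_trans h)// lerDl.
have m1 : 0 <= B j.+1 * C by rewrite mulr_ge0.
have m2 : 0 <= B j.+2 * C ^+ 2 by rewrite mulr_ge0// sqr_ge0.
split.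
- apply: le_trans (hB _ _ (ltnW j4) (dC _ c1)) _; rewrite -addrA lerDl; exact: addr_ge0.
- rewrite normrM; apply: le_trans (ler_pM _ _ (hB _ _ (ltnW j5) (dC _ c1)) c2) _ => //.
  by rewrite addrAC lerDr addr_ge0.
- have [c c01 E1] := @pot_mvt _ _ _ _ _ hf j (a x + t * u x) (a x + s * u x) j4.
  have [c' c01' E2] := @pot_mvt _ _ _ _ _ hf j.+1
     (a x + s * u x + c * (a x + t * u x - (a x + s * u x))) (a x + s * u x) j5.
  rewrite [derive1n j f _ - derive1n j f _]E1.
  rewrite (_ : _ - _ = (derive1n j.+1 f (a x + s * u x + c * (a x + t * u x - (a x + s * u x)))
     - derive1n j.+1 f (a x + s * u x)) * ((t - s) * u x)); last by ring.
  rewrite E2.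
  have -> : a x + s * u x + c * (a x + t * u x - (a x + s * u x)) - (a x + s * u x) = c * ((t - s) * u x) by ring.
  set y := a x + s * u x + _.
  have hy : `|y| <= C + C.
    rewrite /y (_ : _ + _ = a x + s * u x + (c' * c) * (a x + t * u x - (a x + s * u x))); last by ring.
    apply: le_trans (convex_norm _ _ _) _.
      move: c01 c01' => /andP[? ?] /andP[? ?]; apply/andP; split; first exact: mulr_ge0.
      exact: mulr_ile1.
    exact: lerD.
  have hc : `|c| <= 1 by move: c01 => /andP[? ?]; rewrite ger0_norm.
  have hb := hB j.+2 y _ hy.
  rewrite (_ : _ * _ = derive1n j.+2 f y * (c * (u x ^+ 2 * (t - s) ^+ 2))); last by ring.
  rewrite normrM; apply: (@le_trans _ _ (B j.+2 * (C ^+ 2 * (t - s) ^+ 2))).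
    apply: ler_pM => //; first by apply: hb; rewrite !ltnS (leq_trans j2).
    rewrite normrM normrM !normrX [leLHS]mulrA -(real_normK (num_real (t - s))).
    rewrite ler_wpM2r ?sqr_ge0// -[leRHS]mul1r ler_pM// ?exprn_ge0//.
    by rewrite lerXn2r// nnegrE.
  by rewrite mulrA ler_wpM2r ?sqr_ge0// lerDr addr_ge0.
Qed.

End families.

(** * Absorption and polarization *)

Section absorption.
Context {R : realType}.

Definition absorb_cst (A : R) : R := 8 * (2 * A ^+ 3) ^+ 2 + 4 * (2 * A ^+ 3).

Let young (B u y : R) : B * (u * y) <= y ^+ 2 / 8 + 2 * B ^+ 2 * u ^+ 2.
Proof.
have h : 0 <= 2 * (y / 4 - B * u) ^+ 2 by rewrite mulr_ge0// sqr_ge0.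
have E : y ^+ 2 / 8 + 2 * B ^+ 2 * u ^+ 2 = B * (u * y) + 2 * (y / 4 - B * u) ^+ 2 by field.
by rewrite E lerDl.
Qed.

Let half (B u y : R) : 0 <= B -> B * (u * y) <= B * u ^+ 2 + B * y ^+ 2.
Proof.
move=> B0; rewrite -mulrDr ler_wpM2l//.
have h1 : 0 <= (u - y) ^+ 2 by exact: sqr_ge0.
have h2 := sqr_ge0 u; have h3 := sqr_ge0 y.
have E : u ^+ 2 + y ^+ 2 = 2^-1 * (u - y) ^+ 2 + (u * y + 2^-1 * (u ^+ 2 + y ^+ 2)) by field.
rewrite E; apply: ler_wpDl; first by rewrite mulr_ge0// invr_ge0.
by rewrite lerDl mulr_ge0// ?invr_ge0// addr_ge0.
Qed.

Let young2 (B u v y : R) : B * ((u + v) * y) <= y ^+ 2 / 8 + 4 * B ^+ 2 * (u ^+ 2 + v ^+ 2).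
Proof.
apply: le_trans (young B (u + v) y) _; rewrite lerD2l.
have h : (u + v) ^+ 2 <= 2 * (u ^+ 2 + v ^+ 2).
  have E : 2 * (u ^+ 2 + v ^+ 2) = (u + v) ^+ 2 + (u - v) ^+ 2 by ring.
  by rewrite E lerDl sqr_ge0.
rewrite (_ : 4 * B ^+ 2 * _ = 2 * B ^+ 2 * (2 * (u ^+ 2 + v ^+ 2))); last by ring.
by rewrite ler_wpM2l// mulr_ge0// sqr_ge0.
Qed.

Let collect (B x y z o r1 r2 r3 : R) : 0 <= B ->
  B * ((o + y) * (r2 + z)) + B * (x * (r2 + z)) + B * (r1 * (z + r2 + x)) + B * (r3 * (o + y)) + B * z ^+ 2 <=
  (x ^+ 2 + y ^+ 2) / 4 + (8 * B ^+ 2 + 4 * B) * (z ^+ 2 + o ^+ 2 + r1 ^+ 2 + r2 ^+ 2 + r3 ^+ 2).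
Proof.
move=> B0.
have h1 := young2 B r2 z y; have h2 := young B r3 y; have h3 := young2 B r2 z x; have h4 := young B r1 x.
have g1 := half o r2 B0; have g2 := half o z B0; have g3 := half r1 z B0; have g4 := half r1 r2 B0.
have g5 := half r3 o B0.
have q1 : 0 <= B * z ^+ 2 by rewrite mulr_ge0// sqr_ge0.
have q2 : 0 <= B * o ^+ 2 by rewrite mulr_ge0// sqr_ge0.
have q3 : 0 <= B * r1 ^+ 2 by rewrite mulr_ge0// sqr_ge0.
have q4 : 0 <= B * r2 ^+ 2 by rewrite mulr_ge0// sqr_ge0.
have q5 : 0 <= B * r3 ^+ 2 by rewrite mulr_ge0// sqr_ge0.
have BB : 0 <= B ^+ 2 by exact: sqr_ge0.
have p2 : 0 <= B ^+ 2 * o ^+ 2 by rewrite mulr_ge0// sqr_ge0.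
have p3 : 0 <= B ^+ 2 * r1 ^+ 2 by rewrite mulr_ge0// sqr_ge0.
have p5 : 0 <= B ^+ 2 * r3 ^+ 2 by rewrite mulr_ge0// sqr_ge0.
have -> : B * ((o + y) * (r2 + z)) + B * (x * (r2 + z)) + B * (r1 * (z + r2 + x)) + B * (r3 * (o + y)) + B * z ^+ 2
  = B * ((r2 + z) * y) + B * (r3 * y) + B * ((r2 + z) * x) + B * (r1 * x) +
    B * (o * r2) + B * (o * z) + B * (r1 * z) + B * (r1 * r2) + B * (r3 * o) + B * z ^+ 2 by ring.
move: h1 h2 h3 h4 g1 g2 g3 g4 g5.
move: (B * ((r2 + z) * y)) (B * (r3 * y)) (B * ((r2 + z) * x)) (B * (r1 * x)) => a1 a2 a3 a4.
move: (B * (o * r2)) (B * (o * z)) (B * (r1 * z)) (B * (r1 * r2)) (B * (r3 * o)) => a5 a6 a7 a8 a9.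
move=> h1 h2 h3 h4 g1 g2 g3 g4 g5.
move: q1 q2 q3 q4 q5 p2 p3 p5 BB h1 h2 h3 h4 g1 g2 g3 g4 g5.
move: (z ^+ 2) (o ^+ 2) (r1 ^+ 2) (r2 ^+ 2) (r3 ^+ 2) (x ^+ 2) (y ^+ 2) (B ^+ 2).
move=> zz oo rr1 rr2 rr3 xx yy BB *.
lra.
Qed.

(** In the application x, y are the square roots of the two parts of the
    dissipation, z and o bound the errors of phase field and velocity at the ends
    of the interval, and r1, r2, r3 are the norms of the residuals. After
    expansion every product contains at most one factor x or y, and Young's inequality
    costs a quarter of the dissipation. *)
Lemma absorb (A a1 al k a2 k1 k2 K x y z o r1 r2 r3 nvw nm t1 t2 t3 t4 t5 : R) :
  1 <= A -> 0 <= a1 <= A -> 0 <= al <= A -> 0 <= k <= A -> 0 <= a2 <= A -> 0 <= k1 <= A ->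
  0 <= k2 <= A -> 0 <= K <= A ->
  0 <= x -> 0 <= y -> 0 <= z -> 0 <= o -> 0 <= r1 -> 0 <= r2 -> 0 <= r3 ->
  0 <= nvw <= o + k * y -> nm <= k1 * (z + r2) + k2 * x ->
  t1 <= a1 * nvw * (r2 + al * z) -> t2 <= x * (a2 * (r2 + al * z)) ->
  t3 <= r1 * (nm + (r2 + al * z)) -> t4 <= r3 * nvw -> t5 <= K * z ^+ 2 ->
  t1 + t2 + t3 + t4 + t5 <=
  (x ^+ 2 + y ^+ 2) / 4 + absorb_cst A * (z ^+ 2 + o ^+ 2 + r1 ^+ 2 + r2 ^+ 2 + r3 ^+ 2).
Proof.
move=> A1 /andP[a10 a1A] /andP[al0 alA] /andP[k0 kA] /andP[a20 a2A] /andP[k10 k1A] /andP[k20 k2A]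
  /andP[K0 KA] x0 y0 z0 o0 r10 r20 r30 /andP[nv0 hnv] hnm h1 h2 h3 h4 h5.
have A0 : 0 <= A by exact: le_trans A1.
have one_le u : 0 <= u -> u <= A * u by move=> u0; rewrite ler_peMl.
have e1 : r2 + al * z <= A * (r2 + z).
  by rewrite mulrDr; apply: lerD; [exact: one_le|rewrite ler_wpM2r].
have e2 : nvw <= A * (o + y).
  by apply: le_trans hnv _; rewrite mulrDr; apply: lerD; [exact: one_le|rewrite ler_wpM2r].
have ez : 0 <= r2 + al * z by rewrite addr_ge0// mulr_ge0.
have rz : 0 <= r2 + z by rewrite addr_ge0.
have oy : 0 <= o + y by rewrite addr_ge0.
have A20 : 0 <= A ^+ 2 by exact: sqr_ge0.
have A30 : 0 <= A ^+ 3 by exact: exprn_ge0.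
have AA3 : A <= A ^+ 3 by rewrite exprS; apply: ler_peMr => //; exact: exprn_ege1.
have A23 : A ^+ 2 <= A ^+ 3 by rewrite [leRHS]exprS; apply: ler_peMl.
have B3 : A ^+ 3 <= 2 * A ^+ 3 by apply: ler_peMl => //; rewrite ler1n.
have B0 : 0 <= 2 * A ^+ 3 by rewrite mulr_ge0.
set B := 2 * A ^+ 3 in B3 B0 *.
apply: le_trans _ (collect x y z o r1 r2 r3 B0); rewrite -/B.
apply: lerD; [apply: lerD; [apply: lerD; [apply: lerD|]|]|].
- apply: le_trans h1 _; apply: (@le_trans _ _ (A * (A * (o + y)) * (A * (r2 + z)))).
    by apply: ler_pM => //; [exact: mulr_ge0|apply: ler_pM].
  rewrite (_ : A * _ * _ = A ^+ 3 * ((o + y) * (r2 + z))); last by ring.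
  by rewrite ler_wpM2r// mulr_ge0.
- apply: le_trans h2 _; apply: (@le_trans _ _ (x * (A * (A * (r2 + z))))).
    by rewrite ler_wpM2l//; apply: ler_pM.
  rewrite (_ : x * _ = A ^+ 2 * (x * (r2 + z))); last by ring.
  by rewrite ler_wpM2r ?mulr_ge0// (le_trans A23).
- apply: le_trans h3 _; rewrite [leRHS]mulrCA ler_wpM2l//.
  apply: (@le_trans _ _ (2 * A * (z + r2 + x))).
    apply: (@le_trans _ _ ((A * (z + r2) + A * x) + A * (r2 + z))).
      apply: lerD e1; apply: le_trans hnm _.
      by apply: lerD; rewrite ler_wpM2r// addr_ge0.
    have Ax : 0 <= A * x by exact: mulr_ge0.
    rewrite (_ : 2 * A * _ = A * (z + r2) + A * x + A * (r2 + z) + A * x); last by ring.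
    by rewrite lerDl.
  rewrite ler_wpM2r//; first by rewrite addr_ge0// addr_ge0.
  by rewrite ler_wpM2l.
- apply: le_trans h4 _; rewrite [leRHS]mulrCA ler_wpM2l//; apply: le_trans e2 _.
  by rewrite ler_wpM2r// (le_trans AA3).
- by apply: le_trans h5 _; rewrite ler_wpM2r ?sqr_ge0// (le_trans KA)// (le_trans AA3).
Qed.

End absorption.

Section polarization.
Context {R : realType} {V : lmodType R} (S : set V) (b : V -> V -> R).
Hypothesis hb : semi_ip S b.

Lemma sip_increment u du : S u -> S du ->
  b (u + du) (u + du) - b u u = 2 * b (u + 2^-1 *: du) du.
Proof.
move=> Su Sd; have S2 := sipZ hb 2^-1 Sd.
have := sip_quad hb 1 Su Sd; rewrite scale1r => ->.
by rewrite (sipDl hb)// (sipZl hb)//; field.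
Qed.

Lemma sip_convex u du t : S u -> S du -> 0 <= t <= 1 ->
  Num.sqrt (b (u + t *: du) (u + t *: du)) <=
  (1 - t) * Num.sqrt (b u u) + t * Num.sqrt (b (u + du) (u + du)).
Proof.
move=> Su Sd /andP[t0 t1]; have Sud := sipD hb Su Sd.
have t1' : 0 <= 1 - t by rewrite subr_ge0.
have E : u + t *: du = (1 - t) *: u + t *: (u + du).
  by rewrite scalerDr addrA -scalerDl subrK scale1r.
rewrite {1 2}E; apply: le_trans (sip_tri hb _ _) _; [exact: (sipZ hb)|exact: (sipZ hb)|].
by rewrite !(sip_nmZ hb)// (ger0_norm t0) (ger0_norm t1').
Qed.

Lemma sip_convex_sqr u du t : S u -> S du -> 0 <= t <= 1 ->
  b (u + t *: du) (u + t *: du) <= b u u + b (u + du) (u + du).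
Proof.
move=> Su Sd /andP[t0 t1]; have Sud := sipD hb Su Sd.
have q1 := sip_quad hb t Su Sd; have q2 := sip_quad hb 1 Su Sd.
rewrite scale1r in q2.
have d0 := sip_ge0 hb Sd; have u0 := sip_ge0 hb Su; have ud0 := sip_ge0 hb Sud.
have E : b (u + t *: du) (u + t *: du) =
    (1 - t) * b u u + t * b (u + du) (u + du) - t * (1 - t) * b du du by rewrite q1 q2; ring.
rewrite E; apply: (@le_trans _ _ ((1 - t) * b u u + t * b (u + du) (u + du))).
  by rewrite gerBl mulr_ge0// mulr_ge0// subr_ge0.
by apply: lerD; apply: ler_piMl => //; rewrite gerBl.
Qed.

(** The right side is the integral over t in [0, 1] of the square norm of u + t du;
    it equals (|u|^2 + <u, v> + |v|^2) / 3 with v = u + du, and 0 <= |u + v|^2. *)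
Lemma sip_simpson u du : S u -> S du ->
  (b u u + b (u + du) (u + du)) / 6 <= b u u + (2 * b u du) / 2 + b du du / 3.
Proof.
move=> Su Sd; have Sud := sipD hb Su Sd.
have q2 := sip_quad hb 1 Su Sd; rewrite scale1r in q2.
have := sip_ge0 hb (sipD hb Su Sud); rewrite (_ : u + (u + du) = 2%:R *: u + 1 *: du); last first.
  by rewrite addrA scale1r scaler_nat mulr2n.
rewrite (sip_quad hb)//; last exact: (sipZ hb).
rewrite !(sipZl hb)//; last exact: (sipZ hb).
rewrite (sipZr hb)// q2.
by move: (b u u) (b u du) (b du du) => x y z; lra.
Qed.

End polarization.

(** * The convection form and the potential energy along an affine path *)

Section cell_estimate.
Context {R : realType} {d : nat} (Om : cube R d).
Hypothesis hd : d = 2%N \/ d = 3%N.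
Local Notation scal := ('rV[R]_d -> R).
Local Notation vect := ('I_d -> 'rV[R]_d -> R).
Local Notation L2 := (L2 Om).
Local Notation H1 := (sobolev Om 1).
Local Notation Hv := (sobolevv Om 1).
Local Notation bnd := (bnd Om).
Local Notation BH := (BH Om).
Local Notation conv := (conv Om).

Let hL := semi_ip_L2 Om.
Let hH := semi_ip_H1 Om.

Lemma lin_BH : lin BH.
Proof.
split; first exact: (BH_cst Om 0).
- by move=> u v [bu Hu] [bv Hv]; split; [exact: bndD|have [] := H1D Hu Hv].
- by move=> k u [bu Hu]; split; [exact: bndZ|have [] := H1Z k Hu].
Qed.

Lemma BHD u v : BH u -> BH v -> BH (u + v). Proof. by case: lin_BH => _ h _; exact: h. Qed.
Lemma BHZ k u : BH u -> BH (k *: u). Proof. by case: lin_BH => _ _; exact. Qed.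
Lemma BHB u v : BH u -> BH v -> BH (u - v).
Proof. by move=> bu bv; rewrite -scaleN1r; apply: BHD => //; exact: BHZ. Qed.
Lemma BH_H1 u : BH u -> ipset H1 u. Proof. by case. Qed.
Lemma BH_L2 u : BH u -> ipset L2 u. Proof. by case=> /bnd_L2. Qed.

Lemma ip_wpartialD (F u v : scal) i : ipset L2 F -> ipset H1 u -> ipset H1 v ->
  ip L2 F (wpartial Om i (u + v)) = ip L2 F (wpartial Om i u) + ip L2 F (wpartial Om i v).
Proof.
move=> LF Hu Hv; have [Huv huv] := H1D Hu Hv.
have Lu := H1_wL2 i Hu; have Lv := H1_wL2 i Hv; have Luv := H1_wL2 i Huv.
rewrite -(sipDr hL)// !(sipC hL LF)//; last exact: L2D.
by apply: ip_aeq (huv i); apply: L2_pm => //; exact: L2D.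
Qed.

Lemma ip_wpartialZ (F u : scal) k i : ipset L2 F -> ipset H1 u ->
  ip L2 F (wpartial Om i (k *: u)) = k * ip L2 F (wpartial Om i u).
Proof.
move=> LF Hu; have [Hk hk] := H1Z k Hu.
have Lu := H1_wL2 i Hu; have Lk := H1_wL2 i Hk.
rewrite -(sipZr hL)// !(sipC hL LF)//; last exact: L2Z.
by apply: ip_aeq (hk i); apply: L2_pm => //; exact: L2Z.
Qed.

Let L2pU p (U : vect) i : BH p -> (forall i, BH (U i)) -> ipset L2 (fun x => p x * U i x).
Proof. by move=> [bp _] bU; apply: bnd_L2; apply: bndM => //; case: (bU i). Qed.

Lemma convDr p (U : vect) u v : BH p -> (forall i, BH (U i)) -> ipset H1 u -> ipset H1 v ->
  conv p U (u + v) = conv p U u + conv p U v.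
Proof.
move=> bp bU Hu Hv; rewrite -big_split; apply: eq_bigr => i _ /=.
by apply: ip_wpartialD => //; exact: L2pU.
Qed.

Lemma convZr p (U : vect) k u : BH p -> (forall i, BH (U i)) -> ipset H1 u ->
  conv p U (k *: u) = k * conv p U u.
Proof.
move=> bp bU Hu; rewrite mulr_sumr; apply: eq_bigr => i _ /=.
by apply: ip_wpartialZ => //; exact: L2pU.
Qed.

Lemma convBr p (U : vect) u v : BH p -> (forall i, BH (U i)) -> ipset H1 u -> ipset H1 v ->
  conv p U (u - v) = conv p U u - conv p U v.
Proof.
move=> bp bU Hu Hv; have HN : ipset H1 (- v) by exact: (sipN hH).
by rewrite convDr// -scaleN1r convZr// mulN1r.
Qed.

Lemma convD p q (U : vect) u : BH p -> BH q -> (forall i, BH (U i)) -> ipset H1 u ->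
  conv (p + q) U u = conv p U u + conv q U u.
Proof.
move=> bp bq bU Hu; rewrite -big_split; apply: eq_bigr => i _.
rewrite -[RHS](sipDl hL); [|exact: L2pU|exact: L2pU|exact: H1_wL2].
by congr (spint Om _); apply/funext => x; congr (_ * _); exact: mulrDl.
Qed.

Lemma convZ p k (U : vect) u : BH p -> (forall i, BH (U i)) -> ipset H1 u ->
  conv (k *: p) U u = k * conv p U u.
Proof.
move=> bp bU Hu; rewrite mulr_sumr; apply: eq_bigr => i _.
rewrite -[RHS](sipZl hL); [|exact: L2pU|exact: H1_wL2].
by congr (spint Om _); apply/funext => x; congr (_ * _); rewrite -[RHS]/(k * (p x * U i x)) mulrA.
Qed.

Lemma convBl p (U W : vect) u : BH p -> (forall i, BH (U i)) -> (forall i, BH (W i)) -> ipset H1 u ->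
  conv p (U - W) u = conv p U u - conv p W u.
Proof.
move=> bp bU bW Hu; rewrite -sumrB; apply: eq_bigr => i _.
rewrite -(sipBl hL); [|exact: L2pU|exact: L2pU|exact: H1_wL2].
congr (spint Om _); apply/funext => x; congr (_ * _).
by rewrite -[LHS]/(p x * (U i x - W i x)) mulrBr.
Qed.

Variables (T : R) (N n : nat).
Hypotheses (hT : 0 < T) (hN : (0 < N)%N) (n0 : (0 < n)%N).
Local Notation tau := (Defs.tau T N).
Local Notation tint := (tint T N n).
Local Notation th := (cell_time T N n).

Variables (f : R -> R) (f1 : R) (f2 f3 : nat -> R).
Hypothesis hf : potential_ok f f1 f2 f3.
Local Notation f' := (derive1 f).
Local Notation f'' := (derive1n 2 f).

Let tau0 : 0 < tau := tau_gt0 hT hN.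

Lemma bndBf (u v : scal) : bnd u -> bnd v -> bnd (fun x => u x - v x).
Proof.
move=> bu bv; rewrite (_ : (fun x => _) = u + (-1) *: v); first by apply: bndD => //; exact: bndZ.
by apply/funext => x; rewrite -[RHS]/(u x + -1 * v x) mulN1r.
Qed.

Lemma C2family_cst u : bnd u -> C2family Om (fun=> u) (fun=> (fun=> 0)).
Proof.
move=> bu; have := C2family_affine bu (bnd_cst Om 0).
by rewrite (_ : (fun t x => u x + t * 0) = (fun=> u))//; apply/funext => t; apply/funext => x; rewrite mulr0 addr0.
Qed.

Lemma C2family_continuous K K' : C2family Om K K' -> continuous (fun t => spint Om (K (th t))).
Proof.
move=> hK; apply: (@continuous_th _ T N (fun t => spint Om (K t)) n).
apply: is_derive_continuous => t; exact: second_order_is_derive (C2family_second_order hK).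
Qed.

Lemma potential_ftc p dp : bnd p -> bnd dp ->
  tint (fun s => ip L2 (f' \o (p + th s *: dp)) dp) =
  tau * (spint Om (f \o (p + dp)) - spint Om (f \o p)).
Proof.
move=> bp bdp; have h := C2family_second_order (C2family_pot (j := 0) hf isT bp bdp).
have := tint_ftc hT hN n0 h.
rewrite (_ : (fun x => derive1n 0 f (p x + 1 * dp x)) = f \o (p + dp)); last first.
  by apply/funext => x; rewrite mul1r.
by rewrite (_ : (fun x => derive1n 0 f (p x + 0 * dp x)) = f \o p)//; apply/funext => x; rewrite mul0r addr0.
Qed.

Lemma continuous_potential p dp xi : bnd p -> bnd dp -> bnd xi ->
  continuous (fun s => ip L2 (f' \o (p + th s *: dp)) xi).
Proof.
move=> bp bdp bxi.
exact: C2family_continuous (C2familyM (C2family_pot (j := 1) hf isT bp bdp) (C2family_cst bxi)).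
Qed.

(** The part of the chain rule for the relative potential energy that the equations
    do not see; it is quadratic in p - q. *)
Definition taylor_rem p q : scal := fun x => f' (p x) - f' (q x) - f'' (q x) * (p x - q x).

Let fam_diff p dp q dq : bnd p -> bnd dp -> bnd q -> bnd dq ->
  C2family Om (fun t x => derive1n 1 f (p x + t * dp x) + -1 * derive1n 1 f (q x + t * dq x))
   (fun t x => derive1n 2 f (p x + t * dp x) * dp x + -1 * (derive1n 2 f (q x + t * dq x) * dq x)).
Proof.
move=> bp bdp bq bdq; apply: C2familyD; first exact: (C2family_pot (j := 1) hf).
by apply: (C2familyZ (-1)); exact: (C2family_pot (j := 1) hf).
Qed.

Lemma continuous_diff p dp q dq xi : bnd p -> bnd dp -> bnd q -> bnd dq -> bnd xi ->
  continuous (fun s => ip L2 ((f' \o (p + th s *: dp)) - (f' \o (q + th s *: dq))) xi).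
Proof.
move=> bp bdp bq bdq bxi.
have := C2family_continuous (C2familyM (fam_diff bp bdp bq bdq) (C2family_cst bxi)).
rewrite (_ : (fun t => _) = (fun s => ip L2 ((f' \o (p + th s *: dp)) - (f' \o (q + th s *: dq))) xi))//.
by apply/funext => s; congr (spint Om _); apply/funext => x; rewrite mulN1r.
Qed.

Lemma continuous_taylor_rem p dp q dq : bnd p -> bnd dp -> bnd q -> bnd dq ->
  continuous (fun s => ip L2 (taylor_rem (p + th s *: dp) (q + th s *: dq)) dq).
Proof.
move=> bp bdp bq bdq.
have bN : bnd (fun x => p x + -1 * q x) by apply: (@bndD _ _ Om p ((-1) *: q)) => //; exact: bndZ.
have bdN : bnd (fun x => dp x + -1 * dq x) by apply: (@bndD _ _ Om dp ((-1) *: dq)) => //; exact: bndZ.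
have h2 := C2familyM (C2family_pot (j := 2) hf isT bq bdq) (C2family_affine bN bdN).
have := C2family_continuous (C2familyM (C2familyD (fam_diff bp bdp bq bdq) (C2familyZ (-1) h2)) (C2family_cst bdq)).
rewrite (_ : (fun t => _) = (fun s => ip L2 (taylor_rem (p + th s *: dp) (q + th s *: dq)) dq))//.
apply/funext => s; congr (spint Om _); apply/funext => x; congr (_ * _).
rewrite /taylor_rem -[derive1n 1 f]/f'.
rewrite -[(p + th s *: dp) x]/(p x + th s * dp x) -[(q + th s *: dq) x]/(q x + th s * dq x).
by ring.
Qed.

Let fam_frel p dp q dq : bnd p -> bnd dp -> bnd q -> bnd dq ->
  exists2 K', C2family Om (fun t => (fun x => Defs.frel f ((p + t *: dp) x) ((q + t *: dq) x))) K' &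
  forall t, K' t = (fun x => (f' ((p + t *: dp) x) - f' ((q + t *: dq) x)) * (dp x - dq x) +
    taylor_rem (p + t *: dp) (q + t *: dq) x * dq x).
Proof.
move=> bp bdp bq bdq.
have bN : bnd (fun x => p x + -1 * q x) by apply: (@bndD _ _ Om p ((-1) *: q)) => //; exact: bndZ.
have bdN : bnd (fun x => dp x + -1 * dq x) by apply: (@bndD _ _ Om dp ((-1) *: dq)) => //; exact: bndZ.
have h0 := C2familyD (C2family_pot (j := 0) hf isT bp bdp)
   (C2familyZ (-1) (C2family_pot (j := 0) hf isT bq bdq)).
have h1 := C2familyM (C2family_pot (j := 1) hf isT bq bdq) (C2family_affine bN bdN).
have h := C2familyD h0 (C2familyZ (-1) h1).
move: h; match goal with |- C2family _ ?K ?K' -> _ => set K0 := K; set K1 := K' end => h.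
exists K1 => [|t].
  rewrite (_ : (fun t => _) = K0)//; apply/funext => t; apply/funext => x.
  rewrite /K0 /Defs.frel -[(p + t *: dp) x]/(p x + t * dp x) -[(q + t *: dq) x]/(q x + t * dq x).
  rewrite -[derive1n 0 f]/f -[derive1n 1 f]/f'.
  by ring.
apply/funext => x; rewrite /K1 /taylor_rem.
rewrite -[(p + t *: dp) x]/(p x + t * dp x) -[(q + t *: dq) x]/(q x + t * dq x).
rewrite -[derive1n 1 f]/f'.
by ring.
Qed.

Lemma continuous_frel p dp q dq : bnd p -> bnd dp -> bnd q -> bnd dq ->
  continuous (fun s => spint Om (fun x => Defs.frel f ((p + th s *: dp) x) ((q + th s *: dq) x))).
Proof.
by move=> bp bdp bq bdq; have [K' h _] := fam_frel bp bdp bq bdq; exact: C2family_continuous h.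
Qed.

(** The derivative of f (p | q) in the direction (dp, dq) is
    (f' p - f' q) (dp - dq) + (f' p - f' q - f'' q (p - q)) dq; the first part is
    tested in the equation of the chemical potential, the second is a remainder. *)
Lemma frel_ftc p dp q dq : bnd p -> bnd dp -> bnd q -> bnd dq ->
  tau * (spint Om (fun x => Defs.frel f ((p + dp) x) ((q + dq) x)) - spint Om (fun x => Defs.frel f (p x) (q x))) =
  tint (fun s => ip L2 ((f' \o (p + th s *: dp)) - (f' \o (q + th s *: dq))) (dp - dq)) +
  tint (fun s => ip L2 (taylor_rem (p + th s *: dp) (q + th s *: dq)) dq).
Proof.
move=> bp bdp bq bdq; have [K' h hK'] := fam_frel bp bdp bq bdq.
have bdd : bnd (dp - dq) by rewrite -scaleN1r; apply: bndD => //; exact: bndZ.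
have := tint_ftc hT hN n0 (C2family_second_order h).
rewrite !scale1r !scale0r !addr0 => <-.
rewrite -tintD//; [|exact: continuous_diff|exact: continuous_taylor_rem].
congr (Rintegral _ _ _); apply/funext => s; rewrite hK' -spintD//.
  apply: bnd_int; apply: bndM => //.
  have -> : (f' \o (p + th s *: dp)) - (f' \o (q + th s *: dq)) =
     (f' \o (p + th s *: dp)) + (-1) *: (f' \o (q + th s *: dq)) by rewrite scaleN1r.
  by apply: bndD; [|apply: bndZ]; apply: (bnd_comp (pot_continuous hf (j := 1) isT)); apply: bndD => //; exact: bndZ.
have -> : (fun x => taylor_rem (p + th s *: dp) (q + th s *: dq) x * dq x) =
  (fun x => (f' ((p + th s *: dp) x) - f' ((q + th s *: dq) x)) * dq x - f'' ((q + th s *: dq) x) * ((p + th s *: dp) x - (q + th s *: dq) x) * dq x).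
  by apply/funext => x; rewrite /taylor_rem mulrBl.
have bps : bnd (p + th s *: dp) by apply: bndD => //; exact: bndZ.
have bqs : bnd (q + th s *: dq) by apply: bndD => //; exact: bndZ.
apply: bnd_int; apply: bndBf; apply: bndM => //.
  by apply: bndBf; apply: (bnd_comp (pot_continuous hf (j := 1) isT)).
by apply: bndM; [exact: (bnd_comp (pot_continuous hf (j := 2) isT))|exact: bndBf].
Qed.

End cell_estimate.

(** * The relative energy estimate on one time interval *)

Section one_step.
Context {R : realType} {d : nat} (Om : cube R d).
Hypothesis hd : d = 2%N \/ d = 3%N.
Local Notation scal := ('rV[R]_d -> R).
Local Notation vect := ('I_d -> 'rV[R]_d -> R).
Local Notation L2 := (L2 Om).
Local Notation L2v := (L2v Om).
Local Notation H1 := (sobolev Om 1).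
Local Notation Hv := (sobolevv Om 1).
Local Notation bnd := (bnd Om).
Local Notation BH := (BH Om).
Local Notation n1 := (ipnorm H1).
Local Notation nv := (ipnorm Hv).
Local Notation gip := (gip Om).
Local Notation wgip := (wgip Om).
Local Notation conv := (conv Om).
Local Notation gr u := (Num.sqrt (gip u u)).
Local Notation c4 := (c4 Om).
Local Notation vol := (vol Om).

Let hL := semi_ip_L2 Om.
Let hH := semi_ip_H1 Om.
Let hG := semi_ip_gip Om.
Let hLv : semi_ip [set u : vect | forall i, ipset L2 (u i)] (ip L2v) := semi_ip_vec _ hL.
Let hHv : semi_ip [set u : vect | forall i, ipset H1 (u i)] (ip Hv) := semi_ip_vec _ hH.

Variables (T : R) (N n : nat).
Hypotheses (hT : 0 < T) (hN : (0 < N)%N) (n0 : (0 < n)%N).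
Local Notation tau := (Defs.tau T N).
Local Notation tint := (tint T N n).
Local Notation th := (cell_time T N n).

Variables (f : R -> R) (f1 : R) (f2 f3 : nat -> R).
Hypothesis hf : potential_ok f f1 f2 f3.
Local Notation f' := (derive1 f).
Variables (gamma b1 b2 eta1 : R).
Hypotheses (hgamma : 0 < gamma) (hb1 : 0 < b1) (hb2 : 0 <= b2) (heta : 0 < eta1).
Let alpha := gamma + f1.

Let tau0 : 0 < tau := tau_gt0 hT hN.

Let f10 : 0 <= f1. Proof. by case: hf. Qed.

Definition wvisc (a : scal) (u w : vect) : R := \sum_i wgip a (u i) (w i).

(** The relative energy in terms of inner products, w being the velocity error. *)
Definition cell_energy (p q : scal) (w : vect) : R :=
  gamma / 2 * gip (p - q) (p - q) + spint Om (fun x => Defs.frel f (p x) (q x))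
  + alpha / 2 * ip L2 (p - q) (p - q) + 2^-1 * ip L2v w w.

(** A number that is at least 1 and at least as large as each constant of the
    estimates, as required for the absorption. *)
Definition step_cst (M Lam : R) : R :=
  1 + d%:R * c4 * M + (gamma + f1) + Num.sqrt eta1^-1 + Num.sqrt b2 +
  (Kml Om f2 f3 M / Num.sqrt vol + 1) + Num.sqrt ((Cpoinc Om + 1) / b1) + Knl Om f2 f3 M * Lam.

Let sq_le (a b : R) : 0 <= b -> a ^+ 2 <= b ^+ 2 -> a <= b.
Proof.
move=> b0 h; case: (leP a 0) => [a0|/ltW a0]; first exact: le_trans b0.
by rewrite -ler_sqr ?nnegrE.
Qed.

Let sq_add (a b : R) : 0 <= a -> 0 <= b -> a ^+ 2 + b ^+ 2 <= (a + b) ^+ 2.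
Proof.
move=> a0 b0; have ab : 0 <= 2 * (a * b) by rewrite mulr_ge0// mulr_ge0.
have -> : (a + b) ^+ 2 = a ^+ 2 + b ^+ 2 + 2 * (a * b) by ring.
by rewrite lerDl.
Qed.

Let convex_le (a b t m : R) : 0 <= t <= 1 -> a <= m -> b <= m -> (1 - t) * a + t * b <= m.
Proof.
move=> /andP[t0 t1] am bm; have t1' : 0 <= 1 - t by rewrite subr_ge0.
have -> : m = (1 - t) * m + t * m by ring.
by apply: lerD; apply: ler_wpM2l.
Qed.

Let parts (c1 c2 c3 c5 c6 c7 c8 : R) : 0 <= c1 -> 0 <= c2 -> 0 <= c3 -> 0 <= c5 -> 0 <= c6 ->
  0 <= c7 -> 0 <= c8 -> let A := 1 + c1 + c2 + c3 + c5 + c6 + c7 + c8 in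
  [/\ 1 <= A, 0 <= c1 <= A, 0 <= c2 <= A, 0 <= c3 <= A &
   [/\ 0 <= c5 <= A, 0 <= c6 <= A, 0 <= c7 <= A & 0 <= c8 <= A]].
Proof.
move=> h1 h2 h3 h5 h6 h7 h8 A; rewrite /A.
by split; [lra|lra|lra|lra|split; lra].
Qed.

Let mean_arith (k z r v : R) : 0 <= k -> 0 <= z -> 0 <= r -> 0 < v ->
  k * z + v * r <= (k / v + 1) * (z + r) * v.
Proof.
move=> k0 z0 r0 v0; have -> : (k / v + 1) * (z + r) * v = k * z + v * r + (k * r + v * z).
  by field; rewrite gt_eqF.
by rewrite lerDl addr_ge0// mulr_ge0// ltW.
Qed.

Let NL_arith (K nd L t z : R) : 0 <= K -> 0 <= z -> 0 < t -> nd <= L * t ->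
  t * (K * nd * z) <= K * L * z * t * t.
Proof.
move=> K0 z0 t0 h; rewrite [leRHS]mulrC ler_pM2l//.
rewrite (_ : K * L * z * t = K * (L * t) * z); last by ring.
by rewrite ler_wpM2r// ler_wpM2l.
Qed.

Let step_arith (dE t D1 D2 s1 s2 s3 s4 s5 C z o a b c : R) : 0 < t ->
  dE + t * (D1 + D2) = t * (s1 + s2 + s3 + s4 + s5) ->
  s1 + s2 + s3 + s4 + s5 <= (D1 + D2) / 4 + C * (z + o + a + b + c) ->
  dE + t * (3 / 4 * (D1 + D2)) <= t * (C * (z + o + a + b + c)).
Proof.
move=> t0 E h.
have -> : dE + t * (3 / 4 * (D1 + D2)) = t * (s1 + s2 + s3 + s4 + s5 - (D1 + D2) / 4).
  by rewrite mulrBr -E; field.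
by rewrite ler_pM2l// lerBlDl.
Qed.

Let Cp0 : 0 <= Cpoinc Om.
Proof. by rewrite mulr_ge0 ?invr_ge0// sqr_ge0. Qed.

Lemma Kml_ge0 M : 0 <= Kml Om f2 f3 M.
Proof.
apply: addr_ge0; first by apply: mulr_ge0 => //; exact: sqrtr_ge0.
by apply: mulr_ge0; [apply: mulr_ge0; [exact: mulr_ge0|exact: c4_ge0]|exact: sqr_ge0].
Qed.

Lemma Knl_ge0 M : 0 <= M -> 0 <= Knl Om f2 f3 M.
Proof.
move=> M0; apply: mulr_ge0; first exact: sqr_ge0.
by apply: addr_ge0; [apply: mulr_ge0 => //; exact: sqrtr_ge0|apply: mulr_ge0 => //; exact: mulr_ge0].
Qed.

Let sqrt_vol : 0 < Num.sqrt vol. Proof. by rewrite sqrtr_gt0 vol_gt0. Qed.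

Lemma spint_le u : ipset L2 u -> `|spint Om u| <= Num.sqrt vol * Num.sqrt (ip L2 u u).
Proof.
move=> Lu; have L1 : ipset L2 (fun=> 1) by exact: bnd_L2 (bnd_cst Om 1).
have := sip_CSn hL Lu L1.
rewrite (_ : ip L2 u (fun=> 1) = spint Om u); last first.
  by congr (spint Om _); apply/funext => x; rewrite mulr1.
have -> : ip L2 (fun=> 1) (fun=> 1) = vol by rewrite /= spint_cst mulr1 mul1r.
by rewrite [leRHS]mulrC.
Qed.

Lemma gip_cst u (c : R) : ipset H1 u -> gip u (fun=> c) = 0.
Proof.
move=> Hu; have [Hc hc] := H1_cst Om c.
have E : gip (fun=> c) (fun=> c) = 0.
  by apply: big1 => i _; apply: aeq_ip00 => //; exact: L2_pm (H1_wL2 i Hc).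
by have := sip_CSn hG Hu Hc; rewrite E sqrtr0 mulr0 normr_le0 => /eqP.
Qed.

Lemma H1_mean_grad u (a : scal) : bnd a -> (forall x, b1 <= a x) -> ipset H1 u ->
  n1 u <= `|spint Om u| / Num.sqrt vol + Num.sqrt ((Cpoinc Om + 1) / b1) * Num.sqrt (wgip a u u).
Proof.
move=> ba ab Hu; have G0 := sip_ge0 hG Hu; have v0 := vol_gt0 Om.
have wg := wgip_ge ba ab Hu.
have k0 : 0 <= (Cpoinc Om + 1) / b1 by rewrite divr_ge0 ?addr_ge0// ltW.
have wg0 : 0 <= wgip a u u by apply: le_trans wg; rewrite mulr_ge0// ltW.
have r0 : 0 <= `|spint Om u| / Num.sqrt vol by rewrite divr_ge0// ltW.
have r1 : 0 <= Num.sqrt ((Cpoinc Om + 1) / b1) * Num.sqrt (wgip a u u) by rewrite mulr_ge0// sqrtr_ge0.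
apply: sq_le; first exact: addr_ge0.
apply: le_trans _ (sq_add r0 r1); rewrite (H1_split Hu) exprMn (_ : _ ^+ 2 * _ ^+ 2 = spint Om u ^+ 2 / vol); last first.
  by rewrite exprVn sqr_sqrtr ?real_normK ?num_real// ltW.
rewrite [(Num.sqrt _ * Num.sqrt _) ^+ 2]exprMn !sqr_sqrtr//.
apply: le_trans (lerD (poincare Hu) (lexx _)) _; rewrite -!addrA lerD2l.
rewrite -[X in _ + X <= _]mul1r -mulrDl mulrAC -mulrA ler_wpM2l ?addr_ge0//.
by rewrite ler_pdivlMr// mulrC.
Qed.

Variables (S : set scal).
Hypotheses (linS : lin S) (S_BH : S `<=` BH) (S1 : forall c, S (fun=> c)).

Variables (p dp q dq m r1 r2 beta eps : scal) (w dw r3 : vect) (rho1 rho3 M Lam : R).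
Let e := p - q.
Let de := dp - dq.
Let em := e + 2^-1 *: de.
Let wb := w + 2^-1 *: dw.
Let pm := p + 2^-1 *: dp.

Hypotheses (Sp : S p) (Sdp : S dp) (Sq : S q) (Sdq : S dq) (Sm : S m) (Sr2 : S r2).
Hypotheses (Bw : forall i, BH (w i)) (Bdw : forall i, BH (dw i)).
Hypotheses (r1L : ipset L2 r1) (r3L : forall i, ipset L2 (r3 i)).
Hypotheses (bbeta : bnd beta) (beps : bnd eps).
Hypotheses (hbeta : forall x, b1 <= beta x <= b2) (heps : forall x, eta1 <= eps x).
Hypothesis eq1 : forall psi, S psi ->
  ip L2 de psi = tau * (conv pm wb psi - wgip beta m psi - ip L2 r1 psi).
Hypothesis eq2 : forall xi, S xi ->
  tau * ip L2 m xi = tau * (gamma * gip em xi) +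
   tint (fun s => ip L2 ((f' \o (p + th s *: dp)) - (f' \o (q + th s *: dq))) xi) - tau * ip L2 r2 xi.
Hypothesis eq3 : ip L2v dw wb = - (tau * wvisc eps wb wb) - tau * conv pm wb m - tau * ip L2v r3 wb.
Hypotheses (rho1_ge0 : 0 <= rho1) (rho3_ge0 : 0 <= rho3).
Hypothesis r1_le : forall psi, S psi -> `|ip L2 r1 psi| <= rho1 * n1 psi.
Hypothesis r3_le : `|ip L2v r3 wb| <= rho3 * nv wb.
Hypotheses (Mp : n1 p <= M) (Mp' : n1 (p + dp) <= M) (Mq : n1 q <= M) (Mq' : n1 (q + dq) <= M).
Hypothesis (hLam : n1 dq <= Lam * tau).

Let SD u v : S u -> S v -> S (u + v). Proof. by case: linS => _ h _; exact: h. Qed.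
Let SZ k u : S u -> S (k *: u). Proof. by case: linS => _ _; exact. Qed.
Let SB u v : S u -> S v -> S (u - v).
Proof. by move=> hu hv; rewrite -scaleN1r; apply: SD => //; exact: SZ. Qed.
Let SH u : S u -> ipset H1 u. Proof. by move=> /S_BH []. Qed.
Let SL u : S u -> ipset L2 u. Proof. by move=> /SH /H1_L2. Qed.

Let Z := n1 e ^+ 2 + n1 (e + de) ^+ 2.
Let W := ip L2v w w + ip L2v (w + dw) (w + dw).
Let Dm := wgip beta m m.
Let Dw := wvisc eps wb wb.

Let Se : S e := SB Sp Sq.
Let Sde : S de := SB Sdp Sdq.
Let Sem : S em := SD Se (SZ 2^-1 Sde).
Let Bwb i : BH (wb i). Proof. exact: BHD (Bw i) (BHZ _ (Bdw i)). Qed.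

Let e_path t : e + t *: de = (p + t *: dp) - (q + t *: dq).
Proof. by rewrite /e /de scalerBr opprD addrACA. Qed.

Let Z_ge0 : 0 <= Z. Proof. by rewrite addr_ge0// sqr_ge0. Qed.

Let n1_e t : 0 <= t <= 1 -> n1 (e + t *: de) <= Num.sqrt Z.
Proof.
move=> t01; rewrite ler_sqrt//; apply: le_trans (sip_convex_sqr hH (SH Se) (SH Sde) t01) _.
have E1 := sip_sqrn hH (SH Se); have E2 := sip_sqrn hH (SH (SD Se Sde)).
by rewrite -E1 -E2.
Qed.

Let n1_path u du t : S u -> S du -> n1 u <= M -> n1 (u + du) <= M -> 0 <= t <= 1 ->
  n1 (u + t *: du) <= M.
Proof.
move=> Su Sdu h1 h2 t01; apply: le_trans (sip_convex hH (SH Su) (SH Sdu) t01) _.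
exact: (convex_le t01 h1 h2).
Qed.

Let half01 : 0 <= (2^-1 : R) <= 1.
Proof. by rewrite invr_ge0 ler0n/= invf_le1 ?ltr0n// ler1n. Qed.

Let M_ge0 : 0 <= M. Proof. exact: le_trans (sqrtr_ge0 _) Mp. Qed.

(** The equations control only the gradient of the error m of the chemical
    potential. Its mean comes from testing the second equation with 1, where the
    gradient term vanishes. *)
Let mean_m : `|spint Om m| <= Kml Om f2 f3 M * Num.sqrt Z + Num.sqrt vol * n1 r2.
Proof.
have E u : ip L2 u (fun=> 1) = spint Om u.
  by congr (spint Om _); apply/funext => x; rewrite mulr1.
have := eq2 (S1 1); rewrite gip_cst; last exact: SH.
rewrite !mulr0 add0r (E m) (E r2) => h.
set X := Defs.tint _ _ _ _ in h.
have hX : `|X| <= tau * (Kml Om f2 f3 M * Num.sqrt Z).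
  apply: tint_abs => //.
    exact: (continuous_diff (n := n) hf (S_BH Sp).1 (S_BH Sdp).1 (S_BH Sq).1 (S_BH Sdq).1 (bnd_cst Om 1)).
  move=> t /(th01 hT hN n0) t01; rewrite E.
  have Ss u du : S u -> S du -> BH (u + th t *: du) by move=> hu hv; apply: S_BH; apply: SD => //; exact: SZ.
  apply: le_trans (lipschitz_mean hd hf (e := e + th t *: de) (M := M) (Ss p dp Sp Sdp) (Ss q dq Sq Sdq) (Ss _ _ Se Sde) _ _ _) _.
  - by move=> x; rewrite e_path.
  - exact: n1_path.
  - exact: n1_path.
  - by rewrite ler_wpM2l ?Kml_ge0// n1_e.
have -> : spint Om m = X / tau - spint Om r2.
  apply: (mulfI (lt0r_neq0 tau0)); rewrite h mulrBr; congr (_ - _).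
  by rewrite mulrCA mulfV ?lt0r_neq0// mulr1.
apply: le_trans (ler_normB _ _) _; apply: lerD.
  by rewrite normrM normfV (gtr0_norm tau0) ler_pdivrMr// mulrC.
apply: le_trans (spint_le (SL Sr2)) _; rewrite ler_wpM2l ?sqrtr_ge0//.
exact: L2_le_n1 (SH Sr2).
Qed.

(** The part of the test function of the first equation besides m. *)
Let psi' := r2 + alpha *: em.
Let Spsi : S psi'. Proof. exact: SD Sr2 (SZ _ Sem). Qed.

(** The first equation is tested with m + psi', the second with de and the third
    with wb. The increments of the quadratic terms are products of midpoint values
    and increments, as these tests provide; the terms conv pm wb m of the first and
    third equation cancel. X2 is the time integral of the Taylor remainder tested
    with dq. *)
Let energy_identity : exists2 X2 : R, `|X2| <= tau * (Knl Om f2 f3 M * n1 dq * Z) &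
  cell_energy (p + dp) (q + dq) (w + dw) - cell_energy p q w + tau * (Dm + Dw) =
  tau * (conv pm wb psi' + - wgip beta m psi' + - ip L2 r1 (m + psi') + - ip L2v r3 wb + X2 / tau / tau).
Proof.
have [[Bp _] [Bdp _]] := (S_BH Sp, S_BH Sdp); have [[Bq _] [Bdq _]] := (S_BH Sq, S_BH Sdq).
have F := frel_ftc hT hN n0 hf Bp Bdp Bq Bdq.
rewrite -/de in F; have E2 := eq2 Sde.
set X1 := Defs.tint _ _ _ _ in F E2; set X2 := Defs.tint _ _ _ _ in F.
exists X2.
  apply: tint_abs => //; first exact: (continuous_taylor_rem (n := n) hf).
  move=> t /(th01 hT hN n0) t01.
  have Ss u du : S u -> S du -> BH (u + th t *: du) by move=> hu hv; apply: S_BH; apply: SD => //; exact: SZ.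
  apply: le_trans (nonlinear_remainder hd hf (e := e + th t *: de) (M := M) (Ss p dp Sp Sdp) (Ss q dq Sq Sdq) (Ss _ _ Se Sde) (S_BH Sdq) _ _ _) _.
  - by move=> x; rewrite e_path.
  - exact: n1_path.
  - exact: n1_path.
  - apply: ler_wpM2l; first by apply: mulr_ge0; [exact: Knl_ge0|exact: sqrtr_ge0].
    rewrite -[leRHS](sqr_sqrtr Z_ge0); apply: lerXn2r; rewrite ?nnegrE ?sqrtr_ge0//.
    exact: n1_e.
have G := sip_increment hG (SH Se) (SH Sde).
have L := sip_increment hL (SL Se) (SL Sde).
have Lw i : ipset L2 (w i) by exact: BH_L2.
have Ldw i : ipset L2 (dw i) by exact: BH_L2.
have V := sip_increment hLv Lw Ldw.
rewrite -/em in G L; rewrite -/wb in V.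
have Lwb i : ipset L2 (wb i) by exact: BH_L2.
have VC : ip L2v wb dw = ip L2v dw wb by exact: (sipC hLv).
have E1 := eq1 (SD Sm Spsi).
have e1 : (p + dp) - (q + dq) = e + de by rewrite /e /de opprD addrACA.
have Epsi : ip L2 de (m + psi') = ip L2 m de + ip L2 r2 de + alpha * ip L2 em de.
  rewrite (sipC hL); [|exact: SL|exact: SL (SD Sm Spsi)].
  rewrite (sipDl hL); [|exact: SL|exact: SL|exact: SL].
  rewrite (sipDl hL); [|exact: SL|exact: SL (SZ _ Sem)|exact: SL].
  by rewrite (sipZl hL); [rewrite addrA|exact: SL|exact: SL].
have bpm : BH pm by apply: S_BH; apply: SD => //; exact: SZ.
have hB := semi_ip_wgip bbeta (fun x => le_trans (ltW hb1) (proj1 (andP (hbeta x)))).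
rewrite Epsi (convDr bpm Bwb (SH Sm) (SH Spsi)) (sipDr hB (SH Sm) (SH Spsi) (SH Sm)) in E1.
rewrite /cell_energy e1 -/e.
move: F E1 E2 eq3 G L V; rewrite VC -/Dm -/Dw.
move: (spint Om (fun x => Defs.frel f ((p + dp) x) ((q + dq) x))) (spint Om (fun x => Defs.frel f (p x) (q x))).
move: (ip L2 (e + de) (e + de)) (ip L2 e e) (gip (e + de) (e + de)) (gip e e).
move: (ip L2v (w + dw) (w + dw)) (ip L2v w w) (ip L2v dw wb) (ip L2v r3 wb).
move: (ip L2 r1 (m + psi')) (wgip beta m psi') (conv pm wb psi') (conv pm wb m) Dm Dw X1 X2.
move: (ip L2 m de) (ip L2 r2 de) (ip L2 em de) (gip em de) alpha tau (lt0r_neq0 tau0).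
move=> x1 x2 x3 x4 al t tn0 x5 x6 x7 x8 x9 x10 X1 X2 y1 y2 y3 y4 y5 y6 y7 y8 F1 F0 F E1 E2 E3 G L V.
(* From here on, linear algebra in abstract numbers. *)
have FF : F1 - F0 = X1 / t + X2 / t.
  by apply: (mulfI tn0); rewrite F mulrDr ![t * _]mulrC !divfK.
have XX : X1 / t = x1 - gamma * x4 + x2.
  apply: (mulfI tn0); rewrite mulrC divfK//.
  have -> : X1 = t * x1 - t * (gamma * x4) + t * x2 by rewrite E2; ring.
  by ring.
have -> : gamma / 2 * y7 + F1 + al / 2 * y5 + 2^-1 * y1 - (gamma / 2 * y8 + F0 + al / 2 * y6 + 2^-1 * y2)
  = gamma / 2 * (y7 - y8) + (F1 - F0) + al / 2 * (y5 - y6) + 2^-1 * (y1 - y2) by ring.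
rewrite G L V FF XX.
have -> : gamma / 2 * (2 * x4) + (x1 - gamma * x4 + x2 + X2 / t) + al / 2 * (2 * x3) + 2^-1 * (2 * y3)
  = (x1 + x2 + al * x3) + X2 / t + y3 by field.
rewrite E1 E3.
rewrite -[X2 / t in LHS](divfK tn0 (X2 / t)).
by ring.
Qed.

(** Every term on the right of the energy identity is at most a product of norms to
    which the absorption lemma applies. The norm of dq / tau is bounded by Lam, so
    that the Taylor remainder is bounded by Z without any power of tau. *)
Theorem relative_energy_step :
  cell_energy (p + dp) (q + dq) (w + dw) - cell_energy p q w + tau * (3 / 4 * (Dm + Dw)) <=
  tau * (absorb_cst (step_cst M Lam) * (Z + W + rho1 ^+ 2 + n1 r2 ^+ 2 + rho3 ^+ 2)).
Proof.
have Bb x : 0 <= beta x by apply: le_trans (ltW hb1) _; case/andP: (hbeta x).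
have Be x : 0 <= eps x by apply: le_trans (ltW heta) _; exact: heps.
have hB := semi_ip_wgip bbeta Bb; have hE := semi_ip_wgip beps Be.
have Dm0 : 0 <= Dm by exact: (sip_ge0 hB (SH Sm)).
have Dw0 : 0 <= Dw by apply: sumr_ge0 => i _; apply: (sip_ge0 hE); case: (Bwb i).
have Lw i : ipset L2 (w i) by exact: BH_L2.
have Ldw i : ipset L2 (dw i) by exact: BH_L2.
have Lwdw i : ipset L2 ((w + dw) i) by exact: (sipD hL).
have W0 : 0 <= W by rewrite addr_ge0// (sip_ge0 hLv).
have Hwb i : ipset H1 (wb i) by case: (Bwb i).
have bpm : BH pm by apply: S_BH; apply: SD => //; exact: SZ.
have nem : n1 em <= Num.sqrt Z by exact: n1_e.
have npm : n1 pm <= M by exact: n1_path.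
have a0 : 0 <= alpha by rewrite addr_ge0// ltW.
have npsi : n1 psi' <= n1 r2 + alpha * Num.sqrt Z.
  apply: le_trans (sip_tri hH (SH Sr2) (SH (SZ _ Sem))) _; rewrite lerD2l.
  by rewrite (sip_nmZ hH) ?(ger0_norm a0) ?ler_wpM2l//; exact: SH.
have c40 := c4_ge0 Om.
have nvb : nv wb <= Num.sqrt W + Num.sqrt eta1^-1 * Num.sqrt Dw.
  apply: sq_le; first by rewrite addr_ge0 ?mulr_ge0 ?sqrtr_ge0.
  have r1' : 0 <= Num.sqrt W by exact: sqrtr_ge0.
  have r2' : 0 <= Num.sqrt eta1^-1 * Num.sqrt Dw by rewrite mulr_ge0// sqrtr_ge0.
  have ie : 0 <= eta1^-1 by rewrite invr_ge0 ltW.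
  apply: le_trans _ (sq_add r1' r2').
  rewrite (sip_sqrn hHv Hwb) exprMn (sqr_sqrtr W0) (sqr_sqrtr ie) (sqr_sqrtr Dw0).
  have -> : ip Hv wb wb = ip L2v wb wb + \sum_i gip (wb i) (wb i) by rewrite -big_split.
  apply: lerD; first exact: (sip_convex_sqr hLv).
  rewrite ler_pdivlMl// mulr_sumr; apply: ler_sum => i _.
  exact: wgip_ge.
have K0 : 0 <= Knl Om f2 f3 M by exact: Knl_ge0.
have Lam0 : 0 <= Lam.
  by rewrite -(pmulr_lge0 Lam tau0); apply: le_trans hLam; exact: sqrtr_ge0.
have [X2 hX2 E] := energy_identity.
have Z0 := Z_ge0.
have [A1 p1 p2 p3 [p4 p5 p6 p7]] := @parts (d%:R * c4 * M) (gamma + f1) (Num.sqrt eta1^-1) (Num.sqrt b2)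
  (Kml Om f2 f3 M / Num.sqrt vol + 1) (Num.sqrt ((Cpoinc Om + 1) / b1)) (Knl Om f2 f3 M * Lam)
  (mulr_ge0 (mulr_ge0 (ler0n _ d) c40) M_ge0) a0 (sqrtr_ge0 _) (sqrtr_ge0 _)
  (addr_ge0 (divr_ge0 (Kml_ge0 M) (sqrtr_ge0 _)) ler01) (sqrtr_ge0 _) (mulr_ge0 K0 Lam0).
rewrite -/(step_cst M Lam) in A1 p1 p2 p3 p4 p5 p6 p7.
have nv0 : 0 <= nv wb by exact: sqrtr_ge0.
have grpsi : gr psi' <= n1 r2 + alpha * Num.sqrt Z by apply: le_trans (gr_le_n1 (SH Spsi)) npsi.
have nm : n1 m <= (Kml Om f2 f3 M / Num.sqrt vol + 1) * (Num.sqrt Z + n1 r2) +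
    Num.sqrt ((Cpoinc Om + 1) / b1) * Num.sqrt Dm.
  apply: le_trans (H1_mean_grad bbeta (fun x => proj1 (andP (hbeta x))) (SH Sm)) _.
  rewrite lerD2r ler_pdivrMr//; apply: le_trans mean_m _.
  exact: mean_arith (Kml_ge0 M) (sqrtr_ge0 _) (sqrtr_ge0 _) sqrt_vol.
have t1 : conv pm wb psi' <= d%:R * c4 * M * nv wb * (n1 r2 + alpha * Num.sqrt Z).
  apply: le_trans (ler_norm _) _; apply: le_trans (conv_le hd bpm Bwb (SH Spsi)) _.
  apply: ler_pM => //; rewrite ?sqrtr_ge0//.
    by apply: mulr_ge0 => //; apply: mulr_ge0; [apply: mulr_ge0|exact: sqrtr_ge0].
  apply: ler_wpM2r => //; apply: ler_wpM2l => //; exact: mulr_ge0.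
have t2 : - wgip beta m psi' <= Num.sqrt Dm * (Num.sqrt b2 * (n1 r2 + alpha * Num.sqrt Z)).
  apply: le_trans (ler_norm _) _; rewrite normrN.
  apply: le_trans (sip_CSn hB (SH Sm) (SH Spsi)) _; apply: ler_wpM2l; first exact: sqrtr_ge0.
  apply: (@le_trans _ _ (Num.sqrt b2 * gr psi')); last by apply: ler_wpM2l => //; exact: sqrtr_ge0.
  rewrite -sqrtrM// ler_sqrt; first by apply: wgip_le (SH Spsi) => // x; rewrite Bb; case/andP: (hbeta x).
  have gp := sip_ge0 hG (SH Spsi); exact: (mulr_ge0 hb2 gp).
have t3 : - ip L2 r1 (m + psi') <= rho1 * (n1 m + (n1 r2 + alpha * Num.sqrt Z)).
  apply: le_trans (ler_norm _) _; rewrite normrN.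
  apply: le_trans (r1_le (SD Sm Spsi)) _; apply: ler_wpM2l => //.
  apply: le_trans (sip_tri hH (SH Sm) (SH Spsi)) _.
  by apply: lerD npsi; exact: lexx.
have t4 : - ip L2v r3 wb <= rho3 * nv wb.
  by apply: le_trans (ler_norm _) _; rewrite normrN.
have t5 : X2 / tau / tau <= Knl Om f2 f3 M * Lam * Num.sqrt Z ^+ 2.
  rewrite (sqr_sqrtr Z0) !ler_pdivrMr//; apply: le_trans (ler_norm _) _; apply: le_trans hX2 _.
  exact: NL_arith.
have key := absorb A1 p1 p2 p3 p4 p5 p6 p7 (sqrtr_ge0 Dm) (sqrtr_ge0 Dw) (sqrtr_ge0 Z) (sqrtr_ge0 W)
  rho1_ge0 (sqrtr_ge0 (ip H1 r2 r2)) rho3_ge0 (introT andP (conj nv0 nvb)) nm t1 t2 t3 t4 t5.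
rewrite (sqr_sqrtr Dm0) (sqr_sqrtr Dw0) (sqr_sqrtr Z0) (sqr_sqrtr W0) in key.
exact: (step_arith tau0 E key).
Qed.

End one_step.

(** * Coercivity of the relative energy and stability of one step *)

Section cell_bounds.
Context {R : realType} {d : nat} (Om : cube R d).
Hypothesis hd : d = 2%N \/ d = 3%N.
Local Notation scal := ('rV[R]_d -> R).
Local Notation vect := ('I_d -> 'rV[R]_d -> R).
Local Notation L2 := (L2 Om).
Local Notation L2v := (L2v Om).
Local Notation H1 := (sobolev Om 1).
Local Notation bnd := (bnd Om).
Local Notation BH := (BH Om).
Local Notation n1 := (ipnorm H1).
Local Notation gip := (gip Om).
Local Notation wgip := (wgip Om).
Local Notation conv := (conv Om).

Let hL := semi_ip_L2 Om.
Let hH := semi_ip_H1 Om.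
Let hG := semi_ip_gip Om.
Let hLv : semi_ip [set u : vect | forall i, ipset L2 (u i)] (ip L2v) := semi_ip_vec _ hL.

Variables (T : R) (N n : nat).
Hypotheses (hT : 0 < T) (hN : (0 < N)%N) (n0 : (0 < n)%N).
Local Notation tau := (Defs.tau T N).
Local Notation tint := (tint T N n).
Local Notation th := (cell_time T N n).

Variables (f : R -> R) (f1 : R) (f2 f3 : nat -> R).
Hypothesis hf : potential_ok f f1 f2 f3.
Local Notation f' := (derive1 f).
Variable gamma : R.
Hypothesis hgamma : 0 < gamma.
Let tau0 : 0 < tau := tau_gt0 hT hN.

Let path_arith (k1 k2 k3 t a1 b1 c1 a2 b2 c2 a3 b3 c3 F : R) :
  k1 * (a1 + 2 * t * b1 + t ^+ 2 * c1) + F + k2 * (a2 + 2 * t * b2 + t ^+ 2 * c2) +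
  k3 * (a3 + 2 * t * b3 + t ^+ 2 * c3) =
  k1 * a1 + k2 * a2 + k3 * a3 + t * (k1 * (2 * b1) + k2 * (2 * b2) + k3 * (2 * b3)) +
  t ^+ 2 * (k1 * c1 + k2 * c2 + k3 * c3) + F.
Proof. by ring. Qed.

Let path_arith2 (k1 k3 t a1 b1 c1 a3 b3 c3 : R) :
  k1 * (a1 + 2 * t * b1 + t ^+ 2 * c1) + k3 * (a3 + 2 * t * b3 + t ^+ 2 * c3) =
  k1 * a1 + k3 * a3 + t * (k1 * (2 * b1) + k3 * (2 * b3)) + t ^+ 2 * (k1 * c1 + k3 * c3).
Proof. by ring. Qed.

Section lower_bound.
Variables (p dp q dq : scal) (w dw : vect).
Hypotheses (Bp : BH p) (Bdp : BH dp) (Bq : BH q) (Bdq : BH dq).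
Hypotheses (Lw : forall i, ipset L2 (w i)) (Ldw : forall i, ipset L2 (dw i)).
Let e := p - q.
Let de := dp - dq.
Let He : ipset H1 e := BH_H1 (BHB Bp Bq).
Let Hde : ipset H1 de := BH_H1 (BHB Bdp Bdq).
Local Notation E := (cell_energy Om f f1 gamma).

Let path t : (p + t *: dp) - (q + t *: dq) = e + t *: de.
Proof. by rewrite /e /de scalerBr opprD addrACA. Qed.

Let quad_continuous (a b c : R) : continuous (fun s : R => a + th s * b + th s ^+ 2 * c).
Proof.
apply: (@continuous_th _ T N (fun t => a + t * b + t ^+ 2 * c) n).
have C : Cinf (fun t : R => a + t * b + t * t * c).
  have ci := @Cinf_id R; have cc (k : R) := Cinf_cst k.
  by apply: CinfD; [apply: CinfD => //|]; apply: CinfM => //; apply: CinfM.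
exact: Cinf_continuous C.
Qed.

Let E_path t : E (p + t *: dp) (q + t *: dq) (w + t *: dw) =
  (gamma / 2 * gip e e + (gamma + f1) / 2 * ip L2 e e + 2^-1 * ip L2v w w) +
  t * (gamma / 2 * (2 * gip e de) + (gamma + f1) / 2 * (2 * ip L2 e de) + 2^-1 * (2 * ip L2v w dw)) +
  t ^+ 2 * (gamma / 2 * gip de de + (gamma + f1) / 2 * ip L2 de de + 2^-1 * ip L2v dw dw) +
  spint Om (fun x => Defs.frel f ((p + t *: dp) x) ((q + t *: dq) x)).
Proof.
have G := sip_quad hG t He Hde; have L := sip_quad hL t (H1_L2 He) (H1_L2 Hde).
have V := sip_quad hLv t Lw Ldw.
rewrite /cell_energy path; move: G L V.
move: (gip _ _) (ip L2 _ _) (ip L2v _ _) => g1 g2 g3 -> -> ->.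
exact: path_arith.
Qed.

Lemma energy_continuous : continuous (fun s => E (p + th s *: dp) (q + th s *: dq) (w + th s *: dw)).
Proof.
rewrite (funext (fun s => E_path (th s))) => s; apply: cvgD; first exact: quad_continuous.
exact: (continuous_frel hf Bp.1 Bdp.1 Bq.1 Bdq.1).
Qed.

(** The term with alpha compensates the concave part f1 of the potential and leaves
    half of gamma times the square of the H1 norm. *)
Lemma energy_coercive t : gamma / 2 * ip H1 (e + t *: de) (e + t *: de) +
  2^-1 * ip L2v (w + t *: dw) (w + t *: dw) <= E (p + t *: dp) (q + t *: dq) (w + t *: dw).
Proof.
rewrite /cell_energy path lerD2r.
have bP : bnd (p + t *: dp) by have [] := BHD Bp (BHZ t Bdp).
have bQ : bnd (q + t *: dq) by have [] := BHD Bq (BHZ t Bdq).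
have bE : bnd (e + t *: de) by have [] := BHD (BHB Bp Bq) (BHZ t (BHB Bdp Bdq)).
have F : - (f1 / 2) * ip L2 (e + t *: de) (e + t *: de) <=
    spint Om (fun x => Defs.frel f ((p + t *: dp) x) ((q + t *: dq) x)).
  rewrite -[ip L2 _ _]/(spint Om (fun x => (e + t *: de) x * (e + t *: de) x)) -spintZ; last first.
    by apply: bnd_int; exact: bndM.
  apply: le_spint.
  - by apply: SintZ; apply: bnd_int; exact: bndM.
  - have c0 := pot_continuous hf (j := 0) isT; have c1 := pot_continuous hf (j := 1) isT.
    apply: bnd_int; apply: bndBf; first by apply: bndBf; exact: (bnd_comp c0).
    by apply: bndM; [exact: (bnd_comp c1)|exact: bndBf].
  - move=> x _; apply: le_trans (pot_frel hf _ _).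
    rewrite -path expr2; exact: lexx.
have -> : ip H1 (e + t *: de) (e + t *: de) =
   ip L2 (e + t *: de) (e + t *: de) + gip (e + t *: de) (e + t *: de) by [].
move: F; move: (spint _ _) (ip L2 _ _) (gip _ _) => s l g F.
have -> : gamma / 2 * (l + g) = gamma / 2 * g + - (f1 / 2) * l + (gamma + f1) / 2 * l by field.
by rewrite lerD2r lerD2l.
Qed.

Let simpson_arith (t g Z1 W1 a b c a' b' c' : R) : 0 < t -> 0 < g ->
  Z1 / 6 <= a + b / 2 + c / 3 -> W1 / 6 <= a' + b' / 2 + c' / 3 ->
  t * (g / 12 * Z1 + W1 / 12) <=
  t * (g / 2 * a + 2^-1 * a' + (g / 2 * b + 2^-1 * b') / 2 + (g / 2 * c + 2^-1 * c') / 3).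
Proof.
move=> t0 g0 h1 h2; rewrite ler_pM2l//.
have -> : g / 2 * a + 2^-1 * a' + (g / 2 * b + 2^-1 * b') / 2 + (g / 2 * c + 2^-1 * c') / 3 =
  g / 2 * (a + b / 2 + c / 3) + 2^-1 * (a' + b' / 2 + c' / 3) by field.
have -> : g / 12 * Z1 + W1 / 12 = g / 2 * (Z1 / 6) + 2^-1 * (W1 / 6) by field.
by apply: lerD; rewrite ler_pM2l// divr_gt0.
Qed.

(** The energy step is bounded by the errors at the end points of the interval,
    whereas the estimate must be in terms of the integral of the energy. On affine
    paths the integral of a square norm controls the end values. *)
Lemma energy_integral_lower :
  tau * (gamma / 12 * (n1 e ^+ 2 + n1 (e + de) ^+ 2) + (ip L2v w w + ip L2v (w + dw) (w + dw)) / 12) <=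
  tint (fun s => E (p + th s *: dp) (q + th s *: dq) (w + th s *: dw)).
Proof.
have Ha := sip_simpson hH He Hde; have Hb := sip_simpson hLv Lw Ldw.
have Q t : gamma / 2 * ip H1 (e + t *: de) (e + t *: de) + 2^-1 * ip L2v (w + t *: dw) (w + t *: dw) =
  (gamma / 2 * ip H1 e e + 2^-1 * ip L2v w w) +
  t * (gamma / 2 * (2 * ip H1 e de) + 2^-1 * (2 * ip L2v w dw)) +
  t ^+ 2 * (gamma / 2 * ip H1 de de + 2^-1 * ip L2v dw dw).
  have G := sip_quad hH t He Hde; have V := sip_quad hLv t Lw Ldw.
  move: G V; move: (ip H1 _ _) (ip L2v _ _) => g1 g2 -> ->.
  exact: path_arith2.
have E1 : n1 e ^+ 2 = ip H1 e e by exact: (sip_sqrn hH He).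
have E2 : n1 (e + de) ^+ 2 = ip H1 (e + de) (e + de) by exact: (sip_sqrn hH (sipD hH He Hde)).
suff main (Z1 Z2 : R) : Z1 = ip H1 e e -> Z2 = ip H1 (e + de) (e + de) ->
    tau * (gamma / 12 * (Z1 + Z2) + (ip L2v w w + ip L2v (w + dw) (w + dw)) / 12) <=
    tint (fun s => E (p + th s *: dp) (q + th s *: dq) (w + th s *: dw)) by exact: (main _ _ E1 E2).
move=> -> ->.
apply: le_trans (simpson_arith tau0 hgamma Ha Hb) _.
rewrite -(tint_quad hT hN _ _ _ n0); apply: tint_le.
- exact: quad_continuous.
- exact: energy_continuous.
- by move=> t _; rewrite -Q; exact: energy_coercive.
Qed.

End lower_bound.

Section stability.
Variables (S : set scal).
Hypotheses (linS : lin S) (S_BH : S `<=` BH) (S1 : forall c, S (fun=> c)).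
Variables (p dp m beta eps : scal) (U dU : vect).
Let pm := p + 2^-1 *: dp.
Let Ub := U + 2^-1 *: dU.
Hypotheses (Sp : S p) (Sdp : S dp) (Sm : S m).
Hypotheses (BU : forall i, BH (U i)) (BdU : forall i, BH (dU i)).
Hypotheses (bbeta : bnd beta) (beps : bnd eps).
Hypotheses (hbeta : forall x, 0 <= beta x) (heps : forall x, 0 <= eps x).
Hypothesis eq1 : forall psi, S psi -> ip L2 dp psi = tau * (conv pm Ub psi - wgip beta m psi).
Hypothesis eq2 : forall xi, S xi ->
  tau * ip L2 m xi = tau * (gamma * gip pm xi) + tint (fun s => ip L2 (f' \o (p + th s *: dp)) xi).
Hypothesis eq3 : ip L2v dU Ub = - (tau * wvisc Om eps Ub Ub) - tau * conv pm Ub m.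

Definition total_energy (p : scal) (U : vect) : R :=
  gamma / 2 * gip p p + spint Om (f \o p) + 2^-1 * ip L2v U U.

Let SH u : S u -> ipset H1 u. Proof. by move=> /S_BH []. Qed.
Let SL u : S u -> ipset L2 u. Proof. by move=> /SH /H1_L2. Qed.
Let BUb i : BH (Ub i). Proof. exact: BHD (BU i) (BHZ _ (BdU i)). Qed.
Let Bpm : BH pm. Proof. exact: BHD (S_BH Sp) (BHZ _ (S_BH Sdp)). Qed.

Lemma conv_cst (c : R) : conv pm Ub (fun=> c) = 0.
Proof.
apply: big1 => i _; have [Hc hc] := H1_cst Om c.
have LF : ipset L2 (fun x => pm x * Ub i x).
  by apply: bnd_L2; apply: bndM; [case: Bpm|case: (BUb i)].
have := sip_CSn hL LF (H1_wL2 i Hc).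
rewrite (aeq_ip00 (L2_pm (H1_wL2 i Hc)) (hc i)) sqrtr0 mulr0 normr_le0 => /eqP.
by [].
Qed.

Lemma mass_conservation : spint Om (p + dp) = spint Om p.
Proof.
have E := eq1 (S1 1); rewrite conv_cst in E.
have w0 : wgip beta m (fun=> 1) = 0.
  have hB := semi_ip_wgip bbeta hbeta; have [Hc hc] := H1_cst Om 1.
  have z : wgip beta (fun=> 1) (fun=> 1) = 0.
    have Lb i : ipset L2 (fun x => beta x * wpartial Om i (fun=> 1) x).
      by apply: bnd_L2M => //; exact: H1_wL2.
    apply: big1 => i _; have := sip_CSn hL (Lb i) (H1_wL2 i Hc).
    by rewrite (aeq_ip00 (L2_pm (H1_wL2 i Hc)) (hc i)) sqrtr0 mulr0 normr_le0 => /eqP.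
  by have := sip_CSn hB (SH Sm) Hc; rewrite z sqrtr0 mulr0 normr_le0 => /eqP.
rewrite w0 subrr mulr0 in E.
have Ed : spint Om dp = 0.
  rewrite -E; congr (spint Om _); apply/funext => x.
  by rewrite mulr1.
have := spintD (L2_int (SL Sp)) (L2_int (SL Sdp)); rewrite Ed addr0; exact.
Qed.

(** Testing with m, dp and Ub, as in the relative case but without residuals: the
    convection terms cancel and the dissipation is nonnegative. *)
Lemma energy_decay : total_energy (p + dp) (U + dU) <= total_energy p U.
Proof.
have [[bp _] [bdp _]] := (S_BH Sp, S_BH Sdp).
have F := potential_ftc hT hN n0 hf bp bdp.
have E2 := eq2 Sdp; rewrite F in E2.
have E1 := eq1 Sm.
have G := sip_increment hG (SH Sp) (SH Sdp).
have LU i : ipset L2 (U i) by exact: BH_L2.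
have LdU i : ipset L2 (dU i) by exact: BH_L2.
have V := sip_increment hLv LU LdU.
rewrite -/pm in G; rewrite -/Ub in V.
have LUb i : ipset L2 (Ub i) by exact: BH_L2.
have VC : ip L2v Ub dU = ip L2v dU Ub by exact: (sipC hLv).
have C : ip L2 dp m = ip L2 m dp by exact: (sipC hL (SL Sdp) (SL Sm)).
have hB := semi_ip_wgip bbeta hbeta; have hE := semi_ip_wgip beps heps.
have D1 : 0 <= wgip beta m m by exact: (sip_ge0 hB (SH Sm)).
have D2 : 0 <= wvisc Om eps Ub Ub by apply: sumr_ge0 => i _; apply: (sip_ge0 hE); case: (BUb i).
move: E1 E2 eq3 G V D1 D2; rewrite /total_energy VC C.
move: (spint Om (f \o (p + dp))) (spint Om (f \o p)) (gip (p + dp) (p + dp)) (gip p p) (gip pm dp).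
move: (ip L2v (U + dU) (U + dU)) (ip L2v U U) (ip L2v dU Ub) (conv pm Ub m) (ip L2 m dp).
move: (wgip beta m m) (wvisc Om eps Ub Ub) tau tau0.
move=> D1 D2 t t0 v1 v2 v3 c md F1 F2 g1 g2 g3 E1 E2 E3 G V D10 D20.
have E2' : md = gamma * g3 + (F1 - F2) by apply: (mulfI (lt0r_neq0 t0)); rewrite E2 [RHS]mulrDr.
have key : gamma / 2 * g1 + F1 + 2^-1 * v1 = gamma / 2 * g2 + F2 + 2^-1 * v2 - t * (D1 + D2).
  have -> : g1 = g2 + 2 * g3 by rewrite -G addrC subrK.
  have -> : v1 = v2 + 2 * v3 by rewrite -V addrC subrK.
  have -> : F1 = F2 + (md - gamma * g3) by rewrite E2'; ring.
  by rewrite E1 E3; field.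
by rewrite key gerBl mulr_ge0// ?addr_ge0// ltW.
Qed.

End stability.
End cell_bounds.

(** * Dual norms and piecewise polynomials on one interval *)

(** A supremum is an upper bound only if the set is bounded, hence the hypothesis
    pC; an element of norm zero is paired to zero by the same hypothesis. *)
Section dual_norm.
Context {R : realType} {V : lmodType R} (X : ipspace V) (S : set V).
Variables (pairing : V -> V -> R) (r : V) (C : R).
Hypothesis S0 : S 0.
Hypothesis SN : forall v, S v -> S (- v).
Hypothesis pN : forall v, S v -> pairing r (- v) = - pairing r v.
Hypothesis nN : forall v, S v -> ipnorm X (- v) = ipnorm X v.
Hypothesis pC : forall v, S v -> `|pairing r v| <= C * ipnorm X v.
Hypothesis C0 : 0 <= C.

Let A : set R := [set pairing r v / ipnorm X v | v in S].

Let A_ub : has_ubound A.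
Proof.
exists C => _ [v Sv <-]; have [->|v0] := eqVneq (ipnorm X v) 0; first by rewrite invr0 mulr0.
have n0 : 0 < ipnorm X v by rewrite lt_neqAle eq_sym v0 sqrtr_ge0.
by rewrite ler_pdivrMr//; apply: le_trans (ler_norm _) (pC Sv).
Qed.

Let le_dual v : S v -> pairing r v <= dual_norm pairing X S r * ipnorm X v.
Proof.
move=> Sv; have [n0|v0] := eqVneq (ipnorm X v) 0.
  by have := pC Sv; rewrite n0 !mulr0 normr_le0 => /eqP ->.
have n0 : 0 < ipnorm X v by rewrite lt_neqAle eq_sym v0 sqrtr_ge0.
by rewrite -ler_pdivrMr//; apply: (ub_le_sup A_ub); exists v.
Qed.

Lemma dual_norm_le v : S v -> `|pairing r v| <= dual_norm pairing X S r * ipnorm X v.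
Proof.
move=> Sv; rewrite ler_norml le_dual// andbT lerNl -pN// -[ipnorm X v]nN//.
by apply: le_dual; exact: SN.
Qed.

Lemma dual_norm_ge0 : 0 <= dual_norm pairing X S r.
Proof.
have p0 : pairing r 0 = 0.
  have := pN S0; rewrite oppr0 => /eqP; rewrite -addr_eq0 -mulr2n mulrn_eq0 => /orP[//|].
  by move/eqP.
by apply: (ub_le_sup A_ub); exists 0 => //; rewrite p0 mul0r.
Qed.

End dual_norm.

Section cells.
Context {R : realType} (T : R) (N : nat).
Hypotheses (hT : 0 < T) (hN : (0 < N)%N).
Local Notation tg := (tgrid T N).
Local Notation tau := (Defs.tau T N).
Local Notation tint := (tint T N).
Local Notation th := (cell_time T N).
Local Notation Inn n t := (tg n.-1 < t <= tg n).

Let tau0 : 0 < tau := tau_gt0 hT hN.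

Section representation.
Context {V : lmodType R} (X : ipspace V).
Hypothesis hX : semi_ip (ipset X) (ip X).

(** Continuity is in the semi-norm of X: the value at the left end point is the limit
    only up to elements of norm zero. *)
Lemma P1c_cell u n : Ppwc T N 1 X u -> (1 <= n <= N)%N ->
  exists A0 A1, [/\ ipset X A0, ipset X A1, forall t, Inn n t -> u t = A0 + th n t *: A1 &
    ip X (u (tg n.-1) - A0) (u (tg n.-1) - A0) = 0].
Proof.
move=> [Pu uC] nN; have [a [Xa aE]] := Pu n nN; have /andP[n0 nN'] := nN.
pose A1 := tau *: a ord_max; pose A0 := a ord0 + tg n.-1 *: a ord_max.
have XA1 : ipset X A1 by exact: (sipZ hX).
have XA0 : ipset X A0 by apply: (sipD hX) => //; exact: (sipZ hX).
have uE t : Inn n t -> u t = A0 + th n t *: A1.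
  move=> /aE ->; rewrite big_ord_recl big_ord1 expr0 scale1r expr1 /A0 /A1 -addrA.
  congr (_ + _); rewrite (_ : lift ord0 ord0 = ord_max); last exact: val_inj.
  by rewrite scalerA -scalerDl /cell_time divfK ?gt_eqF// addrC subrK.
exists A0, A1; split => //.
set t := tg n.-1; have tT : 0 <= t <= T.
  by rewrite (tg_ge0 hT hN) -(tgN T hN) (tg_mono hT hN)// (leq_trans (leq_pred n)).
have Xt : ipset X (u t) by exact: uC.1.
set D := u t - A0; have XD : ipset X D by exact: (sipB hX).
(* The value at the left end point is approached from inside the interval, at a
   distance del that makes both the modulus of continuity and the slope small. *)
have small e : 0 < e -> Num.sqrt (ip X D D) <= e.
  move=> e0; have [r r0 hr] := bochner_C_near uC tT (divr_gt0 e0 (ltr0n _ 2)).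
  pose nA := Num.sqrt (ip X A1 A1); have nA0 : 0 <= nA by exact: sqrtr_ge0.
  have k0 : 0 < 2 * (nA + 1) by rewrite mulr_gt0// ltr_wpDl.
  pose del := Num.min (r / 2) (Num.min tau (tau * (e / (2 * (nA + 1))))).
  have d0 : 0 < del.
    rewrite /del !lt_min; apply/andP; split; first exact: divr_gt0.
    by apply/andP; split => //; apply: mulr_gt0 => //; exact: divr_gt0.
  have d1 : del <= r / 2 by rewrite ge_min lexx.
  have d2 : del <= tau by rewrite !ge_min lexx orbT.
  have d3 : del <= tau * (e / (2 * (nA + 1))) by rewrite !ge_min lexx !orbT.
  have sI : Inn n (t + del) by rewrite ltrDl d0/= (tgP T N n0) lerD2l.
  have sT : 0 <= t + del <= T.
    have /andP[_ h] := sI; rewrite addr_ge0 ?(tg_ge0 hT hN) ?(ltW d0)//=.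
    by apply: le_trans h _; rewrite -[leRHS](tgN T hN) (tg_mono hT hN).
  have h1 : Num.sqrt (ip X (u (t + del) - u t) (u (t + del) - u t)) <= e / 2.
    apply: hr => //; rewrite addrAC subrr add0r gtr0_norm//.
    by apply: le_lt_trans d1 _; rewrite ltr_pdivrMr// ltr_pMr// ltr1n.
  have thE : th n (t + del) = del / tau by rewrite /cell_time addrAC subrr add0r.
  have ED : D = - (u (t + del) - u t) + th n (t + del) *: A1.
    have gen (x a' k : V) : x - a' = - (a' + k - x) + k by rewrite opprB opprD addrA subrK.
    by rewrite (uE _ sI) /D; exact: gen.
  have XS : ipset X (u (t + del)) by exact: uC.1.
  have Xd := sipB hX XS Xt.
  rewrite {1 2}ED; apply: le_trans (sip_tri hX (sipN hX Xd) (sipZ hX _ XA1)) _.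
  rewrite (sip_nmN hX Xd) (sip_nmZ hX _ XA1) thE -/nA ger0_norm; last by rewrite divr_ge0// ltW.
  have h2 : del / tau * nA <= e / 2.
    apply: (@le_trans _ _ (e / (2 * (nA + 1)) * nA)).
      by apply: ler_wpM2r => //; rewrite ler_pdivrMr// mulrC.
    rewrite invfM mulrA -mulrA ler_piMr//; first by rewrite divr_ge0// ltW.
    by rewrite mulrC ler_pdivrMr ?mul1r ?lerDl// ltr_wpDl.
  by apply: le_trans (lerD h1 h2) _; rewrite -splitr.
have c0 := sqrtr_ge0 (ip X D D).
rewrite -(sip_sqrn hX XD); suff -> : Num.sqrt (ip X D D) = 0 by rewrite expr0n.
apply/eqP; rewrite eq_le c0 andbT; apply/ler_addgt0Pr => e e0; rewrite add0r; exact: small.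
Qed.

End representation.

Lemma I1_cell {V : lmodType R} (u : R -> V) n t : (0 < n)%N -> tg n.-1 <= t <= tg n ->
  I1 T N u t = u (tg n.-1) + th n t *: (u (tg n) - u (tg n.-1)).
Proof.
move=> n0 /andP[t1 t2]; rewrite /I1.
have E m : tg m / tau = m%:R by rewrite /tgrid mulfK// gt_eqF.
have [tn|tn] := eqVneq t (tg n).
  by rewrite tn E natrK subrr scale0r addr0 (th_end hT hN n0) scale1r addrC subrK.
have tr : Num.truncn (t / tau) = n.-1.
  apply: truncn_def; rewrite prednK// ler_pdivlMr// ltr_pdivrMr//.
  by rewrite t1 lt_neqAle tn.
rewrite tr prednK//; congr (_ + _ *: _).
by rewrite /cell_time mulrBl E.
Qed.

Lemma dt_cell {S : Type} (u : R -> S -> R) (a0 a1 : S -> R) n t :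
  (forall s, Inn n s -> u s = a0 + th n s *: a1) -> tg n.-1 < t < tg n ->
  dt u t = tau^-1 *: a1.
Proof.
move=> uE /andP[t1 t2]; apply/funext => x; rewrite /dt derive1E.
pose g s : R := a0 x + th n s * a1 x.
have dg : is_derive t (1 : R) g (tau^-1 * a1 x).
  have dth : is_derive t (1 : R) (th n) tau^-1.
    have := @is_derive_aff R id (fun=> 1) (tg n.-1) tau^-1 t (fun s => is_derive_id _ _).
    by rewrite mul1r.
  have d2 : is_derive t (1 : R) (fun=> a0 x) 0 by exact: is_derive_cst.
  have d3 : is_derive t (1 : R) (fun=> a1 x) 0 by exact: is_derive_cst.
  have := is_deriveD d2 (is_deriveM dth d3).
  rewrite scaler0 !add0r => h; apply: is_derive_eq h _.
  by rewrite [LHS]mulrC.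
have [_ E] := dg; transitivity ('D_1 g t); last exact: E.
apply: near_eq_derive.
near=> s; rewrite (uE s)//.
have s1 : tg n.-1 < s by near: s; exact: lt_nbhsr.
have s2 : s < tg n by near: s; exact: lt_nbhsl.
by rewrite s1 ltW.
Unshelve. all: by end_near. Qed.

Lemma tint_affine_on n g a b : (0 < n)%N ->
  (forall t, tg n.-1 < t < tg n -> g t = a + th n t * b) -> tint n g = tau * (a + 2^-1 * b).
Proof.
move=> n0 h; rewrite -(tint_affine hT hN a b n0); apply: tint_eq => //.
exact: continuous_th_affine.
Qed.

Lemma tint_cst_on n g a : (0 < n)%N ->
  (forall t, tg n.-1 < t < tg n -> g t = a) -> tint n g = tau * a.
Proof.
move=> n0 h; rewrite (@tint_affine_on n g a 0 n0) ?mulr0 ?addr0// => t tn.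
by rewrite mulr0 addr0; exact: h.
Qed.

End cells.

(** * Independence of representatives *)

Section representatives.
Context {R : realType} {d : nat} (Om : cube R d).
Local Notation scal := ('rV[R]_d -> R).
Local Notation vect := ('I_d -> 'rV[R]_d -> R).
Local Notation L2 := (L2 Om).
Local Notation L2v := (L2v Om).
Local Notation H1 := (sobolev Om 1).
Local Notation Hv := (sobolevv Om 1).
Local Notation bnd := (bnd Om).
Local Notation BH := (BH Om).
Local Notation gip := (gip Om).
Local Notation wgip := (wgip Om).
Local Notation conv := (conv Om).
Local Notation aeq := (aeq Om).
Local Notation pm := (pm Om).

Let hL := semi_ip_L2 Om.
Let hH := semi_ip_H1 Om.
Let hG := semi_ip_gip Om.

Lemma BH_pm u : BH u -> pm u. Proof. by case=> -[]. Qed.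

Lemma aeq_sub u v : ipset L2 u -> ipset L2 v -> ip L2 (u - v) (u - v) = 0 -> aeq u v.
Proof.
move=> Lu Lv h; have := aeq_ip0 (sipB hL Lu Lv) h.
by apply: filterS => x h0 Dx; apply/eqP; rewrite -subr_eq0; apply/eqP; exact: h0.
Qed.

Lemma aeq_vec (u v : vect) : (forall i, ipset L2 (u i)) -> (forall i, ipset L2 (v i)) ->
  ip L2v (u - v) (u - v) = 0 -> forall i, aeq (u i) (v i).
Proof.
move=> Lu Lv h i; apply: aeq_sub => //.
have L0 j : 0 <= ip L2 ((u - v) j) ((u - v) j) by exact: (sip_ge0 hL (sipB hL (Lu j) (Lv j))).
apply/eqP; rewrite eq_le; apply/andP; split; last exact: L0.
by rewrite -h /= (bigD1 i)//= lerDl; apply: sumr_ge0 => j _; exact: L0.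
Qed.

Lemma aeq_H1 u v : ipset H1 u -> ipset H1 v -> ip H1 (u - v) (u - v) = 0 -> aeq u v.
Proof.
move=> Hu Hv h; apply: aeq_sub; [exact: H1_L2|exact: H1_L2|].
have Huv := sipB hH Hu Hv; apply/eqP; rewrite eq_le; apply/andP; split.
  by rewrite -h lerDl; exact: (sip_ge0 hG Huv).
exact: (sip_ge0 hL (H1_L2 Huv)).
Qed.

Lemma conv_aeq p (U U' : vect) psi : pm p -> (forall i, pm (U i)) -> (forall i, pm (U' i)) ->
  (forall i, aeq (U i) (U' i)) -> ipset H1 psi -> conv p U psi = conv p U' psi.
Proof.
move=> pp pU pU' UU Hpsi; apply: eq_bigr => i _; apply: ip_aeq.
- exact: pmM.
- exact: pmM.
- exact: L2_pm (H1_wL2 i Hpsi).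
- by apply: (aeq_op2 *%R) => //; exact: aeq_refl.
Qed.

Lemma gip_aeq2 u u' : pm u -> pm u' -> aeq u u' -> gip u u = gip u' u'.
Proof. by move=> pu pu' uu; apply: eq_bigr => i _; rewrite (wpartial_aeq i pu pu' uu). Qed.

Let mulE (k a b : R) : a = b -> k * a = k * b. Proof. by move->. Qed.

Section transport.

Lemma advectD (a a' : vect) u : advect Om (a + a') u = advect Om a u + advect Om a' u.
Proof.
apply/funext => x; rewrite -[RHS]/(advect Om a u x + advect Om a' u x) /advect -big_split /=.
by apply: eq_bigr => j _; exact: mulrDl.
Qed.

Lemma advectZ (k : R) (a : vect) u : advect Om (k *: a) u = k *: advect Om a u.
Proof.
apply/funext => x; rewrite -[RHS]/(k * advect Om a u x) /advect mulr_sumr.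
by apply: eq_bigr => j _; rewrite mulrA.
Qed.

Let L2_sum (s : seq 'I_d) (F : 'I_d -> scal) : (forall j, ipset L2 (F j)) ->
  ipset L2 (fun x => \sum_(j <- s) F j x).
Proof.
move=> LF; elim: s => [|j s IH].
  have -> : (fun x => \sum_(j <- [::]) F j x) = 0 :> scal by apply/funext => x; rewrite big_nil.
  exact: L2_0.
rewrite (_ : (fun x => _) = F j + (fun x => \sum_(k <- s) F k x)); first exact: L2D.
by apply/funext => x; rewrite big_cons.
Qed.

Lemma advect_L2 (a : vect) u : (forall j, bnd (a j)) -> ipset H1 u -> ipset L2 (advect Om a u).
Proof. by move=> ba Hu; apply: L2_sum => j; apply: bnd_L2M => //; exact: H1_wL2. Qed.

Lemma advectBr (a : vect) u v : ipset H1 u -> ipset H1 v ->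
  aeq (advect Om a (u - v)) (advect Om a u - advect Om a v).
Proof.
move=> Hu Hv; have HN : ipset H1 (- v) by exact: (sipN hH).
have aall : {ae lebesgue_rV d, forall x, forall j : 'I_d, cube_set Om x ->
    wpartial Om j (u - v) x = wpartial Om j u x - wpartial Om j v x}.
  apply: filter_forall => j; have [_ /(_ j) h1] := H1D Hu HN; have [_ /(_ j) h2] := H1Z (-1) Hv.
  rewrite -scaleN1r in h1 *; apply: filterS2 h1 h2 => x h1 h2 Dx; rewrite h1//.
  by rewrite -[LHS]/(wpartial Om j u x + wpartial Om j (-1 *: v) x) h2// -[X in _ + X]/(-1 * wpartial Om j v x) mulN1r.
apply: filterS aall => x h Dx.
rewrite -[RHS]/(advect Om a u x - advect Om a v x) /advect -sumrB.
by apply: eq_bigr => j _; rewrite h// mulrBr.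
Qed.

(** The two halves of the skew-symmetric form coincide. *)
Lemma skw_antisym (a b : vect) : skw Om a b b = 0.
Proof.
rewrite /skw (_ : ip L2v b _ = ip L2v (advectv Om a b) b) ?subrr ?mulr0//.
by apply: eq_bigr => i _; congr (spint Om _); apply/funext => x; exact: mulrC.
Qed.

Lemma skw_affine (a a' b c : vect) (k : R) : (forall j, bnd (a j)) -> (forall j, bnd (a' j)) ->
  (forall i, BH (b i)) -> (forall i, BH (c i)) ->
  skw Om (a + k *: a') b c = skw Om a b c + k * skw Om a' b c.
Proof.
move=> ba ba' bb bc; have bka j : bnd ((k *: a') j) by exact: bndZ.
have Lb i : ipset L2 (b i) by exact: BH_L2.
have Lc i : ipset L2 (c i) by exact: BH_L2.
have A u v : (forall i, ipset H1 (u i)) -> (forall i, ipset L2 (v i)) ->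
    ip L2v (advectv Om (a + k *: a') u) v = ip L2v (advectv Om a u) v + k * ip L2v (advectv Om a' u) v.
  move=> Hu Lv; rewrite mulr_sumr -big_split; apply: eq_bigr => i _ /=.
  have L1 := advect_L2 ba (Hu i); have L2' := advect_L2 ba' (Hu i).
  rewrite -[RHS]/(ip L2 (advect Om a (u i)) (v i) + k * ip L2 (advect Om a' (u i)) (v i)).
  rewrite -(sipZl hL k L2' (Lv i)) -(sipDl hL L1 (sipZ hL k L2') (Lv i)).
  by rewrite -advectZ -advectD.
have C u v : ip L2v u v = ip L2v v u.
  by apply: eq_bigr => i _; congr (spint Om _); apply/funext => x; exact: mulrC.
have Hb i : ipset H1 (b i) by case: (bb i).
have Hc i : ipset H1 (c i) by case: (bc i).
rewrite /skw (C b) (C b (advectv Om a c)) (C b (advectv Om a' c)) (A b c)// (A c b)//.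
by move: (ip L2v _ _) (ip L2v _ _) (ip L2v _ _) (ip L2v _ _) => x1 x2 x3 x4; field.
Qed.

Lemma skwBm (a b b' c : vect) : (forall j, bnd (a j)) ->
  (forall i, BH (b i)) -> (forall i, BH (b' i)) -> (forall i, BH (c i)) ->
  skw Om a (b - b') c = skw Om a b c - skw Om a b' c.
Proof.
move=> ba bb bb' bc.
have E1 : ip L2v (advectv Om a (b - b')) c = ip L2v (advectv Om a b) c - ip L2v (advectv Om a b') c.
  rewrite -sumrB; apply: eq_bigr => i _.
  have [Hb Hb'] := (BH_H1 (bb i), BH_H1 (bb' i)).
  have [L1 L1'] := (advect_L2 ba Hb, advect_L2 ba Hb').
  rewrite -[RHS]/(ip L2 (advect Om a (b i)) (c i) - ip L2 (advect Om a (b' i)) (c i)).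
  rewrite -(sipBl hL L1 L1' (BH_L2 (bc i))); apply: ip_aeq.
  - by apply: L2_pm; apply: advect_L2 => //; exact: (sipB hH Hb Hb').
  - by apply: L2_pm; exact: (sipB hL).
  - exact: BH_pm.
  - exact: advectBr.
have E2 : ip L2v (b - b') (advectv Om a c) = ip L2v b (advectv Om a c) - ip L2v b' (advectv Om a c).
  rewrite -sumrB; apply: eq_bigr => i _.
  by rewrite -(sipBl hL (BH_L2 (bb i)) (BH_L2 (bb' i)) (advect_L2 ba (BH_H1 (bc i)))).
rewrite /skw E1 E2.
by move: (ip L2v _ _) (ip L2v _ _) (ip L2v _ _) (ip L2v _ _) => x1 x2 x3 x4; field.
Qed.

(** The field b' enters through its weak derivatives, which are literally those of b,
    and through integrals. *)
Lemma skw_aeq (a b b' c : vect) : (forall j, bnd (a j)) -> (forall i, ipset H1 (b i)) ->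
  (forall i, pm (b' i)) -> (forall i, aeq (b i) (b' i)) -> (forall i, ipset H1 (c i)) ->
  skw Om a b' c = skw Om a b c.
Proof.
move=> ba Hb pb' bb Hc.
have pb i : pm (b i) by exact: L2_pm (H1_L2 (Hb i)).
have E1 : ip L2v (advectv Om a b') c = ip L2v (advectv Om a b) c.
  apply: eq_bigr => i _; congr (spint Om _); apply/funext => x; congr (_ * _); apply: eq_bigr => j _.
  by rewrite (wpartial_aeq j (pb i) (pb' i) (bb i)).
have E2 : ip L2v b (advectv Om a c) = ip L2v b' (advectv Om a c).
  apply: eq_bigr => i _; exact: (ip_aeq (pb i) (pb' i) (L2_pm (advect_L2 ba (Hc i))) (bb i)).
by rewrite /skw E1 E2.
Qed.

End transport.

Lemma visc_aeq a (u u' w : vect) : (forall i, pm (u i)) -> (forall i, pm (u' i)) ->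
  (forall i, aeq (u i) (u' i)) -> visc Om a u w = visc Om a u' w.
Proof.
move=> pu pu' uu; apply: eq_bigr => i _; apply: eq_bigr => j _.
by rewrite /scalev /grad (wpartial_aeq j (pu i) (pu' i) (uu i)).
Qed.

Lemma conv_swap p (u v : vect) : ip L2v (scalev p u) v = ip L2v (scalev p v) u.
Proof.
by apply: eq_bigr => i _; congr (spint Om _); apply/funext => x; rewrite /scalev mulrAC.
Qed.

Let sum3 (a a' b b' c c' : R) : a = a' -> b = b' -> c = c' -> a + b + c = a' + b' + c'.
Proof. by move=> -> -> ->. Qed.

Let sum4 (a a' b b' c c' e e' : R) : a = a' -> b = b' -> c = c' -> e = e' ->
  a + b + c + e = a' + b' + c' + e'.
Proof. by move=> -> -> -> ->. Qed.

Let sum_int (I : finType) (F : I -> scal) : (forall i, Sint Om (F i)) ->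
  Sint Om (fun x => \sum_i F i x) /\ spint Om (fun x => \sum_i F i x) = \sum_i spint Om (F i).
Proof. by move=> iF; split; [exact: Sint_sum|exact: spint_sum]. Qed.

Section energies.
Variables (f : R -> R) (f1 : R) (f2 f3 : nat -> R) (gamma : R).
Hypothesis hf : potential_ok f f1 f2 f3.

Let cf : continuous f := pot_continuous hf (j := 0) isT.
Let cf' : continuous (derive1 f) := pot_continuous hf (j := 1) isT.

Let bfrel p q : bnd p -> bnd q -> bnd (fun x => Defs.frel f (p x) (q x)).
Proof.
move=> bp bq; apply: bndBf; first by apply: bndBf; exact: (bnd_comp cf).
by apply: bndM; [exact: (bnd_comp cf')|exact: bndBf].
Qed.

Lemma cell_energy_aeq p p' q w w' : BH p -> BH p' -> BH q ->
  (forall i, ipset L2 (w i)) -> (forall i, ipset L2 (w' i)) ->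
  aeq p p' -> (forall i, aeq (w i) (w' i)) ->
  cell_energy Om f f1 gamma p q w = cell_energy Om f f1 gamma p' q w'.
Proof.
move=> bp bp' bq Lw Lw' pp ww.
have be := BHB bp bq; have be' := BHB bp' bq.
have [pe pe'] := (BH_pm be, BH_pm be').
have ee : aeq (p - q) (p' - q) by apply: filterS pp => x h Dx; rewrite -[LHS]/(p x - q x) h.
have ip2 u u' : ipset L2 u -> ipset L2 u' -> aeq u u' -> ip L2 u u = ip L2 u' u'.
  move=> Lu Lu' uu; have [pu pu'] := (L2_pm Lu, L2_pm Lu').
  rewrite (ip_aeq pu pu' pu uu) (sipC hL Lu' Lu).
  exact: (ip_aeq pu pu' pu' uu).
apply: sum4.
- by apply: mulE; exact: gip_aeq2.
- apply: spint_aeq.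
  + by case: (bfrel bp.1 bq.1) => -[].
  + by case: (bfrel bp'.1 bq.1) => -[].
  + by apply: filterS pp => x h Dx; rewrite h.
- by apply: mulE; apply: ip2; [exact: BH_L2|exact: BH_L2|].
- by apply: mulE; apply: eq_bigr => i _; exact: ip2.
Qed.

Lemma total_energy_aeq p p' w w' : BH p -> BH p' ->
  (forall i, ipset L2 (w i)) -> (forall i, ipset L2 (w' i)) ->
  aeq p p' -> (forall i, aeq (w i) (w' i)) ->
  total_energy Om f gamma p w = total_energy Om f gamma p' w'.
Proof.
move=> bp bp' Lw Lw' pp ww; have [pe pe'] := (BH_pm bp, BH_pm bp').
have ip2 u u' : ipset L2 u -> ipset L2 u' -> aeq u u' -> ip L2 u u = ip L2 u' u'.
  move=> Lu Lu' uu; have [pu pu'] := (L2_pm Lu, L2_pm Lu').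
  rewrite (ip_aeq pu pu' pu uu) (sipC hL Lu' Lu).
  exact: (ip_aeq pu pu' pu' uu).
apply: sum3.
- by apply: mulE; exact: gip_aeq2.
- apply: spint_aeq.
  + by case: (bnd_comp cf bp.1) => -[].
  + by case: (bnd_comp cf bp'.1) => -[].
  + by apply: filterS pp => x h Dx; rewrite /= h.
- by apply: mulE; apply: eq_bigr => i _; exact: ip2.
Qed.

Lemma sum_sqr_spint (F : vect) : (forall i, ipset L2 (F i)) ->
  Sint Om (fun x => \sum_i F i x ^+ 2) /\ spint Om (fun x => \sum_i F i x ^+ 2) = ip L2v F F.
Proof.
move=> LF; have i2 i : Sint Om (fun x => F i x ^+ 2).
  by rewrite (_ : (fun x => _) = fun x => F i x * F i x) ?L2_mul//; apply/funext => x; rewrite expr2.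
have [h1 h2] := sum_int i2; split => //; rewrite h2; apply: eq_bigr => i _.
Qed.

(** As f1 is nonnegative, the maximum in alpha is gamma + f1. *)
Lemma rel_energyE p q (u v : vect) : 0 <= f1 -> BH p -> BH q ->
  (forall i, ipset L2 (u i)) -> (forall i, ipset L2 (v i)) ->
  rel_energy Om gamma f (Num.max gamma (gamma + f1)) p u q v = cell_energy Om f f1 gamma p q (u - v).
Proof.
move=> f10 bp bq Lu Lv.
have -> : Num.max gamma (gamma + f1) = gamma + f1 by apply: max_r; rewrite lerDl.
have [Hp Hq] := (BH_H1 bp, BH_H1 bq); have be := BHB bp bq; have Le := BH_L2 be.
pose G : vect := fun i => wpartial Om i p - wpartial Om i q.
have LG i : ipset L2 (G i) by apply: (sipB hL); exact: H1_wL2.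
have Luv i : ipset L2 ((u - v) i) by exact: (sipB hL).
have [iG sG] := sum_sqr_spint LG; have [iW sW] := sum_sqr_spint Luv.
have iF : Sint Om (fun x => Defs.frel f (p x) (q x)) by apply: bnd_int; apply: bfrel; [case: bp|case: bq].
have iE : Sint Om (fun x => (p x - q x) ^+ 2).
  by rewrite (_ : (fun x => _) = fun x => (p - q) x * (p - q) x) ?L2_mul//; apply/funext => x; rewrite expr2.
have EE : spint Om (fun x => (p x - q x) ^+ 2) = ip L2 (p - q) (p - q).
  by congr (spint Om _); apply/funext => x; rewrite expr2.
have EG : ip L2v G G = gip (p - q) (p - q).
  apply: eq_bigr => i _; have HN : ipset H1 (- q) by exact: (sipN hH).
  have ww : aeq (wpartial Om i (p - q)) (G i).
    have [_ /(_ i) h1] := H1D Hp HN; have [_ /(_ i) h2] := H1Z (-1) Hq.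
    rewrite -scaleN1r in h1 *; apply: filterS2 h1 h2 => x h1 h2 Dx; rewrite h1//.
    by rewrite -[LHS]/(wpartial Om i p x + wpartial Om i (-1 *: q) x) h2// -[X in _ + X]/(-1 * wpartial Om i q x) mulN1r.
  have Lw := H1_wL2 i (BH_H1 be).
  have [pw pG] := (L2_pm Lw, L2_pm (LG i)).
  rewrite -(ip_aeq pw pG pG ww) (sipC hL Lw (LG i)).
  exact/esym/(ip_aeq pw pG pw ww).
rewrite /rel_energy /cell_energy.
rewrite spintD; last 2 first.
- by apply: SintD; [apply: SintD => //; exact: SintZ|exact: SintZ].
- exact: SintZ.
rewrite spintD; last 2 first.
- by apply: SintD => //; exact: SintZ.
- exact: SintZ.
rewrite spintD//; last exact: SintZ.
rewrite (spintZ _ iG) (spintZ _ iE) (spintZ _ iW) EE.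
rewrite -[spint Om (fun x => \sum_i G i x ^+ 2)]/(spint Om (fun x => \sum_i G i x ^+ 2)) sG EG.
by congr (_ + _ * _); rewrite -sW.
Qed.

End energies.

Lemma dissipationE (b eta : R -> R) p m m' (u u' : vect) :
  bnd (b \o p) -> bnd (eta \o p) ->
  pm m -> ipset H1 m' -> aeq m m' -> (forall i, pm (u i)) -> (forall i, ipset H1 (u' i)) ->
  (forall i, aeq (u i) (u' i)) ->
  dissipation Om b eta p m u = wgip (b \o p) m' m' + wvisc Om (eta \o p) u' u'.
Proof.
move=> bb be pm' Hm mm pu Hu uu.
have G i : grad Om m i = grad Om m' i by exact: (wpartial_aeq i pm' (L2_pm (H1_L2 Hm)) mm).
have GU i j : grad Om (u i) j = grad Om (u' i) j by exact: (wpartial_aeq j (pu i) (L2_pm (H1_L2 (Hu i))) (uu i)).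
rewrite /dissipation.
have w2 a (v : scal) j : bnd a -> ipset H1 v -> Sint Om (fun x => (a x * wpartial Om j v x) * wpartial Om j v x).
  by move=> ba Hv; apply: L2_mul; [apply: bnd_L2M => //|]; exact: H1_wL2.
have iB := sum_int (fun j => w2 (b \o p) m' j bb Hm).
have iE1 i := sum_int (fun j => w2 (eta \o p) (u' i) j be (Hu i)).
have iE := sum_int (fun i => (iE1 i).1).
rewrite (_ : (fun x => _) = (fun x => \sum_j (b \o p) x * wpartial Om j m' x * wpartial Om j m' x) \+
    (fun x => \sum_i \sum_j (eta \o p) x * wpartial Om j (u' i) x * wpartial Om j (u' i) x)); last first.
  apply/funext => x /=; congr (_ + _); rewrite mulr_sumr; apply: eq_bigr => i _.
    by rewrite G expr2 mulrA.
  by rewrite mulr_sumr; apply: eq_bigr => j _; rewrite GU expr2 mulrA.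
rewrite spintD; [|exact: iB.1|exact: iE.1].
rewrite iB.2 iE.2; congr (_ + _); apply: eq_bigr => i _.
by rewrite (iE1 i).2.
Qed.

End representatives.

Section projections.
Context {R : realType} {d : nat} (Om : cube R d) (Th : seq 'M[R]_(d.+1, d)).
Hypothesis cover : \bigcup_(K in [set` Th]) cell K = cube_set Om.
Local Notation vect := ('I_d -> 'rV[R]_d -> R).
Local Notation L2 := (L2 Om).
Local Notation H1 := (sobolev Om 1).
Local Notation Hv := (sobolevv Om 1).
Let hL := semi_ip_L2 Om.
Let hH := semi_ip_H1 Om.

Lemma Vh_BH v : Vh Om Th v -> BH Om v.
Proof. by move=> hv; split; [exact: (Vh_bnd cover hv)|exact: (Vh_H1 hv)]. Qed.

Lemma lin_Vhv : lin (Vhv Om Th).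
Proof.
have [V0 VD VZ] := lin_Vh Om Th; split => //.
- by move=> u v hu hv i; exact: VD.
- by move=> a u hu i; exact: VZ.
Qed.

(** The divergence of the family is a sum of functions, and the inner product is
    additive because the derivatives are square integrable. *)
Lemma ip_div (u : vect) q : (forall i, ipset H1 (u i)) -> ipset L2 q ->
  ip L2 (div Om u) q = \sum_i ip L2 q (wpartial Om i (u i)).
Proof.
move=> Hu Lq; rewrite -spint_sum; last by move=> i; apply: L2_mul => //; exact: H1_wL2.
by congr (spint Om _); apply/funext => x; rewrite /div fct_sumE mulr_suml; apply: eq_bigr => i _; exact: mulrC.
Qed.

Let sum0 (F G : 'I_d -> R) : \sum_i F i = 0 -> \sum_i G i = 0 -> \sum_i (F i + G i) = 0.
Proof. by move=> h1 h2; rewrite big_split /= h1 h2 addr0. Qed.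

Lemma lin_Zh : lin (Zh Om Th).
Proof.
have [V0 VD VZ] := lin_Vhv.
have LQ q : Qh Om Th q -> ipset L2 q by case=> -[].
have HV (u : vect) : Vhv Om Th u -> forall i, ipset H1 (u i) by move=> hu i; exact: (Vh_H1 (hu i)).
split.
- split => // q /LQ Lq; rewrite (ip_div (HV _ V0) Lq) big1// => i _.
  have := ip_wpartialZ 0 i Lq (HV _ V0 i); rewrite mul0r => <-.
  by rewrite scale0r.
- move=> u v [hu du] [hv dv]; split => [|q hq]; first exact: VD.
  have Lq := LQ _ hq; rewrite (ip_div (HV _ (VD _ _ hu hv)) Lq).
  rewrite (eq_bigr (fun i => ip L2 q (wpartial Om i (u i)) + ip L2 q (wpartial Om i (v i)))).
    have := du q hq; have := dv q hq; rewrite (ip_div (HV _ hu) Lq) (ip_div (HV _ hv) Lq) => h1 h2.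
    exact: sum0 h2 h1.
  by move=> i _; exact: (ip_wpartialD i Lq (HV _ hu i) (HV _ hv i)).
- move=> a u [hu du]; split => [|q hq]; first exact: VZ.
  have Lq := LQ _ hq; rewrite (ip_div (HV _ (VZ a _ hu)) Lq).
  rewrite (eq_bigr (fun i => a * ip L2 q (wpartial Om i (u i)))).
    have := du q hq; rewrite (ip_div (HV _ hu) Lq) => h1.
    by rewrite -mulr_sumr h1 mulr0.
  by move=> i _; exact: (ip_wpartialZ a i Lq (HV _ hu i)).
Qed.

Lemma proj_Vh_L2 : has_proj (ipset L2) (ip L2) (Vh Om Th).
Proof.
apply: (fin_proj hL _ (lin_Vh Om Th) (fun v hv => Vh_span cover hv)).
by move=> v /Vh_H1 /H1_L2.
Qed.

Lemma proj_Vh_H1 : has_proj (ipset H1) (ip H1) (Vh Om Th).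
Proof.
apply: (fin_proj hH _ (lin_Vh Om Th) (fun v hv => Vh_span cover hv)).
by move=> v /Vh_H1.
Qed.

Lemma proj_Qh : has_proj (ipset L2) (ip L2) (Qh Om Th).
Proof.
apply: (fin_proj hL _ (lin_Qh Om Th) (fun v hv => Qh_span cover hv)).
by move=> v [] [].
Qed.

Lemma proj_Zh : has_proj (ipset Hv) (ip Hv) (Zh Om Th).
Proof.
apply: (fin_proj (semi_ip_vec _ hH) _ lin_Zh (fun v hv => Vhv_span cover hv.1)).
by move=> v [hv _] i; exact: (Vh_H1 (hv i)).
Qed.

End projections.

(** * Time integrals of the terms of the discrete equations *)

Section cell_terms.
Context {R : realType} {d : nat} (Om : cube R d).
Local Notation scal := ('rV[R]_d -> R).
Local Notation vect := ('I_d -> 'rV[R]_d -> R).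
Local Notation L2 := (L2 Om).
Local Notation L2v := (L2v Om).
Local Notation H1 := (sobolev Om 1).
Local Notation bnd := (bnd Om).
Local Notation BH := (BH Om).
Local Notation gip := (gip Om).
Local Notation wgip := (wgip Om).
Local Notation conv := (conv Om).
Local Notation aeq := (aeq Om).
Local Notation pm := (pm Om).
Let hL := semi_ip_L2 Om.
Let hG := semi_ip_gip Om.

Variables (T : R) (N n : nat).
Hypotheses (hT : 0 < T) (hN : (0 < N)%N) (n0 : (0 < n)%N).
Local Notation tg := (tgrid T N).
Local Notation tau := (Defs.tau T N).
Local Notation tint := (tint T N n).
Local Notation th := (cell_time T N n).
Local Notation Inn t := (tg n.-1 < t <= tg n).
Let tau0 : 0 < tau := tau_gt0 hT hN.

Let Iow t : tg n.-1 < t < tg n -> Inn t.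
Proof. by move=> /andP[-> /ltW]. Qed.

(** On an interval the discrete solution is affine. Terms that are linear in it
    integrate to the length of the interval times the value at the midpoint; the
    potential term stays an integral along the path. *)
Section scalar_path.
Variables (phi : R -> scal) (p dp : scal).
Hypotheses (phiE : forall t, Inn t -> phi t = p + th t *: dp) (bp : BH p) (bdp : BH dp).
Local Notation pmid := (p + 2^-1 *: dp).

Lemma dt_tint xi : ipset L2 xi -> tint (fun s => ip L2 (dt phi s) xi) = ip L2 dp xi.
Proof.
move=> Lxi; rewrite (@tint_cst_on _ T N hT hN n _ (tau^-1 * ip L2 dp xi) n0).
  by rewrite mulrA mulfV ?mul1r// gt_eqF.
move=> t tn; rewrite (dt_cell phiE tn).
exact: (sipZl hL tau^-1 (BH_L2 bdp) Lxi).
Qed.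

(** Wa is the value of the time average, known to agree with the midpoint value Wb
    only almost everywhere. *)
Lemma conv_tint (W : R -> vect) (Wa Wb : vect) (g : R -> scal) psi :
  (forall t, Inn t -> W t = Wa) -> (forall i, pm (Wa i)) -> (forall i, BH (Wb i)) ->
  (forall i, aeq (Wa i) (Wb i)) -> ipset H1 psi ->
  (forall t, Inn t -> grad Om (g t) = grad Om psi) ->
  tint (fun s => ip L2v (scalev (phi s) (W s)) (grad Om (g s))) = tau * conv pmid Wb psi.
Proof.
move=> WE pWa BWb WW Hpsi gE.
rewrite (@tint_affine_on _ T N hT hN n _ (conv p Wb psi) (conv dp Wb psi) n0).
  by congr (_ * _); rewrite (convD bp (BHZ 2^-1 bdp) BWb Hpsi) (convZ 2^-1 bdp BWb Hpsi).
move=> t /Iow tn; rewrite (WE t tn) (gE t tn) (phiE tn).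
have bps : BH (p + th t *: dp) := BHD bp (BHZ (th t) bdp).
have := conv_aeq (BH_pm bps) pWa (fun i => BH_pm (BWb i)) WW Hpsi.
rewrite (convD bp (BHZ _ bdp) BWb Hpsi) (convZ _ bdp BWb Hpsi) => <-.
by [].
Qed.

Lemma gip_tint xi : ipset H1 xi ->
  tint (fun s => ip L2v (grad Om (phi s)) (grad Om xi)) = tau * gip pmid xi.
Proof.
move=> Hxi; have [Hp Hdp] := (BH_H1 bp, BH_H1 bdp).
rewrite (@tint_affine_on _ T N hT hN n _ (gip p xi) (gip dp xi) n0).
  congr (_ * _); rewrite -(sipZl hG 2^-1 Hdp Hxi).
  by rewrite -(sipDl hG Hp (sipZ hG 2^-1 Hdp) Hxi).
move=> t /Iow tn; rewrite (phiE tn) -(sipZl hG (th t) Hdp Hxi).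
by rewrite -(sipDl hG Hp (sipZ hG (th t) Hdp) Hxi).
Qed.

Lemma pot_tint (f : R -> R) f1 f2 f3 xi : potential_ok f f1 f2 f3 -> bnd xi ->
  tint (fun s => ip L2 (derive1 f \o phi s) xi) =
  tint (fun s => ip L2 (derive1 f \o (p + th s *: dp)) xi).
Proof.
move=> hf bxi; apply: tint_eq; first exact: (continuous_potential hf bp.1 bdp.1 bxi).
by move=> t /Iow tn; rewrite (phiE tn).
Qed.

End scalar_path.

Lemma wgip_tint (be : R -> R) (a : R -> scal) aa (g : R -> scal) m psi :
  (forall t, Inn t -> a t = aa) -> (forall t, Inn t -> grad Om (g t) = grad Om m) ->
  tint (fun s => ip L2v (scalev (be \o a s) (grad Om (g s))) (grad Om psi)) =
  tau * wgip (be \o aa) m psi.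
Proof.
move=> aE gE; apply: (@tint_cst_on _ T N hT hN n _ _ n0) => t /Iow tn.
by rewrite (aE t tn) (gE t tn).
Qed.

Lemma ip_tint (g : R -> scal) a b xi : (forall t, Inn t -> g t = a) -> pm a -> pm b -> aeq a b -> pm xi ->
  tint (fun s => ip L2 (g s) xi) = tau * ip L2 b xi.
Proof.
move=> gE pa pb ab pxi; apply: (@tint_cst_on _ T N hT hN n _ _ n0) => t /Iow tn.
by rewrite (gE t tn); exact: (ip_aeq pa pb pxi ab).
Qed.

Lemma ipv_tint (g : R -> vect) a v : (forall t, Inn t -> g t = a) ->
  tint (fun s => ip L2v (g s) v) = tau * ip L2v a v.
Proof.
move=> gE; apply: (@tint_cst_on _ T N hT hN n _ _ n0) => t /Iow tn.
by rewrite (gE t tn).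
Qed.

Lemma visc_tint (eta : R -> R) (a : R -> scal) aa (W : R -> vect) (Wa Wb : vect) v :
  (forall t, Inn t -> a t = aa) -> (forall t, Inn t -> W t = Wa) ->
  (forall i, pm (Wa i)) -> (forall i, pm (Wb i)) -> (forall i, aeq (Wa i) (Wb i)) ->
  tint (fun s => visc Om (eta \o a s) (W s) v) = tau * wvisc Om (eta \o aa) Wb v.
Proof.
move=> aE WE pWa pWb WW; apply: (@tint_cst_on _ T N hT hN n _ _ n0) => t /Iow tn.
by rewrite (aE t tn) (WE t tn) (visc_aeq _ _ pWa pWb WW).
Qed.

Section vector_path.
Variables (u : R -> vect) (U dU : vect).
Hypotheses (uE : forall t, Inn t -> u t = U + th t *: dU).
Hypotheses (bU : forall i, BH (U i)) (bdU : forall i, BH (dU i)).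
Local Notation Umid := (U + 2^-1 *: dU).

Lemma dtv_tint v : (forall i, ipset L2 (v i)) -> tint (fun s => ip L2v (dtv u s) v) = ip L2v dU v.
Proof.
move=> Lv; rewrite (@tint_cst_on _ T N hT hN n _ (tau^-1 * ip L2v dU v) n0).
  by rewrite mulrA mulfV ?mul1r// gt_eqF.
move=> t tn.
have E i : dtv u t i = tau^-1 *: dU i.
  by apply: (dt_cell _ tn) => s sn; rewrite (uE sn).
rewrite /= mulr_sumr; apply: eq_bigr => i _; rewrite E.
exact: (sipZl hL tau^-1 (BH_L2 (bdU i)) (Lv i)).
Qed.

Lemma skw_tint (W : R -> vect) (Wa Wb : vect) v :
  (forall t, Inn t -> W t = Wa) -> (forall i, pm (Wa i)) -> (forall i, BH (Wb i)) ->
  (forall i, aeq (Wa i) (Wb i)) -> (forall i, BH (v i)) ->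
  tint (fun s => skw Om (u s) (W s) v) = tau * skw Om Umid Wb v.
Proof.
move=> WE pWa bWb WW bv.
have bb (F : vect) : (forall i, BH (F i)) -> forall i, bnd (F i) by move=> h i; case: (h i).
rewrite (@tint_affine_on _ T N hT hN n _ (skw Om U Wb v) (skw Om dU Wb v) n0).
  by congr (_ * _); rewrite (skw_affine 2^-1 (bb _ bU) (bb _ bdU) bWb bv).
move=> t /Iow tn; rewrite (WE t tn) (uE tn) -(skw_affine (th t) (bb _ bU) (bb _ bdU) bWb bv).
apply: skw_aeq => //.
- by move=> j; apply: bndD; [exact: bb|apply: bndZ; exact: bb].
- by move=> i; exact: BH_H1.
- by move=> i; apply: aeq_sym; exact: WW.
- by move=> i; exact: BH_H1.
Qed.

End vector_path.
End cell_terms.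

(** * The discrete solution on one interval and its uniform bound *)

Section discrete_cells.
Context {R : realType} {d : nat} (Om : cube R d).
Hypothesis hd : d = 2%N \/ d = 3%N.
Local Notation scal := ('rV[R]_d -> R).
Local Notation vect := ('I_d -> 'rV[R]_d -> R).
Local Notation L2 := (L2 Om).
Local Notation L2v := (L2v Om).
Local Notation H1 := (sobolev Om 1).
Local Notation Hv := (sobolevv Om 1).
Local Notation bnd := (bnd Om).
Local Notation BH := (BH Om).
Local Notation n1 := (ipnorm H1).
Local Notation nv := (ipnorm Hv).
Local Notation gip := (gip Om).
Local Notation wgip := (wgip Om).
Local Notation conv := (conv Om).
Local Notation aeq := (aeq Om).
Local Notation pm := (pm Om).
Let hL := semi_ip_L2 Om.
Let hH := semi_ip_H1 Om.
Let hG := semi_ip_gip Om.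
Let hLv : semi_ip [set u : vect | forall i, ipset L2 (u i)] (ip L2v) := semi_ip_vec _ hL.
Let hHv : semi_ip [set u : vect | forall i, ipset H1 (u i)] (ip Hv) := semi_ip_vec _ hH.

Variables (T : R) (N : nat).
Hypotheses (hT : 0 < T) (hN : (0 < N)%N).
Variables (f : R -> R) (f1 : R) (f2 f3 : nat -> R).
Hypothesis hf : potential_ok f f1 f2 f3.
Variables (b : R -> R) (b1 b2 b3 b4 : R).
Hypothesis hb : coefficient_ok b b1 b2 b3 b4.
Variables (eta : R -> R) (eta1 eta2 eta3 eta4 : R).
Hypothesis heta : coefficient_ok eta eta1 eta2 eta3 eta4.
Variable gamma : R.
Hypothesis hgamma : 0 < gamma.
Variable Th : seq 'M[R]_(d.+1, d).
Hypothesis cover : \bigcup_(K in [set` Th]) cell K = cube_set Om.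
Local Notation tg := (tgrid T N).
Local Notation tau := (Defs.tau T N).
Local Notation tint := (tint T N).
Local Notation th := (cell_time T N).
Local Notation Inn n t := (tg n.-1 < t <= tg n).
Local Notation Vh := (Vh Om Th).
Local Notation Vhv := (Vhv Om Th).
Local Notation Zh := (Zh Om Th).

Variables (phi0 : scal) (u0 : vect) (phiht muht : R -> scal) (uht : R -> vect) (pht : R -> scal).
Hypothesis hds : discrete_solution Om T gamma b eta f N Th phi0 u0 phiht muht uht pht.
Hypotheses (Hphi0 : ipset H1 phi0) (Hu0 : ipset Hv u0).

Let VBH (v : scal) (hv : Vh v) : BH v := Vh_BH cover hv.
Let tau0 : 0 < tau := tau_gt0 hT hN.

Lemma coefficient_continuous (k : R -> R) (k1 k2 k3 k4 : R) : coefficient_ok k k1 k2 k3 k4 -> continuous k.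
Proof.
move=> [[dk _] _ _ _ _]; apply: (@is_derive_continuous R (derive1 k)) => t.
by split; [exact: (dk 0%N)|rewrite -derive1E].
Qed.

Lemma coefficient_bnd (k : R -> R) (k1 k2 k3 k4 : R) (a : scal) : coefficient_ok k k1 k2 k3 k4 -> pm a -> bnd (k \o a).
Proof.
move=> hk pa; have ck := coefficient_continuous hk; case: hk => _ k0 hk _ _.
split; first exact: pm_comp.
exists k2 => x; have /andP[h1 h2] := hk (a x).
by rewrite ger0_norm// (le_trans (ltW k0)).
Qed.

Let hVX : semi_ip (ipset (VhX Om Th)) (ip (VhX Om Th)).
Proof.
have [V0 VD VZ] := lin_Vh Om Th; apply: (semi_ipS hH) => //.
by move=> v /Vh_H1.
Qed.

Let hVvX : semi_ip (ipset (VhvX Om Th)) (ip (VhvX Om Th)).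
Proof.
have [V0 VD VZ] := lin_Vhv Om Th; apply: (semi_ipS hHv) => //.
by move=> v hv i; exact: (Vh_H1 (hv i)).
Qed.

Lemma ipL2_0 (v : scal) : ip L2 v 0 = 0.
Proof. by rewrite /= (_ : (fun x => _) = fun=> 0) ?spint_cst ?mul0r//; apply/funext => x; exact: mulr0. Qed.

Lemma ipL2v_0 (v : vect) : ip L2v v 0 = 0.
Proof. by apply: big1 => i _; exact: ipL2_0. Qed.

(** The content of the discrete problem on one interval. The vectors a and Ua are the
    values of the time averages of phi and u, which are determined only almost
    everywhere; a is kept in the coefficients, where its representative is
    irrelevant. Restricting dc_eq3 to discretely divergence free test functions
    removes the pressure. *)
Record discrete_cell n (p dp m : scal) (U dU : vect) (a : scal) (Ua : vect) : Prop := DiscreteCell {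
  dc_p : Vh p; dc_dp : Vh dp; dc_m : Vh m; dc_U : Vhv U; dc_dU : Vhv dU;
  dc_phi : forall t, Inn n t -> phiht t = p + th n t *: dp;
  dc_mu : forall t, Inn n t -> muht t = m;
  dc_u : forall t, Inn n t -> uht t = U + th n t *: dU;
  dc_start : [/\ Vh (phiht (tg n.-1)), aeq (phiht (tg n.-1)) p,
     ip H1 (phiht (tg n.-1) - p) (phiht (tg n.-1) - p) = 0,
     Vhv (uht (tg n.-1)) & forall i, aeq (uht (tg n.-1) i) (U i)];
  dc_bar : ipset L2 a /\ forall t, Inn n t -> pi0bar T N L2 phiht t = a;
  dc_barv : [/\ forall i, ipset L2 (Ua i), forall t, Inn n t -> pi0bar T N L2v uht t = Ua &
     forall i, aeq (Ua i) ((U + 2^-1 *: dU) i)];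
  dc_div : Zh (U + 2^-1 *: dU);
  dc_eq1 : forall psi, Vh psi -> ip L2 dp psi =
     tau * conv (p + 2^-1 *: dp) (U + 2^-1 *: dU) psi - tau * wgip (b \o a) m psi;
  dc_eq2 : forall xi, Vh xi -> tau * ip L2 m xi = tau * (gamma * gip (p + 2^-1 *: dp) xi) +
     tint n (fun s => ip L2 (derive1 f \o (p + th n s *: dp)) xi);
  dc_eq3 : forall v, Zh v -> ip L2v dU v =
     - (tau * skw Om (U + 2^-1 *: dU) (U + 2^-1 *: dU) v)
     - tau * wvisc Om (eta \o a) (U + 2^-1 *: dU) v - tau * conv (p + 2^-1 *: dp) v m }.

Let pack2 (g t X x P1 P2 : R) : X = t * x -> P1 = P2 -> g * X + P1 = t * (g * x) + P2.
Proof. by move=> -> ->; rewrite mulrCA. Qed.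

Lemma discrete_cellP n : (1 <= n <= N)%N -> exists p dp m U dU a Ua, discrete_cell n p dp m U dU a Ua.
Proof.
move=> nN; have /andP[n0 nN'] := nN.
have [[Pphi Pmu Pu Pp] _ heq] := hds.
have [V0 VD VZ] := lin_Vh Om Th; have [W0 WD WZ] := lin_Vhv Om Th.
have [p [dp [Vp Vdp phiE sp]]] := P1c_cell hT hN hVX Pphi nN.
have [U [dU [VU VdU uE su]]] := P1c_cell hT hN hVvX Pu nN.
have [m Vm muE] := P0_val Pmu nN; have [q Qq pE] := P0_val Pp nN.
rewrite /= in Vp Vdp VU VdU.
have VL v : Vh v -> ipset L2 v by move=> /Vh_H1 /H1_L2.
have cellL2 : forall k, (1 <= k <= N)%N -> exists a0 a1, [/\ ipset L2 a0, ipset L2 a1 &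
    forall t, Inn k t -> phiht t = a0 + th k t *: a1].
  move=> k kN; have [a0 [a1 [h0 h1 h2 _]]] := P1c_cell hT hN hVX Pphi kN.
  by exists a0, a1; split => //; exact: VL.
have cellL2v : forall k, (1 <= k <= N)%N -> exists a0 a1, [/\ ipset L2v a0, ipset L2v a1 &
    forall t, Inn k t -> uht t = a0 + th k t *: a1].
  move=> k kN; have [a0 [a1 [h0 h1 h2 _]]] := P1c_cell hT hN hVvX Pu kN.
  by exists a0, a1; split => // i; exact: VL.
have [a [La aE _]] := bar_affine hT hN hL ipL2_0 cellL2 nN (VL _ Vp) (VL _ Vdp) phiE.
have LU i : ipset L2 (U i) by exact: VL.
have LdU i : ipset L2 (dU i) by exact: VL.
have [Ua [LUa UaE Ua0]] := bar_affine (X := L2v) hT hN hLv ipL2v_0 cellL2v nN LU LdU uE.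
have Vmid : Vhv (U + 2^-1 *: dU) by apply: WD => //; exact: WZ.
have Lmid i : ipset L2 ((U + 2^-1 *: dU) i) by exact: VL.
have Uaeq := aeq_vec LUa Lmid Ua0.
have [e1 e2 e3 e4] := heq n nN.
have bp := VBH Vp; have bdp := VBH Vdp.
have bU i : BH (U i) by exact: VBH.
have bdU i : BH (dU i) by exact: VBH.
have bmid i : BH ((U + 2^-1 *: dU) i) by exact: VBH.
have pUa i : pm (Ua i) by exact: L2_pm.
have muG t : Inn n t -> grad Om (muht t) = grad Om m by move=> /muE ->.
(* Testing with functions constant in time determines the divergence of the
   midpoint value only. *)
have Zmid : Zh (U + 2^-1 *: dU).
  split => // r Qr; have Lr : ipset L2 r by case: Qr => -[].
  have HU i : ipset H1 (U i) by exact: BH_H1.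
  have HdU i : ipset H1 (dU i) by exact: BH_H1.
  have Hm i : ipset H1 ((U + 2^-1 *: dU) i) by exact: BH_H1.
  have dE (k : R) : ip L2 (div Om (U + k *: dU)) r = ip L2 (div Om U) r + k * ip L2 (div Om dU) r.
    have Hk i : ipset H1 ((U + k *: dU) i) by apply: (sipD hH) => //; exact: (sipZ hH).
    rewrite !(ip_div _ Lr)// mulr_sumr -big_split; apply: eq_bigr => i _.
    have Zk := sipZ hH k (HdU i).
    by rewrite -(ip_wpartialZ k i Lr (HdU i)) -[RHS](ip_wpartialD i Lr (HU i) Zk).
  have := e4 (fun=> r) (@P0_cst R _ T N _ _ Qr).
  rewrite (@tint_affine_on _ T N hT hN n _ (ip L2 (div Om U) r) (ip L2 (div Om dU) r) n0).
    by rewrite dE => /eqP; rewrite mulf_eq0 gt_eqF//= => /eqP.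
  by move=> t /andP[t1 t2]; rewrite uE ?t1 ?ltW// dE.
exists p, dp, m, U, dU, a, Ua; split => //.
- have tT : 0 <= tg n.-1 <= T.
    by rewrite (tg_ge0 hT hN) -[X in _ <= X](tgN T hN) (tg_mono hT hN)// (leq_trans (leq_pred n)).
  have [_ [Vs _]] := Pphi; have [_ [Vsu _]] := Pu.
  have Vst := Vs _ tT; have Vsut := Vsu _ tT; rewrite /= in Vst Vsut.
  split => //.
    exact: (aeq_H1 (Vh_H1 Vst) (Vh_H1 Vp) sp).
  move=> i; apply: aeq_H1; [exact: (Vh_H1 (Vsut i))|exact: (Vh_H1 (VU i))|].
  have L0 j : 0 <= ip H1 ((uht (tg n.-1) - U) j) ((uht (tg n.-1) - U) j).
    by apply: (sip_ge0 hH); apply: (sipB hH); [exact: (Vh_H1 (Vsut j))|exact: (Vh_H1 (VU j))].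
  apply/eqP; rewrite eq_le; apply/andP; split; last exact: L0.
  by rewrite -su [leRHS](bigD1 i)//= lerDl; apply: sumr_ge0 => j _; exact: L0.
- move=> psi Vpsi; have Hpsi := Vh_H1 Vpsi.
  have := e1 (fun=> psi) (@P0_cst R _ T N _ _ Vpsi).
  rewrite (dt_tint hT hN n0 phiE bdp (VL _ Vpsi)) => ->.
  rewrite (conv_tint hT hN n0 phiE bp bdp UaE pUa bmid Uaeq Hpsi (fun t _ => erefl)).
  by rewrite (wgip_tint hT hN n0 b psi aE muG).
- move=> xi Vxi; have Hxi := Vh_H1 Vxi; have [bxi _] := VBH Vxi.
  have := e2 (fun=> xi) (@P0_cst R _ T N _ _ Vxi).
  rewrite (ip_tint hT hN n0 muE (BH_pm (VBH Vm)) (BH_pm (VBH Vm)) (aeq_refl _ _) (BH_pm (VBH Vxi))) => ->.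
  exact: (pack2 gamma (gip_tint hT hN n0 phiE bp bdp Hxi) (pot_tint phiE bp bdp hf bxi)).
- move=> v [Vv dv]; have bv i : BH (v i) by exact: VBH.
  have := e3 (fun=> v) (@P0_cst R _ T N _ _ Vv).
  rewrite (dtv_tint hT hN n0 uE bdU (fun i => BH_L2 (bv i))) => ->.
  rewrite (skw_tint hT hN n0 uE bU bdU UaE pUa bmid Uaeq bv).
  rewrite (visc_tint hT hN n0 eta v aE UaE pUa (fun i => BH_pm (bmid i)) Uaeq).
  rewrite (conv_tint hT hN n0 phiE bp bdp (fun t _ => erefl v) (fun i => BH_pm (bv i)) bv
     (fun i => aeq_refl _ _) (Vh_H1 Vm) muG).
  have -> : tint n (fun s => ip L2 (pht s) (div Om v)) = 0.
    rewrite (@tint_cst_on _ T N hT hN n _ 0 n0) ?mulr0// => t /andP[t1 t2].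
    rewrite pE ?t1 ?ltW//; have := dv q Qq; rewrite /= => <-.
    by congr (spint Om _); apply/funext => x; exact: mulrC.
  by rewrite addr0.
Qed.


Local Notation E0 := (total_energy Om f gamma).

Lemma discrete_cell_end n p dp m U dU a Ua : (1 <= n <= N)%N ->
  discrete_cell n p dp m U dU a Ua ->
  phiht (tg n) = p + dp /\ uht (tg n) = U + dU.
Proof.
move=> /andP[n0 nN] c; have tn : Inn n (tg n) by rewrite lexx andbT (tg_lt hT hN).
by rewrite (dc_phi c tn) (dc_u c tn) (th_end hT hN n0) !scale1r.
Qed.

Lemma discrete_step n : (1 <= n <= N)%N ->
  E0 (phiht (tg n)) (uht (tg n)) <= E0 (phiht (tg n.-1)) (uht (tg n.-1)) /\
  spint Om (phiht (tg n)) = spint Om (phiht (tg n.-1)).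
Proof.
move=> nN; have /andP[n0 _] := nN.
have [p [dp [m [U [dU [a [Ua c]]]]]]] := discrete_cellP nN.
have [e1 e2] := discrete_cell_end nN c.
have [Vs sp _ Vsu su] := dc_start c.
have [La _] := dc_bar c.
have bp := VBH (dc_p c); have bdp := VBH (dc_dp c).
have bU i : BH (U i) by exact: VBH (dc_U c i).
have bdU i : BH (dU i) by exact: VBH (dc_dU c i).
have bbeta := coefficient_bnd hb (L2_pm La); have beps := coefficient_bnd heta (L2_pm La).
have beta0 x : 0 <= (b \o a) x by case: hb => _ k0 /(_ (a x)) /andP[h _] _ _; exact: le_trans (ltW k0) h.
have eps0 x : 0 <= (eta \o a) x by case: heta => _ k0 /(_ (a x)) /andP[h _] _ _; exact: le_trans (ltW k0) h.
have q1 psi (h : Vh psi) : ip L2 dp psi =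
    tau * (conv (p + 2^-1 *: dp) (U + 2^-1 *: dU) psi - wgip (b \o a) m psi).
  by rewrite mulrBr; exact: (dc_eq1 c).
have q3 : ip L2v dU (U + 2^-1 *: dU) =
    - (tau * wvisc Om (eta \o a) (U + 2^-1 *: dU) (U + 2^-1 *: dU))
    - tau * conv (p + 2^-1 *: dp) (U + 2^-1 *: dU) m.
  by have := dc_eq3 c (dc_div c); rewrite skw_antisym mulr0 oppr0 sub0r.
rewrite e1 e2; split.
  have -> : E0 (phiht (tg n.-1)) (uht (tg n.-1)) = E0 p U.
    apply: (total_energy_aeq gamma hf (VBH Vs) bp) => //.
    + by move=> i; exact: BH_L2 (VBH (Vsu i)).
    + by move=> i; exact: BH_L2.
  exact: (energy_decay hT hN n0 hf VBH (dc_p c) (dc_dp c) (dc_m c) bU bdU bbeta beps beta0 eps0 q1 (dc_eq2 c) q3).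
have -> : spint Om (phiht (tg n.-1)) = spint Om p.
  by apply: spint_aeq sp; [case: (BH_pm (VBH Vs))|case: (BH_pm bp)].
exact: (mass_conservation VBH (Vh_cst Om Th) (dc_p c) (dc_dp c) (dc_m c) bU bdU bbeta beta0 q1).
Qed.

(** Steps are chained at the grid points; the left limit on an interval agrees almost
    everywhere with the value at the grid point. *)
Lemma discrete_stability n : (n <= N)%N ->
  E0 (phiht (tg n)) (uht (tg n)) <= E0 (phiht 0) (uht 0) /\
  spint Om (phiht (tg n)) = spint Om (phiht 0).
Proof.
elim: n => [|n IH] nN; first by rewrite (tg0 T N).
have [h1 h2] := IH (ltnW nN); have [h3 h4] := @discrete_step n.+1 nN.
by split; [exact: le_trans h3 h1|rewrite h4].
Qed.

Lemma oproj_norm {V : lmodType R} (Dom S : set V) (B : V -> V -> R) u : semi_ip Dom B -> S `<=` Dom ->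
  has_proj Dom B S -> Dom u ->
  Num.sqrt (B (oproj B S u) (oproj B S u)) <= Num.sqrt (B u u).
Proof.
move=> hB SD hP Du; have [Sp hp] := oprojP hP Du; have Dp := SD _ Sp.
have E : B u (oproj B S u) = B (oproj B S u) (oproj B S u).
  by apply/eqP; rewrite -subr_eq0 -(sipBl hB Du Dp Dp); apply/eqP; exact: hp.
have := sip_CSn hB Du Dp; rewrite E ger0_norm ?(sip_ge0 hB Dp)//.
rewrite -{1}(sip_sqrn hB Dp) expr2.
have := sqrtr_ge0 (B (oproj B S u) (oproj B S u)); rewrite le_eqVlt => /predU1P[<- _|p].
  exact: sqrtr_ge0.
by rewrite ler_pM2r.
Qed.

Definition energy_bound (B W : R) : R :=
  gamma / 2 * B ^+ 2 + (`|f2 0| * vol Om + `|f3 0| * (c4 Om ^+ 2 * B ^+ 4)) + 2^-1 * W ^+ 2.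

(** A bound of the H1 norm of the discrete phase field: the gradient is bounded by the
    initial energy, the mean is conserved. It depends on norms of the initial data
    only, hence neither on the mesh nor on the time step. *)
Definition phi_bound (B W : R) : R :=
  Num.sqrt (B ^+ 2 + (Cpoinc Om + 1) * (2 / gamma * energy_bound B W)).

Let Cp0 : 0 <= Cpoinc Om. Proof. by rewrite mulr_ge0 ?invr_ge0// sqr_ge0. Qed.

Lemma energy_bound_ge0 B W : 0 <= energy_bound B W.
Proof.
rewrite /energy_bound; apply: addr_ge0; last by apply: mulr_ge0; rewrite ?invr_ge0// sqr_ge0.
apply: addr_ge0; first by apply: mulr_ge0; [rewrite divr_ge0// ltW|exact: sqr_ge0].
apply: addr_ge0; first by apply: mulr_ge0 => //; rewrite ltW// vol_gt0.
apply: mulr_ge0 => //; apply: mulr_ge0; first exact: sqr_ge0.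
by rewrite (exprM _ 2 2) sqr_ge0.
Qed.

Lemma le_phi_bound B W : 0 <= B -> B <= phi_bound B W.
Proof.
move=> B0; rewrite -[leLHS](ger0_norm B0) -sqrtr_sqr ler_sqrt.
  rewrite lerDl; apply: mulr_ge0; first exact: addr_ge0.
  by apply: mulr_ge0; [rewrite divr_ge0// ltW|exact: energy_bound_ge0].
apply: addr_ge0; first exact: sqr_ge0.
apply: mulr_ge0; first exact: addr_ge0.
by apply: mulr_ge0; [rewrite divr_ge0// ltW|exact: energy_bound_ge0].
Qed.

Lemma discrete_initial B W : n1 phi0 <= B -> nv u0 <= W ->
  [/\ Vh (phiht 0), n1 (phiht 0) <= B & E0 (phiht 0) (uht 0) <= energy_bound B W].
Proof.
move=> hB hW; have [_ [-> ->] _] := hds.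
have [Vp _] := oprojP (proj_Vh_H1 cover) Hphi0.
have np : n1 (pih1 Om Th phi0) <= B.
  apply: le_trans hB; apply: (oproj_norm hH _ (proj_Vh_H1 cover) Hphi0).
  by move=> v /Vh_H1.
have [ZU _] := oprojP (proj_Zh cover) Hu0.
have nU : nv (Ph1 Om Th u0) <= W.
  apply: le_trans hW; apply: (oproj_norm hHv _ (proj_Zh cover) Hu0).
  by move=> v [hv _] i; exact: (Vh_H1 (hv i)).
split => //; have HP := Vh_H1 Vp.
have HU i : ipset H1 (Ph1 Om Th u0 i) by exact: (Vh_H1 (ZU.1 i)).
have B0 : 0 <= B by apply: le_trans np; exact: sqrtr_ge0.
have W0 : 0 <= W by apply: le_trans nU; exact: sqrtr_ge0.
have n0 : 0 <= n1 (pih1 Om Th phi0) by exact: sqrtr_ge0.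
have [/andP[_ F]] := (spint_potential hd hf (VBH Vp)).
have G : gip (pih1 Om Th phi0) (pih1 Om Th phi0) <= B ^+ 2.
  apply: (@le_trans _ _ (n1 (pih1 Om Th phi0) ^+ 2)).
    by rewrite (H1_split HP) lerDr; exact: (sip_ge0 hL (H1_L2 HP)).
  by rewrite lerXn2r.
have L : ip L2v (Ph1 Om Th u0) (Ph1 Om Th u0) <= W ^+ 2.
  apply: (@le_trans _ _ (nv (Ph1 Om Th u0) ^+ 2)).
    have -> : nv (Ph1 Om Th u0) ^+ 2 = ip Hv (Ph1 Om Th u0) (Ph1 Om Th u0) by exact: (sip_sqrn hHv HU).
    apply: ler_sum => i _; rewrite lerDl; exact: (sip_ge0 hG (HU i)).
  by rewrite lerXn2r// nnegrE sqrtr_ge0.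
rewrite /total_energy /energy_bound; apply: lerD; last by rewrite ler_wpM2l// invr_ge0.
apply: lerD; first by rewrite ler_wpM2l// divr_ge0// ltW.
apply: le_trans F _; rewrite lerD2l ler_wpM2l// ler_wpM2l ?sqr_ge0//.
by rewrite lerXn2r.
Qed.

Lemma discrete_bound B W n : n1 phi0 <= B -> nv u0 <= W -> (n <= N)%N -> Vh (phiht (tg n)) ->
  n1 (phiht (tg n)) <= phi_bound B W.
Proof.
move=> hB hW nN Vn; have [V0 h0 hE] := discrete_initial hB hW.
have [h1 h2] := discrete_stability nN.
have Hn := Vh_H1 Vn; have H0 := Vh_H1 V0; have v0 := vol_gt0 Om.
have B0 : 0 <= B by apply: le_trans h0; exact: sqrtr_ge0.
have G0 : 0 <= gip (phiht (tg n)) (phiht (tg n)) by exact: (sip_ge0 hG Hn).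
have [/andP[F0 _]] := (spint_potential hd hf (VBH Vn)).
have gle : gip (phiht (tg n)) (phiht (tg n)) <= 2 / gamma * energy_bound B W.
  rewrite mulrAC ler_pdivlMr// mulrC -ler_pdivrMl// mulrA.
  apply: le_trans (le_trans h1 hE); rewrite /total_energy.
  rewrite [_^-1 * gamma]mulrC -addrA lerDl addr_ge0//.
  by apply: mulr_ge0; [rewrite invr_ge0|apply: sumr_ge0 => i _; apply: spint_ge0 => x _; rewrite -expr2 sqr_ge0].
have mean : spint Om (phiht (tg n)) ^+ 2 / vol Om <= B ^+ 2.
  rewrite h2 ler_pdivrMr// -(real_normK (num_real (spint Om (phiht 0)))).
  have k1 := spint_le (H1_L2 H0); have k2 := L2_le_n1 H0.
  have k3 : `|spint Om (phiht 0)| <= Num.sqrt (vol Om) * B.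
    by apply: le_trans k1 _; rewrite ler_wpM2l ?sqrtr_ge0// (le_trans k2).
  apply: (@le_trans _ _ ((Num.sqrt (vol Om) * B) ^+ 2)).
    by rewrite lerXn2r// nnegrE mulr_ge0// sqrtr_ge0.
  have -> : (Num.sqrt (vol Om) * B) ^+ 2 = B ^+ 2 * vol Om by rewrite exprMn (sqr_sqrtr (ltW v0)) mulrC.
  exact: lexx.
have C1 : 0 <= Cpoinc Om + 1 by exact: addr_ge0.
rewrite /ipnorm /phi_bound ler_sqrt; last first.
  apply: addr_ge0; first exact: sqr_ge0.
  by apply: mulr_ge0 => //; exact: le_trans gle.
rewrite -[leLHS]/(ip L2 (phiht (tg n)) (phiht (tg n)) + gip (phiht (tg n)) (phiht (tg n))).
apply: le_trans (lerD (poincare Hn) (lexx _)) _; rewrite -addrA; apply: lerD => //.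
rewrite -[X in _ + X]mul1r -mulrDl; exact: ler_wpM2l.
Qed.

End discrete_cells.

(** * The discrete residuals on one interval *)

Section residual_cells.
Context {R : realType} {d : nat} (Om : cube R d).
Hypothesis hd : d = 2%N \/ d = 3%N.
Local Notation scal := ('rV[R]_d -> R).
Local Notation vect := ('I_d -> 'rV[R]_d -> R).
Local Notation L2 := (L2 Om).
Local Notation L2v := (L2v Om).
Local Notation H1 := (sobolev Om 1).
Local Notation Hv := (sobolevv Om 1).
Local Notation bnd := (bnd Om).
Local Notation BH := (BH Om).
Local Notation n1 := (ipnorm H1).
Local Notation nv := (ipnorm Hv).
Local Notation gip := (gip Om).
Local Notation wgip := (wgip Om).
Local Notation conv := (conv Om).
Local Notation aeq := (aeq Om).
Local Notation pm := (pm Om).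
Let hL := semi_ip_L2 Om.
Let hH := semi_ip_H1 Om.
Let hG := semi_ip_gip Om.
Let hLv : semi_ip [set u : vect | forall i, ipset L2 (u i)] (ip L2v) := semi_ip_vec _ hL.
Let hHv : semi_ip [set u : vect | forall i, ipset H1 (u i)] (ip Hv) := semi_ip_vec _ hH.


Variables (T : R) (N : nat).
Hypotheses (hT : 0 < T) (hN : (0 < N)%N).
Variables (f : R -> R) (f1 : R) (f2 f3 : nat -> R).
Hypothesis hf : potential_ok f f1 f2 f3.
Variables (b : R -> R) (b1 b2 b3 b4 : R).
Hypothesis hb : coefficient_ok b b1 b2 b3 b4.
Variables (eta : R -> R) (eta1 eta2 eta3 eta4 : R).
Hypothesis heta : coefficient_ok eta eta1 eta2 eta3 eta4.
Variable gamma : R.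
Hypothesis hgamma : 0 < gamma.
Variable Th : seq 'M[R]_(d.+1, d).
Hypothesis cover : \bigcup_(K in [set` Th]) cell K = cube_set Om.
Local Notation tg := (tgrid T N).
Local Notation tau := (Defs.tau T N).
Local Notation tint := (tint T N).
Local Notation th := (cell_time T N).
Local Notation Inn n t := (tg n.-1 < t <= tg n).
Local Notation Vh := (Vh Om Th).
Local Notation Vhv := (Vhv Om Th).
Local Notation Zh := (Zh Om Th).
Local Notation Qh := (Qh Om Th).

Variables (phi mu : R -> scal) (u : R -> vect) (prs : R -> scal).
Hypotheses (Cphi : bochner_C T H1 phi) (Cu : bochner_C T Hv u).
Local Notation phih := (hat_phi Om T N Th phi).
Local Notation muh := (hat_mu Om T N Th mu).
Local Notation uh := (hat_u Om T N Th u).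
Local Notation ph := (hat_p Om T N Th prs).
Variables (phiht muht : R -> scal) (uht : R -> vect) (pht : R -> scal).
Hypothesis hds : discrete_solution Om T gamma b eta f N Th (phi 0) (u 0) phiht muht uht pht.
Variables (r1 r2 : R -> scal) (r3 : R -> vect).
Hypothesis hres : discrete_residuals Om T gamma b eta f N Th phiht uht phih muh uh ph r1 r2 r3.

Let VBH (v : scal) (hv : Vh v) : BH v := Vh_BH cover hv.
Let tau0 : 0 < tau := tau_gt0 hT hN.

Let grid_T n : (n <= N)%N -> 0 <= tg n <= T.
Proof. by move=> nN; rewrite (tg_ge0 hT hN) -[X in _ <= X](tgN T hN) (tg_mono hT hN). Qed.

Lemma div_L2 (v : vect) : (forall i, ipset H1 (v i)) -> ipset L2 (div Om v).
Proof.
move=> Hv'; apply: (big_ind (ipset L2)); first exact: L2_0.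
  by move=> x y; exact: L2D.
by move=> i _; exact: H1_wL2.
Qed.

(** The projected solution is the interpolation of these values. *)
Definition grid_phi n : scal := pih1 Om Th (phi (tg n)).
Definition grid_u n : vect := Ph1 Om Th (u (tg n)).

Lemma grid_phi_Vh n : Vh (grid_phi n).
Proof. by apply: oproj_in; case: (lin_Vh Om Th). Qed.

Lemma grid_u_Zh n : Zh (grid_u n).
Proof. by apply: oproj_in; case: (lin_Zh Om Th). Qed.

Let subV n : Vh (grid_phi n - grid_phi n.-1).
Proof.
have [_ VD VZ] := lin_Vh Om Th; rewrite -scaleN1r; apply: VD; first exact: grid_phi_Vh.
by apply: VZ; exact: grid_phi_Vh.
Qed.

Let subZ n : Zh (grid_u n - grid_u n.-1).
Proof.
have [_ VD VZ] := lin_Zh Om Th; rewrite -scaleN1r; apply: VD; first exact: grid_u_Zh.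
by apply: VZ; exact: grid_u_Zh.
Qed.

(** The counterpart of discrete_cell for the projected exact solution, which solves
    the same equations up to the residuals s1, s2, s3. The convecting velocity U and
    the phase field p are those of the discrete solution. Y is a representative in
    the finite element space of the time average ya of the chemical potential. *)
Record residual_cell n (p dp : scal) (U dU : vect) (a : scal) (q dq : scal) (V dV : vect)
    (Y ya : scal) (va : vect) (s1 s2 : scal) (s3 : vect) : Prop := ResidualCell {
  rc_Y : Vh Y; rc_s1 : Vh s1; rc_s2 : Vh s2; rc_s3 : Vhv s3;
  rc_r1 : forall t, Inn n t -> r1 t = s1;
  rc_r2 : forall t, Inn n t -> r2 t = s2;
  rc_r3 : forall t, Inn n t -> r3 t = s3;
  rc_mu : [/\ ipset L2 ya, aeq ya Y & forall t, Inn n t -> muh t = ya];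
  rc_bar : [/\ forall i, ipset L2 (va i), forall i, aeq (va i) ((V + 2^-1 *: dV) i) &
     forall t, Inn n t -> pi0bar T N L2v uh t = va];
  rc_eq1 : forall psi, Vh psi -> ip L2 dq psi =
     tau * conv (p + 2^-1 *: dp) (V + 2^-1 *: dV) psi - tau * wgip (b \o a) Y psi + tau * ip L2 s1 psi;
  rc_eq2 : forall xi, Vh xi -> tau * ip L2 Y xi = tau * (gamma * gip (q + 2^-1 *: dq) xi) +
     tint n (fun s => ip L2 (derive1 f \o (q + th n s *: dq)) xi) + tau * ip L2 s2 xi;
  rc_eq3 : forall v, Zh v -> ip L2v dV v =
     - (tau * skw Om (U + 2^-1 *: dU) (V + 2^-1 *: dV) v)
     - tau * wvisc Om (eta \o a) (V + 2^-1 *: dV) v - tau * conv (p + 2^-1 *: dp) v Y + tau * ip L2v s3 v }.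

Lemma hat_phi_cell n t : (1 <= n <= N)%N -> tg n.-1 <= t <= tg n ->
  phih t = grid_phi n.-1 + th n t *: (grid_phi n - grid_phi n.-1).
Proof. by move=> /andP[n0 _] tn; exact: (I1_cell hT hN _ n0 tn). Qed.

Lemma hat_u_cell n t : (1 <= n <= N)%N -> tg n.-1 <= t <= tg n ->
  uh t = grid_u n.-1 + th n t *: (grid_u n - grid_u n.-1).
Proof. by move=> /andP[n0 _] tn; exact: (I1_cell hT hN _ n0 tn). Qed.

Let pack2 (g t X x P1 P2 Z1 Z2 : R) : X = t * x -> P1 = P2 -> Z1 = Z2 ->
  g * X + P1 + Z1 = t * (g * x) + P2 + Z2.
Proof. by move=> -> -> ->; rewrite mulrCA. Qed.

Lemma residual_cellP n p dp m U dU a Ua : (1 <= n <= N)%N ->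
  discrete_cell Om T N f b eta gamma Th phiht muht uht n p dp m U dU a Ua ->
  exists Y ya va s1 s2 s3, residual_cell n p dp U dU a (grid_phi n.-1) (grid_phi n - grid_phi n.-1)
    (grid_u n.-1) (grid_u n - grid_u n.-1) Y ya va s1 s2 s3.
Proof.
move=> nN c; have /andP[n0 nN'] := nN.
have [R1 R2 R3 heq] := hres; have [e1 e2 e3] := heq n nN.
have [V0 VD VZ] := lin_Vh Om Th; have [W0 WD WZ] := lin_Vhv Om Th.
have VL v : Vh v -> ipset L2 v by move=> /Vh_H1 /H1_L2.
have [s1 Vs1 r1E] := P0_val R1 nN; have [s2 Vs2 r2E] := P0_val R2 nN; have [s3 Vs3 r3E] := P0_val R3 nN.
set q := grid_phi n.-1; set dq := grid_phi n - grid_phi n.-1.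
set V := grid_u n.-1; set dV := grid_u n - grid_u n.-1.
have Vq : Vh q := grid_phi_Vh n.-1; have Vdq : Vh dq := subV n.
have [VV _] := grid_u_Zh n.-1; have [VdV _] := subZ n.
rewrite -/V in VV; rewrite -/dV in VdV.
have inn t : Inn n t -> tg n.-1 <= t <= tg n by move=> /andP[/ltW -> ->].
have phiE t (ht : Inn n t) : phih t = q + th n t *: dq := hat_phi_cell nN (inn t ht).
have uE t (ht : Inn n t) : uh t = V + th n t *: dV := hat_u_cell nN (inn t ht).
have [ya [Y [Lya VY muE ya0]]] : exists ya Y, [/\ ipset L2 ya, Vh Y, forall t, Inn n t -> muh t = ya &
    ip L2 (ya - Y) (ya - Y) = 0].
  have uY t : Vh (pih0 Om Th (mu t)) by exact: oproj_in.
  exact: (bar_sub (X := L2) (Y := Vh) hT hN hL (ipL2_0 Om) VL (lin_Vh Om Th) (proj_Vh_L2 cover) uY nN).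
have [Q0 QD QZ] := lin_Qh Om Th.
have QL v : Qh v -> ipset L2 v by case=> -[].
have [pa [Qp [Lpa QQ pE pa0]]] : exists pa Qp, [/\ ipset L2 pa, Qh Qp, forall t, Inn n t -> ph t = pa &
    ip L2 (pa - Qp) (pa - Qp) = 0].
  have uY t : Qh (pih0t Om Th (prs t)) by exact: oproj_in.
  exact: (bar_sub (X := L2) (Y := Qh) hT hN hL (ipL2_0 Om) QL (lin_Qh Om Th) (proj_Qh cover) uY nN).
have cellL2v : forall k, (1 <= k <= N)%N -> exists a0 a1, [/\ ipset L2v a0, ipset L2v a1 &
    forall t, Inn k t -> uh t = a0 + th k t *: a1].
  move=> k kN; exists (grid_u k.-1), (grid_u k - grid_u k.-1); split.
  - by move=> i; apply: VL; have [h _] := grid_u_Zh k.-1; exact: h.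
  - by move=> i; apply: VL; have [h _] := subZ k; exact: h.
  - by move=> t /andP[t1 t2]; apply: hat_u_cell => //; rewrite ltW.
have LV i : ipset L2 (V i) by exact: VL.
have LdV i : ipset L2 (dV i) by exact: VL.
have [va [Lva vaE va0]] := bar_affine (X := L2v) hT hN hLv (ipL2v_0 Om) cellL2v nN LV LdV uE.
have Vmid : Vhv (V + 2^-1 *: dV) by apply: WD => //; exact: WZ.
have bmid i : BH ((V + 2^-1 *: dV) i) by exact: VBH.
have Lmid i : ipset L2 ((V + 2^-1 *: dV) i) by exact: VL.
have vaeq := aeq_vec Lva Lmid va0.
have yaeq := aeq_sub Lya (VL _ VY) ya0.
have paeq := aeq_sub Lpa (QL _ QQ) pa0.
have bp := VBH (dc_p c); have bdp := VBH (dc_dp c).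
have bq := VBH Vq; have bdq := VBH Vdq.
have bU i : BH (U i) := VBH (dc_U c i).
have bdU i : BH (dU i) := VBH (dc_dU c i).
have bV i : BH (V i) by exact: VBH.
have bdV i : BH (dV i) by exact: VBH.
have pva i : pm (va i) by exact: L2_pm.
have [_ aE] := dc_bar c.
have muG t : Inn n t -> grad Om (muh t) = grad Om Y.
  move=> /muE ->; apply/funext => i; exact: (wpartial_aeq i (L2_pm Lya) (BH_pm (VBH VY)) yaeq).
exists Y, ya, va, s1, s2, s3; split => //.
- move=> psi Vpsi; have Hpsi := Vh_H1 Vpsi.
  have := e1 (fun=> psi) (@P0_cst R _ T N _ _ Vpsi).
  rewrite (dt_tint hT hN n0 phiE bdq (VL _ Vpsi)) => ->.
  rewrite (conv_tint hT hN n0 (dc_phi c) bp bdp vaE pva bmid vaeq Hpsi (fun t _ => erefl)).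
  rewrite (wgip_tint hT hN n0 b psi aE muG).
  by rewrite (ip_tint hT hN n0 r1E (BH_pm (VBH Vs1)) (BH_pm (VBH Vs1)) (aeq_refl _ _) (BH_pm (VBH Vpsi))).
- move=> xi Vxi; have Hxi := Vh_H1 Vxi; have [bxi _] := VBH Vxi.
  have := e2 (fun=> xi) (@P0_cst R _ T N _ _ Vxi).
  rewrite (ip_tint hT hN n0 muE (L2_pm Lya) (BH_pm (VBH VY)) yaeq (BH_pm (VBH Vxi))) => ->.
  exact: (pack2 gamma (gip_tint hT hN n0 phiE bq bdq Hxi) (pot_tint phiE bq bdq hf bxi)
    (ip_tint hT hN n0 r2E (BH_pm (VBH Vs2)) (BH_pm (VBH Vs2)) (aeq_refl _ _) (BH_pm (VBH Vxi)))).
- move=> v [Vv dv]; have bv i : BH (v i) by exact: VBH.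
  have := e3 (fun=> v) (@P0_cst R _ T N _ _ Vv).
  rewrite (dtv_tint hT hN n0 uE bdV (fun i => BH_L2 (bv i))) => ->.
  rewrite (skw_tint hT hN n0 (dc_u c) bU bdU vaE pva bmid vaeq bv).
  rewrite (visc_tint hT hN n0 eta v aE vaE pva (fun i => BH_pm (bmid i)) vaeq).
  have -> : tint n (fun s => ip L2v (scalev (phiht s) (grad Om (muh s))) v) =
      tau * conv (p + 2^-1 *: dp) v Y.
    rewrite -(conv_tint hT hN n0 (dc_phi c) bp bdp (fun t _ => erefl v) (fun i => BH_pm (bv i)) bv
     (fun i => aeq_refl _ _) (Vh_H1 VY) muG).
    by congr (Rintegral _ _ _); apply/funext => s; exact: conv_swap.
  rewrite (ipv_tint Om hT hN n0 v r3E).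
  have -> : tint n (fun s => ip L2 (ph s) (div Om v)) = 0.
    have Hv' i : ipset H1 (v i) := BH_H1 (bv i).
    rewrite (ip_tint hT hN n0 pE (L2_pm Lpa) (L2_pm (QL _ QQ)) paeq (L2_pm (div_L2 Hv'))).
    have := dv Qp QQ; rewrite (sipC hL (div_L2 Hv') (QL _ QQ)) => ->.
    by rewrite mulr0.
  by rewrite addr0.
Qed.

Variable K : R.
Hypothesis K0 : 0 <= K.
Hypothesis hK : forall s t, 0 <= s <= T -> 0 <= t <= T -> n1 (phi t - phi s) <= K * `|t - s|.

Let B : R := n1 (phi 0) + K * T.
Let W : R := nv (u 0).
Let M : R := phi_bound Om f2 f3 gamma B W.

Let Hphi t : 0 <= t <= T -> ipset H1 (phi t). Proof. by case: Cphi => h _; exact: h. Qed.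

Let T00 : 0 <= (0 : R) <= T. Proof. by rewrite lexx ltW. Qed.

(** The projection is a contraction, and the Lipschitz bound propagates the norm at
    time 0. *)
Lemma grid_phi_norm n : (n <= N)%N -> n1 (grid_phi n) <= B.
Proof.
move=> nN; have tT := grid_T nN; have Ht := Hphi tT; have H0 := Hphi T00.
have VH : Vh `<=` ipset H1 by move=> v; exact: Vh_H1.
apply: le_trans (oproj_norm hH VH (proj_Vh_H1 cover) Ht) _.
have E : phi (tg n) = phi 0 + (phi (tg n) - phi 0) by rewrite addrC subrK.
rewrite -/(ipnorm H1 (phi (tg n))) E.
apply: le_trans (sip_tri hH H0 (sipB hH Ht H0)) _; rewrite lerD2l.
apply: le_trans (hK T00 tT) _; rewrite ler_wpM2l// subr0.
by move: tT => /andP[t0 t1]; rewrite ger0_norm.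
Qed.

Lemma grid_phi_lip n : (1 <= n <= N)%N -> n1 (grid_phi n - grid_phi n.-1) <= K * tau.
Proof.
move=> /andP[n0 nN]; have t1 := grid_T nN; have t2 : 0 <= tg n.-1 <= T by apply: grid_T; rewrite (leq_trans (leq_pred n)).
have VH : Vh `<=` ipset H1 by move=> v; exact: Vh_H1.
apply: le_trans (oproj_contract hH VH (lin_Vh Om Th) (proj_Vh_H1 cover) (Hphi t1) (Hphi t2)) _.
apply: le_trans (hK t2 t1) _.
by rewrite (tgP T N n0) addrAC subrr add0r gtr0_norm.
Qed.

Let B0 : 0 <= B. Proof. by apply: addr_ge0; [exact: sqrtr_ge0|rewrite mulr_ge0// ltW]. Qed.

Let HN (v : scal) : ipset H1 v -> ipset H1 (- v). Proof. exact: (sipN hH). Qed.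
Let ipN (s v : scal) : ipset L2 s -> ipset H1 v -> ip L2 s (- v) = - ip L2 s v.
Proof. by move=> Ls Hv'; exact: (sipNr hL (H1_L2 Hv') Ls). Qed.
Let n1N (v : scal) : ipset H1 v -> n1 (- v) = n1 v.
Proof. by move=> Hv'; exact: (sip_nmN hH Hv'). Qed.
Let ipC (s v : scal) : ipset L2 s -> ipset H1 v -> `|ip L2 s v| <= Num.sqrt (ip L2 s s) * n1 v.
Proof.
move=> Ls Hv'; apply: le_trans (sip_CSn hL Ls (H1_L2 Hv')) _.
by apply: ler_wpM2l; [exact: sqrtr_ge0|exact: L2_le_n1].
Qed.

Lemma Hm1_le s psi : ipset L2 s -> ipset H1 psi -> `|ip L2 s psi| <= norm_Hm1 Om s * n1 psi.
Proof.
move=> Ls Hpsi.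
exact: (dual_norm_le HN (fun v => ipN Ls) n1N (fun v => ipC Ls) (sqrtr_ge0 _) Hpsi).
Qed.

Lemma Hm1_ge0 s : ipset L2 s -> 0 <= norm_Hm1 Om s.
Proof.
move=> Ls; exact: (dual_norm_ge0 (sip0 hH) (fun v => ipN Ls) (fun v => ipC Ls) (sqrtr_ge0 _)).
Qed.

Let ZH (v : vect) (hv : Zh v) : forall i, ipset H1 (v i). Proof. by move=> i; case: hv => h _; exact: (Vh_H1 (h i)). Qed.

Let Zh_CS (s v : vect) : (forall i, ipset L2 (s i)) -> Zh v ->
  `|ip L2v s v| <= Num.sqrt (ip L2v s s) * nv v.
Proof.
move=> Ls Zv; have Hv' := ZH Zv; have Lv i : ipset L2 (v i) by exact: H1_L2.
apply: le_trans (sip_CSn hLv Ls Lv) _; apply: ler_wpM2l; first exact: sqrtr_ge0.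
have le : ip L2v v v <= ip Hv v v.
  by apply: ler_sum => i _; rewrite lerDl; exact: (sip_ge0 hG (Hv' i)).
have p : 0 <= ip Hv v v by exact: (sip_ge0 hHv).
by rewrite ler_sqrt.
Qed.

Let ZN (v : vect) : Zh v -> Zh (- v).
Proof. by move=> Zv; have [_ _ ZZ] := lin_Zh Om Th; rewrite -scaleN1r; exact: ZZ. Qed.
Let ipvN (s v : vect) : (forall i, ipset L2 (s i)) -> Zh v -> ip L2v s (- v) = - ip L2v s v.
Proof. by move=> Ls Zv; apply: (sipNr hLv) => // i; apply: H1_L2; exact: (ZH Zv). Qed.
Let nvN (v : vect) : Zh v -> nv (- v) = nv v.
Proof. by move=> Zv; apply: (sip_nmN hHv); exact: (ZH Zv). Qed.

(** The supremum is finite by the Cauchy-Schwarz inequality. *)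
Lemma Zhd_le (s v : vect) : (forall i, ipset L2 (s i)) -> Zh v -> `|ip L2v s v| <= norm_Zhd Om Th s * nv v.
Proof.
move=> Ls Zv.
exact: (dual_norm_le ZN (fun v => ipvN Ls) nvN (fun v => Zh_CS Ls) (sqrtr_ge0 _) Zv).
Qed.

Lemma Zhd_ge0 (s : vect) : (forall i, ipset L2 (s i)) -> 0 <= norm_Zhd Om Th s.
Proof.
move=> Ls; have [Z0 _ _] := lin_Zh Om Th.
exact: (dual_norm_ge0 Z0 (fun v => ipvN Ls) (fun v => Zh_CS Ls) (sqrtr_ge0 _)).
Qed.

Local Notation CE := (cell_energy Om f f1 gamma).

Definition final_cst : R := absorb_cst (step_cst Om f1 f2 f3 gamma b1 b2 eta1 M K).

Let final_arith (dE t D A g Z1 W1 x y z te : R) : 0 <= A -> 0 < g -> 0 <= Z1 -> 0 <= W1 ->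
  dE + t * (3 / 4 * D) <= t * (A * (Z1 + W1 + x + y + z)) ->
  t * (g / 12 * Z1 + W1 / 12) <= te -> 0 < t ->
  dE + 3 / 4 * (t * D) <= A * (12 * (g^-1 + 1)) * te + A * (t * (x + y + z)).
Proof.
move=> A0 g0 Z0 W0 h1 h2 t0.
have e1 : dE + 3 / 4 * (t * D) = dE + t * (3 / 4 * D) by ring.
rewrite e1; apply: le_trans h1 _.
have e2 : t * (A * (Z1 + W1 + x + y + z)) = A * (t * (Z1 + W1)) + A * (t * (x + y + z)) by ring.
rewrite e2 lerD2r -mulrA; apply: ler_wpM2l => //.
have gi : 0 <= g^-1 by rewrite invr_ge0 ltW.
have k0 : 0 <= 12 * (g^-1 + 1) by apply: mulr_ge0 => //; exact: addr_ge0.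
apply: le_trans _ (ler_wpM2l k0 h2).
have e3 : 12 * (g^-1 + 1) * (t * (g / 12 * Z1 + W1 / 12)) = t * (Z1 + W1) + t * (g * Z1 + g^-1 * W1).
  by field; rewrite gt_eqF.
rewrite e3 lerDl; apply: mulr_ge0; first exact: ltW.
by apply: addr_ge0; apply: mulr_ge0 => //; exact: ltW.
Qed.

Let diff_arith2 (t g G1 G2 T1 T2 X : R) : t * (g * G1) + T1 - (t * (g * G2) + T2 + t * X) =
  t * (g * (G1 - G2)) + (T1 - T2) - t * X.
Proof. by ring. Qed.

Let absorb_ge0 (A : R) : 0 <= A -> 0 <= absorb_cst A.
Proof.
move=> A0; have e : 0 <= 2 * A ^+ 3 by rewrite mulr_ge0// exprn_ge0.
by rewrite /absorb_cst; apply: addr_ge0; apply: mulr_ge0 => //; exact: sqr_ge0.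
Qed.

Let f10 : 0 <= f1. Proof. by case: hf. Qed.

Lemma step_cst_ge0 Lam : 0 <= M -> 0 <= Lam -> 0 <= step_cst Om f1 f2 f3 gamma b1 b2 eta1 M Lam.
Proof.
move=> M0 L0; rewrite /step_cst.
have h1 := c4_ge0 Om; have h2 := Kml_ge0 Om f2 f3 M; have h3 := Knl_ge0 Om f2 f3 M0.
have h4 : 0 <= d%:R * c4 Om * M by apply: mulr_ge0 => //; exact: mulr_ge0.
have h5 : 0 <= Kml Om f2 f3 M / Num.sqrt (vol Om) by apply: divr_ge0 => //; exact: sqrtr_ge0.
have h6 : 0 <= gamma + f1 by apply: addr_ge0 => //; exact: ltW.
have h7 : 0 <= Knl Om f2 f3 M * Lam by exact: mulr_ge0.
have h8 := sqrtr_ge0 eta1^-1; have h9 := sqrtr_ge0 b2; have h10 := sqrtr_ge0 ((Cpoinc Om + 1) / b1).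
exact: (addr_ge0 (addr_ge0 (addr_ge0 (addr_ge0 (addr_ge0 (addr_ge0 (addr_ge0 ler01 h4) h6) h8) h9) (addr_ge0 h5 ler01)) h10) h7).
Qed.

Let E (t : R) : R := rel_energy Om gamma f (Num.max gamma (gamma + f1)) (phiht t) (uht t) (phih t) (uh t).

(** The differences of the two systems of equations on the interval satisfy the
    hypotheses of the one-step estimate: the convection by the same velocity drops
    out by skew symmetry, and the phase field is common to the coupling terms. The
    factor 12 (1 / gamma + 1) comes from the lower bound of the integral of the
    energy by gamma / 12 and 1 / 12 times the squared errors. *)
Theorem relative_energy_cell n : (1 <= n <= N)%N ->
  E (tg n) - E (tg n.-1) + 3 / 4 * tint n (fun s =>
    dissipation Om b eta (pi0bar T N L2 phiht s) (muht s - muh s)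
      (pi0bar T N L2v uht s - pi0bar T N L2v uh s)) <=
  final_cst * (12 * (gamma^-1 + 1)) * tint n E + final_cst * tint n (fun s =>
    norm_Hm1 Om (r1 s) ^+ 2 + n1 (r2 s) ^+ 2 + norm_Zhd Om Th (r3 s) ^+ 2).
Proof.
move=> nN; have /andP[n0 nN'] := nN.
have [p [dp [m [U [dU [a [Ua c]]]]]]] := discrete_cellP hT hN hf cover hds nN.
have [Y [ya [va [s1 [s2 [s3 c']]]]]] := residual_cellP nN c.
set q := grid_phi n.-1 in c'; set dq := grid_phi n - grid_phi n.-1 in c'.
set V := grid_u n.-1 in c'; set dV := grid_u n - grid_u n.-1 in c'.
have [V0 VD VZ] := lin_Vh Om Th.
have VB x y : Vh x -> Vh y -> Vh (x - y) by move=> hx hy; rewrite -scaleN1r; apply: VD => //; exact: VZ.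
have [Z0 ZD ZZ] := lin_Zh Om Th.
have [Vp Vdp] := (dc_p c, dc_dp c).
have Vq : Vh q := grid_phi_Vh n.-1; have Vdq : Vh dq := subV n.
have ZV : Zh V := grid_u_Zh n.-1; have ZdV : Zh dV := subZ n.
have bU i : BH (U i) := VBH (dc_U c i).
have bdU i : BH (dU i) := VBH (dc_dU c i).
have bV i : BH (V i) by apply: VBH; case: ZV.
have bdV i : BH (dV i) by apply: VBH; case: ZdV.
pose w : vect := U - V; pose dw : vect := dU - dV.
have bw i : BH (w i) by exact: BHB.
have bdw i : BH (dw i) by exact: BHB.
pose Ub : vect := U + 2^-1 *: dU; pose Vb : vect := V + 2^-1 *: dV.
have bUb i : BH (Ub i) by exact: BHD (bU i) (BHZ _ (bdU i)).
have bVb i : BH (Vb i) by exact: BHD (bV i) (BHZ _ (bdV i)).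
have wbE : w + 2^-1 *: dw = Ub - Vb by rewrite /w /dw /Ub /Vb scalerBr opprD addrACA.
have ZVb : Zh Vb := ZD _ _ ZV (ZZ 2^-1 _ ZdV).
have Zwb : Zh (w + 2^-1 *: dw).
  by rewrite wbE -scaleN1r; exact: (ZD _ _ (dc_div c) (ZZ (-1) _ ZVb)).
have bwb i : BH ((w + 2^-1 *: dw) i) by exact: BHD (bw i) (BHZ _ (bdw i)).
have VY := rc_Y c'; have Vm := dc_m c; have Vmy := VB _ _ Vm VY.
have [La aE] := dc_bar c.
have bbeta := coefficient_bnd hb (L2_pm La); have beps := coefficient_bnd heta (L2_pm La).
have b10 : 0 < b1 by case: hb.
have beta_b x : b1 <= (b \o a) x <= b2 by case: hb => _ _ /(_ (a x)).
have b20 : 0 <= b2 by have /andP[h1 h2] := beta_b 0; exact: le_trans (ltW b10) (le_trans h1 h2).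
have beta0 x : 0 <= (b \o a) x by have /andP[h1 _] := beta_b x; exact: le_trans (ltW b10) h1.
have eta10 : 0 < eta1 by case: heta.
have eps_b x : eta1 <= (eta \o a) x by case: heta => _ _ /(_ (a x)) /andP[].
have eps0 x : 0 <= (eta \o a) x by exact: le_trans (ltW eta10) (eps_b x).
have bp := VBH Vp; have bdp := VBH Vdp; have bq := VBH Vq; have bdq := VBH Vdq.
have bpm : BH (p + 2^-1 *: dp) by exact: BHD bp (BHZ _ bdp).
have VL v : Vh v -> ipset L2 v by move=> /Vh_H1 /H1_L2.
have hB := semi_ip_wgip bbeta beta0; have hE := semi_ip_wgip beps eps0.
have Hm := Vh_H1 Vm; have HY := Vh_H1 VY.
have Ls1 := VL _ (rc_s1 c'); have Ls2 := VL _ (rc_s2 c').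
have Ls3 i : ipset L2 (s3 i) by apply: VL; exact: (rc_s3 c' i).
have q1 psi : Vh psi -> ip L2 (dp - dq) psi =
    tau * (conv (p + 2^-1 *: dp) (w + 2^-1 *: dw) psi - wgip (b \o a) (m - Y) psi - ip L2 s1 psi).
  move=> Vpsi; have Hpsi := Vh_H1 Vpsi.
  rewrite (sipBl hL (VL _ Vdp) (VL _ Vdq) (VL _ Vpsi)) (dc_eq1 c Vpsi) (rc_eq1 c' Vpsi).
  rewrite wbE (convBl bpm bUb bVb Hpsi) (sipBl hB Hm HY Hpsi).
  by move: (conv _ _ _) (conv _ _ _) (wgip _ _ _) (wgip _ _ _) (ip L2 _ _) => x1 x2 x3 x4 x5; ring.
have eE : (p - q) + 2^-1 *: (dp - dq) = (p + 2^-1 *: dp) - (q + 2^-1 *: dq).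
  by rewrite scalerBr opprD addrACA.
have q2 xi : Vh xi -> tau * ip L2 (m - Y) xi = tau * (gamma * gip ((p - q) + 2^-1 *: (dp - dq)) xi) +
   tint n (fun s => ip L2 ((derive1 f \o (p + th n s *: dp)) - (derive1 f \o (q + th n s *: dq))) xi) - tau * ip L2 s2 xi.
  move=> Vxi; have Hxi := Vh_H1 Vxi; have [bxi _] := VBH Vxi.
  have E1 := dc_eq2 c Vxi; have E2 := rc_eq2 c' Vxi.
  have E3 : tint n (fun s => ip L2 ((derive1 f \o (p + th n s *: dp)) - (derive1 f \o (q + th n s *: dq))) xi) =
      tint n (fun s => ip L2 (derive1 f \o (p + th n s *: dp)) xi) - tint n (fun s => ip L2 (derive1 f \o (q + th n s *: dq)) xi).
    rewrite -tintB; [|exact: (continuous_potential hf bp.1 bdp.1 bxi)|exact: (continuous_potential hf bq.1 bdq.1 bxi)].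
    congr (Rintegral _ _ _); apply/funext => s.
    have cf' := pot_continuous hf (j := 1) isT.
    have L1 : ipset L2 (derive1 f \o (p + th n s *: dp)).
      by apply: bnd_L2; apply: (bnd_comp cf'); have [] := BHD bp (BHZ (th n s) bdp).
    have L2' : ipset L2 (derive1 f \o (q + th n s *: dq)).
      by apply: bnd_L2; apply: (bnd_comp cf'); have [] := BHD bq (BHZ (th n s) bdq).
    exact: (sipBl hL L1 L2' (VL _ Vxi)).
  have Hpm := BH_H1 bpm; have Hqm := BH_H1 (BHD bq (BHZ 2^-1 bdq)).
  rewrite E3 eE (sipBl hG Hpm Hqm Hxi) (sipBl hL (VL _ Vm) (VL _ VY) (VL _ Vxi)) mulrBr E1 E2.
  exact: diff_arith2.
have wviscB : wvisc Om (eta \o a) (w + 2^-1 *: dw) (w + 2^-1 *: dw) =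
    wvisc Om (eta \o a) Ub (w + 2^-1 *: dw) - wvisc Om (eta \o a) Vb (w + 2^-1 *: dw).
  rewrite /wvisc -sumrB; apply: eq_bigr => i _; rewrite {1}wbE.
  exact: (sipBl hE (BH_H1 (bUb i)) (BH_H1 (bVb i)) (BH_H1 (bwb i))).
have q3 : ip L2v dw (w + 2^-1 *: dw) = - (tau * wvisc Om (eta \o a) (w + 2^-1 *: dw) (w + 2^-1 *: dw))
    - tau * conv (p + 2^-1 *: dp) (w + 2^-1 *: dw) (m - Y) - tau * ip L2v s3 (w + 2^-1 *: dw).
  have E1 := dc_eq3 c Zwb; have E2 := rc_eq3 c' Zwb; rewrite -/Ub -/Vb in E1 E2.
  have S : skw Om Ub Ub (w + 2^-1 *: dw) - skw Om Ub Vb (w + 2^-1 *: dw) = 0.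
    have bb i : bnd (Ub i) by case: (bUb i).
    by rewrite -(skwBm bb bUb bVb bwb) -wbE skw_antisym.
  have LdU i : ipset L2 (dU i) := BH_L2 (bdU i).
  have LdV i : ipset L2 (dV i) := BH_L2 (bdV i).
  have Lwb i : ipset L2 ((w + 2^-1 *: dw) i) := BH_L2 (bwb i).
  have D : ip L2v dw (w + 2^-1 *: dw) = ip L2v dU (w + 2^-1 *: dw) - ip L2v dV (w + 2^-1 *: dw).
    exact: (sipBl hLv LdU LdV Lwb).
  rewrite D wviscB (convBr bpm bwb Hm HY) E1 E2.
  move: S; move: (skw _ _ _ _) (skw _ _ _ _) (wvisc _ _ _ _) (wvisc _ _ _ _) (conv _ _ _) (conv _ _ _) (ip L2v _ _).
  move=> x1 x2 x3 x4 x5 x6 x7 /eqP; rewrite subr_eq0 => /eqP ->.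
  by ring.
have rho1 psi : Vh psi -> `|ip L2 s1 psi| <= norm_Hm1 Om s1 * n1 psi.
  by move=> Vpsi; exact: (Hm1_le Ls1 (Vh_H1 Vpsi)).
have nle : (n.-1 <= N)%N by rewrite (leq_trans (leq_pred n)).
have HC : n1 (phi 0) <= B by rewrite lerDl mulr_ge0// ltW.
have [Vst sst snorm Vsu su] := dc_start c.
have [Ep EU] := discrete_cell_end hT hN nN c.
have Hp := Vh_H1 Vp; have Hst := Vh_H1 Vst.
have H0 := Hphi T00.
have HU0 : ipset Hv (u 0) by case: Cu => h _; exact: h.
have Mp : n1 p <= M.
  have e : p = phiht (tg n.-1) - (phiht (tg n.-1) - p) by rewrite opprB addrC subrK.
  have hD := sipB hH Hst Hp.
  have z : n1 (- (phiht (tg n.-1) - p)) = 0 by rewrite /ipnorm (sip_nmN hH hD) snorm sqrtr0.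
  rewrite e; apply: le_trans (sip_tri hH Hst (sipN hH hD)) _.
  rewrite -[X in _ + X]/(n1 _) z addr0.
  exact: (discrete_bound hd hT hN hf hb heta hgamma cover hds H0 HU0 HC (lexx _) nle Vst).
have Vend : Vh (p + dp) by exact: VD.
have Mp' : n1 (p + dp) <= M.
  rewrite -Ep; apply: (discrete_bound hd hT hN hf hb heta hgamma cover hds H0 HU0 HC (lexx _) nN').
  by rewrite Ep.
have qend : q + dq = grid_phi n by rewrite /q /dq addrC subrK.
have Vqe : V + dV = grid_u n by rewrite /V /dV addrC subrK.
have BM : B <= M by exact: le_phi_bound.
have Mq : n1 q <= M by exact: le_trans (grid_phi_norm nle) BM.
have Mq' : n1 (q + dq) <= M by rewrite qend; exact: le_trans (grid_phi_norm nN') BM.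
have step := relative_energy_step hd hT hN n0 hf hgamma b10 b20 eta10 (lin_Vh Om Th) VBH (Vh_cst Om Th)
  Vp Vdp Vq Vdq Vmy (rc_s2 c') bw bdw bbeta beps beta_b eps_b q1 q2 q3 (Hm1_ge0 Ls1) (Zhd_ge0 Ls3)
  rho1 (Zhd_le Ls3 Zwb) Mp Mp' Mq Mq' (grid_phi_lip nN).
have bw_end i : BH ((w + dw) i) by exact: BHD (bw i) (bdw i).
have Lw i : ipset L2 (w i) := BH_L2 (bw i).
have Ldw i : ipset L2 (dw i) := BH_L2 (bdw i).
have low := energy_integral_lower hT hN n0 hf hgamma bp bdp bq bdq Lw Ldw.
have LU i : ipset L2 (U i) := BH_L2 (bU i).
have LV i : ipset L2 (V i) := BH_L2 (bV i).
have LdU i : ipset L2 (dU i) := BH_L2 (bdU i).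
have LdV i : ipset L2 (dV i) := BH_L2 (bdV i).
have uV (t : R) : (U + t *: dU) - (V + t *: dV) = w + t *: dw.
  by apply: esym; rewrite /w /dw scalerBr opprD addrACA.
have cellE t : Inn n t -> E t = CE (p + th n t *: dp) (q + th n t *: dq) (w + th n t *: dw).
  move=> tn; have tn' : tg n.-1 <= t <= tg n by move: tn => /andP[/ltW -> ->].
  rewrite /E (dc_phi c tn) (dc_u c tn) (hat_phi_cell nN tn') (hat_u_cell nN tn') -uV.
  apply: (rel_energyE gamma hf f10) => //.
  - exact: BHD bp (BHZ _ bdp).
  - exact: BHD bq (BHZ _ bdq).
  - by move=> i; apply: (sipD hL) => //; exact: (sipZ hL).
  - by move=> i; apply: (sipD hL) => //; exact: (sipZ hL).
have Eend : E (tg n) = CE (p + dp) (q + dq) (w + dw).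
  have tn : Inn n (tg n) by rewrite lexx andbT (tg_lt hT hN).
  by rewrite (cellE _ tn) (th_end hT hN n0) !scale1r.
have Estart : E (tg n.-1) = CE p q w.
  have tn : tg n.-1 <= tg n.-1 <= tg n by rewrite lexx (tg_le hT hN).
  rewrite /E (hat_phi_cell nN tn) (hat_u_cell nN tn) th_start !scale0r !addr0 -/q -/V.
  have Lst i : ipset L2 (uht (tg n.-1) i) := BH_L2 (VBH (Vsu i)).
  rewrite (rel_energyE gamma hf f10 (VBH Vst) bq Lst LV).
  apply: (cell_energy_aeq gamma hf (VBH Vst) bp bq) => //.
  - by move=> i; exact: (sipB hL (Lst i) (LV i)).
  - by move=> i; apply: filterS (su i) => x h Dx; rewrite -[LHS]/(uht (tg n.-1) i x - V i x) h.
have Etint : tint n E = tint n (fun s => CE (p + th n s *: dp) (q + th n s *: dq) (w + th n s *: dw)).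
  apply: tint_eq; first exact: (energy_continuous hf bp bdp bq bdq Lw Ldw).
  by move=> t /andP[t1 t2]; apply: cellE; rewrite t1 ltW.
have [Lya yaeq muE] := rc_mu c'; have [Lva vaeq vaE] := rc_bar c'.
have [LUa UaE Uaeq] := dc_barv c.
have diss : tint n (fun s => dissipation Om b eta (pi0bar T N L2 phiht s) (muht s - muh s)
      (pi0bar T N L2v uht s - pi0bar T N L2v uh s)) =
    tau * (wgip (b \o a) (m - Y) (m - Y) + wvisc Om (eta \o a) (w + 2^-1 *: dw) (w + 2^-1 *: dw)).
  apply: (tint_cst_on hT hN n0) => t /andP[t1 t2].
  have tn : Inn n t by rewrite t1 ltW.
  rewrite (aE t tn) (dc_mu c tn) (muE t tn) (UaE t tn) (vaE t tn).
  apply: dissipationE => //.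
  - by apply: L2_pm; exact: (sipB hL (VL _ Vm) Lya).
  - exact: (Vh_H1 Vmy).
  - by apply: filterS yaeq => x h Dx; rewrite -[LHS]/(m x - ya x) h.
  - by move=> i; apply: L2_pm; exact: (sipB hL (LUa i) (Lva i)).
  - by move=> i; exact: BH_H1.
  - move=> i; apply: filterS2 (Uaeq i) (vaeq i) => x h1 h2 Dx.
    by rewrite wbE -[LHS]/(Ua i x - va i x) h1// h2.
have resid : tint n (fun s => norm_Hm1 Om (r1 s) ^+ 2 + n1 (r2 s) ^+ 2 + norm_Zhd Om Th (r3 s) ^+ 2) =
    tau * (norm_Hm1 Om s1 ^+ 2 + n1 s2 ^+ 2 + norm_Zhd Om Th s3 ^+ 2).
  apply: (tint_cst_on hT hN n0) => t /andP[t1 t2].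
  have tn : Inn n t by rewrite t1 ltW.
  by rewrite (rc_r1 c' tn) (rc_r2 c' tn) (rc_r3 c' tn).
rewrite Eend Estart Etint diss resid.
have Z1 : 0 <= n1 (p - q) ^+ 2 + n1 (p - q + (dp - dq)) ^+ 2 by apply: addr_ge0; exact: sqr_ge0.
have Lwdw i : ipset L2 ((w + dw) i) := BH_L2 (bw_end i).
have W1 : 0 <= ip L2v w w + ip L2v (w + dw) (w + dw).
  by apply: addr_ge0; [exact: (sip_ge0 hLv Lw)|exact: (sip_ge0 hLv Lwdw)].
have A0 : 0 <= final_cst.
  apply: absorb_ge0; have M0 : 0 <= M by exact: le_trans BM.
  exact: step_cst_ge0.
exact: (final_arith A0 hgamma Z1 W1 step low tau0).
Qed.

End residual_cells.

(** * The relative energy estimate *)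

Theorem lemma11 (R : realType) (d : nat) (hd : d = 2%N \/ d = 3%N)
  (Om : cube R d) (T : R) (hT : 0 < T)
  (gamma : R) (hgamma : 0 < gamma)
  (b : R -> R) (b1 b2 b3 b4 : R) (hb : coefficient_ok b b1 b2 b3 b4)
  (f : R -> R) (f1 : R) (f2 f3 : nat -> R) (hf : potential_ok f f1 f2 f3)
  (eta : R -> R) (eta1 eta2 eta3 eta4 : R)
  (heta : coefficient_ok eta eta1 eta2 eta3 eta4)
  (sigma : R) (hsigma : 0 < sigma)
  (phi mu : R -> 'rV[R]_d -> R) (u : R -> 'I_d -> 'rV[R]_d -> R)
  (p : R -> 'rV[R]_d -> R)
  (hsol : exact_solution Om T gamma b eta f phi mu u p) :
  exists cbar Cbar : R,
  forall (Th : seq 'M[R]_(d.+1, d)) (N : nat),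
  admissible_mesh Om sigma Th -> (0 < N)%N ->
  forall (phiht muht : R -> 'rV[R]_d -> R) (uht : R -> 'I_d -> 'rV[R]_d -> R)
    (pht r1 r2 : R -> 'rV[R]_d -> R) (r3 : R -> 'I_d -> 'rV[R]_d -> R),
  let phih := hat_phi Om T N Th phi in
  let muh := hat_mu Om T N Th mu in
  let uh := hat_u Om T N Th u in
  let ph := hat_p Om T N Th p in
  let alpha := Num.max gamma (gamma + f1) in
  let E := fun t : R =>
    rel_energy Om gamma f alpha (phiht t) (uht t) (phih t) (uh t) in
  let phib := pi0bar T N (L2 Om) phiht in
  let ub := pi0bar T N (L2v Om) uht in
  let uhb := pi0bar T N (L2v Om) uh in
  discrete_solution Om T gamma b eta f N Th (phi 0) (u 0) phiht muht uht pht ->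
  discrete_residuals Om T gamma b eta f N Th phiht uht phih muh uh ph
    r1 r2 r3 ->
  forall n, (1 <= n <= N)%N ->
  E (tgrid T N n) - E (tgrid T N n.-1)
  + 3 / 4 * tint T N n (fun s =>
      dissipation Om b eta (phib s) (muht s - muh s) (ub s - uhb s))
  <= cbar * tint T N n E
     + Cbar * tint T N n (fun s =>
         norm_Hm1 Om (r1 s) ^+ 2 + ipnorm (sobolev Om 1) (r2 s) ^+ 2
         + norm_Zhd Om Th (r3 s) ^+ 2).
Proof.
have [_ [[Hphi _] _ _ _ [Cphi Cu]] _] := hsol.
have [K K0 hK] := time_lipschitz (semi_ip_H1 Om) hT Hphi Cphi.
pose A := final_cst Om T f1 f2 f3 b1 b2 eta1 gamma phi u K.
exists (A * (12 * (gamma^-1 + 1))), A.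
move=> Th N [_ cover _ _] hN phiht muht uht pht r1 r2 r3 phih muh uh ph alpha E phib ub uhb hds hres n nN.
exact: (relative_energy_cell hd hT hN hf hb heta hgamma cover Cphi Cu hds hres K0 hK nN).
Qed.
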